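(* Assume $\alpha\ge1$, $\alpha\neq2$, and $\sum_{j=1}^n m_j=1$. For each positive integer $\mathfrak p$ there is an integer $\mathfrak q_0$ such that for each integer $\mathfrak q>\mathfrak q_0$ the restricted $(n+1)$-body problem has at least two $2\pi\mathfrak q$-periodic solutions of the form $$q(t)=\varepsilon^{-1}e^{J(\theta_j+\mathfrak p t/\mathfrak q)}x_0+\mathcal O(\varepsilon),\qquad \varepsilon=(\mathfrak p/\mathfrak q)^{2/(\alpha+1)},\quad j=1,2,$$ where $\theta_j\in[0,2\pi]$ and $\mathcal O(\varepsilon)$ is a $2\pi\mathfrak q$-periodic function of order $\varepsilon$ (bounded by a constant independent of $\mathfrak q$ times $\varepsilon$).
   Context: Let $n\ge2$, $\alpha\ge1$, masses $m_1,\dots,m_n>0$, and let $q_1,\dots,q_n:\mathbb R\to\mathbb R^2$ be a collision-free $2\pi$-periodic solution of the $n$-body problem $\ddot q_j=-\sum_{k\neq j}m_k\frac{q_j-q_k}{\|q_j-q_k\|^{\alpha+1}}$ with center of mass at the origin, $\sum_j m_jq_j(t)=0$. The restricted $(n+1)$-body problem is the equation $\ddot q(t)=-\sum_{j=1}^n m_j\frac{q(t)-q_j(t)}{\|q(t)-q_j(t)\|^{\alpha+1}}$ for $q:\mathbb R\to\mathbb R^2$. $J=\begin{pmatrix}0&1\\-1&0\end{pmatrix}$, $e^{J\theta}=\cos\theta\,I+\sin\theta\,J$, $x_0=(1,0)^T$, $\|\cdot\|$ the Euclidean norm. *)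

(* Defs.v *)
From Stdlib Require Import Reals.
From Coquelicot Require Import Coquelicot.
Open Scope R_scope.

Definition vec2 := (R * R)%type.
Definition vadd (u v : vec2) : vec2 := (fst u + fst v, snd u + snd v).
Definition vsub (u v : vec2) : vec2 := (fst u - fst v, snd u - snd v).
Definition vscal (a : R) (u : vec2) : vec2 := (a * fst u, a * snd u).
Definition vzero : vec2 := (0, 0).
Definition vnorm (u : vec2) : R := sqrt (fst u * fst u + snd u * snd u).

(* J = [[0,1],[-1,0]] acting on column vectors *)
Definition Jmul (u : vec2) : vec2 := (snd u, - fst u).
Definition expJ (theta : R) (u : vec2) : vec2 :=
  vadd (vscal (cos theta) u) (vscal (sin theta) (Jmul u)).
Definition x0 : vec2 := (1, 0).

Fixpoint vsum (n : nat) (f : nat -> vec2) : vec2 :=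
  match n with O => vzero | S k => vadd (vsum k f) (f k) end.
Fixpoint rsum (n : nat) (f : nat -> R) : R :=
  match n with O => 0 | S k => rsum k f + f k end.

Definition has_second_derivative (x : R -> vec2) (a : R -> vec2) : Prop :=
  exists v : R -> vec2, forall t,
    is_derive (fun s => fst (x s)) t (fst (v t)) /\
    is_derive (fun s => snd (x s)) t (snd (v t)) /\
    is_derive (fun s => fst (v s)) t (fst (a t)) /\
    is_derive (fun s => snd (v s)) t (snd (a t)).

Definition force (alpha : R) (x y : vec2) : vec2 :=
  vscal (/ Rpower (vnorm (vsub x y)) (alpha + 1)) (vsub x y).

Definition nbody_solution (n : nat) (alpha : R) (m : nat -> R)
    (qs : nat -> R -> vec2) : Prop :=
  (forall t j k, (j < n)%nat -> (k < n)%nat -> j <> k -> qs j t <> qs k t) /\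
  (forall j, (j < n)%nat ->
     has_second_derivative (qs j)
       (fun t => vscal (-1) (vsum n (fun k =>
          if Nat.eqb k j then vzero else vscal (m k) (force alpha (qs j t) (qs k t)))))).

Definition restricted_solution (n : nat) (alpha : R) (m : nat -> R)
    (qs : nat -> R -> vec2) (q : R -> vec2) : Prop :=
  (forall t j, (j < n)%nat -> q t <> qs j t) /\
  has_second_derivative q
    (fun t => vscal (-1) (vsum n (fun j => vscal (m j) (force alpha (q t) (qs j t))))).

(* Main.v *)
Require Import Defs.
From Stdlib Require Import Reals Lra Lia Psatz ZArith FunctionalExtensionality ClassicalEpsilon.
From Coquelicot Require Import Coquelicot.
Open Scope R_scope.

(** With [eps] as unit of inverse length and [p/q] as unit of frequency, the primaries form a
cluster of size [eps] at the origin, of short period [2 PI p / q], and a periodic orbit of period [2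
PI p] is sought near the unit circle described at unit speed. In the rotating frame the circle is a
circle of equilibria, and the linearisation at one of them has on [2 PI p]-periodic functions the
kernel spanned by the translation along the circle (amplitude [theta]) and, exactly when [3 - alpha
= (k/p)^2], by two radial oscillations (amplitudes [a1], [a2]).

Since the centre of mass is at the origin the perturbation is of order [eps^2], and a contraction
solves the equation modulo the kernel, with a correction of order [eps^2]. The remaining multipliers
are the derivatives of the action along this family, so that they vanish at an interior minimum of
the action over [theta] in the circle and [|a1|, |a2| <= A], where [A] is a large multiple of
[eps^2]. In the resonant case the minimum is interior because the multipliers point outwards on the
faces of the box: for [q >= 6 p] all other terms of low order average out, and the quadrupole of the
primaries contributes [eps^2 a B (B - 2) / 4 R0] to the multiplier, with [B = alpha + 1 > 2] and
[R0] the integral of their moment of inertia.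

Translating this solution by a multiple of [2 PI] moves its phase by about [PI] and gives the second
one. *)

(** * Periodic functions *)

(** Eliminating the angular variable leaves a radial oscillator of stiffness [3 - alpha], and the
    arithmetic of the resonance [3 - alpha = (k/p)^2] uses the range of [alpha]. From [alpha >= 1]
    comes [k < 2 p]; [alpha = 1] cannot be resonant, 2 being no rational square, so [B (B - 2) > 0]
    where it is needed; and [alpha <> 2] means [k <> p]. In the rotating frame the primaries turn
    with frequency [p/p], so their moments meet the modes at [p - k] and [2 p - 2 k], which must not
    vanish.

    The obstacle is that the correction, of order [eps^2], times a mode of amplitude [a] gives a
    term of order [a eps^2], as large as the quadrupole term. The correction is known only as a
    fixed point; testing its equation against an explicit function exchanges it for the force that
    produces it.

    At the faces [a] is of order [eps^2], so leading term and errors are both of order [eps^4];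
    hence the large multiple. No derivative of the reduced action is formed: a first-order expansion
    with quadratic error gives the sign conditions at a minimum. *)

Definition cont (f : R -> R) := forall t : R, continuous f t.
Definition pc (T : R) (f : R -> R) := cont f /\ forall t, f (t + T) = f t.
Definition Int0 (T : R) (f : R -> R) : R := RInt f 0 T.

Lemma cont_const c : cont (fun _ => c).
Proof. intro t; apply continuous_const. Qed.
Lemma cont_id : cont (fun t => t).
Proof. intro t; apply continuous_id. Qed.
Lemma cont_plus f g : cont f -> cont g -> cont (fun t => f t + g t).
Proof. intros F G t; apply (continuous_plus f g t (F t) (G t)). Qed.
Lemma cont_minus f g : cont f -> cont g -> cont (fun t => f t - g t).
Proof. intros F G t; apply (continuous_minus f g t (F t) (G t)). Qed.
Lemma cont_opp f : cont f -> cont (fun t => - f t).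
Proof. intros F t; apply (continuous_opp f t (F t)). Qed.
Lemma cont_mult f g : cont f -> cont g -> cont (fun t => f t * g t).
Proof. intros F G t; apply (continuous_mult f g t (F t) (G t)). Qed.
Lemma cont_comp f g : cont f -> cont g -> cont (fun t => f (g t)).
Proof. intros F G t; apply (continuous_comp g f t (G t) (F (g t))). Qed.
Lemma cont_derive f df : (forall t : R, is_derive f t (df t)) -> cont f.
Proof. intros H t; apply (ex_derive_continuous (K:=R_AbsRing) (V:=R_NormedModule) f); exists (df t); apply H. Qed.
Lemma cont_cos : cont cos.
Proof. apply (cont_derive cos (fun t => - sin t)); intro t; apply is_derive_cos. Qed.
Lemma cont_sin : cont sin.
Proof. apply (cont_derive sin cos); intro t; apply is_derive_sin. Qed.

Lemma pc_cont T f : pc T f -> cont f.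
Proof. intros [H _]; exact H. Qed.
Lemma pc_const T c : pc T (fun _ => c).
Proof. split; [apply cont_const | reflexivity]. Qed.
Lemma pc_plus T f g : pc T f -> pc T g -> pc T (fun t => f t + g t).
Proof. intros [F F'] [G G']; split; [apply cont_plus; auto | intro t; now rewrite F', G']. Qed.
Lemma pc_minus T f g : pc T f -> pc T g -> pc T (fun t => f t - g t).
Proof. intros [F F'] [G G']; split; [apply cont_minus; auto | intro t; now rewrite F', G']. Qed.
Lemma pc_mult T f g : pc T f -> pc T g -> pc T (fun t => f t * g t).
Proof. intros [F F'] [G G']; split; [apply cont_mult; auto | intro t; now rewrite F', G']. Qed.
Lemma pc_opp T f : pc T f -> pc T (fun t => - f t).
Proof. intros [F F']; split; [apply cont_opp; auto | intro t; now rewrite F']. Qed.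
Lemma pc_pow T f k : pc T f -> pc T (fun t => f t ^ k).
Proof.
  intro F; induction k as [|k IH]; [exact (pc_const T 1)|].
  exact (pc_mult T f (fun t => f t ^ k) F IH).
Qed.

Ltac pcs := repeat match goal with
  | |- pc _ _ => assumption
  | |- pc ?T (fun _ => ?c) => apply (pc_const T c)
  | |- pc ?T (fun t => @?f t + @?g t) => apply (pc_plus T f g)
  | |- pc ?T (fun t => @?f t - @?g t) => apply (pc_minus T f g)
  | |- pc ?T (fun t => @?f t * @?g t) => apply (pc_mult T f g)
  | |- pc ?T (fun t => @?f t / ?c) => apply (pc_mult T f (fun _ => / c))
  | |- pc ?T (fun t => - @?f t) => apply (pc_opp T f)
  | |- pc ?T (fun t => @?f t ^ ?k) => apply (pc_pow T f k)
  end.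
Ltac cts := repeat match goal with
  | |- cont _ => assumption
  | |- pc _ _ => assumption
  | H : pc _ ?f |- cont ?f => exact (proj1 H)
  | H : pc _ ?f |- cont (fun t => ?f t) => exact (proj1 H)
  | |- cont (fun _ => ?c) => apply (cont_const c)
  | |- cont (fun t => t) => apply cont_id
  | |- cont (fun t => @?f t + @?g t) => apply (cont_plus f g)
  | |- cont (fun t => @?f t - @?g t) => apply (cont_minus f g)
  | |- cont (fun t => @?f t * @?g t) => apply (cont_mult f g)
  | |- cont (fun t => @?f t / ?c) => apply (cont_mult f (fun _ => / c))
  | |- cont (fun t => - @?f t) => apply (cont_opp f)
  | |- cont (fun t => cos (@?g t)) => apply (cont_comp cos g cont_cos)
  | |- cont (fun t => sin (@?g t)) => apply (cont_comp sin g cont_sin)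
  end.

Lemma ex_RInt_cont f a b : cont f -> ex_RInt f a b.
Proof. intros F; apply (ex_RInt_continuous (V := R_CompleteNormedModule)); intros; apply F. Qed.

Lemma Int0_plus T f g : cont f -> cont g -> Int0 T (fun t => f t + g t) = Int0 T f + Int0 T g.
Proof. intros; unfold Int0; apply (RInt_plus (V:=R_CompleteNormedModule) f g); apply ex_RInt_cont; auto. Qed.
Lemma Int0_minus T f g : cont f -> cont g -> Int0 T (fun t => f t - g t) = Int0 T f - Int0 T g.
Proof. intros; unfold Int0; apply (RInt_minus (V:=R_CompleteNormedModule) f g); apply ex_RInt_cont; auto. Qed.
Lemma Int0_scal T c f : cont f -> Int0 T (fun t => c * f t) = c * Int0 T f.
Proof. intros; unfold Int0; apply (RInt_scal (V:=R_CompleteNormedModule) f); apply ex_RInt_cont; auto. Qed.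
Lemma Int0_opp T f : cont f -> Int0 T (fun t => - f t) = - Int0 T f.
Proof. intros; unfold Int0; apply (RInt_opp (V:=R_CompleteNormedModule) f); apply ex_RInt_cont; auto. Qed.
Lemma Int0_const T c : Int0 T (fun _ => c) = T * c.
Proof. unfold Int0; rewrite RInt_const. unfold scal; simpl; unfold mult; simpl; ring. Qed.
Lemma Int0_ext T f g : (forall t, f t = g t) -> Int0 T f = Int0 T g.
Proof. intro H; unfold Int0; apply RInt_ext; auto. Qed.

Lemma Int0_bound T f M : 0 <= T -> cont f -> (forall t, Rabs (f t) <= M) -> Rabs (Int0 T f) <= T * M.
Proof.
  intros HT F HM. unfold Int0.
  replace (T * M) with ((T - 0) * M) by ring.
  apply abs_RInt_le_const; auto. apply ex_RInt_cont; auto.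
Qed.

Lemma Int0_derive T F f : cont f -> (forall t : R, is_derive F t (f t)) -> Int0 T f = F T - F 0.
Proof.
  intros Cf H. unfold Int0. apply is_RInt_unique.
  apply (is_RInt_derive (V:=R_CompleteNormedModule) F f); intros; [apply H | apply Cf].
Qed.

Lemma Int0_derive0 T F f : cont f -> (forall t : R, is_derive F t (f t)) ->
  (forall t, F (t + T) = F t) -> Int0 T f = 0.
Proof.
  intros Cf H P. rewrite (Int0_derive T F f Cf H).
  specialize (P 0); rewrite Rplus_0_l in P; lra.
Qed.

Definition prim (f : R -> R) (t : R) : R := RInt f 0 t.

Lemma is_derive_prim f : cont f -> forall t : R, is_derive (prim f) t (f t).
Proof.
  intros F t. unfold prim. apply (is_derive_RInt f (fun t => RInt f 0 t) 0 t).
  - exists (mkposreal 1 Rlt_0_1). intros y _. apply (@RInt_correct R_CompleteNormedModule).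
    apply ex_RInt_cont; auto.
  - apply F.
Qed.

Lemma cont_prim f : cont f -> cont (prim f).
Proof. intro F; apply (cont_derive _ f); apply is_derive_prim; auto. Qed.

Lemma deriv0_const (F : R -> R) : (forall t : R, is_derive F t 0) -> forall s t, F s = F t.
Proof.
  intros H s t.
  destruct (MVT_gen F s t (fun _ => 0)) as [c [_ Hc]].
  - intros; apply H.
  - intros x _; apply continuity_pt_filterlim; apply (ex_derive_continuous (K:=R_AbsRing) (V:=R_NormedModule) F).
    exists 0; apply H.
  - lra.
Qed.

Lemma is_derive_shift (F : R -> R) (l s t : R) :
  is_derive F (t + s) l -> is_derive (fun u => F (u + s)) t l.
Proof.
  intro H. evar_last.
  - apply (is_derive_comp F (fun u => u + s) t l 1 H). auto_derive; auto.
  - unfold scal; simpl; unfold mult; simpl; ring.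
Qed.

Lemma prim_shift T f : pc T f -> forall t, prim f (t + T) = prim f t + Int0 T f.
Proof.
  intros [F P] t.
  assert (H : forall u : R, is_derive (fun u => prim f (u + T) - prim f u) u 0).
  { intro u. evar_last.
    - apply (is_derive_minus (V:=R_NormedModule) (fun u => prim f (u+T)) (prim f) u (f (u + T)) (f u)).
      + apply is_derive_shift. apply is_derive_prim; auto.
      + apply is_derive_prim; auto.
    - rewrite P. unfold minus, plus, opp; simpl; ring. }
  assert (E := deriv0_const _ H t 0). cbv beta in E. rewrite Rplus_0_l in E.
  unfold Int0. change (RInt f 0 T) with (prim f T).
  replace (prim f 0) with 0 in E; [lra|].
  unfold prim. rewrite RInt_point. reflexivity.
Qed.

Lemma pc_prim T f : pc T f -> Int0 T f = 0 -> pc T (prim f).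
Proof.
  intros F Z; split; [apply cont_prim, F | intro t; rewrite prim_shift, Z; [ring | exact F]].
Qed.

Lemma prim_0 f : prim f 0 = 0.
Proof. unfold prim. rewrite RInt_point. reflexivity. Qed.

Lemma prim_bound f M t : cont f -> 0 <= t -> (forall s, 0 <= s <= t -> Rabs (f s) <= M) ->
  Rabs (prim f t) <= t * M.
Proof.
  intros F Ht H. unfold prim. replace (t * M) with ((t - 0) * M) by ring.
  apply abs_RInt_le_const; auto. apply ex_RInt_cont; auto.
Qed.

Lemma per_IZR T f : (forall t, f (t + T) = f t :> R) -> forall (k : Z) t, f (t + IZR k * T) = f t.
Proof.
  intros P.
  assert (N : forall (k : nat) t, f (t + INR k * T) = f t).
  { induction k as [|k IH]; intro t.
    - simpl; f_equal; ring.
    - rewrite S_INR. replace (t + (INR k + 1) * T) with ((t + INR k * T) + T) by ring.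
      rewrite P; apply IH. }
  intros k t. destruct (Z_le_gt_dec 0 k) as [H|H].
  - rewrite <- (Z2Nat.id k H), <- INR_IZR_INZ. apply N.
  - rewrite <- (N (Z.to_nat (- k)) (t + IZR k * T)).
    f_equal. rewrite INR_IZR_INZ, Z2Nat.id by lia. rewrite opp_IZR. ring.
Qed.

Lemma per_reduce T f : 0 < T -> (forall t, f (t + T) = f t :> R) ->
  forall t, exists s, 0 <= s <= T /\ f t = f s.
Proof.
  intros HT P t. set (k := up (t / T)).
  destruct (archimed (t / T)) as [A B]. fold k in A, B.
  (* [up] is the floor plus one, so [1 - k] is minus the floor of [t / T]. *)
  exists (t + IZR (1 - k) * T). split; [|symmetry; apply per_IZR; exact P].
  rewrite minus_IZR.
  assert (E : t = (t / T) * T) by (field; lra).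
  set (r := t / T) in *. rewrite E. nra.
Qed.

Lemma prim_bound_per T f M : 0 < T -> pc T f -> Int0 T f = 0 -> (forall s, Rabs (f s) <= M) ->
  forall t, Rabs (prim f t) <= T * M.
Proof.
  intros HT F Z H t.
  destruct (per_reduce T (prim f) HT (proj2 (pc_prim T f F Z)) t) as [s [Hs E]].
  rewrite E. apply Rle_trans with (s * M); [apply prim_bound; [apply F|lra|auto]|].
  assert (0 <= M) by (eapply Rle_trans; [apply Rabs_pos | apply (H 0)]). nra.
Qed.

Lemma Int0_shift T f s : pc T f -> Int0 T (fun t => f (t + s)) = Int0 T f.
Proof.
  intros [F P].
  rewrite (Int0_derive T (fun t => prim f (t + s)) (fun t => f (t + s))).
  - rewrite (Rplus_comm T s), Rplus_0_l, prim_shift by (split; auto). ring.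
  - apply (cont_comp f (fun t => t + s) F). cts.
  - intro t. apply is_derive_shift, is_derive_prim; auto.
Qed.

Lemma Int0_pos T f t0 : 0 < T -> pc T f -> (forall t, 0 <= f t) -> 0 < f t0 -> 0 < Int0 T f.
Proof.
  intros HT [F P] H0 Ht.
  (* Periodicity moves [t0] to the left end of the interval, where a one-sided neighbourhood is
     enough. *)
  rewrite <- (Int0_shift T f t0) by (split; auto).
  set (g := fun t => f (t + t0)).
  assert (G : cont g) by (apply (cont_comp f (fun t => t + t0) F); cts).
  assert (G0 : 0 < g 0) by (unfold g; now rewrite Rplus_0_l).
  assert (C := G 0). apply continuity_pt_filterlim in C.
  destruct (C (g 0 / 2)) as [d [Hd H]]; [lra|].
  set (e := Rmin (d / 2) (T / 2)).
  assert (He : 0 < e) by (unfold e; apply Rmin_pos; lra).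
  assert (e <= d / 2) by apply Rmin_l. assert (e <= T / 2) by apply Rmin_r.
  assert (L : forall t, 0 < t < e -> g 0 / 2 < g t).
  { intros t Ht'. assert (D : Rabs (g t - g 0) < g 0 / 2).
    { apply H. split; [split; [exact Logic.I|lra]|]. simpl; unfold R_dist. rewrite Rabs_right; lra. }
    apply Rabs_def2 in D. lra. }
  unfold Int0. change (0 < RInt g 0 T).
  rewrite <- (RInt_Chasles (V:=R_CompleteNormedModule) g 0 e T) by (apply ex_RInt_cont; auto).
  assert (0 < RInt g 0 e).
  { apply RInt_gt_0; auto. intros x Hx. specialize (L x Hx). lra. }
  assert (0 <= RInt g e T).
  { apply RInt_ge_0; [lra | apply ex_RInt_cont; auto | intros; apply H0]. }
  unfold plus; simpl. lra.
Qed.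

Lemma pc_bounded T f : 0 < T -> pc T f -> exists M, 0 < M /\ forall t, Rabs (f t) <= M.
Proof.
  intros HT [F P].
  destruct (continuity_ab_maj (fun t => Rabs (f t)) 0 T) as [x [Hx _]]; [lra| |].
  - intros c _. apply continuity_pt_filterlim. apply (continuous_comp f Rabs); [apply F|].
    apply continuity_pt_filterlim, Rcontinuity_abs.
  - exists (Rabs (f x) + 1). split; [assert (H := Rabs_pos (f x)); lra|].
    intro t. destruct (per_reduce T f HT P t) as [s [Hs E]]. rewrite E.
    specialize (Hx s Hs). cbv beta in Hx. lra.
Qed.

(** * The periodically forced oscillator *)

(** A bounded right inverse of [y'' + K y] on periodic functions orthogonal to the constants and to
    [c], [s]. Additivity on differences is the form of linearity that contraction estimates use. The
    zero mean of [Y g] separates the constant mode, which makes the notion uniform down to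
    [K = 0]. *)
Definition solver (T K : R) (c s : R -> R) : Prop :=
  exists (Y dY : (R -> R) -> R -> R) (M : R), 0 < M /\
  (forall g, pc T g -> Int0 T g = 0 ->
     Int0 T (fun t => g t * c t) = 0 -> Int0 T (fun t => g t * s t) = 0 ->
     pc T (Y g) /\ Int0 T (Y g) = 0 /\
     (forall t : R, is_derive (Y g) t (dY g t)) /\
     (forall t : R, is_derive (dY g) t (g t - K * Y g t)) /\
     forall B, (forall t, Rabs (g t) <= B) -> forall t,
       Rabs (Y g t) <= M * B /\ Rabs (dY g t) <= M * B) /\
  (forall g1 g2, pc T g1 -> pc T g2 -> forall t,
     Y (fun t => g1 t - g2 t) t = Y g1 t - Y g2 t /\
     dY (fun t => g1 t - g2 t) t = dY g1 t - dY g2 t).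

Lemma pc_derive T F f : (forall t : R, is_derive F t (f t)) -> cont f ->
  (forall t, F (t + T) = F t) -> pc T f.
Proof.
  intros D C P. split; [exact C|]. intro t.
  assert (D1 := is_derive_shift F (f (t + T)) T t (D (t + T))).
  apply (is_derive_ext _ F) in D1; [|intro; apply P].
  rewrite <- (is_derive_unique _ _ _ D1). apply is_derive_unique, D.
Qed.

(** * Variation of constants with normalised fundamental solutions *)

Section Oscillator.
Variables (T K : R) (C S : R -> R).
Hypothesis HT : 0 < T.
Hypothesis dC : forall t : R, is_derive C t (- K * S t).
Hypothesis dS : forall t : R, is_derive S t (C t).
Hypothesis CS : forall t, C t * C t + K * (S t * S t) = 1.
Hypothesis C0 : C 0 = 1.
Hypothesis S0 : S 0 = 0.

Lemma cont_C : cont C. Proof. exact (cont_derive _ _ dC). Qed.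
Lemma cont_S : cont S. Proof. exact (cont_derive _ _ dS). Qed.

(** [E1] and [E2] are the Wronskians of [z] with the two fundamental solutions, hence constant;
    [C^2 + K S^2 = 1] recovers [z] from them, whatever the sign of [K]. *)
Lemma hom_zero (z dz : R -> R) :
  (forall t : R, is_derive z t (dz t)) -> (forall t : R, is_derive dz t (- K * z t)) ->
  z 0 = 0 -> dz 0 = 0 -> forall t, z t = 0.
Proof.
  intros D1 D2 Z0 Z1 t.
  assert (E1 : C t * dz t + K * S t * z t = C 0 * dz 0 + K * S 0 * z 0).
  { apply (deriv0_const (fun t => C t * dz t + K * S t * z t)). intro u.
    evar_last.
    - apply (is_derive_plus (V:=R_NormedModule)).
      + apply (is_derive_mult C dz u _ _ (dC u) (D2 u)). intros; apply Rmult_comm.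
      + apply (is_derive_mult (fun t => K * S t) z u (K * C u) (dz u)).
        * apply (is_derive_scal S u K (C u)); apply dS.
        * apply D1.
        * intros; apply Rmult_comm.
    - unfold plus, mult; simpl; unfold mult; simpl. ring. }
  assert (E2 : S t * dz t - C t * z t = S 0 * dz 0 - C 0 * z 0).
  { apply (deriv0_const (fun t => S t * dz t - C t * z t)). intro u.
    evar_last.
    - apply (is_derive_minus (V:=R_NormedModule)).
      + apply (is_derive_mult S dz u _ _ (dS u) (D2 u)). intros; apply Rmult_comm.
      + apply (is_derive_mult C z u _ _ (dC u) (D1 u)). intros; apply Rmult_comm.
    - unfold minus, plus, mult, opp; simpl; unfold mult; simpl. ring. }
  rewrite Z0, Z1 in E1, E2.
  replace (z t) with ((C t * C t + K * (S t * S t)) * z t) by (rewrite CS; ring).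
  replace ((C t * C t + K * (S t * S t)) * z t) with
    (S t * (C t * dz t + K * S t * z t) - C t * (S t * dz t - C t * z t)) by ring.
  rewrite E1, E2. ring.
Qed.

(** The variation of constants formula with initial value [c1] and initial velocity [c2]. *)
Definition voc (c1 c2 : R) (g : R -> R) (t : R) : R :=
  S t * (prim (fun s => C s * g s) t + c2) - C t * (prim (fun s => S s * g s) t - c1).
Definition dvoc (c1 c2 : R) (g : R -> R) (t : R) : R :=
  C t * (prim (fun s => C s * g s) t + c2) + K * S t * (prim (fun s => S s * g s) t - c1).

Lemma voc_derive c1 c2 g : cont g -> forall t : R, is_derive (voc c1 c2 g) t (dvoc c1 c2 g t).
Proof.
  intros G t. unfold voc, dvoc.
  assert (P1 := is_derive_prim (fun s => C s * g s) (cont_mult _ _ cont_C G) t).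
  assert (P2 := is_derive_prim (fun s => S s * g s) (cont_mult _ _ cont_S G) t).
  set (A := prim (fun s => C s * g s)) in *. set (B := prim (fun s => S s * g s)) in *.
  evar_last.
  - apply (is_derive_minus (V:=R_NormedModule)).
    + apply (is_derive_mult S (fun t => A t + c2) t (C t) (C t * g t)); [apply dS| |intros; apply Rmult_comm].
      evar_last. { apply (is_derive_plus (V:=R_NormedModule)); [apply P1 | apply (is_derive_const (K:=R_AbsRing) (V:=R_NormedModule))]. }
      unfold plus, zero; simpl; ring.
    + apply (is_derive_mult C (fun t => B t - c1) t (- K * S t) (S t * g t)); [apply dC| |intros; apply Rmult_comm].
      evar_last. { apply (is_derive_minus (V:=R_NormedModule)); [apply P2 | apply (is_derive_const (K:=R_AbsRing) (V:=R_NormedModule))]. }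
      unfold minus, plus, opp, zero; simpl; ring.
  - unfold minus, plus, mult, opp; simpl; unfold mult; simpl. ring.
Qed.

Lemma dvoc_derive c1 c2 g : cont g ->
  forall t : R, is_derive (dvoc c1 c2 g) t (g t - K * voc c1 c2 g t).
Proof.
  intros G t. unfold voc, dvoc.
  assert (P1 := is_derive_prim (fun s => C s * g s) (cont_mult _ _ cont_C G) t).
  assert (P2 := is_derive_prim (fun s => S s * g s) (cont_mult _ _ cont_S G) t).
  set (A := prim (fun s => C s * g s)) in *. set (B := prim (fun s => S s * g s)) in *.
  evar_last.
  - apply (is_derive_plus (V:=R_NormedModule)).
    + apply (is_derive_mult C (fun t => A t + c2) t (- K * S t) (C t * g t)); [apply dC| |intros; apply Rmult_comm].
      evar_last. { apply (is_derive_plus (V:=R_NormedModule)); [apply P1 | apply (is_derive_const (K:=R_AbsRing) (V:=R_NormedModule))]. }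
      unfold plus, zero; simpl; ring.
    + apply (is_derive_mult (fun t => K * S t) (fun t => B t - c1) t (K * C t) (S t * g t)); [|  |intros; apply Rmult_comm].
      * apply (is_derive_scal S t K (C t)); apply dS.
      * evar_last. { apply (is_derive_minus (V:=R_NormedModule)); [apply P2 | apply (is_derive_const (K:=R_AbsRing) (V:=R_NormedModule))]. }
      unfold minus, plus, opp, zero; simpl; ring.
  - unfold minus, plus, mult, opp; simpl; unfold mult; simpl.
    transitivity ((C t * C t + K * (S t * S t)) * g t -
      K * (S t * (A t + c2) - C t * (B t - c1))); [ring | rewrite CS; ring].
Qed.

(** The difference between the solution and its translate by [T] solves the homogeneous equation
    with zero initial data as soon as value and velocity agree at [0] and [T]. *)
Lemma voc_pc c1 c2 g : pc T g -> voc c1 c2 g T = c1 -> dvoc c1 c2 g T = c2 ->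
  pc T (voc c1 c2 g) /\ pc T (dvoc c1 c2 g).
Proof.
  intros G E1 E2.
  assert (D1 := voc_derive c1 c2 g (proj1 G)). assert (D2 := dvoc_derive c1 c2 g (proj1 G)).
  assert (Z : forall t, voc c1 c2 g (t + T) - voc c1 c2 g t = 0).
  { apply (hom_zero (fun t => voc c1 c2 g (t + T) - voc c1 c2 g t)
                    (fun t => dvoc c1 c2 g (t + T) - dvoc c1 c2 g t)).
    - intro t. apply (is_derive_minus (V:=R_NormedModule)); [|apply D1].
      apply is_derive_shift, D1.
    - intro t. evar_last.
      + apply (is_derive_minus (V:=R_NormedModule)); [|apply D2]. apply is_derive_shift, D2.
      + rewrite (proj2 G). unfold minus, plus, opp; simpl. ring.
    - rewrite Rplus_0_l, E1. unfold voc. rewrite !prim_0, C0, S0. ring.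
    - rewrite Rplus_0_l, E2. unfold dvoc. rewrite !prim_0, C0, S0. ring. }
  assert (P : forall t, voc c1 c2 g (t + T) = voc c1 c2 g t) by (intro t; specialize (Z t); lra).
  split.
  - split; [exact (cont_derive _ _ D1) | exact P].
  - apply (pc_derive T (voc c1 c2 g)); auto. exact (cont_derive _ _ D2).
Qed.

Lemma prim_minus f g t : cont f -> cont g ->
  prim (fun t => f t - g t) t = prim f t - prim g t.
Proof. intros; exact (Int0_minus t f g H H0). Qed.

Lemma prim_lin f g1 g2 t : cont f -> cont g1 -> cont g2 ->
  prim (fun s => f s * (g1 s - g2 s)) t = prim (fun s => f s * g1 s) t - prim (fun s => f s * g2 s) t.
Proof.
  intros. rewrite <- prim_minus by cts. apply (Int0_ext t). intro; ring.
Qed.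

Lemma bounded_CS : exists M, 1 <= M /\ forall t, 0 <= t <= T -> Rabs (C t) <= M /\ Rabs (S t) <= M.
Proof.
  assert (H : forall f, cont f -> exists M, forall t, 0 <= t <= T -> Rabs (f t) <= M).
  { intros f F. destruct (continuity_ab_maj (fun t => Rabs (f t)) 0 T) as [x [Hx _]]; [lra| |].
    - intros c _. apply continuity_pt_filterlim. apply (continuous_comp f Rabs); [apply F|].
      apply continuity_pt_filterlim, Rcontinuity_abs.
    - exists (Rabs (f x)). exact Hx. }
  destruct (H C cont_C) as [M1 H1]. destruct (H S cont_S) as [M2 H2].
  exists (Rmax 1 (Rmax M1 M2)). split; [apply Rmax_l|].
  intros t Ht. specialize (H1 t Ht). specialize (H2 t Ht).
  assert (A := Rmax_r 1 (Rmax M1 M2)). assert (B := Rmax_l M1 M2). assert (D := Rmax_r M1 M2).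
  split; lra.
Qed.

(** [k1] and [k2] select initial data from the forcing. It is enough that this selection gives a
    periodic solution, is bounded and is additive; everything else comes from the variation of
    constants formula. *)
Lemma voc_solver (c s : R -> R) (k1 k2 : (R -> R) -> R) (M1 : R) :
  K <> 0 -> 0 <= M1 ->
  (forall g, pc T g -> Int0 T g = 0 -> Int0 T (fun t => g t * c t) = 0 -> Int0 T (fun t => g t * s t) = 0 ->
     voc (k1 g) (k2 g) g T = k1 g /\ dvoc (k1 g) (k2 g) g T = k2 g) ->
  (forall g B, pc T g -> (forall t, Rabs (g t) <= B) -> Rabs (k1 g) <= M1 * B /\ Rabs (k2 g) <= M1 * B) ->
  (forall g1 g2, pc T g1 -> pc T g2 -> k1 (fun t => g1 t - g2 t) = k1 g1 - k1 g2 /\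
     k2 (fun t => g1 t - g2 t) = k2 g1 - k2 g2) ->
  solver T K c s.
Proof.
  intros HK HM1 Hper Hb Hlin.
  destruct bounded_CS as [M0 [HM0 HCS]].
  set (M := (2 + Rabs K) * M0 * (T * M0 + M1)).
  assert (KP := Rabs_pos K).
  assert (0 < T * M0) by (apply Rmult_lt_0_compat; lra).
  exists (fun g => voc (k1 g) (k2 g) g), (fun g => dvoc (k1 g) (k2 g) g), M.
  split; [|split].
  - unfold M. apply Rmult_lt_0_compat; [apply Rmult_lt_0_compat|]; lra.
  - intros g G Z Zc Zs. destruct (Hper g G Z Zc Zs) as [E1 E2].
    destruct (voc_pc _ _ g G E1 E2) as [P1 P2].
    assert (D1 := voc_derive (k1 g) (k2 g) g (proj1 G)).
    assert (D2 := dvoc_derive (k1 g) (k2 g) g (proj1 G)).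
    split; [exact P1|]. split; [|split; [exact D1|split; [exact D2|]]].
    (* The derivative of a periodic function has zero mean, so [K] times the mean of the solution is
       the mean of [g]. *)
    + assert (E : Int0 T (fun t => g t - K * voc (k1 g) (k2 g) g t) = 0).
      { apply (Int0_derive0 T (dvoc (k1 g) (k2 g) g)); [|exact D2|apply P2].
        cts. }
      rewrite Int0_minus, Int0_scal, Z in E by cts.
      apply Rmult_eq_reg_l with K; [lra|exact HK].
    + intros B HB.
      assert (HB0 : 0 <= B) by (eapply Rle_trans; [apply Rabs_pos | apply (HB 0)]).
      destruct (Hb g B G HB) as [B1 B2].
      assert (L : forall t, 0 <= t <= T -> Rabs (voc (k1 g) (k2 g) g t) <= M * B /\
                   Rabs (dvoc (k1 g) (k2 g) g t) <= M * B).
      { intros t Ht. destruct (HCS t Ht) as [Ct St].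
        assert (PB : forall f, cont f -> (forall s, 0 <= s <= T -> Rabs (f s) <= M0) ->
                  Rabs (prim (fun s => f s * g s) t) <= T * M0 * B).
        { intros f F Hf. apply Rle_trans with (t * (M0 * B)).
          - apply prim_bound; [cts|lra|].
            intros u Hu. rewrite Rabs_mult. apply Rmult_le_compat; try apply Rabs_pos; [apply Hf; lra|apply HB].
          - assert (0 <= M0 * B) by (apply Rmult_le_pos; lra). nra. }
        assert (PA := PB C cont_C (fun s Hs => proj1 (HCS s Hs))).
        assert (PS := PB S cont_S (fun s Hs => proj2 (HCS s Hs))).
        unfold voc, dvoc.
        set (A := prim (fun s => C s * g s) t) in *. set (Bq := prim (fun s => S s * g s) t) in *.
        assert (XA : Rabs (A + k2 g) <= (T * M0 + M1) * B).
        { eapply Rle_trans; [apply Rabs_triang|]. lra. }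
        assert (XB : Rabs (Bq - k1 g) <= (T * M0 + M1) * B).
        { unfold Rminus; eapply Rle_trans; [apply Rabs_triang|]. rewrite Rabs_Ropp. lra. }
        set (W := (T * M0 + M1) * B) in *.
        assert (HW : 0 <= W) by (eapply Rle_trans; [apply Rabs_pos | apply XA]).
        assert (Q : forall a b, Rabs a <= M0 -> Rabs b <= W -> Rabs (a * b) <= M0 * W).
        { intros a b Ha Hb'. rewrite Rabs_mult. apply Rmult_le_compat; auto; apply Rabs_pos. }
        assert (HMW : 0 <= M0 * W) by (apply Rmult_le_pos; lra).
        replace (M * B) with (M0 * W + M0 * W + Rabs K * (M0 * W)) by (unfold M, W; ring).
        assert (0 <= Rabs K * (M0 * W)) by (apply Rmult_le_pos; auto).
        split.
        - unfold Rminus at 1. eapply Rle_trans; [apply Rabs_triang|]. rewrite Rabs_Ropp.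
          assert (Q1 := Q _ _ St XA). assert (Q2 := Q _ _ Ct XB). lra.
        - eapply Rle_trans; [apply Rabs_triang|].
          assert (Q1 := Q _ _ Ct XA). assert (Q2 := Q _ _ St XB).
          rewrite Rmult_assoc, (Rabs_mult K).
          assert (Rabs K * Rabs (S t * (Bq - k1 g)) <= Rabs K * (M0 * W)) by (apply Rmult_le_compat_l; auto).
          lra. }
      intro t. split.
      * destruct (per_reduce T _ HT (proj2 P1) t) as [u [Hu ->]]. apply L; auto.
      * destruct (per_reduce T _ HT (proj2 P2) t) as [u [Hu ->]]. apply L; auto.
  - intros g1 g2 G1 G2 t. destruct (Hlin g1 g2 G1 G2) as [L1 L2].
    unfold voc, dvoc. rewrite L1, L2.
    rewrite (prim_lin C), (prim_lin S) by (try apply cont_C; try apply cont_S; eapply pc_cont; eassumption).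
    split; ring.
Qed.

(** The monodromy matrix has determinant 1 and trace [2 * C T], so 1 is not an eigenvalue exactly
    when [C T <> 1]. The initial data follow from Cramer's rule with determinant [D]; [X] stands for
    the initial velocity plus [a], and [Z] for the initial value minus [b]. *)
Lemma solver_nonres : K <> 0 -> C T <> 1 -> solver T K (fun _ => 0) (fun _ => 0).
Proof.
  intros HK HC.
  destruct bounded_CS as [M0 [HM0 HCS]].
  pose (D := 2 * (C T - 1)).
  assert (HD : D <> 0) by (unfold D; lra).
  assert (CST := CS T).
  pose (X := fun A B => ((C T - 1) * A - K * S T * B) / D).
  pose (Z := fun A B => - (S T * A + (C T - 1) * B) / D).
  pose (a := fun g => prim (fun s => C s * g s) T). pose (b := fun g => prim (fun s => S s * g s) T).
  pose (N := (M0 + 1 + Rabs K * M0 + (M0 + (M0 + 1))) / Rabs D).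
  assert (HaD : 0 < Rabs D) by (apply Rabs_pos_lt; auto).
  assert (KP := Rabs_pos K).
  assert (HKM : 0 <= Rabs K * M0) by (apply Rmult_le_pos; lra).
  assert (HN : 0 <= N) by (unfold N; apply Rdiv_le_0_compat; lra).
  assert (HTM : 0 <= T * M0) by (apply Rmult_le_pos; lra).
  apply (voc_solver _ _ (fun g => Z (a g) (b g) + b g) (fun g => X (a g) (b g) - a g) (N * (T * M0) + T * M0)); auto.
  - assert (0 <= N * (T * M0)) by (apply Rmult_le_pos; auto). lra.
  - intros g G _ _ _. unfold voc, dvoc. fold (a g) (b g).
    set (u := a g). set (v := b g).
    replace (u + (X u v - u)) with (X u v) by ring.
    replace (v - (Z u v + v)) with (- Z u v) by ring.
    assert (E1 : S T * X u v + (C T - 1) * Z u v = v).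
    { unfold X, Z. replace v with ((- K * (S T * S T) - (C T - 1) * (C T - 1)) * v / D) at 3.
      - field; auto.
      - replace (- K * (S T * S T) - (C T - 1) * (C T - 1)) with D; [field; auto|unfold D; nra]. }
    assert (E2 : (C T - 1) * X u v - K * S T * Z u v = - u).
    { unfold X, Z. replace (-u) with (- ((- K * (S T * S T) - (C T - 1) * (C T - 1)) * u / D)).
      - assert (HC2 : (C T - 1) * (C T - 1) + K * (S T * S T) = - D) by (unfold D; nra).
        transitivity (((C T - 1) * (C T - 1) + K * (S T * S T)) * u / D); [field; auto|].
        rewrite HC2. replace (- K * (S T * S T) - (C T - 1) * (C T - 1)) with D by (unfold D; nra). field; auto.
      - replace (- K * (S T * S T) - (C T - 1) * (C T - 1)) with D; [field; auto|unfold D; nra]. }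
    split; nra.
  - intros g B G HB.
    assert (HB0 : 0 <= B) by (eapply Rle_trans; [apply Rabs_pos | apply (HB 0)]).
    assert (PB : forall f, cont f -> (forall s, 0 <= s <= T -> Rabs (f s) <= M0) ->
                  Rabs (prim (fun s => f s * g s) T) <= T * M0 * B).
    { intros f F Hf. replace (T * M0 * B) with (T * (M0 * B)) by ring.
      apply prim_bound; [cts|lra|].
      intros u Hu. rewrite Rabs_mult. apply Rmult_le_compat; try apply Rabs_pos; [apply Hf; lra|apply HB]. }
    assert (PA := PB C cont_C (fun s Hs => proj1 (HCS s Hs))). fold (a g) in PA.
    assert (PS := PB S cont_S (fun s Hs => proj2 (HCS s Hs))). fold (b g) in PS.
    destruct (HCS T (conj (Rlt_le _ _ HT) (Rle_refl T))) as [CT ST].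
    assert (CT1 : Rabs (C T - 1) <= M0 + 1).
    { unfold Rminus; eapply Rle_trans; [apply Rabs_triang|]. rewrite Rabs_Ropp, Rabs_R1. lra. }
    set (W := T * M0 * B) in *.
    assert (HW : 0 <= W) by (unfold W; apply Rmult_le_pos; lra).
    assert (Q : forall x y m, Rabs x <= m -> Rabs y <= W -> Rabs (x * y) <= m * W).
    { intros x y m Hx Hy. rewrite Rabs_mult. apply Rmult_le_compat; auto; apply Rabs_pos. }
    assert (Dv : forall x m, Rabs x <= m * W -> m <= M0 + 1 + Rabs K * M0 + (M0 + (M0 + 1)) -> Rabs (x / D) <= N * W).
    { intros x m Hx Hm. unfold Rdiv. rewrite Rabs_mult, Rabs_inv.
      unfold N, Rdiv. rewrite Rmult_assoc, (Rmult_comm (/ Rabs D)), <- Rmult_assoc.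
      apply Rmult_le_compat_r; [left; apply Rinv_0_lt_compat; auto|].
      apply Rle_trans with (m * W); auto. apply Rmult_le_compat_r; auto. }
    replace ((N * (T * M0) + T * M0) * B) with (N * W + W) by (unfold W; ring).
    split.
    + eapply Rle_trans; [apply Rabs_triang|]. apply Rplus_le_compat; auto.
      unfold Z. apply (Dv _ (M0 + (M0 + 1))); [|lra].
      rewrite Rabs_Ropp. eapply Rle_trans; [apply Rabs_triang|].
      assert (Q1 := Q _ _ _ ST PA). assert (Q2 := Q _ _ _ CT1 PS). lra.
    + unfold Rminus; eapply Rle_trans; [apply Rabs_triang|]. rewrite Rabs_Ropp. apply Rplus_le_compat; auto.
      unfold X. apply (Dv _ (M0 + 1 + Rabs K * M0)); [|lra].
      unfold Rminus; eapply Rle_trans; [apply Rabs_triang|]. rewrite Rabs_Ropp.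
      fold (C T - 1).
      assert (KS : Rabs (K * S T) <= Rabs K * M0).
      { rewrite Rabs_mult. apply Rmult_le_compat_l; auto. }
      assert (Q1 := Q _ _ _ CT1 PA). assert (Q2 := Q _ _ _ KS PS). lra.
  - intros g1 g2 G1 G2. unfold a, b, X, Z.
    rewrite (prim_lin C), (prim_lin S) by (try apply cont_C; try apply cont_S; eapply pc_cont; eassumption).
    split; field; auto.
Qed.

(** The monodromy matrix is the identity, so the two orthogonality conditions alone make the
    solution with zero initial data periodic. The factor [r] allows a mode [s] normalised
    differently from [S]. *)
Lemma solver_res (r : R) (s : R -> R) : K <> 0 -> C T = 1 -> S T = 0 ->
  cont s -> (forall t, S t = r * s t) -> solver T K C s.
Proof.
  intros HK HC HS Cs Hr.
  apply (voc_solver _ _ (fun _ => 0) (fun _ => 0) 0); auto; try lra.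
  - intros g G _ ZC ZS. unfold voc, dvoc.
    replace (prim (fun s => C s * g s) T) with 0.
    replace (prim (fun s => S s * g s) T) with 0.
    rewrite HC, HS. split; ring.
    + transitivity (r * Int0 T (fun t => g t * s t)); [rewrite ZS; ring|].
      rewrite <- Int0_scal by cts. apply Int0_ext. intro; rewrite Hr; ring.
    + rewrite <- ZC. apply Int0_ext. intro; ring.
  - intros g B _ _. rewrite Rabs_R0. split; lra.
  - intros; split; ring.
Qed.
End Oscillator.

(** For [K = 0] the forcing is integrated twice. Each primitive is centred, once to make the next
    one periodic and once to normalise the result. *)
Lemma solver_zero T : 0 < T -> solver T 0 (fun _ => 0) (fun _ => 0).
Proof.
  intro HT.
  pose (dY := fun g t => prim g t - Int0 T (prim g) / T).
  pose (Y := fun g t => prim (dY g) t - Int0 T (prim (dY g)) / T).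
  assert (cdY : forall g, cont g -> cont (dY g)) by (intros; apply cont_minus; [apply cont_prim; auto | cts]).
  assert (AV : forall h, pc T h -> Int0 T (fun t => h t - Int0 T h / T) = 0).
  { intros h H. rewrite Int0_minus, Int0_const; [field; lra|apply H|cts]. }
  assert (BD : forall h B, pc T h -> Int0 T h = 0 -> (forall t, Rabs (h t) <= B) ->
             forall t, Rabs (prim h t - Int0 T (prim h) / T) <= 2 * T * B).
  { intros h B H Z HB t. unfold Rminus; eapply Rle_trans; [apply Rabs_triang|]. rewrite Rabs_Ropp.
    assert (P := prim_bound_per T h B HT H Z HB).
    assert (Q := Int0_bound T (prim h) (T * B) (Rlt_le _ _ HT) (proj1 (pc_prim T h H Z)) P).
    unfold Rdiv. rewrite Rabs_mult, Rabs_inv, (Rabs_right T) by lra.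
    assert (Rabs (Int0 T (prim h)) * / T <= T * B).
    { apply Rmult_le_reg_r with T; [auto|]. rewrite Rmult_assoc, Rinv_l by lra. lra. }
    specialize (P t). lra. }
  exists Y, dY, (2 * T + 4 * T * T). split; [nra|]. split.
  - intros g G Z _ _.
    assert (P1 := pc_prim T g G Z).
    assert (PdY : pc T (dY g)) by (unfold dY; pcs).
    assert (ZdY : Int0 T (dY g) = 0) by (apply AV; auto).
    assert (P2 := pc_prim T (dY g) PdY ZdY).
    split; [unfold Y; pcs|]. split; [apply AV; auto|]. split; [|split].
    + intro t. unfold Y. evar_last.
      * apply (is_derive_minus (V:=R_NormedModule)); [apply is_derive_prim; apply PdY|apply (is_derive_const (K:=R_AbsRing) (V:=R_NormedModule))].
      * unfold minus, plus, opp, zero; simpl; ring.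
    + intro t. unfold dY at 1. evar_last.
      * apply (is_derive_minus (V:=R_NormedModule)); [apply is_derive_prim; apply G|apply (is_derive_const (K:=R_AbsRing) (V:=R_NormedModule))].
      * unfold minus, plus, opp, zero; simpl; ring.
    + intros B HB t.
      assert (HB0 : 0 <= B) by (eapply Rle_trans; [apply Rabs_pos | apply (HB 0)]).
      assert (0 <= T * T * B) by (apply Rmult_le_pos; nra).
      assert (0 <= T * B) by (apply Rmult_le_pos; lra).
      assert (BdY : forall t, Rabs (dY g t) <= 2 * T * B) by (apply BD; auto).
      assert (BY := BD (dY g) (2 * T * B) PdY ZdY BdY t). fold (Y g t) in BY.
      specialize (BdY t). split; nra.
  - intros g1 g2 G1 G2.
    assert (LP : forall f g, cont f -> cont g -> prim (fun t => f t - g t) = (fun t => prim f t - prim g t)).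
    { intros f g F G. apply functional_extensionality; intro t. apply prim_minus; auto. }
    assert (LdY : dY (fun t => g1 t - g2 t) = (fun t => dY g1 t - dY g2 t)).
    { apply functional_extensionality; intro t. unfold dY.
      rewrite (LP g1 g2) by (eapply pc_cont; eassumption).
      rewrite Int0_minus by (apply cont_prim; eapply pc_cont; eassumption). field; lra. }
    intro t. split; [|rewrite LdY; reflexivity].
    unfold Y. rewrite LdY, (LP (dY g1) (dY g2)) by (apply cdY; eapply pc_cont; eassumption).
    rewrite Int0_minus by (apply cont_prim, cdY; eapply pc_cont; eassumption). field; lra.
Qed.

Lemma cos_eq_1 x : cos x = 1 -> exists k : Z, x = 2 * IZR k * PI.
Proof.
  intro H. assert (S : sin (x / 2) = 0).
  { assert (E := cos_2a_sin (x / 2)). replace (2 * (x / 2)) with x in E by field. rewrite H in E. nra. }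
  destruct (sin_eq_0_0 _ S) as [k Hk]. exists k. lra.
Qed.

(* In the resonant case a [2 PI p]-periodic forcing excites the radial oscillations, of frequency
[sqrt (3 - alpha) = k / p]. *)
Lemma oscillator_solver (p : nat) (K : R) : (1 <= p)%nat ->
  solver (2 * PI * INR p) K (fun _ => 0) (fun _ => 0) \/
  exists k : nat, (1 <= k)%nat /\ K = (INR k / INR p) * (INR k / INR p) /\
    solver (2 * PI * INR p) K (fun t => cos (INR k / INR p * t)) (fun t => sin (INR k / INR p * t)).
Proof.
  intro Hp. assert (Pp : 0 < INR p) by (apply lt_0_INR; lia).
  set (T := 2 * PI * INR p).
  assert (HPI := PI_RGT_0).
  assert (HT : 0 < T) by (unfold T; apply Rmult_lt_0_compat; lra).
  destruct (Rtotal_order K 0) as [HK|[HK|HK]].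
  - left. set (w := sqrt (- K)).
    assert (Hw : 0 < w) by (apply sqrt_lt_R0; lra).
    assert (Hw2 : w * w = - K) by (apply sqrt_sqrt; lra).
    apply (solver_nonres T K (fun t => (exp (w * t) + exp (- (w * t))) / 2)
             (fun t => (exp (w * t) - exp (- (w * t))) / (2 * w))); auto.
    + intro t. auto_derive; auto. replace (- K) with (w * w) by lra. field. lra.
    + intro t. auto_derive; auto. field. lra.
    + intro t. replace K with (- (w * w)) by lra.
      assert (E : exp (w * t) * exp (- (w * t)) = 1) by (rewrite <- exp_plus; replace (w * t + - (w * t)) with 0 by ring; apply exp_0).
      set (u := exp (w * t)) in *. set (v := exp (- (w * t))) in *.
      replace 1 with (u * v) by auto. field. lra.
    + rewrite Rmult_0_r, Ropp_0, exp_0. field.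
    + rewrite Rmult_0_r, Ropp_0, exp_0. field. lra.
    + lra.
    + assert (E : exp (w * T) * exp (- (w * T)) = 1) by (rewrite <- exp_plus; replace (w * T + - (w * T)) with 0 by ring; apply exp_0).
      assert (1 < exp (w * T)).
      { rewrite <- exp_0. apply exp_increasing. apply Rmult_lt_0_compat; auto. }
      intro H1. set (u := exp (w * T)) in *. set (v := exp (- (w * T))) in *. nra.
  - left. subst K. apply solver_zero; auto.
  - set (w := sqrt K).
    assert (Hw : 0 < w) by (apply sqrt_lt_R0; lra).
    assert (Hw2 : w * w = K) by (apply sqrt_sqrt; lra).
    assert (E : forall t, cos (w * t) * cos (w * t) + sin (w * t) * sin (w * t) = 1).
    { intro t. assert (H := sin2_cos2 (w * t)). unfold Rsqr in H. lra. }
    assert (F1 : forall t : R, is_derive (fun t => cos (w * t)) t (- K * (/ w * sin (w * t)))).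
    { intro t. auto_derive; auto. rewrite <- Hw2. field. lra. }
    assert (F2 : forall t : R, is_derive (fun t => / w * sin (w * t)) t (cos (w * t))).
    { intro t. auto_derive; auto. field. lra. }
    assert (F3 : forall t, cos (w * t) * cos (w * t) + K * (/ w * sin (w * t) * (/ w * sin (w * t))) = 1).
    { intro t. rewrite <- Hw2, <- (E t). field. lra. }
    destruct (Req_dec (cos (w * T)) 1) as [H1|H1].
    + right. destruct (cos_eq_1 _ H1) as [k Hk].
      assert (Hkp : IZR k = w * INR p).
      { unfold T in Hk. apply Rmult_eq_reg_r with (2 * PI); lra. }
      assert (0 < k)%Z.
      { apply lt_IZR. rewrite Hkp. apply Rmult_lt_0_compat; auto. }
      exists (Z.to_nat k). split; [lia|].
      assert (Ek : INR (Z.to_nat k) / INR p = w).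
      { rewrite INR_IZR_INZ, Z2Nat.id by lia. rewrite Hkp. field. lra. }
      rewrite Ek. split; [auto|].
      apply (solver_res T K _ (fun t => / w * sin (w * t)) HT F1 F2 F3) with (r := / w); auto; try lra.
      * rewrite Rmult_0_r. apply cos_0.
      * rewrite Rmult_0_r, sin_0. ring.
      * assert (E' := E T). rewrite H1 in E'. assert (H2 : sin (w * T) = 0) by nra. rewrite H2. ring.
      * cts.
    + left.
      apply (solver_nonres T K (fun t => cos (w * t)) (fun t => / w * sin (w * t))); auto; try lra.
      * rewrite Rmult_0_r. apply cos_0.
      * rewrite Rmult_0_r, sin_0. ring.
Qed.

(** * The linearisation in the rotating frame *)

(* The kernel, on [T]-periodic functions, of [x1'' + 2 x2' - beta x1], [x2'' - 2 x1'] is spanned by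
[(0, 1)] and, in the resonant case only, by [(c, 2/kappa s)] and [(s, -2/kappa c)]. The nonresonant
case is encoded by [c = s = 0]. *)
Record modes (T K kappa : R) (c s : R -> R) : Prop := {
  md_kappa : 0 < kappa;
  md_c : pc T c; md_s : pc T s;
  md_dc : forall t : R, is_derive c t (- (kappa * s t));
  md_ds : forall t : R, is_derive s t (kappa * c t);
  md_Kc : forall t, K * c t = kappa * kappa * c t;
  md_Ks : forall t, K * s t = kappa * kappa * s t;
  md_bound : forall t, Rabs (c t) <= 1 /\ Rabs (s t) <= 1;
  md_Ic : Int0 T c = 0; md_Is : Int0 T s = 0;
  md_Ics : Int0 T (fun t => c t * s t) = 0;
  md_norm : (Int0 T (fun t => c t * c t) = T / 2 /\ Int0 T (fun t => s t * s t) = T / 2) \/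
    forall t, c t = 0 /\ s t = 0 }.

(** The common squared norm of the two modes when they are present. It keeps this positive value
    when [c = s = 0], so that dividing by it is harmless. *)
Definition mode_norm2 (T kappa : R) : R := T / 2 * (1 + 2 / kappa * (2 / kappa)).
Definition pr0 (T : R) (h2 : R -> R) : R := Int0 T h2 / T.
Definition pr1 (T kappa : R) (c s h1 h2 : R -> R) : R :=
  Int0 T (fun t => h1 t * c t + h2 t * (2 / kappa * s t)) / mode_norm2 T kappa.
Definition pr2 (T kappa : R) (c s h1 h2 : R -> R) : R :=
  Int0 T (fun t => h1 t * s t - h2 t * (2 / kappa * c t)) / mode_norm2 T kappa.

Section LinearOperator.
Variables (T K kappa : R) (c s : R -> R).
Hypothesis HT : 0 < T.
Hypothesis MD : modes T K kappa c s.

Let k2 := 2 / kappa.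
Let n := mode_norm2 T kappa.
Notation p1 := (pr1 T kappa c s).
Notation p2 := (pr2 T kappa c s).

Lemma msq_pos : 0 < n.
Proof.
  unfold n, mode_norm2. assert (0 <= 2 / kappa * (2 / kappa)) by apply Rle_0_sqr.
  apply Rmult_lt_0_compat; lra.
Qed.

Lemma pr_lin a b h1 h2 h1' h2' : pc T h1 -> pc T h2 -> pc T h1' -> pc T h2' ->
  p1 (fun t => a * h1 t + b * h1' t) (fun t => a * h2 t + b * h2' t) = a * p1 h1 h2 + b * p1 h1' h2' /\
  p2 (fun t => a * h1 t + b * h1' t) (fun t => a * h2 t + b * h2' t) = a * p2 h1 h2 + b * p2 h1' h2'.
Proof.
  intros A1 A2 B1 B2. destruct MD. assert (N := msq_pos). unfold n in N.
  unfold pr1, pr2. split.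
  - rewrite (Int0_ext T _ (fun t => a * (h1 t * c t + h2 t * (2 / kappa * s t)) + b * (h1' t * c t + h2' t * (2 / kappa * s t)))) by (intro; ring).
    rewrite Int0_plus, !Int0_scal by cts. field; lra.
  - rewrite (Int0_ext T _ (fun t => a * (h1 t * s t - h2 t * (2 / kappa * c t)) + b * (h1' t * s t - h2' t * (2 / kappa * c t)))) by (intro; ring).
    rewrite Int0_plus, !Int0_scal by cts. field; lra.
Qed.

Lemma pr_minus h1 h2 h1' h2' : pc T h1 -> pc T h2 -> pc T h1' -> pc T h2' ->
  p1 (fun t => h1 t - h1' t) (fun t => h2 t - h2' t) = p1 h1 h2 - p1 h1' h2' /\
  p2 (fun t => h1 t - h1' t) (fun t => h2 t - h2' t) = p2 h1 h2 - p2 h1' h2'.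
Proof.
  intros A1 A2 B1 B2. destruct (pr_lin 1 (-1) h1 h2 h1' h2' A1 A2 B1 B2) as [E1 E2].
  assert (F : forall u v : R -> R, (fun t => 1 * u t + -1 * v t) = (fun t => u t - v t))
    by (intros; apply functional_extensionality; intro; ring).
  rewrite !F in E1, E2. lra.
Qed.

(** The three kernel vectors are orthogonal: the modes have zero mean, and the products of [c] and
    [s] integrate to zero. *)
Lemma pr_modes (a b r : R) :
  (forall t, c t = 0 /\ s t = 0) \/
  (p1 (fun t => a * c t + b * s t) (fun t => r + a * (k2 * s t) - b * (k2 * c t)) = a /\
   p2 (fun t => a * c t + b * s t) (fun t => r + a * (k2 * s t) - b * (k2 * c t)) = b).
Proof.
  destruct MD. destruct md_norm0 as [[Q1 Q2]|Q]; [right|left; exact Q].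
  assert (N := msq_pos). unfold n in N. unfold pr1, pr2. split.
  - rewrite (Int0_ext T _ (fun t => a * (c t * c t) + a * (k2 * k2) * (s t * s t) + (b * (1 - k2 * k2)) * (c t * s t) + r * k2 * s t)) by (intro; unfold k2; ring).
    rewrite !Int0_plus, !Int0_scal, Q1, Q2, md_Ics0, md_Is0 by cts. unfold k2, mode_norm2 in *. field.
    split; [lra|]. assert (0 <= 2 / kappa * (2 / kappa)) by apply Rle_0_sqr.
    assert (0 < kappa * kappa) by (apply Rmult_lt_0_compat; lra). nra.
  - rewrite (Int0_ext T _ (fun t => b * (s t * s t) + b * (k2 * k2) * (c t * c t) + (a * (1 - k2 * k2)) * (c t * s t) + (- r * k2) * c t)) by (intro; unfold k2; ring).
    rewrite !Int0_plus, !Int0_scal, Q1, Q2, md_Ics0, md_Ic0 by cts. unfold k2, mode_norm2 in *. field.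
    split; [lra|]. assert (0 <= 2 / kappa * (2 / kappa)) by apply Rle_0_sqr.
    assert (0 < kappa * kappa) by (apply Rmult_lt_0_compat; lra). nra.
Qed.

Lemma pr_bound B h1 h2 : pc T h1 -> pc T h2 ->
  (forall t, Rabs (h1 t) <= B /\ Rabs (h2 t) <= B) ->
  Rabs (p1 h1 h2) <= T * (1 + k2) / n * B /\ Rabs (p2 h1 h2) <= T * (1 + k2) / n * B.
Proof.
  intros A1 A2 HB. destruct MD. assert (N := msq_pos). unfold n in *.
  assert (Hk : 0 < k2) by (unfold k2; apply Rdiv_lt_0_compat; lra).
  assert (Q : forall x y, Rabs x <= B -> Rabs y <= 1 -> Rabs (x * y) <= B).
  { intros x y Hx Hy. rewrite Rabs_mult. assert (H1 := Rabs_pos x). assert (H2 := Rabs_pos y). nra. }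
  assert (Q' : forall x y, Rabs x <= B -> Rabs y <= 1 -> Rabs (x * (k2 * y)) <= k2 * B).
  { intros x y Hx Hy. replace (x * (k2 * y)) with (k2 * (x * y)) by ring.
    rewrite Rabs_mult, (Rabs_right k2) by lra. apply Rmult_le_compat_l; [lra|auto]. }
  assert (W : forall f, cont f -> (forall t, Rabs (f t) <= (1 + k2) * B) ->
     Rabs (Int0 T f / mode_norm2 T kappa) <= T * (1 + k2) / mode_norm2 T kappa * B).
  { intros f F Hf. assert (Z := Int0_bound T f _ (Rlt_le _ _ HT) F Hf).
    unfold Rdiv. rewrite Rabs_mult, Rabs_inv, (Rabs_right (mode_norm2 _ _)) by lra.
    replace (T * (1 + k2) * / mode_norm2 T kappa * B) with (T * ((1 + k2) * B) * / mode_norm2 T kappa) by ring.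
    apply Rmult_le_compat_r; [left; apply Rinv_0_lt_compat; auto | auto]. }
  unfold pr1, pr2. split.
  - apply W; [cts|]. intro t. destruct (HB t), (md_bound0 t). fold k2.
    eapply Rle_trans; [apply Rabs_triang|]. assert (X := Q (h1 t) (c t)). assert (X' := Q' (h2 t) (s t)).
    intuition lra.
  - apply W; [cts|]. intro t. destruct (HB t), (md_bound0 t). fold k2.
    unfold Rminus; eapply Rle_trans; [apply Rabs_triang|]. rewrite Rabs_Ropp.
    assert (X := Q (h1 t) (s t)). assert (X' := Q' (h2 t) (c t)).
    intuition lra.
Qed.

Definition centered (f : R -> R) (t : R) : R := f t - Int0 T f / T.

Lemma centered_pc f : pc T f -> pc T (centered f).
Proof. intro; unfold centered; pcs. Qed.
Lemma centered_zero f : pc T f -> Int0 T (centered f) = 0.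
Proof. intro; unfold centered. rewrite Int0_minus, Int0_const by cts. field; lra. Qed.
Lemma centered_minus f g : pc T f -> pc T g ->
  centered (fun t => f t - g t) = (fun t => centered f t - centered g t).
Proof.
  intros; apply functional_extensionality; intro t; unfold centered.
  rewrite Int0_minus by cts. field; lra.
Qed.
Lemma mean_bound f B : cont f -> (forall t, Rabs (f t) <= B) -> Rabs (Int0 T f / T) <= B.
Proof.
  intros F HB. assert (Q := Int0_bound T f B (Rlt_le _ _ HT) F HB).
  unfold Rdiv. rewrite Rabs_mult, Rabs_inv, (Rabs_right T) by lra.
  apply Rmult_le_reg_r with T; [auto|]. rewrite Rmult_assoc, Rinv_l by lra. lra.
Qed.
Lemma centered_bound f B : cont f -> (forall t, Rabs (f t) <= B) -> forall t, Rabs (centered f t) <= 2 * B.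
Proof.
  intros F HB t. unfold centered, Rminus. eapply Rle_trans; [apply Rabs_triang|]. rewrite Rabs_Ropp.
  assert (Q := mean_bound f B F HB). specialize (HB t). lra.
Qed.

(** [red1] and [red2] form the orthogonal projection of [(h1, h2)] off the kernel. *)
Definition red1 (h1 h2 : R -> R) (t : R) : R := h1 t - p1 h1 h2 * c t - p2 h1 h2 * s t.
Definition red2 (h1 h2 : R -> R) (t : R) : R :=
  h2 t - pr0 T h2 - p1 h1 h2 * (k2 * s t) + p2 h1 h2 * (k2 * c t).

Lemma red_pc h1 h2 : pc T h1 -> pc T h2 -> pc T (red1 h1 h2) /\ pc T (red2 h1 h2).
Proof. intros; destruct MD; unfold red1, red2; split; pcs. Qed.

Lemma red_orth h1 h2 : pc T h1 -> pc T h2 ->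
  p1 (red1 h1 h2) (red2 h1 h2) = 0 /\ p2 (red1 h1 h2) (red2 h1 h2) = 0.
Proof.
  intros A1 A2. set (a := p1 h1 h2). set (b := p2 h1 h2). set (r := pr0 T h2).
  pose (u1 := fun t => a * c t + b * s t).
  pose (u2 := fun t => r + a * (k2 * s t) - b * (k2 * c t)).
  assert (U1 : pc T u1) by (destruct MD; unfold u1; pcs).
  assert (U2 : pc T u2) by (destruct MD; unfold u2; pcs).
  assert (E1 : red1 h1 h2 = fun t => h1 t - u1 t)
    by (apply functional_extensionality; intro; unfold red1, u1, a, b; ring).
  assert (E2 : red2 h1 h2 = fun t => h2 t - u2 t)
    by (apply functional_extensionality; intro; unfold red2, u2, a, b, r; ring).
  rewrite E1, E2. destruct (pr_minus h1 h2 u1 u2 A1 A2 U1 U2) as [-> ->].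
  destruct (pr_modes a b r) as [Z|[Q1 Q2]].
  - assert (forall f1 f2, p1 f1 f2 = 0 /\ p2 f1 f2 = 0) as P.
    { intros f1 f2. unfold pr1, pr2.
      rewrite (Int0_ext T _ (fun _ => 0)), (Int0_ext T (fun t => f1 t * s t - _) (fun _ => 0)), Int0_const.
      - unfold Rdiv; split; ring.
      - intro t; destruct (Z t) as [-> ->]; ring.
      - intro t; destruct (Z t) as [-> ->]; ring. }
    destruct (P h1 h2) as [-> ->], (P u1 u2) as [-> ->]. split; ring.
  - fold u1 u2 in Q1, Q2. rewrite Q1, Q2. unfold a, b; split; ring.
Qed.

Lemma red2_zero h1 h2 : pc T h1 -> pc T h2 -> Int0 T (red2 h1 h2) = 0.
Proof.
  intros A1 A2. destruct MD. unfold red2.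
  rewrite !Int0_plus, !Int0_minus, !Int0_scal, Int0_const, md_Ic0, md_Is0 by cts.
  unfold pr0. field; lra.
Qed.

Lemma red_minus h1 h2 h1' h2' : pc T h1 -> pc T h2 -> pc T h1' -> pc T h2' ->
  red1 (fun t => h1 t - h1' t) (fun t => h2 t - h2' t) = (fun t => red1 h1 h2 t - red1 h1' h2' t) /\
  red2 (fun t => h1 t - h1' t) (fun t => h2 t - h2' t) = (fun t => red2 h1 h2 t - red2 h1' h2' t).
Proof.
  intros A1 A2 B1 B2. destruct (pr_minus h1 h2 h1' h2' A1 A2 B1 B2) as [E1 E2].
  split; apply functional_extensionality; intro t; unfold red1, red2; rewrite E1, E2; [ring|].
  unfold pr0. rewrite Int0_minus by cts. field; lra.
Qed.

Lemma red_bound : exists M, 0 < M /\ forall B h1 h2, pc T h1 -> pc T h2 ->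
  (forall t, Rabs (h1 t) <= B /\ Rabs (h2 t) <= B) ->
  forall t, Rabs (red1 h1 h2 t) <= M * B /\ Rabs (red2 h1 h2 t) <= M * B.
Proof.
  assert (N := msq_pos). destruct MD.
  assert (Hk : 0 < k2) by (unfold k2; apply Rdiv_lt_0_compat; lra).
  set (a := T * (1 + k2) / n).
  assert (Ha : 0 < a) by (unfold a; apply Rdiv_lt_0_compat; nra).
  exists (2 + 2 * a + 2 * a * k2). split; [nra|].
  intros B h1 h2 A1 A2 HB t.
  destruct (pr_bound B h1 h2 A1 A2 HB) as [P1 P2]. fold a in P1, P2.
  assert (P0 : Rabs (pr0 T h2) <= B) by (apply mean_bound; [cts|intro u; apply HB]).
  destruct (HB t) as [H1 H2], (md_bound0 t) as [Hc Hs].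
  assert (HB0 : 0 <= B) by (eapply Rle_trans; [apply Rabs_pos | exact H1]).
  assert (Q : forall x y, Rabs x <= a * B -> Rabs y <= 1 -> Rabs (x * y) <= a * B).
  { intros x y Hx Hy. rewrite Rabs_mult. assert (Z1 := Rabs_pos x). assert (Z2 := Rabs_pos y). nra. }
  assert (Q' : forall x y, Rabs x <= a * B -> Rabs y <= 1 -> Rabs (x * (k2 * y)) <= a * k2 * B).
  { intros x y Hx Hy. replace (x * (k2 * y)) with (k2 * (x * y)) by ring.
    rewrite Rabs_mult, (Rabs_right k2) by lra. specialize (Q x y Hx Hy). nra. }
  assert (0 <= a * B) by nra. assert (0 <= a * k2 * B) by (apply Rmult_le_pos; nra).
  unfold red1, red2. set (x := p1 h1 h2) in *. set (y := p2 h1 h2) in *.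
  assert (Z1 := Q x (c t) P1 Hc). assert (Z2 := Q y (s t) P2 Hs).
  assert (Z3 := Q' x (s t) P1 Hs). assert (Z4 := Q' y (c t) P2 Hc).
  assert (TR : forall u v, Rabs (u - v) <= Rabs u + Rabs v).
  { intros u v. unfold Rminus. eapply Rle_trans; [apply Rabs_triang|]. rewrite Rabs_Ropp. lra. }
  split.
  - eapply Rle_trans; [apply TR|]. assert (W := TR (h1 t) (x * c t)). lra.
  - eapply Rle_trans; [apply Rabs_triang|]. assert (W := TR (h2 t - pr0 T h2) (x * (k2 * s t))).
    assert (W' := TR (h2 t) (pr0 T h2)). lra.
Qed.

(** * Inversion of the linearisation on the complement of the kernel *)

Section Inverse.
Variables (Y dY : (R -> R) -> R -> R) (M : R).
Hypothesis HM : 0 < M.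
Hypothesis HY : forall g, pc T g -> Int0 T g = 0 ->
     Int0 T (fun t => g t * c t) = 0 -> Int0 T (fun t => g t * s t) = 0 ->
     pc T (Y g) /\ Int0 T (Y g) = 0 /\
     (forall t : R, is_derive (Y g) t (dY g t)) /\
     (forall t : R, is_derive (dY g) t (g t - K * Y g t)) /\
     forall B, (forall t, Rabs (g t) <= B) -> forall t,
       Rabs (Y g t) <= M * B /\ Rabs (dY g t) <= M * B.
Hypothesis HYlin : forall g1 g2, pc T g1 -> pc T g2 -> forall t,
     Y (fun t => g1 t - g2 t) t = Y g1 t - Y g2 t /\
     dY (fun t => g1 t - g2 t) t = dY g1 t - dY g2 t.
Hypothesis HK : 4 - K <> 0.

(** With [H] a primitive of the second component, the angular equation gives [x2' = 2 x1 + H] up to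
    a constant; substitution turns [x1'' + 2 x2' - (4 - K) x1] into [x1'' + K x1], forced by the
    first component minus [2 H]. *)
Definition src (h1 h2 : R -> R) (t : R) : R :=
  centered (red1 h1 h2) t - 2 * centered (prim (red2 h1 h2)) t.

Lemma src_pc h1 h2 : pc T h1 -> pc T h2 -> pc T (src h1 h2).
Proof.
  intros A1 A2. destruct (red_pc h1 h2 A1 A2) as [R1 R2].
  assert (R3 := pc_prim T _ R2 (red2_zero h1 h2 A1 A2)).
  assert (Q1 := centered_pc _ R1). assert (Q3 := centered_pc _ R3). unfold src. pcs.
Qed.

(** Integration by parts exchanges [H] against a mode for [g2] against the conjugate mode ([P1],
    [P2]). Orthogonality to the vector modes thereby becomes orthogonality of the scalar forcing to
    [c] and [s]. *)
Lemma src_orth h1 h2 : pc T h1 -> pc T h2 ->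
  Int0 T (src h1 h2) = 0 /\ Int0 T (fun t => src h1 h2 t * c t) = 0 /\ Int0 T (fun t => src h1 h2 t * s t) = 0.
Proof.
  intros A1 A2. destruct (red_pc h1 h2 A1 A2) as [R1 R2].
  assert (Z2 := red2_zero h1 h2 A1 A2).
  assert (R3 := pc_prim T _ R2 Z2).
  assert (C1 := centered_pc _ R1). assert (C3 := centered_pc _ R3).
  destruct (red_orth h1 h2 A1 A2) as [O1 O2].
  assert (N := msq_pos). unfold n in N. destruct MD.
  set (g1 := red1 h1 h2) in *. set (g2 := red2 h1 h2) in *. set (H := prim g2) in *.
  assert (dH := is_derive_prim g2 (proj1 R2)). fold H in dH.
  assert (P1 : Int0 T (fun t => g2 t * s t) + kappa * Int0 T (fun t => H t * c t) = 0).
  { rewrite <- Int0_scal, <- Int0_plus by cts.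
    apply (Int0_derive0 T (fun t => H t * s t)); [cts| |].
    - intro t. evar_last. { apply (is_derive_mult H s t _ _ (dH t) (md_ds0 t)). intros; apply Rmult_comm. }
      unfold plus, mult; simpl. ring.
    - apply (proj2 (pc_mult T _ _ R3 md_s0)). }
  assert (P2 : Int0 T (fun t => g2 t * c t) - kappa * Int0 T (fun t => H t * s t) = 0).
  { rewrite <- Int0_scal, <- Int0_minus by cts.
    apply (Int0_derive0 T (fun t => H t * c t)); [cts| |].
    - intro t. evar_last. { apply (is_derive_mult H c t _ _ (dH t) (md_dc0 t)). intros; apply Rmult_comm. }
      unfold plus, mult; simpl. ring.
    - apply (proj2 (pc_mult T _ _ R3 md_c0)). }
  assert (O1' : Int0 T (fun t => g1 t * c t) + k2 * Int0 T (fun t => g2 t * s t) = 0).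
  { rewrite <- Int0_scal, <- Int0_plus by cts. unfold pr1, Rdiv in O1.
    apply Rmult_integral in O1. destruct O1 as [O1|O1].
    - rewrite <- O1. apply Int0_ext. intro; unfold k2, Rdiv; ring.
    - exfalso. apply Rinv_neq_0_compat in O1; auto. lra. }
  assert (O2' : Int0 T (fun t => g1 t * s t) - k2 * Int0 T (fun t => g2 t * c t) = 0).
  { rewrite <- Int0_scal, <- Int0_minus by cts. unfold pr2, Rdiv in O2.
    apply Rmult_integral in O2. destruct O2 as [O2|O2].
    - rewrite <- O2. apply Int0_ext. intro; unfold k2, Rdiv; ring.
    - exfalso. apply Rinv_neq_0_compat in O2; auto. lra. }
  assert (Hk : forall x y, y + kappa * x = 0 -> - 2 * x = k2 * y).
  { intros x y E. unfold k2. replace y with (- (kappa * x)) by lra. field. lra. }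
  split; [|split].
  - unfold src. fold g1 g2 H. rewrite Int0_minus, Int0_scal, !centered_zero by cts. ring.
  - unfold src. fold g1 g2 H. unfold centered.
    rewrite (Int0_ext T _ (fun t => g1 t * c t - 2 * (H t * c t) - (Int0 T g1 / T - 2 * (Int0 T H / T)) * c t)) by (intro; ring).
    rewrite !Int0_minus, !Int0_scal, md_Ic0 by cts.
    specialize (Hk _ _ P1). lra.
  - unfold src. fold g1 g2 H. unfold centered.
    rewrite (Int0_ext T _ (fun t => g1 t * s t - 2 * (H t * s t) - (Int0 T g1 / T - 2 * (Int0 T H / T)) * s t)) by (intro; ring).
    rewrite !Int0_minus, !Int0_scal, md_Is0 by cts.
    assert (E := Hk (- Int0 T (fun t => H t * s t)) (Int0 T (fun t => g2 t * c t))). lra.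
Qed.

(** The mean of the forcing is solved apart: for constant [x1] the radial equation reads
    [- (4 - K) x1 = mean]. This constant does not enter [dZ2], because the integration constant of
    [x2'] absorbs it; otherwise [Z2] would drift. *)
Definition Z1 (h1 h2 : R -> R) (t : R) : R := Y (src h1 h2) t - Int0 T (red1 h1 h2) / T / (4 - K).
Definition dZ2 (h1 h2 : R -> R) (t : R) : R := 2 * Y (src h1 h2) t + centered (prim (red2 h1 h2)) t.
Definition Z2 (h1 h2 : R -> R) : R -> R := centered (prim (dZ2 h1 h2)).

(** Removing the kernel part of [(Z1, Z2)] normalises the solution; [D1] and [D2] are its
    velocities, where the modes have been differentiated using [k2 * kappa = 2]. *)
Definition X1 (h1 h2 : R -> R) : R -> R := red1 (Z1 h1 h2) (Z2 h1 h2).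
Definition X2 (h1 h2 : R -> R) : R -> R := red2 (Z1 h1 h2) (Z2 h1 h2).
Definition D1 (h1 h2 : R -> R) (t : R) : R :=
  dY (src h1 h2) t + p1 (Z1 h1 h2) (Z2 h1 h2) * (kappa * s t) - p2 (Z1 h1 h2) (Z2 h1 h2) * (kappa * c t).
Definition D2 (h1 h2 : R -> R) (t : R) : R :=
  dZ2 h1 h2 t - p1 (Z1 h1 h2) (Z2 h1 h2) * (2 * c t) - p2 (Z1 h1 h2) (Z2 h1 h2) * (2 * s t).

Lemma dZ2_pc h1 h2 : pc T h1 -> pc T h2 -> pc T (dZ2 h1 h2) /\ Int0 T (dZ2 h1 h2) = 0.
Proof.
  intros A1 A2. destruct (red_pc h1 h2 A1 A2) as [R1 R2].
  assert (R3 := pc_prim T _ R2 (red2_zero h1 h2 A1 A2)).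
  assert (C3 := centered_pc _ R3). destruct (src_orth h1 h2 A1 A2) as [O [Oc Os]].
  destruct (HY _ (src_pc h1 h2 A1 A2) O Oc Os) as [PY [ZY _]].
  unfold dZ2. split; [pcs|]. rewrite Int0_plus, Int0_scal, ZY, centered_zero by cts. ring.
Qed.

Lemma Z_pc h1 h2 : pc T h1 -> pc T h2 -> pc T (Z1 h1 h2) /\ pc T (Z2 h1 h2).
Proof.
  intros A1 A2. destruct (dZ2_pc h1 h2 A1 A2) as [PZ ZZ].
  destruct (src_orth h1 h2 A1 A2) as [O [Oc Os]].
  destruct (HY _ (src_pc h1 h2 A1 A2) O Oc Os) as [PY [ZY _]].
  split; [unfold Z1; pcs | apply centered_pc, pc_prim; auto].
Qed.

Lemma X_spec h1 h2 : pc T h1 -> pc T h2 ->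
  pc T (X1 h1 h2) /\ pc T (X2 h1 h2) /\
  (forall t : R, is_derive (X1 h1 h2) t (D1 h1 h2 t)) /\
  (forall t : R, is_derive (X2 h1 h2) t (D2 h1 h2 t)) /\
  (forall t : R, is_derive (D1 h1 h2) t (red1 h1 h2 t - 2 * D2 h1 h2 t + (4 - K) * X1 h1 h2 t)) /\
  (forall t : R, is_derive (D2 h1 h2) t (red2 h1 h2 t + 2 * D1 h1 h2 t)) /\
  Int0 T (X2 h1 h2) = 0 /\ p1 (X1 h1 h2) (X2 h1 h2) = 0 /\ p2 (X1 h1 h2) (X2 h1 h2) = 0.
Proof.
  intros A1 A2. destruct (Z_pc h1 h2 A1 A2) as [PZ1 PZ2].
  destruct (dZ2_pc h1 h2 A1 A2) as [PdZ ZdZ].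
  destruct (src_orth h1 h2 A1 A2) as [O [Oc Os]].
  destruct (HY _ (src_pc h1 h2 A1 A2) O Oc Os) as [PY [ZY [dY1 [dY2 _]]]].
  destruct (red_pc h1 h2 A1 A2) as [R1 R2].
  assert (Z2e := red2_zero h1 h2 A1 A2).
  assert (dZ1 : forall t : R, is_derive (Z1 h1 h2) t (dY (src h1 h2) t)).
  { intro t. unfold Z1. evar_last.
    - apply (is_derive_minus (V:=R_NormedModule)); [apply dY1 | apply (is_derive_const (K:=R_AbsRing) (V:=R_NormedModule))].
    - unfold minus, plus, opp, zero; simpl; ring. }
  assert (dZ2' : forall t : R, is_derive (Z2 h1 h2) t (dZ2 h1 h2 t)).
  { intro t. unfold Z2, centered. evar_last.
    - apply (is_derive_minus (V:=R_NormedModule)); [apply is_derive_prim, PdZ | apply (is_derive_const (K:=R_AbsRing) (V:=R_NormedModule))].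
    - unfold minus, plus, opp, zero; simpl; ring. }
  assert (ddZ2 : forall t : R, is_derive (dZ2 h1 h2) t (2 * dY (src h1 h2) t + red2 h1 h2 t)).
  { intro t. unfold dZ2 at 1, centered. evar_last.
    - apply (is_derive_plus (V:=R_NormedModule)).
      + apply (is_derive_scal _ t 2). apply dY1.
      + apply (is_derive_minus (V:=R_NormedModule)); [apply is_derive_prim, R2 | apply (is_derive_const (K:=R_AbsRing) (V:=R_NormedModule))].
    - unfold minus, plus, opp, zero; simpl; ring. }
  destruct (red_pc (Z1 h1 h2) (Z2 h1 h2) PZ1 PZ2) as [PX1 PX2].
  destruct (red_orth (Z1 h1 h2) (Z2 h1 h2) PZ1 PZ2) as [OX1 OX2].
  assert (ZX2 := red2_zero (Z1 h1 h2) (Z2 h1 h2) PZ1 PZ2).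
  assert (Zm : pr0 T (Z2 h1 h2) = 0).
  { unfold pr0, Z2. rewrite centered_zero by (apply pc_prim; auto). unfold Rdiv; ring. }
  split; [exact PX1|]. split; [exact PX2|].
  assert (Hk : k2 * kappa = 2) by (unfold k2; destruct MD; field; lra).
  destruct MD.
  set (a := p1 (Z1 h1 h2) (Z2 h1 h2)). set (b := p2 (Z1 h1 h2) (Z2 h1 h2)).
  split; [|split; [|split; [|split; [|split; [exact ZX2|split; [exact OX1|exact OX2]]]]]].
  - intro t. unfold X1, D1, red1. fold a b. evar_last.
    + apply (is_derive_minus (V:=R_NormedModule)); [apply (is_derive_minus (V:=R_NormedModule)); [apply dZ1|]|].
      * apply (is_derive_scal c t a). apply md_dc0.
      * apply (is_derive_scal s t b). apply md_ds0.
    + unfold minus, plus, opp, scal; simpl; unfold mult; simpl. ring.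
  - intro t. unfold X2, D2, red2. fold a b. evar_last.
    + apply (is_derive_plus (V:=R_NormedModule)); [apply (is_derive_minus (V:=R_NormedModule)); [apply (is_derive_minus (V:=R_NormedModule)); [apply dZ2'|apply (is_derive_const (K:=R_AbsRing) (V:=R_NormedModule))]|]|].
      * apply (is_derive_scal (fun t => k2 * s t) t a). apply (is_derive_scal s t k2). apply md_ds0.
      * apply (is_derive_scal (fun t => k2 * c t) t b). apply (is_derive_scal c t k2). apply md_dc0.
    + unfold minus, plus, opp, scal, zero; simpl; unfold mult; simpl. rewrite <- Hk. ring.
  - intro t. unfold D1 at 1. fold a b. evar_last.
    + apply (is_derive_minus (V:=R_NormedModule)); [apply (is_derive_plus (V:=R_NormedModule)); [apply dY2|]|].
      * apply (is_derive_scal (fun t => kappa * s t) t a). apply (is_derive_scal s t kappa). apply md_ds0.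
      * apply (is_derive_scal (fun t => kappa * c t) t b). apply (is_derive_scal c t kappa). apply md_dc0.
    + unfold minus, plus, opp, scal; simpl; unfold mult; simpl.
      unfold D2, X1, red1 at 2. fold a b. unfold dZ2, Z1, src. unfold centered at 1.
      assert (K1 := md_Kc0 t). assert (K2 := md_Ks0 t).
      transitivity (red1 h1 h2 t - Int0 T (red1 h1 h2) / T - 2 * centered (prim (red2 h1 h2)) t -
         K * Y (src h1 h2) t + a * (kappa * kappa * c t) + b * (kappa * kappa * s t)); [ unfold src, centered; ring|].
      rewrite <- K1, <- K2. unfold src, centered. field. split; [lra|auto].
  - intro t. unfold D2 at 1. fold a b. evar_last.
    + apply (is_derive_minus (V:=R_NormedModule)); [apply (is_derive_minus (V:=R_NormedModule)); [apply ddZ2|]|].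
      * apply (is_derive_scal (fun t => 2 * c t) t a). apply (is_derive_scal c t 2). apply md_dc0.
      * apply (is_derive_scal (fun t => 2 * s t) t b). apply (is_derive_scal s t 2). apply md_ds0.
    + unfold minus, plus, opp, scal; simpl; unfold mult; simpl. unfold D1. fold a b. ring.
Qed.

Lemma X_lin h1 h2 h1' h2' : pc T h1 -> pc T h2 -> pc T h1' -> pc T h2' -> forall t,
  let d1 := fun t => h1 t - h1' t in let d2 := fun t => h2 t - h2' t in
  X1 d1 d2 t = X1 h1 h2 t - X1 h1' h2' t /\ X2 d1 d2 t = X2 h1 h2 t - X2 h1' h2' t /\
  D1 d1 d2 t = D1 h1 h2 t - D1 h1' h2' t /\ D2 d1 d2 t = D2 h1 h2 t - D2 h1' h2' t.
Proof.
  intros A1 A2 B1 B2 t d1 d2.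
  destruct (red_pc h1 h2 A1 A2) as [R1 R2]. destruct (red_pc h1' h2' B1 B2) as [S1 S2].
  destruct (red_minus h1 h2 h1' h2' A1 A2 B1 B2) as [E1 E2]. fold d1 d2 in E1, E2.
  assert (Es : src d1 d2 = fun t => src h1 h2 t - src h1' h2' t).
  { apply functional_extensionality; intro u. unfold src. rewrite E1, E2.
    rewrite centered_minus by auto.
    replace (prim (fun t0 => red2 h1 h2 t0 - red2 h1' h2' t0)) with (fun t0 => prim (red2 h1 h2) t0 - prim (red2 h1' h2') t0)
      by (apply functional_extensionality; intro v; symmetry; apply prim_minus; cts).
    rewrite centered_minus by (apply pc_prim; [auto|apply red2_zero; auto]). ring. }
  assert (Ep : prim (red2 d1 d2) = fun t0 => prim (red2 h1 h2) t0 - prim (red2 h1' h2') t0).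
  { rewrite E2. apply functional_extensionality; intro v; apply prim_minus; cts. }
  assert (L := HYlin _ _ (src_pc h1 h2 A1 A2) (src_pc h1' h2' B1 B2)). rewrite <- Es in L.
  assert (EZ1 : Z1 d1 d2 = fun t => Z1 h1 h2 t - Z1 h1' h2' t).
  { apply functional_extensionality; intro u. unfold Z1. rewrite (proj1 (L u)), E1.
    rewrite Int0_minus by cts. field. split; [lra|auto]. }
  assert (EdZ : dZ2 d1 d2 = fun t => dZ2 h1 h2 t - dZ2 h1' h2' t).
  { apply functional_extensionality; intro u. unfold dZ2. rewrite (proj1 (L u)), Ep.
    rewrite centered_minus by (apply pc_prim; [auto|apply red2_zero; auto]). ring. }
  destruct (dZ2_pc h1 h2 A1 A2) as [P1 Q1]. destruct (dZ2_pc h1' h2' B1 B2) as [P2 Q2].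
  assert (EZ2 : Z2 d1 d2 = fun t => Z2 h1 h2 t - Z2 h1' h2' t).
  { assert (Eq : prim (dZ2 d1 d2) = fun t0 => prim (dZ2 h1 h2) t0 - prim (dZ2 h1' h2') t0).
    { rewrite EdZ. apply functional_extensionality; intro v.
      exact (prim_minus (dZ2 h1 h2) (dZ2 h1' h2') v (proj1 P1) (proj1 P2)). }
    unfold Z2. rewrite Eq.
    apply centered_minus; apply pc_prim; auto. }
  destruct (Z_pc h1 h2 A1 A2) as [U1 U2]. destruct (Z_pc h1' h2' B1 B2) as [V1 V2].
  destruct (red_minus _ _ _ _ U1 U2 V1 V2) as [F1 F2].
  destruct (pr_minus _ _ _ _ U1 U2 V1 V2) as [G1 G2].
  unfold X1, X2, D1, D2. rewrite EZ1, EZ2, EdZ, F1, F2, G1, G2, (proj2 (L t)).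
  repeat split; ring.
Qed.

Lemma X_bound : exists M', 0 < M' /\ forall B h1 h2, pc T h1 -> pc T h2 ->
  (forall t, Rabs (h1 t) <= B /\ Rabs (h2 t) <= B) -> forall t,
  Rabs (X1 h1 h2 t) <= M' * B /\ Rabs (X2 h1 h2 t) <= M' * B /\
  Rabs (D1 h1 h2 t) <= M' * B /\ Rabs (D2 h1 h2 t) <= M' * B.
Proof.
  destruct red_bound as [Mr [HMr HR]].
  assert (N := msq_pos).
  assert (Hkap : 0 < kappa) by (destruct MD; auto).
  assert (Hk : 0 < k2) by (unfold k2; apply Rdiv_lt_0_compat; lra).
  set (a := T * (1 + k2) / n).
  assert (Ha : 0 < a) by (unfold a; apply Rdiv_lt_0_compat; nra).
  set (iK := Rabs (/ (4 - K))). assert (HiK : 0 <= iK) by apply Rabs_pos.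
  set (m1 := 2 * Mr + 2 * (2 * (T * Mr))).
  set (m2 := M * m1).
  set (m3 := 2 * m2 + 2 * (T * Mr)).
  set (m4 := m2 + Mr * iK + 2 * (T * m3)).
  assert (Hm1 : 0 < m1) by (unfold m1; nra).
  assert (Hm2 : 0 < m2) by (unfold m2; nra).
  assert (Hm3 : 0 < m3) by (unfold m3; nra).
  assert (0 <= Mr * iK) by nra. assert (0 < T * m3) by nra.
  assert (Hm4 : 0 < m4) by (unfold m4; nra).
  exists (Mr * m4 + m2 + m3 + 2 * (a * m4) * (kappa + 2)).
  assert (0 < a * m4) by nra.
  split; [nra|].
  intros B h1 h2 A1 A2 HB t.
  assert (HB0 : 0 <= B) by (eapply Rle_trans; [apply Rabs_pos | apply (HB 0)]).
  destruct (red_pc h1 h2 A1 A2) as [R1 R2].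
  assert (Z2e := red2_zero h1 h2 A1 A2).
  assert (R3 := pc_prim T _ R2 Z2e).
  assert (BR := HR B h1 h2 A1 A2 HB).
  assert (BH : forall t, Rabs (centered (prim (red2 h1 h2)) t) <= 2 * (T * (Mr * B))).
  { apply centered_bound; [cts|]. apply prim_bound_per; auto. intro; apply BR. }
  assert (BS : forall t, Rabs (src h1 h2 t) <= m1 * B).
  { intro u. unfold src, Rminus. eapply Rle_trans; [apply Rabs_triang|]. rewrite Rabs_Ropp, Rabs_mult, (Rabs_right 2) by lra.
    assert (Q := centered_bound _ (Mr * B) (proj1 R1) (fun t => proj1 (BR t)) u). specialize (BH u). unfold m1. lra. }
  destruct (src_orth h1 h2 A1 A2) as [O [Oc Os]].
  destruct (HY _ (src_pc h1 h2 A1 A2) O Oc Os) as [PY [ZY [dY1 [dY2 BY]]]].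
  specialize (BY (m1 * B) BS).
  assert (BY1 : forall t, Rabs (Y (src h1 h2) t) <= m2 * B) by (intro u; unfold m2; destruct (BY u); lra).
  assert (BY2 : forall t, Rabs (dY (src h1 h2) t) <= m2 * B) by (intro u; unfold m2; destruct (BY u); lra).
  assert (BdZ : forall t, Rabs (dZ2 h1 h2 t) <= m3 * B).
  { intro u. unfold dZ2. eapply Rle_trans; [apply Rabs_triang|]. rewrite Rabs_mult, (Rabs_right 2) by lra.
    specialize (BY1 u). specialize (BH u). unfold m3. lra. }
  destruct (dZ2_pc h1 h2 A1 A2) as [PdZ ZdZ].
  destruct (Z_pc h1 h2 A1 A2) as [PZ1 PZ2].
  assert (0 <= m2 * B) by nra. assert (0 <= m3 * B) by nra. assert (0 <= T * (m3 * B)) by nra.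
  assert (0 <= Mr * B) by nra. assert (0 <= Mr * B * iK) by nra.
  assert (BZ : forall t, Rabs (Z1 h1 h2 t) <= m4 * B /\ Rabs (Z2 h1 h2 t) <= m4 * B).
  { intro u. split.
    - unfold Z1, Rminus. eapply Rle_trans; [apply Rabs_triang|]. rewrite Rabs_Ropp.
      unfold Rdiv at 1. rewrite Rabs_mult. change (4 + - K) with (4 - K). fold iK.
      assert (Q := mean_bound _ (Mr * B) (proj1 R1) (fun t => proj1 (BR t))).
      assert (Rabs (Int0 T (red1 h1 h2) / T) * iK <= Mr * B * iK) by (apply Rmult_le_compat_r; auto).
      specialize (BY1 u). unfold m4. nra.
    - unfold Z2. apply Rle_trans with (2 * (T * (m3 * B))).
      + apply centered_bound; [apply cont_prim; cts|]. apply prim_bound_per; auto.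
      + unfold m4. nra. }
  assert (BX := HR (m4 * B) _ _ PZ1 PZ2 BZ t).
  destruct (pr_bound (m4 * B) _ _ PZ1 PZ2 BZ) as [BP1 BP2]. fold a in BP1, BP2.
  set (P := p1 (Z1 h1 h2) (Z2 h1 h2)) in *. set (Q := p2 (Z1 h1 h2) (Z2 h1 h2)) in *.
  assert (W : forall x y k, Rabs x <= a * (m4 * B) -> Rabs y <= 1 -> 0 < k -> Rabs (x * (k * y)) <= k * (a * m4 * B)).
  { intros x y k Hx Hy Hk'. replace (x * (k * y)) with (k * (x * y)) by ring.
    rewrite Rabs_mult, (Rabs_right k) by lra. apply Rmult_le_compat_l; [lra|].
    rewrite Rabs_mult. assert (Y1 := Rabs_pos x). assert (Y2 := Rabs_pos y). nra. }
  assert (0 <= Mr * m4 * B) by (apply Rmult_le_pos; nra).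
  assert (0 <= a * m4 * B) by (apply Rmult_le_pos; nra).
  assert (0 <= kappa * (a * m4 * B)) by (apply Rmult_le_pos; lra).
  destruct (md_bound _ _ _ _ _ MD t) as [Hc Hs].
  assert (TR : forall u v, Rabs (u - v) <= Rabs u + Rabs v).
  { intros u v. unfold Rminus. eapply Rle_trans; [apply Rabs_triang|]. rewrite Rabs_Ropp. lra. }
  specialize (BY2 t). specialize (BdZ t).
  replace ((Mr * m4 + m2 + m3 + 2 * (a * m4) * (kappa + 2)) * B) with
   (Mr * m4 * B + m2 * B + m3 * B + 2 * (kappa * (a * m4 * B)) + 4 * (a * m4 * B)) by ring.
  split; [|split; [|split]].
  - unfold X1. destruct BX. lra.
  - unfold X2. destruct BX. lra.
  - unfold D1. fold P Q. eapply Rle_trans; [apply TR|].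
    assert (Y1 := Rabs_triang (dY (src h1 h2) t) (P * (kappa * s t))).
    assert (Y2 := W P (s t) kappa BP1 Hs Hkap). assert (Y3 := W Q (c t) kappa BP2 Hc Hkap). lra.
  - unfold D2. fold P Q. eapply Rle_trans; [apply TR|].
    assert (Y1 := TR (dZ2 h1 h2 t) (P * (2 * c t))).
    assert (Y2 := W P (c t) 2 BP1 Hc Rlt_0_2). assert (Y3 := W Q (s t) 2 BP2 Hs Rlt_0_2). lra.
Qed.
End Inverse.
End LinearOperator.

Lemma vec_solver (T K kappa : R) (c s : R -> R) :
  0 < T -> modes T K kappa c s -> solver T K c s -> 4 - K <> 0 ->
  exists (X1 X2 D1 D2 : (R -> R) -> (R -> R) -> R -> R) (M : R), 0 < M /\
  (forall h1 h2, pc T h1 -> pc T h2 ->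
    pc T (X1 h1 h2) /\ pc T (X2 h1 h2) /\
    (forall t : R, is_derive (X1 h1 h2) t (D1 h1 h2 t)) /\
    (forall t : R, is_derive (X2 h1 h2) t (D2 h1 h2 t)) /\
    (forall t : R, is_derive (D1 h1 h2) t
       (red1 T kappa c s h1 h2 t - 2 * D2 h1 h2 t + (4 - K) * X1 h1 h2 t)) /\
    (forall t : R, is_derive (D2 h1 h2) t (red2 T kappa c s h1 h2 t + 2 * D1 h1 h2 t)) /\
    Int0 T (X2 h1 h2) = 0 /\
    pr1 T kappa c s (X1 h1 h2) (X2 h1 h2) = 0 /\ pr2 T kappa c s (X1 h1 h2) (X2 h1 h2) = 0) /\
  (forall h1 h2 h1' h2', pc T h1 -> pc T h2 -> pc T h1' -> pc T h2' -> forall B,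
    (forall t, Rabs (h1 t - h1' t) <= B /\ Rabs (h2 t - h2' t) <= B) -> forall t,
    Rabs (X1 h1 h2 t - X1 h1' h2' t) <= M * B /\ Rabs (X2 h1 h2 t - X2 h1' h2' t) <= M * B /\
    Rabs (D1 h1 h2 t - D1 h1' h2' t) <= M * B /\ Rabs (D2 h1 h2 t - D2 h1' h2' t) <= M * B) /\
  (forall B h1 h2, pc T h1 -> pc T h2 ->
    (forall t, Rabs (h1 t) <= B /\ Rabs (h2 t) <= B) -> forall t,
    Rabs (X1 h1 h2 t) <= M * B /\ Rabs (X2 h1 h2 t) <= M * B /\
    Rabs (D1 h1 h2 t) <= M * B /\ Rabs (D2 h1 h2 t) <= M * B).
Proof.
  intros HT MD [Y [dY [M [HM [HY HL]]]]] HK.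
  destruct (X_bound T K kappa c s HT MD Y dY M HM HY) as [M' [HM' HB]].
  exists (X1 T K kappa c s Y), (X2 T K kappa c s Y), (D1 T K kappa c s Y dY), (D2 T K kappa c s Y), M'.
  split; [exact HM'|]. split; [|split].
  - intros h1 h2 A1 A2. exact (X_spec T K kappa c s HT MD Y dY M HY HK h1 h2 A1 A2).
  - intros h1 h2 h1' h2' A1 A2 B1 B2 B Hd t.
    destruct (X_lin T K kappa c s HT MD Y dY M HY HL HK h1 h2 h1' h2' A1 A2 B1 B2 t) as [<- [<- [<- <-]]].
    apply HB; [pcs|pcs|exact Hd].
  - exact HB.
Qed.

(** * Taylor expansion of the force *)

Lemma ab_plus x y X Y : Rabs x <= X -> Rabs y <= Y -> Rabs (x + y) <= X + Y.
Proof. intros; eapply Rle_trans; [apply Rabs_triang | lra]. Qed.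
Lemma ab_opp x X : Rabs x <= X -> Rabs (- x) <= X.
Proof. now rewrite Rabs_Ropp. Qed.
Lemma ab_minus x y X Y : Rabs x <= X -> Rabs y <= Y -> Rabs (x - y) <= X + Y.
Proof. intros; apply ab_plus; [auto | apply ab_opp; auto]. Qed.
Lemma ab_mult x y X Y : Rabs x <= X -> Rabs y <= Y -> Rabs (x * y) <= X * Y.
Proof. intros; rewrite Rabs_mult; apply Rmult_le_compat; auto; apply Rabs_pos. Qed.
Lemma ab_const x : Rabs x <= Rabs x.
Proof. lra. Qed.
Lemma ab_pow x X k : Rabs x <= X -> Rabs (x ^ k) <= X ^ k.
Proof. intro; rewrite <- RPow_abs; apply pow_incr; split; [apply Rabs_pos | auto]. Qed.
Ltac absb := repeat match goal with
  | |- Rabs _ <= _ => eassumption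
  | |- Rabs (_ + _) <= _ => apply ab_plus
  | |- Rabs (_ - _) <= _ => apply ab_minus
  | |- Rabs (- _) <= _ => apply ab_opp
  | |- Rabs (_ * _) <= _ => apply ab_mult
  | |- Rabs (_ ^ _) <= _ => apply ab_pow
  | |- Rabs _ <= _ => apply ab_const
  end.

Definition pw (b u : R) : R := Rpower (1 + u) (- b).

Lemma pw_derive b u : -1 < u -> is_derive (pw b) u (- b * pw (b + 1) u).
Proof.
  intro H. unfold pw, Rpower. auto_derive; [lra|].
  replace (- (b + 1) * ln (1 + u)) with (- b * ln (1 + u) + - ln (1 + u)) by ring.
  rewrite exp_plus, exp_Ropp, exp_ln by lra. ring.
Qed.

Lemma pw_bound b : 0 <= b -> exists C, 0 < C /\ forall u, Rabs u <= 1 / 2 -> Rabs (pw b u) <= C.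
Proof.
  intro Hb. exists (Rpower (1 / 2) (- b)). split; [apply exp_pos|].
  intros u Hu. apply Rabs_le_between in Hu. unfold pw.
  rewrite Rabs_right by (left; apply exp_pos).
  rewrite !Rpower_Ropp. apply Rinv_le_contravar; [apply exp_pos|].
  apply Rle_Rpower_l; lra.
Qed.

Lemma mvt_abs (F f : R -> R) (C x y : R) :
  (forall u, Rmin x y <= u <= Rmax x y -> is_derive F u (f u) /\ Rabs (f u) <= C) ->
  Rabs (F y - F x) <= C * Rabs (y - x).
Proof.
  intros H.
  destruct (MVT_gen F x y f) as [c [Hc E]].
  - intros u Hu; apply H; lra.
  - intros u Hu. apply continuity_pt_filterlim.
    apply (ex_derive_continuous (K:=R_AbsRing) (V:=R_NormedModule) F).
    exists (f u). apply H; auto.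
  - rewrite E, Rabs_mult. apply Rmult_le_compat_r; [apply Rabs_pos | apply H; auto].
Qed.

Lemma between_abs x y u : Rmin x y <= u <= Rmax x y -> Rabs u <= Rmax (Rabs x) (Rabs y).
Proof.
  unfold Rmin, Rmax. intro H. destruct (Rle_dec x y), (Rle_dec (Rabs x) (Rabs y));
  unfold Rabs in *; repeat destruct (Rcase_abs _); lra.
Qed.

(** The mean value theorem on the segment from [0] to [u] raises the order of vanishing by one;
    iterated, it yields all the Taylor remainders below. *)
Lemma rem_step (F f : R -> R) (C : R) (k : nat) : F 0 = 0 -> 0 <= C ->
  (forall u, Rabs u <= 1 / 2 -> is_derive F u (f u) /\ Rabs (f u) <= C * Rabs u ^ k) ->
  forall u, Rabs u <= 1 / 2 -> Rabs (F u) <= C * Rabs u ^ (S k).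
Proof.
  intros F0 HC H u Hu.
  replace (F u) with (F u - F 0) by (rewrite F0; ring).
  replace (C * Rabs u ^ S k) with (C * Rabs u ^ k * Rabs (u - 0)) by (rewrite Rminus_0_r; simpl; ring).
  apply (mvt_abs F f). intros v Hv. apply between_abs in Hv.
  rewrite Rabs_R0, Rmax_right in Hv by apply Rabs_pos.
  destruct (H v) as [H1 H2]; [lra|]. split; [exact H1|].
  eapply Rle_trans; [exact H2|]. apply Rmult_le_compat_l; [auto|].
  apply pow_incr. split; [apply Rabs_pos | auto].
Qed.

(** The Taylor remainders of [pw b] at [0], numbered by their order. Differentiation lowers the
    order and raises the exponent: the derivative of [rem2 b] is [- b * rem1 (b + 1)], and likewise
    further up. *)
Definition rem1 b u := pw b u - 1.
Definition rem2 b u := pw b u - (1 - b * u).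
Definition rem3 b u := pw b u - (1 - b * u + b * (b + 1) / 2 * u ^ 2).
Definition rem4 b u := pw b u - (1 - b * u + b * (b + 1) / 2 * u ^ 2 - b * (b + 1) * (b + 2) / 6 * u ^ 3).

Lemma pw_0 b : pw b 0 = 1.
Proof. unfold pw. rewrite Rplus_0_r. unfold Rpower. rewrite ln_1, Rmult_0_r. apply exp_0. Qed.

Lemma rem_derive (b u : R) (P : R -> R) (dP : R) : -1 < u -> is_derive P u dP ->
  is_derive (fun u => pw b u - P u) u (- b * pw (b + 1) u - dP).
Proof. intros H HP. apply (is_derive_minus (V:=R_NormedModule)); [apply pw_derive; auto | exact HP]. Qed.

Lemma half_gt u : Rabs u <= 1 / 2 -> -1 < u.
Proof. intro H; apply Rabs_le_between in H; lra. Qed.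

Lemma rem1_bound b : 0 <= b -> exists C, 0 <= C /\ forall u, Rabs u <= 1 / 2 -> Rabs (rem1 b u) <= C * Rabs u ^ 1.
Proof.
  intro Hb. destruct (pw_bound (b + 1)) as [C [HC H]]; [lra|].
  exists (b * C). split; [nra|]. apply (rem_step _ (fun u => - b * pw (b + 1) u)).
  - unfold rem1; rewrite pw_0; ring.
  - nra.
  - intros u Hu. split.
    + unfold rem1. evar_last. { apply rem_derive; [apply half_gt; auto | apply (is_derive_const (K:=R_AbsRing) (V:=R_NormedModule))]. }
      unfold zero; simpl; ring.
    + rewrite Rabs_mult, Rabs_Ropp, (Rabs_right b) by lra. simpl. specialize (H u Hu). nra.
Qed.

Lemma rem2_bound b : 0 <= b -> exists C, 0 <= C /\ forall u, Rabs u <= 1 / 2 -> Rabs (rem2 b u) <= C * Rabs u ^ 2.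
Proof.
  intro Hb. destruct (rem1_bound (b + 1)) as [C [HC H]]; [lra|].
  exists (b * C). split; [nra|]. apply (rem_step _ (fun u => - b * rem1 (b + 1) u)).
  - unfold rem2; rewrite pw_0; ring.
  - nra.
  - intros u Hu. split.
    + unfold rem2. evar_last. { apply rem_derive; [apply half_gt; auto | auto_derive; [auto|reflexivity]]. }
      unfold rem1; ring.
    + rewrite Rabs_mult, Rabs_Ropp, (Rabs_right b) by lra. specialize (H u Hu).
      rewrite Rmult_assoc. apply Rmult_le_compat_l; lra.
Qed.

Lemma rem3_bound b : 0 <= b -> exists C, 0 <= C /\ forall u, Rabs u <= 1 / 2 -> Rabs (rem3 b u) <= C * Rabs u ^ 3.
Proof.
  intro Hb. destruct (rem2_bound (b + 1)) as [C [HC H]]; [lra|].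
  exists (b * C). split; [nra|]. apply (rem_step _ (fun u => - b * rem2 (b + 1) u)).
  - unfold rem3; rewrite pw_0; ring.
  - nra.
  - intros u Hu. split.
    + unfold rem3. evar_last. { apply rem_derive; [apply half_gt; auto | auto_derive; [auto|reflexivity]]. }
      unfold rem2; simpl; field.
    + rewrite Rabs_mult, Rabs_Ropp, (Rabs_right b) by lra. specialize (H u Hu).
      rewrite Rmult_assoc. apply Rmult_le_compat_l; lra.
Qed.

Lemma rem4_bound b : 0 <= b -> exists C, 0 <= C /\ forall u, Rabs u <= 1 / 2 -> Rabs (rem4 b u) <= C * Rabs u ^ 4.
Proof.
  intro Hb. destruct (rem3_bound (b + 1)) as [C [HC H]]; [lra|].
  exists (b * C). split; [nra|]. apply (rem_step _ (fun u => - b * rem3 (b + 1) u)).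
  - unfold rem4; rewrite pw_0; ring.
  - nra.
  - intros u Hu. split.
    + unfold rem4. evar_last. { apply rem_derive; [apply half_gt; auto | auto_derive; [auto|reflexivity]]. }
      unfold rem3; simpl; field.
    + rewrite Rabs_mult, Rabs_Ropp, (Rabs_right b) by lra. specialize (H u Hu).
      rewrite Rmult_assoc. apply Rmult_le_compat_l; lra.
Qed.

Lemma rem2_lip b : 0 <= b -> exists C, 0 <= C /\ forall u v, Rabs u <= 1 / 2 -> Rabs v <= 1 / 2 ->
  Rabs (rem2 b u - rem2 b v) <= C * (Rabs u + Rabs v) * Rabs (u - v).
Proof.
  intro Hb. destruct (rem1_bound (b + 1)) as [C [HC H]]; [lra|].
  exists (b * C). split; [nra|]. intros u v Hu Hv.
  apply (mvt_abs (rem2 b) (fun u => - b * rem1 (b + 1) u)).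
  intros w Hw. apply between_abs in Hw.
  assert (HU := Rabs_pos u). assert (HV := Rabs_pos v).
  assert (Hm : Rmax (Rabs v) (Rabs u) <= 1 / 2) by (apply Rmax_lub; auto).
  assert (Hm2 : Rmax (Rabs v) (Rabs u) <= Rabs u + Rabs v) by (apply Rmax_lub; lra).
  assert (Hw2 : Rabs w <= 1 / 2) by lra.
  split.
  - unfold rem2. evar_last. { apply rem_derive; [apply half_gt; auto | auto_derive; [auto|reflexivity]]. }
    unfold rem1; ring.
  - rewrite Rabs_mult, Rabs_Ropp, (Rabs_right b) by lra. specialize (H w Hw2). simpl in H.
    rewrite Rmult_assoc. apply Rmult_le_compat_l; [lra|].
    eapply Rle_trans; [exact H|]. apply Rmult_le_compat_l; lra.
Qed.

(* The force [- (x0 + d) / |x0 + d|^(2 b)] at [x0 + d] is [- (x0 + ((1 - 2 b) d1, d2) + (nl1 b d,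
nl2 b d))]. *)
Definition sq (d1 d2 : R) : R := 2 * d1 + d1 * d1 + d2 * d2.
Definition nl1 (b d1 d2 : R) : R := (1 + d1) * pw b (sq d1 d2) - 1 + (2 * b - 1) * d1.
Definition nl2 (b d1 d2 : R) : R := d2 * pw b (sq d1 d2) - d2.

Lemma nl1_rem b d1 d2 : nl1 b d1 d2 =
  (1 + d1) * rem2 b (sq d1 d2) - b * (d1 * d1 + d2 * d2) - b * (sq d1 d2 * d1).
Proof. unfold nl1, rem2, sq; ring. Qed.
Lemma nl2_rem b d1 d2 : nl2 b d1 d2 = d2 * rem2 b (sq d1 d2) - b * (sq d1 d2 * d2).
Proof. unfold nl2, rem2, sq; ring. Qed.

Lemma sq_bound d1 d2 s : Rabs d1 <= s -> Rabs d2 <= s -> s <= 1 / 8 -> Rabs (sq d1 d2) <= 3 * s.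
Proof.
  intros H1 H2 Hs. unfold sq.
  assert (0 <= s) by (eapply Rle_trans; [apply Rabs_pos | exact H1]).
  eapply Rle_trans; [absb|]. rewrite Rabs_right by lra. nra.
Qed.

(** The Lipschitz constant is proportional to the size [s] of the displacements. This makes the
    equation for the correction a contraction once [eps] is small. *)
Lemma nl_lip b : 0 <= b -> exists C, 0 < C /\ forall d1 d2 e1 e2 s D,
  Rabs d1 <= s -> Rabs d2 <= s -> Rabs e1 <= s -> Rabs e2 <= s -> s <= 1 / 8 ->
  Rabs (d1 - e1) <= D -> Rabs (d2 - e2) <= D ->
  Rabs (nl1 b d1 d2 - nl1 b e1 e2) <= C * s * D /\ Rabs (nl2 b d1 d2 - nl2 b e1 e2) <= C * s * D.
Proof.
  intro Hb. destruct (rem2_lip b Hb) as [C1 [HC1 L]]. destruct (rem2_bound b Hb) as [C2 [HC2 B]].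
  exists (60 * C1 + 9 * C2 + 20 * b + 1). split; [lra|].
  intros d1 d2 e1 e2 s D H1 H2 H3 H4 Hs HD1 HD2.
  assert (s0 : 0 <= s) by (eapply Rle_trans; [apply Rabs_pos | exact H1]).
  assert (D0 : 0 <= D) by (eapply Rle_trans; [apply Rabs_pos | exact HD1]).
  assert (U := sq_bound d1 d2 s H1 H2 Hs). assert (V := sq_bound e1 e2 s H3 H4 Hs).
  assert (UV : Rabs (sq d1 d2 - sq e1 e2) <= 3 * D).
  { replace (sq d1 d2 - sq e1 e2) with (2 * (d1 - e1) + (d1 - e1) * (d1 + e1) + (d2 - e2) * (d2 + e2)) by (unfold sq; ring).
    eapply Rle_trans; [absb|]. rewrite Rabs_right by lra. nra. }
  assert (U2 : Rabs (sq d1 d2) <= 1 / 2) by lra. assert (V2 : Rabs (sq e1 e2) <= 1 / 2) by lra.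
  set (u := sq d1 d2) in *. set (v := sq e1 e2) in *.
  assert (S1 : Rabs (rem2 b u - rem2 b v) <= 18 * C1 * s * D).
  { eapply Rle_trans; [apply L; auto|].
    apply Rle_trans with (C1 * (6 * s) * (3 * D)); [|lra].
    apply Rmult_le_compat; [|apply Rabs_pos| |auto].
    - apply Rmult_le_pos; [auto|]. assert (Q1 := Rabs_pos u). assert (Q2 := Rabs_pos v). lra.
    - apply Rmult_le_compat_l; lra. }
  assert (S2 : Rabs (rem2 b v) <= 9 * C2 * s).
  { eapply Rle_trans; [apply B; auto|].
    apply Rle_trans with (C2 * (9 * s)); [|lra]. apply Rmult_le_compat_l; auto.
    assert (Q := Rabs_pos v). simpl. nra. }
  assert (Q1 : 0 <= C1 * s * D) by (apply Rmult_le_pos; [apply Rmult_le_pos|]; auto).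
  assert (Q2 : 0 <= C2 * s * D) by (apply Rmult_le_pos; [apply Rmult_le_pos|]; auto).
  assert (Q3 : 0 <= b * s * D) by (apply Rmult_le_pos; [apply Rmult_le_pos|]; auto).
  assert (Q0 : 0 <= s * D) by (apply Rmult_le_pos; auto).
  clear U2 V2.
  assert (Q4 : s * (C1 * s * D) <= C1 * s * D) by nra.
  replace ((60 * C1 + 9 * C2 + 20 * b + 1) * s * D) with (60 * (C1 * s * D) + 9 * (C2 * s * D) + 20 * (b * s * D) + s * D) by ring.
  split.
  - rewrite !nl1_rem. fold u v.
    replace ((1 + d1) * rem2 b u - b * (d1 * d1 + d2 * d2) - b * (u * d1) -
      ((1 + e1) * rem2 b v - b * (e1 * e1 + e2 * e2) - b * (v * e1))) with
      ((1 + d1) * (rem2 b u - rem2 b v) + (d1 - e1) * rem2 b v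
       - b * ((d1 - e1) * (d1 + e1) + (d2 - e2) * (d2 + e2)) - b * ((u - v) * d1 + v * (d1 - e1))) by ring.
    eapply Rle_trans; [absb|]. rewrite !Rabs_right by lra. lra.
  - rewrite !nl2_rem. fold u v.
    replace (d2 * rem2 b u - b * (u * d2) - (e2 * rem2 b v - b * (v * e2))) with
      (d2 * (rem2 b u - rem2 b v) + (d2 - e2) * rem2 b v - b * ((u - v) * d2 + v * (d2 - e2))) by ring.
    eapply Rle_trans; [absb|]. rewrite !Rabs_right by lra. lra.
Qed.

Lemma sq_0 : sq 0 0 = 0.
Proof. unfold sq; ring. Qed.

Lemma nl_bound b : 0 <= b -> exists C, 0 < C /\ forall d1 d2 s,
  Rabs d1 <= s -> Rabs d2 <= s -> s <= 1 / 8 ->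
  Rabs (nl1 b d1 d2) <= C * s * s /\ Rabs (nl2 b d1 d2) <= C * s * s.
Proof.
  intro Hb. destruct (nl_lip b Hb) as [C [HC L]]. exists C. split; [auto|].
  intros d1 d2 s H1 H2 Hs.
  assert (s0 : 0 <= s) by (eapply Rle_trans; [apply Rabs_pos | exact H1]).
  destruct (L d1 d2 0 0 s s) as [L1 L2]; auto; rewrite ?Rabs_R0, ?Rminus_0_r; auto.
  assert (E1 : nl1 b 0 0 = 0) by (unfold nl1; rewrite sq_0, pw_0; ring).
  assert (E2 : nl2 b 0 0 = 0) by (unfold nl2; rewrite sq_0, pw_0; ring).
  rewrite E1, Rminus_0_r in L1. rewrite E2, Rminus_0_r in L2. auto.
Qed.

(** The quadratic and cubic Taylor terms of [nl1] and [nl2], written in the exponent [B = 2 * b] of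
    the force. *)
Definition quad1 (B d1 d2 : R) : R := B / 2 * ((B - 1) * (d1 * d1) - d2 * d2).
Definition quad2 (B d1 d2 : R) : R := - B * (d1 * d2).
Definition cub1 (B d1 d2 : R) : R :=
  - B * (B * B - 1) / 6 * (d1 * d1 * d1) + B * (B + 1) / 2 * (d1 * (d2 * d2)).
Definition cub2 (B d1 d2 : R) : R :=
  B * (B + 1) / 2 * (d1 * d1 * d2) - B / 2 * (d2 * d2 * d2).

(** The cubic terms are needed explicitly because, with two factors from the primaries and one from
    a mode, they contribute at order [eps^2 a]. For displacements of order [eps] the remainder has
    order [eps^4]. *)
Lemma nl_taylor b : 0 <= b -> exists C, 0 < C /\ forall d1 d2 s,
  Rabs d1 <= s -> Rabs d2 <= s -> s <= 1 / 8 ->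
  Rabs (nl1 b d1 d2 - quad1 (2 * b) d1 d2 - cub1 (2 * b) d1 d2) <= C * s ^ 4 /\
  Rabs (nl2 b d1 d2 - quad2 (2 * b) d1 d2 - cub2 (2 * b) d1 d2) <= C * s ^ 4.
Proof.
  intro Hb. destruct (rem4_bound b Hb) as [C [HC H]].
  set (c2 := b * (b + 1) / 2). set (c3 := b * (b + 1) * (b + 2) / 6).
  assert (Hc2 : 0 <= c2) by (unfold c2; nra).
  assert (Hc3 : 0 <= c3).
  { unfold c3. assert (0 <= b * (b + 1) * (b + 2)) by (apply Rmult_le_pos; nra). lra. }
  exists (200 * C + 40 * c2 + 200 * c3 + 1). split; [lra|].
  intros d1 d2 s H1 H2 Hs.
  assert (s0 : 0 <= s) by (eapply Rle_trans; [apply Rabs_pos | exact H1]).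
  assert (U := sq_bound d1 d2 s H1 H2 Hs).
  assert (U2 : Rabs (sq d1 d2) <= 1 / 2) by lra.
  assert (S1 : Rabs (rem4 b (sq d1 d2)) <= 81 * C * s ^ 4).
  { eapply Rle_trans; [apply H; auto|].
    replace (81 * C * s ^ 4) with (C * (3 * s) ^ 4) by ring.
    apply Rmult_le_compat_l; auto. apply pow_incr. split; [apply Rabs_pos|auto]. }
  set (r := rem4 b (sq d1 d2)) in *.
  clear U2.
  assert (P4 : 0 <= s ^ 4) by (apply pow_le; auto).
  assert (Q : pw b (sq d1 d2) = r + 1 - b * sq d1 d2 + c2 * sq d1 d2 ^ 2 - c3 * sq d1 d2 ^ 3)
    by (unfold r, rem4, c2, c3; ring).
  set (q := d1 * d1 + d2 * d2).
  assert (Hq : Rabs q <= 2 * s ^ 2) by (unfold q; eapply Rle_trans; [absb|]; lra).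
  assert (Eu : sq d1 d2 = 2 * d1 + q) by (unfold sq, q; ring).
  assert (P5 : s ^ 5 <= s ^ 4) by (simpl; simpl in P4; nra).
  assert (P5' : 0 <= s ^ 5) by (apply pow_le; auto).
  assert (P6 : s ^ 6 <= s ^ 4) by (simpl; simpl in P5, P5', P4; nra).
  assert (C4 : 0 <= C * s ^ 4) by nra. assert (C24 : 0 <= c2 * s ^ 4) by nra. assert (C34 : 0 <= c3 * s ^ 4) by nra.
  assert (C25 : c2 * s ^ 5 <= c2 * s ^ 4) by nra. assert (C35 : c3 * s ^ 5 <= c3 * s ^ 4) by nra.
  assert (C36 : c3 * s ^ 6 <= c3 * s ^ 4) by nra.
  assert (C5 : C * s ^ 5 <= C * s ^ 4) by nra.
  split.
  - assert (E : nl1 b d1 d2 - quad1 (2 * b) d1 d2 - cub1 (2 * b) d1 d2 =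
       (1 + d1) * r + c2 * q ^ 2 - c3 * (12 * (d1 ^ 2 * q) + 6 * (d1 * q ^ 2) + q ^ 3)
       + d1 * (c2 * (4 * (d1 * q) + q ^ 2)) - d1 * (c3 * sq d1 d2 ^ 3)).
    { unfold nl1, quad1, cub1. rewrite Q, Eu. unfold q, c2, c3. field. }
    rewrite E. eapply Rle_trans; [absb|]. rewrite !Rabs_right by lra.
    match goal with |- ?X <= _ => replace X with (81 * (C * s ^ 4) + 81 * (C * s ^ 5) + 4 * (c2 * s ^ 4)
       + c3 * (24 * s ^ 4 + 24 * s ^ 5 + 8 * s ^ 6) + 8 * (c2 * s ^ 4) + 4 * (c2 * s ^ 5) + 27 * (c3 * s ^ 4)) by ring end.
    lra.
  - assert (E : nl2 b d1 d2 - quad2 (2 * b) d1 d2 - cub2 (2 * b) d1 d2 =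
       d2 * r + d2 * (c2 * (4 * (d1 * q) + q ^ 2)) - d2 * (c3 * sq d1 d2 ^ 3)).
    { unfold nl2, quad2, cub2. rewrite Q, Eu. unfold q, c2, c3. field. }
    rewrite E. eapply Rle_trans; [absb|]. rewrite !Rabs_right by lra.
    match goal with |- ?X <= _ => replace X with (81 * (C * s ^ 5)
       + 8 * (c2 * s ^ 4) + 4 * (c2 * s ^ 5) + 27 * (c3 * s ^ 4)) by ring end.
    lra.
Qed.

(** * Contraction and minimisation *)

Lemma half_pow_small (M e : R) : 0 <= M -> 0 < e -> exists n, forall k, (n <= k)%nat -> M * (/ 2) ^ k < e.
Proof.
  intros HM He.
  destruct (pow_lt_1_zero (/ 2)) with (y := e / (M + 1)) as [n Hn].
  - rewrite Rabs_right; lra.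
  - apply Rdiv_lt_0_compat; lra.
  - exists n. intros k Hk. specialize (Hn k Hk).
    assert (0 < (/ 2) ^ k) by (apply pow_lt; lra).
    rewrite Rabs_right in Hn by lra.
    apply Rmult_lt_compat_l with (r := M + 1) in Hn; [|lra].
    replace ((M + 1) * (e / (M + 1))) with e in Hn by (field; lra). nra.
Qed.

Lemma le_half_pow (x a M : R) : 0 <= M -> (forall k, x <= a + M * (/ 2) ^ k) -> x <= a.
Proof.
  intros HM H. destruct (Rle_or_lt x a) as [|Hlt]; auto.
  destruct (half_pow_small M (x - a) HM) as [n Hn]; [lra|].
  specialize (Hn n (le_n n)). specialize (H n). lra.
Qed.

(** Each application halves the distance of the known bound from [2 * A]. It turns the estimate of a
    contraction into a bound on a difference of fixed points, without a norm on a function space. *)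
Lemma sup_absorb (phi : R -> R) (A B : R) : 0 <= B -> (forall t, phi t <= B) ->
  (forall D, 0 <= D -> (forall t, phi t <= D) -> forall t, phi t <= A + D / 2) -> 0 <= A ->
  forall t, phi t <= 2 * A.
Proof.
  intros HB H0 H HA t.
  apply (le_half_pow _ _ B); auto. intro k. revert t.
  induction k as [|k IH]; intro t.
  - simpl. specialize (H0 t). lra.
  - assert (0 <= B * (/ 2) ^ k) by (apply Rmult_le_pos; [auto | apply pow_le; lra]).
    assert (Q := H (2 * A + B * (/ 2) ^ k) ltac:(lra) IH t). simpl. lra.
Qed.

Lemma unif_lim (T C : R) (u : nat -> R -> R) : 0 <= C -> (forall n, pc T (u n)) ->
  (forall n t, Rabs (u (S n) t - u n t) <= C * (/ 2) ^ n) ->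
  exists l, pc T l /\ forall n t, Rabs (l t - u n t) <= 2 * C * (/ 2) ^ n.
Proof.
  intros HC HP Hu.
  assert (Hd : forall k n t, Rabs (u (n + k)%nat t - u n t) <= 2 * C * (/ 2) ^ n - 2 * C * (/ 2) ^ (n + k)).
  { induction k as [|k IH]; intros n t.
    - rewrite Nat.add_0_r, !Rminus_diag, Rabs_R0. lra.
    - replace (u (n + S k)%nat t - u n t) with ((u (S (n + k)) t - u (n + k)%nat t) + (u (n + k)%nat t - u n t))
        by (rewrite Nat.add_succ_r; ring).
      eapply Rle_trans; [apply Rabs_triang|].
      specialize (IH n t). assert (Q := Hu (n + k)%nat t).
      rewrite Nat.add_succ_r. simpl pow. lra. }
  assert (Hd' : forall n m t, (n <= m)%nat -> Rabs (u m t - u n t) <= 2 * C * (/ 2) ^ n).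
  { intros n m t Hm. replace m with (n + (m - n))%nat by lia.
    eapply Rle_trans; [apply Hd|].
    assert (0 <= 2 * C * (/ 2) ^ (n + (m - n))) by (apply Rmult_le_pos; [lra | apply pow_le; lra]). lra. }
  assert (HL : forall t, exists l : R, is_lim_seq (fun n => u n t) l).
  { intro t. apply ex_lim_seq_cauchy_corr. intros [e He].
    destruct (half_pow_small (4 * C) e) as [n Hn]; [lra|auto|].
    exists n. intros i j Hi Hj. simpl.
    assert (Qi := Hd' n i t Hi). assert (Qj := Hd' n j t Hj).
    replace (u i t - u j t) with ((u i t - u n t) - (u j t - u n t)) by ring.
    eapply Rle_lt_trans; [apply Rabs_triang|]. rewrite Rabs_Ropp.
    specialize (Hn n (le_n n)). lra. }
  pose (l := fun t => proj1_sig (constructive_indefinite_description _ (HL t))).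
  assert (Hl : forall t, is_lim_seq (fun n => u n t) (l t)) by (intro t; exact (proj2_sig (constructive_indefinite_description _ (HL t)))).
  assert (B : forall n t, Rabs (l t - u n t) <= 2 * C * (/ 2) ^ n).
  { intros n t.
    assert (L1 : is_lim_seq (fun m => Rabs (u m t - u n t)) (Rabs (l t - u n t))).
    { apply (is_lim_seq_abs (fun m => u m t - u n t) (l t - u n t)).
      apply (is_lim_seq_minus' _ (fun _ => u n t)); [apply Hl | apply is_lim_seq_const]. }
    apply (is_lim_seq_le_loc _ (fun _ => 2 * C * (/ 2) ^ n) (Rabs (l t - u n t)) (2 * C * (/ 2) ^ n)) in L1; [exact L1| |apply is_lim_seq_const].
    exists n. intros m Hm. apply Hd'; auto. }
  exists l. split; [split|exact B].
  - intros t. apply continuity_pt_filterlim. intros e He.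
    destruct (half_pow_small (2 * C) (e / 3)) as [n Hn]; [lra|lra|]. specialize (Hn n (le_n n)).
    assert (Cn := proj1 (HP n) t). apply continuity_pt_filterlim in Cn.
    destruct (Cn (e / 3)) as [d [Hd0 Hdd]]; [lra|].
    exists d. split; [auto|]. intros x Hx. specialize (Hdd x Hx).
    simpl in *. unfold R_dist in *.
    assert (B1 := B n x). assert (B2 := B n t).
    replace (l x - l t) with ((l x - u n x) + (u n x - u n t) - (l t - u n t)) by ring.
    eapply Rle_lt_trans; [apply Rabs_triang|]. rewrite Rabs_Ropp.
    eapply Rle_lt_trans; [apply Rplus_le_compat_r; apply Rabs_triang|]. lra.
  - intro t. assert (E := Hl (t + T)).
    apply (is_lim_seq_ext _ (fun n => u n t)) in E; [|intro n; apply HP].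
    assert (F := Hl t). apply is_lim_seq_unique in E. apply is_lim_seq_unique in F. congruence.
Qed.

Definition small_pc (T r : R) (f1 f2 : R -> R) : Prop :=
  pc T f1 /\ pc T f2 /\ forall t, Rabs (f1 t) <= r /\ Rabs (f2 t) <= r.

(** Picard iteration from zero on a ball of periodic pairs. The sup norm is present only through
    constants [D] bounding both components for all [t]. *)
Lemma fixpoint (T r : R) (F1 F2 : (R -> R) -> (R -> R) -> R -> R) : 0 <= r ->
  (forall f1 f2, small_pc T r f1 f2 -> small_pc T r (F1 f1 f2) (F2 f1 f2)) ->
  (forall f1 f2 g1 g2, small_pc T r f1 f2 -> small_pc T r g1 g2 -> forall D,
     (forall t, Rabs (f1 t - g1 t) <= D /\ Rabs (f2 t - g2 t) <= D) ->
     forall t, Rabs (F1 f1 f2 t - F1 g1 g2 t) <= D / 2 /\ Rabs (F2 f1 f2 t - F2 g1 g2 t) <= D / 2) ->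
  exists f1 f2, small_pc T r f1 f2 /\ forall t, F1 f1 f2 t = f1 t /\ F2 f1 f2 t = f2 t.
Proof.
  intros Hr HA HC.
  pose (u := fix u n := match n with O => ((fun _ : R => 0), (fun _ : R => 0)) | S k => (F1 (fst (u k)) (snd (u k)), F2 (fst (u k)) (snd (u k))) end).
  assert (U : forall n, small_pc T r (fst (u n)) (snd (u n))).
  { induction n as [|n IH]; simpl; [|apply HA; auto].
    split; [apply pc_const|split; [apply pc_const|]]. intro; rewrite Rabs_R0; lra. }
  assert (D : forall n t, Rabs (fst (u (S n)) t - fst (u n) t) <= 2 * r * (/ 2) ^ n /\
                          Rabs (snd (u (S n)) t - snd (u n) t) <= 2 * r * (/ 2) ^ n).
  { induction n as [|n IH]; intro t.
    - simpl pow. assert (Q := proj2 (proj2 (U 1%nat)) t).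
      change (fst (u 0%nat) t) with 0. change (snd (u 0%nat) t) with 0. rewrite !Rminus_0_r. lra.
    - assert (Q := HC _ _ _ _ (U (S n)) (U n) _ IH t).
      change (fst (u (S (S n)))) with (F1 (fst (u (S n))) (snd (u (S n)))).
      change (snd (u (S (S n)))) with (F2 (fst (u (S n))) (snd (u (S n)))).
      change (fst (u (S n)) t) with (F1 (fst (u n)) (snd (u n)) t).
      change (snd (u (S n)) t) with (F2 (fst (u n)) (snd (u n)) t).
      simpl pow. lra. }
  destruct (unif_lim T (2 * r) (fun n => fst (u n))) as [l1 [P1 B1]]; [lra|intro; apply U|intros; apply D|].
  destruct (unif_lim T (2 * r) (fun n => snd (u n))) as [l2 [P2 B2]]; [lra|intro; apply U|intros; apply D|].
  assert (AL : small_pc T r l1 l2).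
  { split; [auto|split; [auto|]]. intro t. split; apply (le_half_pow _ _ (2 * (2 * r))); try lra; intro k.
    - replace (l1 t) with ((l1 t - fst (u k) t) + fst (u k) t) by ring.
      eapply Rle_trans; [apply Rabs_triang|]. assert (Q := proj2 (proj2 (U k)) t). specialize (B1 k t). lra.
    - replace (l2 t) with ((l2 t - snd (u k) t) + snd (u k) t) by ring.
      eapply Rle_trans; [apply Rabs_triang|]. assert (Q := proj2 (proj2 (U k)) t). specialize (B2 k t). lra. }
  exists l1, l2. split; [exact AL|]. intro t.
  (* [F] at the limit is compared with [F] at the [k]-th iterate, which is the next iterate and
     itself close to the limit. *)
  assert (K : forall k, Rabs (F1 l1 l2 t - l1 t) <= 0 + 8 * r * (/ 2) ^ k /\ Rabs (F2 l1 l2 t - l2 t) <= 0 + 8 * r * (/ 2) ^ k).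
  { intro k. assert (Q := HC _ _ _ _ AL (U k) (2 * (2 * r) * (/ 2) ^ k) (fun t => conj (B1 k t) (B2 k t)) t).
    assert (C1 := B1 (S k) t). assert (C2 := B2 (S k) t).
    change (fst (u (S k)) t) with (F1 (fst (u k)) (snd (u k)) t) in C1.
    change (snd (u (S k)) t) with (F2 (fst (u k)) (snd (u k)) t) in C2.
    simpl pow in C1, C2.
    assert (0 <= r * (/ 2) ^ k) by (apply Rmult_le_pos; [auto|apply pow_le; lra]).
    split.
    - replace (F1 l1 l2 t - l1 t) with ((F1 l1 l2 t - F1 (fst (u k)) (snd (u k)) t) - (l1 t - F1 (fst (u k)) (snd (u k)) t)) by ring.
      eapply Rle_trans; [apply Rabs_triang|]. rewrite Rabs_Ropp. lra.
    - replace (F2 l1 l2 t - l2 t) with ((F2 l1 l2 t - F2 (fst (u k)) (snd (u k)) t) - (l2 t - F2 (fst (u k)) (snd (u k)) t)) by ring.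
      eapply Rle_trans; [apply Rabs_triang|]. rewrite Rabs_Ropp. lra. }
  split.
  - assert (Z : Rabs (F1 l1 l2 t - l1 t) <= 0) by (apply (le_half_pow _ _ (8 * r)); [lra|intro; apply K]).
    assert (Z' := Rabs_pos (F1 l1 l2 t - l1 t)). assert (Z2 : F1 l1 l2 t - l1 t = 0); [|lra].
    destruct (Req_dec (F1 l1 l2 t - l1 t) 0) as [|E]; auto. apply Rabs_pos_lt in E. lra.
  - assert (Z : Rabs (F2 l1 l2 t - l2 t) <= 0) by (apply (le_half_pow _ _ (8 * r)); [lra|intro; apply K]).
    assert (Z' := Rabs_pos (F2 l1 l2 t - l2 t)). assert (Z2 : F2 l1 l2 t - l2 t = 0); [|lra].
    destruct (Req_dec (F2 l1 l2 t - l2 t) 0) as [|E]; auto. apply Rabs_pos_lt in E. lra.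
Qed.

Lemma min_lip (f : R -> R) (L l h : R) : l <= h -> (forall x y, Rabs (f x - f y) <= L * Rabs (x - y)) ->
  exists x, l <= x <= h /\ forall y, l <= y <= h -> f x <= f y.
Proof.
  intros Hlh HL.
  destruct (continuity_ab_min f l h Hlh) as [x [H1 H2]].
  - intros c _ e He. exists (e / (Rabs L + 1)). assert (LP := Rabs_pos L). split; [apply Rdiv_lt_0_compat; lra|].
    intros y [_ Hy]. simpl in *. unfold R_dist in *.
    eapply Rle_lt_trans; [apply HL|].
    apply Rmult_lt_compat_l with (r := Rabs L + 1) in Hy; [|lra].
    replace ((Rabs L + 1) * (e / (Rabs L + 1))) with e in Hy by (field; lra).
    assert (Q := Rle_abs L). assert (Q' := Rabs_pos (y - c)). nra.
  - exists x. split; auto.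
Qed.

(** Taking the minimum over one variable preserves the Lipschitz constant in the others.
    Minimisation over a box thus reduces to one-dimensional compactness, with a minimiser [a x]
    chosen separately for each [x]. *)
Lemma part_min {X : Type} (f : X -> R -> R) (d : X -> X -> R) (L l h : R) : l <= h ->
  (forall x, d x x = 0) ->
  (forall x y x' y', Rabs (f x y - f x' y') <= L * (d x x' + Rabs (y - y'))) ->
  exists a : X -> R, (forall x, l <= a x <= h) /\ (forall x y, l <= y <= h -> f x (a x) <= f x y) /\
    forall x x', Rabs (f x (a x) - f x' (a x')) <= L * (d x x').
Proof.
  intros Hlh Hd HL.
  assert (H : forall x, exists a, l <= a <= h /\ forall y, l <= y <= h -> f x a <= f x y).
  { intro x. apply (min_lip (f x) L l h Hlh). intros y z.
    assert (Q := HL x y x z). rewrite Hd in Q. lra. }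
  pose (a := fun x => proj1_sig (constructive_indefinite_description _ (H x))).
  assert (Ha : forall x, l <= a x <= h /\ forall y, l <= y <= h -> f x (a x) <= f x y)
    by (intro x; exact (proj2_sig (constructive_indefinite_description _ (H x)))).
  exists a. split; [intro; apply Ha|]. split; [intro; apply Ha|].
  intros x x'. destruct (Ha x) as [A1 A2], (Ha x') as [B1 B2].
  specialize (A2 (a x') B1). specialize (B2 (a x) A1).
  assert (Q1 := HL x (a x') x' (a x')). assert (Q2 := HL x (a x) x' (a x)).
  rewrite Rminus_diag, Rabs_R0 in Q1, Q2. apply Rabs_le_between in Q1. apply Rabs_le_between in Q2.
  apply Rabs_le_between. lra.
Qed.

Lemma min3_lip (f : R -> R -> R -> R) (L l h r : R) : l <= h -> 0 <= r ->
  (forall x y z x' y' z', Rabs (f x y z - f x' y' z') <= L * (Rabs (x - x') + Rabs (y - y') + Rabs (z - z'))) ->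
  exists x y z, l <= x <= h /\ - r <= y <= r /\ - r <= z <= r /\
    forall x' y' z', l <= x' <= h -> - r <= y' <= r -> - r <= z' <= r -> f x y z <= f x' y' z'.
Proof.
  intros Hlh Hr HL.
  (* The last variable is eliminated first, with the pair of the other two as parameter. *)
  destruct (part_min (fun p z => f (fst p) (snd p) z)
    (fun p q => Rabs (fst p - fst q) + Rabs (snd p - snd q)) L (- r) r) as [a [A1 [A2 A3]]]; [lra| |intros; apply HL|].
  { intros [x y]; simpl. rewrite !Rminus_diag, Rabs_R0; ring. }
  destruct (part_min (fun x y => f x y (a (x, y))) (fun x x' => Rabs (x - x')) L (- r) r) as [b [B1 [B2 B3]]]; [lra| | |].
  { intro; rewrite Rminus_diag, Rabs_R0; ring. }
  { intros x y x' y'. exact (A3 (x, y) (x', y')). }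
  destruct (min_lip (fun x => f x (b x) (a (x, b x))) L l h Hlh B3) as [x [X1 X2]].
  exists x, (b x), (a (x, b x)). split; [auto|split; [apply B1|split; [apply A1|]]].
  intros x' y' z' Hx Hy Hz.
  eapply Rle_trans; [apply (X2 x' Hx)|]. eapply Rle_trans; [apply (B2 x' y' Hy)|]. exact (A2 (x', y') z' Hz).
Qed.

(** * The action *)

Lemma rsum_ext n f g : (forall j, (j < n)%nat -> f j = g j) -> rsum n f = rsum n g.
Proof. induction n as [|n IH]; intro H; simpl; [auto|]. rewrite IH, H; auto. Qed.
Lemma rsum_plus n f g : rsum n (fun j => f j + g j) = rsum n f + rsum n g.
Proof. induction n as [|n IH]; simpl; [ring|]. rewrite IH; ring. Qed.
Lemma rsum_minus n f g : rsum n (fun j => f j - g j) = rsum n f - rsum n g.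
Proof. induction n as [|n IH]; simpl; [ring|]. rewrite IH; ring. Qed.
Lemma rsum_scal n c f : rsum n (fun j => c * f j) = c * rsum n f.
Proof. induction n as [|n IH]; simpl; [ring|]. rewrite IH; ring. Qed.
Lemma rsum_le n f g : (forall j, (j < n)%nat -> f j <= g j) -> rsum n f <= rsum n g.
Proof. induction n as [|n IH]; intro H; simpl; [lra|]. apply Rplus_le_compat; auto. Qed.
Lemma rsum_abs n f : Rabs (rsum n f) <= rsum n (fun j => Rabs (f j)).
Proof.
  induction n as [|n IH]; simpl; [rewrite Rabs_R0; lra|].
  eapply Rle_trans; [apply Rabs_triang | lra].
Qed.
Lemma rsum_avg n m f C : (forall j, (j < n)%nat -> 0 < m j) -> rsum n m = 1 ->
  (forall j, (j < n)%nat -> Rabs (f j) <= C) -> Rabs (rsum n (fun j => m j * f j)) <= C.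
Proof.
  intros Hm H1 Hf. eapply Rle_trans; [apply rsum_abs|].
  apply Rle_trans with (rsum n (fun j => C * m j)).
  - apply rsum_le. intros j Hj. specialize (Hm j Hj). specialize (Hf j Hj).
    rewrite Rabs_mult, (Rabs_right (m j)) by lra. nra.
  - rewrite rsum_scal, H1. lra.
Qed.
Lemma pc_rsum T n (f : nat -> R -> R) : (forall j, (j < n)%nat -> pc T (f j)) ->
  pc T (fun t => rsum n (fun j => f j t)).
Proof.
  induction n as [|n IH]; intro H; simpl; [apply pc_const|].
  apply (pc_plus T (fun t => rsum n (fun j => f j t)) (f n)); auto.
Qed.

Lemma pc_pw T b u : pc T u -> (forall t, -1 < u t) -> pc T (fun t => pw b (u t)).
Proof.
  intros [C P] H. split; [|intro t; now rewrite P].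
  intro t. apply (continuous_comp u (pw b)); [apply C|].
  apply (ex_derive_continuous (K:=R_AbsRing) (V:=R_NormedModule) (pw b)).
  eexists; apply pw_derive; auto.
Qed.

Lemma pw_lip b : 0 <= b -> exists C, 0 < C /\ forall u v, Rabs u <= 1 / 2 -> Rabs v <= 1 / 2 ->
  Rabs (pw b v - pw b u) <= C * Rabs (v - u).
Proof.
  intro Hb. destruct (pw_bound (b + 1)) as [C [HC H]]; [lra|].
  exists (b * C + 1). split; [nra|]. intros u v Hu Hv.
  apply (mvt_abs (pw b) (fun w => - b * pw (b + 1) w)). intros w Hw. apply between_abs in Hw.
  assert (Rmax (Rabs u) (Rabs v) <= 1 / 2) by (apply Rmax_lub; auto).
  split; [apply pw_derive, half_gt; lra|].
  rewrite Rabs_mult, Rabs_Ropp, (Rabs_right b) by lra. specialize (H w ltac:(lra)). nra.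
Qed.

(** The potential as a function of the squared distance minus 1: the gradient of [pot b (|y|^2 - 1)]
    is [y / |y|^(2 b)]. As an integral it covers the logarithmic potential ([b = 1]) and the power
    laws at once. *)
Definition pot (b u : R) : R := RInt (fun v => / 2 * pw b v) 0 u.

Lemma pot_derive b u : -1 < u -> is_derive (pot b) u (/ 2 * pw b u).
Proof.
  intro Hu.
  assert (C : forall v, -1 < v -> continuous (fun v => / 2 * pw b v) v).
  { intros v Hv. apply (ex_derive_continuous (K:=R_AbsRing) (V:=R_NormedModule) (fun v => / 2 * pw b v)).
    eexists. apply (is_derive_scal (pw b) v (/ 2)). apply pw_derive; auto. }
  apply (is_derive_RInt (fun v => / 2 * pw b v) (pot b) 0 u); [|apply C; auto].
  assert (He : 0 < u + 1) by lra. exists (mkposreal _ He). intros y Hy.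
  unfold pot. apply (@RInt_correct R_CompleteNormedModule). apply (ex_RInt_continuous (V:=R_CompleteNormedModule)).
  intros z Hz. apply C. unfold ball in Hy; simpl in Hy. unfold AbsRing_ball, abs, minus, plus, opp in Hy; simpl in Hy.
  apply Rabs_def2 in Hy. unfold Rmin in Hz. destruct (Rle_dec 0 y); lra.
Qed.

Lemma pot_taylor b : 0 <= b -> exists C, 0 < C /\ forall u v, Rabs u <= 1 / 2 -> Rabs v <= 1 / 2 ->
  Rabs (pot b v - pot b u - / 2 * pw b u * (v - u)) <= C * (v - u) ^ 2.
Proof.
  intro Hb. destruct (pw_lip b Hb) as [C [HC H]]. exists C. split; [auto|]. intros u v Hu Hv.
  replace (pot b v - pot b u - / 2 * pw b u * (v - u)) with
    ((pot b v - / 2 * pw b u * v) - (pot b u - / 2 * pw b u * u)) by ring.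
  replace (C * (v - u) ^ 2) with (C * Rabs (v - u) * Rabs (v - u)).
  2:{ rewrite Rmult_assoc, <- Rabs_mult, Rabs_right; [ring|]. apply Rle_ge, Rle_0_sqr. }
  apply (mvt_abs (fun w => pot b w - / 2 * pw b u * w) (fun w => / 2 * pw b w - / 2 * pw b u)).
  intros w Hw. assert (Hw' := Hw). apply between_abs in Hw'.
  assert (Rmax (Rabs u) (Rabs v) <= 1 / 2) by (apply Rmax_lub; auto).
  assert (W : Rabs w <= 1 / 2) by lra. split.
  - apply (is_derive_minus (V:=R_NormedModule)); [apply pot_derive, half_gt; auto|].
    auto_derive; [auto|ring].
  - rewrite <- Rmult_minus_distr_l, Rabs_mult, (Rabs_right (/ 2)) by lra.
    assert (Q := H u w Hu W).
    assert (Rabs (w - u) <= Rabs (v - u)).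
    { unfold Rmin, Rmax in Hw. destruct (Rle_dec u v); unfold Rabs; repeat destruct (Rcase_abs _); lra. }
    assert (Q' := Rabs_pos (w - u)). nra.
Qed.

Lemma pc_pot T b u : pc T u -> (forall t, -1 < u t) -> pc T (fun t => pot b (u t)).
Proof.
  intros [C P] H. split; [|intro t; now rewrite P].
  intro t. apply (continuous_comp u (pot b)); [apply C|].
  apply (ex_derive_continuous (K:=R_AbsRing) (V:=R_NormedModule) (pot b)).
  eexists; apply pot_derive; auto.
Qed.

Lemma Int0_parts T f g df dg : pc T f -> pc T g -> cont df -> cont dg ->
  (forall t : R, is_derive f t (df t)) -> (forall t : R, is_derive g t (dg t)) ->
  Int0 T (fun t => f t * dg t) = - Int0 T (fun t => df t * g t).
Proof.
  intros F G CF CG DF DG.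
  assert (E : Int0 T (fun t => df t * g t + f t * dg t) = 0).
  { apply (Int0_derive0 T (fun t => f t * g t)); [cts| |apply (pc_mult T f g F G)].
    intro t. apply (is_derive_mult f g t _ _ (DF t) (DG t)). intros; apply Rmult_comm. }
  rewrite Int0_plus in E by cts. lra.
Qed.

Lemma sq_sum_le x y : x * x + y * y <= 4 -> Rabs x <= 2 /\ Rabs y <= 2.
Proof. intro H; split; apply Rabs_le; split; nra. Qed.

Section Action.
Variables (T b eps : R) (n : nat) (m : nat -> R) (b1 b2 : nat -> R -> R).
Hypothesis HT : 0 < T.
Hypothesis Hb : 0 <= b.
Hypothesis Hm : forall j, (j < n)%nat -> 0 < m j.
Hypothesis Hm1 : rsum n m = 1.
Hypothesis Pb : forall j, (j < n)%nat -> pc T (b1 j) /\ pc T (b2 j).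

(** The squared distance to a primary minus its unperturbed value 1, which is the argument that [pw]
    and [pot] take. *)
Definition gap (Q1 Q2 : R -> R) (j : nat) (t : R) : R :=
  (Q1 t - eps * b1 j t) * (Q1 t - eps * b1 j t) + (Q2 t - eps * b2 j t) * (Q2 t - eps * b2 j t) - 1.
Definition force1 (Q1 Q2 : R -> R) (t : R) : R :=
  rsum n (fun j => m j * ((Q1 t - eps * b1 j t) * pw b (gap Q1 Q2 j t))).
Definition force2 (Q1 Q2 : R -> R) (t : R) : R :=
  rsum n (fun j => m j * ((Q2 t - eps * b2 j t) * pw b (gap Q1 Q2 j t))).
(** The Lagrangian action of the path [Q] with velocity [P]. The gradient of the potential is the
    vector [force1], [force2], so critical paths satisfy [Q'' = - force]. *)
Definition action (Q1 Q2 P1 P2 : R -> R) : R :=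
  Int0 T (fun t => / 2 * (P1 t * P1 t + P2 t * P2 t) - rsum n (fun j => m j * pot b (gap Q1 Q2 j t))).

Lemma gap_pc Q1 Q2 j : pc T Q1 -> pc T Q2 -> (j < n)%nat -> pc T (gap Q1 Q2 j).
Proof. intros A1 A2 Hj. destruct (Pb j Hj). unfold gap. pcs. Qed.

Lemma force_pc Q1 Q2 : pc T Q1 -> pc T Q2 ->
  (forall j t, (j < n)%nat -> Rabs (gap Q1 Q2 j t) <= 1 / 2) ->
  pc T (force1 Q1 Q2) /\ pc T (force2 Q1 Q2).
Proof.
  intros A1 A2 Hg. unfold force1, force2. split.
  - apply (pc_rsum T n (fun j t => m j * ((Q1 t - eps * b1 j t) * pw b (gap Q1 Q2 j t)))).
    intros j Hj. destruct (Pb j Hj). assert (W := pc_pw T b _ (gap_pc Q1 Q2 j A1 A2 Hj) (fun t => half_gt _ (Hg j t Hj))). pcs.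
  - apply (pc_rsum T n (fun j t => m j * ((Q2 t - eps * b2 j t) * pw b (gap Q1 Q2 j t)))).
    intros j Hj. destruct (Pb j Hj). assert (W := pc_pw T b _ (gap_pc Q1 Q2 j A1 A2 Hj) (fun t => half_gt _ (Hg j t Hj))). pcs.
Qed.

(** The first variation at a path that is not a solution: [E] is the residual in [Q'' = E - force].
    Integrating the kinetic term by parts leaves only the residual paired with the displacement, up
    to a quadratic error. *)
Lemma action_expand : exists C, 0 < C /\
  forall Q1 Q2 P1 P2 R1 R2 S1 S2 E1 E2 delta,
  pc T Q1 -> pc T Q2 -> pc T P1 -> pc T P2 -> pc T R1 -> pc T R2 -> pc T S1 -> pc T S2 ->
  pc T E1 -> pc T E2 ->
  (forall t : R, is_derive Q1 t (P1 t)) -> (forall t : R, is_derive Q2 t (P2 t)) ->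
  (forall t : R, is_derive R1 t (S1 t)) -> (forall t : R, is_derive R2 t (S2 t)) ->
  (forall t : R, is_derive P1 t (E1 t - force1 Q1 Q2 t)) ->
  (forall t : R, is_derive P2 t (E2 t - force2 Q1 Q2 t)) ->
  (forall j t, (j < n)%nat -> Rabs (gap Q1 Q2 j t) <= 1 / 2) ->
  (forall j t, (j < n)%nat -> Rabs (gap R1 R2 j t) <= 1 / 2) ->
  (forall t, Rabs (R1 t - Q1 t) <= delta) -> (forall t, Rabs (R2 t - Q2 t) <= delta) ->
  (forall t, Rabs (S1 t - P1 t) <= delta) -> (forall t, Rabs (S2 t - P2 t) <= delta) ->
  Rabs (action R1 R2 S1 S2 - action Q1 Q2 P1 P2 +
    Int0 T (fun t => E1 t * (R1 t - Q1 t) + E2 t * (R2 t - Q2 t))) <= C * (delta * delta).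
Proof.
  destruct (pot_taylor b Hb) as [C1 [HC1 HP]]. destruct (pw_bound b Hb) as [C2 [HC2 HW]].
  exists (T * (1 + C2 + 100 * C1)). split; [nra|].
  intros Q1 Q2 P1 P2 R1 R2 S1 S2 E1 E2 delta cQ1 cQ2 cP1 cP2 cR1 cR2 cS1 cS2 cE1 cE2 dQ1 dQ2 dR1 dR2 dP1 dP2 GQ GR B1 B2 B3 B4.
  assert (Hd0 : 0 <= delta) by (eapply Rle_trans; [apply Rabs_pos | apply (B1 0)]).
  destruct (force_pc Q1 Q2 cQ1 cQ2 GQ) as [cF1 cF2].
  assert (cD1 : pc T (fun t => R1 t - Q1 t)) by pcs. assert (cD2 : pc T (fun t => R2 t - Q2 t)) by pcs.
  assert (Parts : forall Q P Rr S E F, pc T P -> pc T (fun t => Rr t - Q t) -> pc T S -> pc T E -> pc T F ->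
    (forall t : R, is_derive Q t (P t)) -> (forall t : R, is_derive Rr t (S t)) ->
    (forall t : R, is_derive P t (E t - F t)) ->
    Int0 T (fun t => P t * (S t - P t)) = Int0 T (fun t => (F t - E t) * (Rr t - Q t))).
  { intros Q P Rr S E F cP cD cS cE cF dQ dR dP.
    rewrite (Int0_parts T P (fun t => Rr t - Q t) (fun t => E t - F t) (fun t => S t - P t)); try assumption; [|cts|cts|].
    - rewrite <- Int0_opp by cts. apply Int0_ext. intro; ring.
    - intro t. apply (is_derive_minus (V:=R_NormedModule)); auto. }
  assert (I1 := Parts _ _ _ _ _ _ cP1 cD1 cS1 cE1 cF1 dQ1 dR1 dP1).
  assert (I2 := Parts _ _ _ _ _ _ cP2 cD2 cS2 cE2 cF2 dQ2 dR2 dP2).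
  assert (cPot : forall X1 X2, pc T X1 -> pc T X2 -> (forall j t, (j < n)%nat -> Rabs (gap X1 X2 j t) <= 1 / 2) ->
     pc T (fun t => rsum n (fun j => m j * pot b (gap X1 X2 j t)))).
  { intros X1 X2 cX1 cX2 GX. apply (pc_rsum T n (fun j t => m j * pot b (gap X1 X2 j t))).
    intros j Hj. assert (W := pc_pot T b _ (gap_pc X1 X2 j cX1 cX2 Hj) (fun t => half_gt _ (GX j t Hj))). pcs. }
  assert (cVQ := cPot Q1 Q2 cQ1 cQ2 GQ). assert (cVR := cPot R1 R2 cR1 cR2 GR).
  unfold action.
  set (VQ := fun t => rsum n (fun j => m j * pot b (gap Q1 Q2 j t))) in *.
  set (VR := fun t => rsum n (fun j => m j * pot b (gap R1 R2 j t))) in *.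
  set (F1 := force1 Q1 Q2) in *. set (F2 := force2 Q1 Q2) in *.
  assert (Eq : Int0 T (fun t => / 2 * (S1 t * S1 t + S2 t * S2 t) - VR t)
     - Int0 T (fun t => / 2 * (P1 t * P1 t + P2 t * P2 t) - VQ t)
     + Int0 T (fun t => E1 t * (R1 t - Q1 t) + E2 t * (R2 t - Q2 t)) =
    Int0 T (fun t => / 2 * ((S1 t - P1 t) * (S1 t - P1 t) + (S2 t - P2 t) * (S2 t - P2 t))
       - (VR t - VQ t - (F1 t * (R1 t - Q1 t) + F2 t * (R2 t - Q2 t))))).
  { rewrite (Int0_ext T (fun t => / 2 * ((S1 t - P1 t) * (S1 t - P1 t) + (S2 t - P2 t) * (S2 t - P2 t)) - _)
      (fun t => (/ 2 * (S1 t * S1 t + S2 t * S2 t) - VR t) - (/ 2 * (P1 t * P1 t + P2 t * P2 t) - VQ t)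
         + (E1 t * (R1 t - Q1 t) + E2 t * (R2 t - Q2 t))
         - (P1 t * (S1 t - P1 t)) - (P2 t * (S2 t - P2 t))
         + ((F1 t - E1 t) * (R1 t - Q1 t)) + ((F2 t - E2 t) * (R2 t - Q2 t)))) by (intro; field).
    rewrite !Int0_plus, !Int0_minus, !Int0_plus, !Int0_minus by cts.
    rewrite I1, I2. ring. }
  match type of Eq with ?L = _ => change (Rabs L <= T * (1 + C2 + 100 * C1) * (delta * delta)) end.
  rewrite Eq.
  replace (T * (1 + C2 + 100 * C1) * (delta * delta)) with (T * ((1 + C2 + 100 * C1) * (delta * delta))) by ring.
  apply Int0_bound; [lra|cts|]. intro t.
  assert (K1 : Rabs (/ 2 * ((S1 t - P1 t) * (S1 t - P1 t) + (S2 t - P2 t) * (S2 t - P2 t))) <= delta * delta).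
  { specialize (B3 t). specialize (B4 t). eapply Rle_trans; [absb|]. rewrite Rabs_right by lra. lra. }
  assert (K2 : Rabs (VR t - VQ t - (F1 t * (R1 t - Q1 t) + F2 t * (R2 t - Q2 t))) <= (C2 + 100 * C1) * (delta * delta)).
  { set (D1 := R1 t - Q1 t). set (D2 := R2 t - Q2 t).
    replace (VR t - VQ t - (F1 t * D1 + F2 t * D2)) with
      (rsum n (fun j => m j * (pot b (gap R1 R2 j t) - pot b (gap Q1 Q2 j t)
         - pw b (gap Q1 Q2 j t) * ((Q1 t - eps * b1 j t) * D1 + (Q2 t - eps * b2 j t) * D2)))).
    - apply rsum_avg; auto. intros j Hj.
      assert (G1 := GQ j t Hj). assert (G2 := GR j t Hj).
      assert (TT := HP _ _ G1 G2). assert (WW := HW _ G1).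
      set (u := gap Q1 Q2 j t) in *. set (v := gap R1 R2 j t) in *.
      set (X := Q1 t - eps * b1 j t). set (Z := Q2 t - eps * b2 j t).
      assert (Ev : v - u = 2 * (X * D1 + Z * D2) + (D1 * D1 + D2 * D2)) by (unfold v, u, gap, X, Z, D1, D2; ring).
      assert (Eu : X * X + Z * Z = 1 + u) by (unfold u, gap, X, Z; ring).
      assert (G1' := G1). apply Rabs_le_between in G1'.
      assert (HXZ : Rabs X <= 2 /\ Rabs Z <= 2) by (apply sq_sum_le; lra). destruct HXZ as [HX HZ].
      assert (HD1 : Rabs D1 <= delta) by apply B1. assert (HD2 : Rabs D2 <= delta) by apply B2.
      assert (HX' : Rabs (X + D1) <= 2 /\ Rabs (Z + D2) <= 2).
      { assert (Ev' : (X + D1) * (X + D1) + (Z + D2) * (Z + D2) = 1 + v) by (unfold v, gap, X, Z, D1, D2; ring).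
        assert (G2' := G2). apply Rabs_le_between in G2'. apply sq_sum_le; lra. }
      destruct HX' as [HX' HZ'].
      (* A difference of squares: the displacement times the sum of two vectors whose components are
         at most 2. *)
      assert (Hvu : Rabs (v - u) <= 10 * delta).
      { replace (v - u) with (D1 * (X + (X + D1)) + D2 * (Z + (Z + D2))) by (rewrite Ev; ring).
        eapply Rle_trans; [absb|]. lra. }
      assert (Hvu2 : (v - u) ^ 2 <= 100 * (delta * delta)).
      { rewrite <- (Rabs_right ((v - u) ^ 2)) by (apply Rle_ge, pow2_ge_0).
        eapply Rle_trans; [apply ab_pow; exact Hvu|]. lra. }
      replace (pot b v - pot b u - pw b u * (X * D1 + Z * D2)) with
        ((pot b v - pot b u - / 2 * pw b u * (v - u)) + / 2 * (pw b u * (D1 * D1 + D2 * D2))) by (rewrite Ev; field).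
      clear Hvu G1 G2.
      eapply Rle_trans; [absb|]. rewrite (Rabs_right (/ 2)) by lra. nra.
    - unfold VR, VQ, F1, F2, force1, force2.
      rewrite <- (rsum_minus n (fun j => m j * pot b (gap R1 R2 j t))).
      rewrite (Rmult_comm _ D1), (Rmult_comm _ D2), <- !rsum_scal, <- rsum_plus, <- rsum_minus.
      apply rsum_ext. intros; ring. }
  eapply Rle_trans; [apply ab_minus; [exact K1|exact K2]|]. lra.
Qed.
End Action.

(** * Averaging over the short period *)

Lemma INR_gt0 n : (1 <= n)%nat -> 0 < INR n.
Proof. intro; apply lt_0_INR; lia. Qed.

Section Frequencies.
Variables (p q : nat).
Hypothesis Hp : (1 <= p)%nat.
Hypothesis Hq : (1 <= q)%nat.

Let T := 2 * PI * INR p.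
Let sg := 2 * PI * INR p / INR q.

(* A function of frequency [l / p] whose amplitudes have the short period [2 PI p / q]. *)
Definition mono (l : Z) (f : R -> R) : Prop :=
  exists S1 S2, pc sg S1 /\ pc sg S2 /\
    forall t, f t = S1 t * cos (IZR l / INR p * t) + S2 t * sin (IZR l / INR p * t).

(** Finite sums of terms with slow frequencies [l / p], [l] in [P], and amplitudes of short period.
    Only the set of possible [l] is recorded, so that the vanishing of an average is decided by
    integer arithmetic. *)
Inductive spec (P : Z -> Prop) : (R -> R) -> Prop :=
| spec_mono l f : P l -> mono l f -> spec P f
| spec_plus f g : spec P f -> spec P g -> spec P (fun t => f t + g t).

Lemma short_long f : pc sg f -> pc T f.
Proof.
  intros [C P]. split; [exact C|]. intro t.
  assert (E := per_IZR sg f P (Z.of_nat q) t). rewrite <- INR_IZR_INZ in E.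
  replace (INR q * sg) with T in E; [exact E|].
  unfold T, sg. field. apply Rgt_not_eq, INR_gt0, Hq.
Qed.

Lemma pc_cosl l : pc T (fun t => cos (IZR l / INR p * t)) /\ pc T (fun t => sin (IZR l / INR p * t)).
Proof.
  assert (Z := INR_gt0 p Hp).
  assert (E : forall t, IZR l / INR p * (t + T) = IZR l / INR p * t + 2 * PI * IZR l).
  { intro t. unfold T. field. lra. }
  assert (X : forall x, cos (x + 2 * PI * IZR l) = cos x /\ sin (x + 2 * PI * IZR l) = sin x).
  { intro x. replace (x + 2 * PI * IZR l) with (x + IZR l * (2 * PI)) by ring. split.
    - apply (per_IZR (2 * PI) cos). intro; rewrite cos_plus, cos_2PI, sin_2PI; ring.
    - apply (per_IZR (2 * PI) sin). intro; rewrite sin_plus, cos_2PI, sin_2PI; ring. }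
  split; (split; [cts | intro t; rewrite E; apply X]).
Qed.

Lemma mono_pc l f : mono l f -> pc T f.
Proof.
  intros [S1 [S2 [A1 [A2 E]]]]. destruct (pc_cosl l) as [C1 C2].
  apply short_long in A1. apply short_long in A2.
  replace f with (fun t => S1 t * cos (IZR l / INR p * t) + S2 t * sin (IZR l / INR p * t))
    by (apply functional_extensionality; auto).
  apply (pc_plus T (fun t => S1 t * cos _) (fun t => S2 t * sin _)).
  - apply (pc_mult T S1 (fun t => cos (IZR l / INR p * t))); auto.
  - apply (pc_mult T S2 (fun t => sin (IZR l / INR p * t))); auto.
Qed.

Lemma spec_pc P f : spec P f -> pc T f.
Proof. induction 1; [eapply mono_pc; eassumption | apply pc_plus; auto]. Qed.

(* Translating by the short period [sg] rotates the phase of the integrand by [2 PI l / q], which is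
not a multiple of [2 PI]. *)
Lemma mono_zero l f : l <> 0%Z -> (Z.abs l < Z.of_nat q)%Z -> mono l f -> Int0 T f = 0.
Proof.
  intros Hl Hlq Hf. destruct Hf as [S1 [S2 [A1 [A2 E]]]].
  destruct (pc_cosl l) as [C1 C2]. assert (Zp := INR_gt0 p Hp). assert (Zq := INR_gt0 q Hq).
  set (w := IZR l / INR p) in *.
  assert (B1 := short_long _ A1). assert (B2 := short_long _ A2).
  assert (Ew : w * sg = 2 * PI * IZR l / INR q) by (unfold w, sg; field; lra).
  set (cs := cos (w * sg)). set (sn := sin (w * sg)).
  assert (N : cs <> 1).
  { unfold cs. rewrite Ew. intro H.
    assert (Sn : sin (PI * (IZR l / INR q)) = 0).
    { assert (Q := cos_2a_sin (PI * (IZR l / INR q))).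
      replace (2 * (PI * (IZR l / INR q))) with (2 * PI * IZR l / INR q) in Q by (field; lra).
      rewrite H in Q. nra. }
    apply sin_eq_0_0 in Sn. destruct Sn as [k Hk].
    assert (HPI := PI_RGT_0).
    assert (Ek : IZR l / INR q = IZR k) by (apply Rmult_eq_reg_l with PI; lra).
    assert (El : IZR l = IZR (k * Z.of_nat q)).
    { rewrite mult_IZR, <- INR_IZR_INZ, <- Ek. field. lra. }
    apply eq_IZR in El. assert (k <> 0)%Z by (intro; subst; lia). assert (1 <= Z.abs k)%Z by lia. rewrite El, Z.abs_mul, (Z.abs_eq (Z.of_nat q)) in Hlq by lia. clear - Hlq H1. nia. }
  assert (CS : cs * cs + sn * sn = 1).
  { assert (Q := sin2_cos2 (w * sg)). unfold Rsqr in Q. fold cs sn in Q. lra. }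
  assert (Key : forall S, pc sg S -> Int0 T (fun t => S t * cos (w * t)) = 0 /\ Int0 T (fun t => S t * sin (w * t)) = 0).
  { intros S PS. assert (LS := short_long _ PS).
    assert (Pc : pc T (fun t => S t * cos (w * t))) by (apply (pc_mult T S (fun t => cos (w * t))); auto).
    assert (Ps : pc T (fun t => S t * sin (w * t))) by (apply (pc_mult T S (fun t => sin (w * t))); auto).
    assert (E1 := Int0_shift T _ sg Pc). assert (E2 := Int0_shift T _ sg Ps). cbv beta in E1, E2.
    rewrite (Int0_ext T _ (fun t => cs * (S t * cos (w * t)) - sn * (S t * sin (w * t)))) in E1.
    2:{ intro t. rewrite (proj2 PS), Rmult_plus_distr_l, cos_plus. fold cs sn. ring. }
    rewrite (Int0_ext T _ (fun t => sn * (S t * cos (w * t)) + cs * (S t * sin (w * t)))) in E2.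
    2:{ intro t. rewrite (proj2 PS), Rmult_plus_distr_l, sin_plus. fold cs sn. ring. }
    rewrite Int0_minus, !Int0_scal in E1 by cts. rewrite Int0_plus, !Int0_scal in E2 by cts.
    set (u := Int0 T (fun t => S t * cos (w * t))) in *. set (v := Int0 T (fun t => S t * sin (w * t))) in *.
    (* The pair [(u, v)] is fixed by a rotation; the determinant of the rotation minus the identity
       is [2 * (1 - cs)], which is not zero. *)
    assert (H1 : (1 - cs) * u = 0 /\ (1 - cs) * v = 0).
    { assert (X1 : (1 - cs) * u + sn * v = 0) by lra. assert (X2 : (1 - cs) * v - sn * u = 0) by lra.
      assert (D : (1 - cs) * (1 - cs) + sn * sn = 2 * (1 - cs)) by lra.
      assert (Y1 : 2 * (1 - cs) * u = 0).
      { rewrite <- D. transitivity ((1 - cs) * ((1 - cs) * u + sn * v) - sn * ((1 - cs) * v - sn * u)); [ring|rewrite X1, X2; ring]. }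
      assert (Y2 : 2 * (1 - cs) * v = 0).
      { rewrite <- D. transitivity ((1 - cs) * ((1 - cs) * v - sn * u) + sn * ((1 - cs) * u + sn * v)); [ring|rewrite X1, X2; ring]. }
      split; lra. }
    destruct H1 as [H1 H2]. apply Rmult_integral in H1. apply Rmult_integral in H2.
    split; [destruct H1; lra | destruct H2; lra]. }
  rewrite (Int0_ext T _ _ E).
  rewrite Int0_plus, (proj1 (Key S1 A1)), (proj2 (Key S2 A2)) by cts. ring.
Qed.

Definition nz (l : Z) : Prop := l <> 0%Z /\ (Z.abs l < Z.of_nat q)%Z.

Lemma spec_zero f : spec nz f -> Int0 T f = 0.
Proof.
  induction 1 as [l f [H1 H2] Hf|f g F IF G IG].
  - exact (mono_zero l f H1 H2 Hf).
  - assert (PF := spec_pc _ _ F). assert (PG := spec_pc _ _ G).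
    rewrite Int0_plus, IF, IG by cts. ring.
Qed.

Lemma spec_imp (P Q : Z -> Prop) f : (forall l, P l -> Q l) -> spec P f -> spec Q f.
Proof. intros H; induction 1; [eapply spec_mono; eauto | apply spec_plus; auto]. Qed.

Lemma spec_scal P c f : spec P f -> spec P (fun t => c * f t).
Proof.
  induction 1 as [l f Hl Hf|f g F IF G IG].
  - apply (spec_mono P l); auto. destruct Hf as [S1 [S2 [A1 [A2 E]]]].
    exists (fun t => c * S1 t), (fun t => c * S2 t). split; [pcs|split; [pcs|]].
    intro t. rewrite E. ring.
  - replace (fun t => c * (f t + g t)) with (fun t => c * f t + c * g t)
      by (apply functional_extensionality; intro; ring).
    apply spec_plus; auto.
Qed.

Lemma spec_minus P f g : spec P f -> spec P g -> spec P (fun t => f t - g t).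
Proof.
  intros F G. replace (fun t => f t - g t) with (fun t => f t + -1 * g t)
    by (apply functional_extensionality; intro; ring).
  apply spec_plus; [auto | apply spec_scal; auto].
Qed.

Lemma spec_short f : pc sg f -> spec (fun l => l = 0%Z) f.
Proof.
  intro F. apply (spec_mono _ 0%Z); [auto|]. exists f, (fun _ => 0).
  split; [pcs|split; [pcs|]]. intro t. unfold Rdiv. rewrite !Rmult_0_l, cos_0. ring.
Qed.

Definition prodset (P Q : Z -> Prop) (n : Z) : Prop :=
  exists l m, P l /\ Q m /\ (n = l + m \/ n = l - m)%Z.

Lemma mono_mult l m f g (P : Z -> Prop) : P (l + m)%Z -> P (l - m)%Z ->
  mono l f -> mono m g -> spec P (fun t => f t * g t).
Proof.
  intros H1 H2 [S1 [S2 [A1 [A2 E]]]] [U1 [U2 [B1 [B2 F]]]].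
  assert (Zp := INR_gt0 p Hp).
  pose (f1 := fun t => / 2 * (S1 t * U1 t - S2 t * U2 t) * cos (IZR (l + m) / INR p * t)
                  + / 2 * (S1 t * U2 t + S2 t * U1 t) * sin (IZR (l + m) / INR p * t)).
  pose (f2 := fun t => / 2 * (S1 t * U1 t + S2 t * U2 t) * cos (IZR (l - m) / INR p * t)
                  + / 2 * (S2 t * U1 t - S1 t * U2 t) * sin (IZR (l - m) / INR p * t)).
  replace (fun t => f t * g t) with (fun t => f1 t + f2 t).
  - apply spec_plus.
    + apply (spec_mono _ (l + m)%Z); auto. unfold f1.
      exists (fun t => / 2 * (S1 t * U1 t - S2 t * U2 t)), (fun t => / 2 * (S1 t * U2 t + S2 t * U1 t)).
      split; [pcs|split; [pcs|reflexivity]].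
    + apply (spec_mono _ (l - m)%Z); auto. unfold f2.
      exists (fun t => / 2 * (S1 t * U1 t + S2 t * U2 t)), (fun t => / 2 * (S2 t * U1 t - S1 t * U2 t)).
      split; [pcs|split; [pcs|reflexivity]].
  - apply functional_extensionality; intro t. unfold f1, f2. rewrite E, F.
    rewrite plus_IZR, minus_IZR.
    replace ((IZR l + IZR m) / INR p * t) with (IZR l / INR p * t + IZR m / INR p * t) by (field; lra).
    replace ((IZR l - IZR m) / INR p * t) with (IZR l / INR p * t - IZR m / INR p * t) by (field; lra).
    rewrite cos_plus, cos_minus, sin_plus, sin_minus. field.
Qed.

Lemma spec_mult P Q f g : spec P f -> spec Q g -> spec (prodset P Q) (fun t => f t * g t).
Proof.
  intros F G. induction F as [l f Hl Hf|f1 f2 F1 I1 F2 I2].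
  - induction G as [m g Hm Hg|g1 g2 G1 J1 G2 J2].
    + apply (mono_mult l m); auto; unfold prodset; eauto 8.
    + replace (fun t => f t * (g1 t + g2 t)) with (fun t => f t * g1 t + f t * g2 t)
        by (apply functional_extensionality; intro; ring).
      apply spec_plus; auto.
  - replace (fun t => (f1 t + f2 t) * g t) with (fun t => f1 t * g t + f2 t * g t)
      by (apply functional_extensionality; intro; ring).
    apply spec_plus; auto.
Qed.

(** The sum must be nonempty: an empty one is the zero function, and [spec P] contains it only if
    [P] holds somewhere. *)
Lemma spec_rsum P n (m : nat -> R) (f : nat -> R -> R) : (1 <= n)%nat ->
  (forall j, (j < n)%nat -> spec P (f j)) -> spec P (fun t => rsum n (fun j => m j * f j t)).
Proof.
  clear Hp Hq. intros Hn H. induction n as [|n IH]; [lia|].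
  destruct n as [|n].
  - simpl. replace (fun t => 0 + m O * f O t) with (fun t => m O * f O t)
      by (apply functional_extensionality; intro; ring).
    apply spec_scal, H; lia.
  - change (spec P (fun t => rsum (S n) (fun j => m j * f j t) + m (S n) * f (S n) t)).
    apply spec_plus; [apply IH; [lia|auto] | apply spec_scal, H; lia].
Qed.

Lemma spec_rot f c1 c2 : pc sg c1 -> pc sg c2 -> (forall t, f t = c1 t * cos t + c2 t * sin t) -> spec (fun l => l = Z.of_nat p) f.
Proof.
  intros A1 A2 E. assert (Zp := INR_gt0 p Hp). apply (spec_mono _ (Z.of_nat p)); [auto|].
  exists c1, c2. split; [auto|split; [auto|]]. intro t. rewrite E.
  rewrite <- INR_IZR_INZ. replace (INR p / INR p * t) with t by (field; lra). reflexivity.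
Qed.
End Frequencies.

(** * The resonant multiplier *)

(** The primaries as seen from the frame that rotates with the unperturbed particle of phase
    [theta]. *)
Definition eta1 (theta : R) (b1 b2 : nat -> R -> R) (j : nat) (t : R) : R :=
  cos (theta + t) * b1 j t - sin (theta + t) * b2 j t.
Definition eta2 (theta : R) (b1 b2 : nat -> R -> R) (j : nat) (t : R) : R :=
  cos (theta + t) * b2 j t + sin (theta + t) * b1 j t.

(** The forcing of the linearised equation. The force is expanded around the unit vector, and its
    part linear in the primaries has been dropped, since it sums to zero by the condition on the
    centre of mass. *)
Definition NN1 (b eps theta : R) (n : nat) (m : nat -> R) (b1 b2 : nat -> R -> R) (x1 x2 : R -> R) (t : R) : R :=
  - rsum n (fun j => m j * nl1 b (x1 t - eps * eta1 theta b1 b2 j t) (x2 t - eps * eta2 theta b1 b2 j t)).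
Definition NN2 (b eps theta : R) (n : nat) (m : nat -> R) (b1 b2 : nat -> R -> R) (x1 x2 : R -> R) (t : R) : R :=
  - rsum n (fun j => m j * nl2 b (x1 t - eps * eta1 theta b1 b2 j t) (x2 t - eps * eta2 theta b1 b2 j t)).

Definition mom1 n (m u : nat -> R) := rsum n (fun j => m j * u j).
Definition mom2 n (m u v : nat -> R) := rsum n (fun j => m j * (u j * v j)).
Definition mom3 n (m u v w : nat -> R) := rsum n (fun j => m j * (u j * v j * w j)).

(** The sums of [quad] and [cub] over the primaries, sorted by moments: [quadM] carries the second
    moments, [cubM] the second moments times one factor [x], and [cubN] the third moments. *)
Definition quadM1 (B M11 M22 : R) : R := B / 2 * ((B - 1) * M11 - M22).
Definition quadM2 (B M12 : R) : R := - B * M12.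
Definition cubM1 (B x1 x2 M11 M12 M22 : R) : R :=
  - B * (B * B - 1) / 2 * (x1 * M11) + B * (B + 1) / 2 * (x1 * M22 + 2 * (x2 * M12)).
Definition cubM2 (B x1 x2 M11 M12 M22 : R) : R :=
  B * (B + 1) / 2 * (x2 * M11 + 2 * (x1 * M12)) - 3 * (B / 2) * (x2 * M22).
Definition cubN1 (B M111 M122 : R) : R := - B * (B * B - 1) / 6 * M111 + B * (B + 1) / 2 * M122.
Definition cubN2 (B M112 M222 : R) : R := B * (B + 1) / 2 * M112 - B / 2 * M222.

Section Moments.
Variables (n : nat) (m h1 h2 : nat -> R) (eps B x1 x2 : R).
Hypothesis Hm1 : rsum n m = 1.
Hypothesis Z1 : mom1 n m h1 = 0.
Hypothesis Z2 : mom1 n m h2 = 0.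

(** The first moments vanish by the choice of origin, so that [c1] and [c2] leave no trace in the
    sum. *)
Lemma moment_expand (F : R -> R -> R) c0 c1 c2 c11 c12 c22 c111 c112 c122 c222 :
  (forall u v, F (x1 - eps * u) (x2 - eps * v) =
    c0 + c1 * u + c2 * v + c11 * (u * u) + c12 * (u * v) + c22 * (v * v)
    + c111 * (u * u * u) + c112 * (u * u * v) + c122 * (u * v * v) + c222 * (v * v * v)) ->
  rsum n (fun j => m j * F (x1 - eps * h1 j) (x2 - eps * h2 j)) =
    c0 + c11 * mom2 n m h1 h1 + c12 * mom2 n m h1 h2 + c22 * mom2 n m h2 h2
    + c111 * mom3 n m h1 h1 h1 + c112 * mom3 n m h1 h1 h2 + c122 * mom3 n m h1 h2 h2 + c222 * mom3 n m h2 h2 h2.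
Proof.
  intro H.
  rewrite (rsum_ext n _ (fun j => c0 * m j + c1 * (m j * h1 j) + c2 * (m j * h2 j)
    + c11 * (m j * (h1 j * h1 j)) + c12 * (m j * (h1 j * h2 j)) + c22 * (m j * (h2 j * h2 j))
    + c111 * (m j * (h1 j * h1 j * h1 j)) + c112 * (m j * (h1 j * h1 j * h2 j))
    + c122 * (m j * (h1 j * h2 j * h2 j)) + c222 * (m j * (h2 j * h2 j * h2 j)))) by (intros; rewrite H; ring).
  rewrite !rsum_plus, !rsum_scal, Hm1.
  fold (mom1 n m h1) (mom1 n m h2). rewrite Z1, Z2. unfold mom2, mom3. ring.
Qed.

Let M11 := mom2 n m h1 h1.
Let M12 := mom2 n m h1 h2.
Let M22 := mom2 n m h2 h2.

Lemma sum_nl1 :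
  rsum n (fun j => m j * (quad1 B (x1 - eps * h1 j) (x2 - eps * h2 j) + cub1 B (x1 - eps * h1 j) (x2 - eps * h2 j))) =
  quad1 B x1 x2 + eps ^ 2 * quadM1 B M11 M22 + cub1 B x1 x2 + eps ^ 2 * cubM1 B x1 x2 M11 M12 M22
    - eps ^ 3 * cubN1 B (mom3 n m h1 h1 h1) (mom3 n m h1 h2 h2).
Proof.
  set (A := - B * (B * B - 1) / 6). set (D := B * (B + 1) / 2).
  rewrite (moment_expand (fun u v => quad1 B u v + cub1 B u v)
    (quad1 B x1 x2 + cub1 B x1 x2)
    (- eps * (B * (B - 1) * x1 + 3 * A * x1 * x1 + D * x2 * x2))
    (- eps * (- B * x2 + 2 * D * x1 * x2))
    (eps ^ 2 * (B / 2 * (B - 1) + 3 * A * x1)) (eps ^ 2 * (2 * D * x2)) (eps ^ 2 * (- B / 2 + D * x1))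
    (- eps ^ 3 * A) 0 (- eps ^ 3 * D) 0).
  - unfold quadM1, cubM1, cubN1, A, D, M11, M12, M22. field.
  - intros u v. unfold quad1, cub1, A, D. field.
Qed.

Lemma sum_nl2 :
  rsum n (fun j => m j * (quad2 B (x1 - eps * h1 j) (x2 - eps * h2 j) + cub2 B (x1 - eps * h1 j) (x2 - eps * h2 j))) =
  quad2 B x1 x2 + eps ^ 2 * quadM2 B M12 + cub2 B x1 x2 + eps ^ 2 * cubM2 B x1 x2 M11 M12 M22
    - eps ^ 3 * cubN2 B (mom3 n m h1 h1 h2) (mom3 n m h2 h2 h2).
Proof.
  set (D := B * (B + 1) / 2).
  rewrite (moment_expand (fun u v => quad2 B u v + cub2 B u v)
    (quad2 B x1 x2 + cub2 B x1 x2)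
    (- eps * (- B * x2 + 2 * D * x1 * x2))
    (- eps * (- B * x1 + D * x1 * x1 - 3 * (B / 2) * x2 * x2))
    (eps ^ 2 * (D * x2)) (eps ^ 2 * (- B + 2 * D * x1)) (eps ^ 2 * (- 3 * (B / 2) * x2))
    0 (- eps ^ 3 * D) 0 (eps ^ 3 * (B / 2))).
  - unfold quadM2, cubM2, cubN2, D, M11, M12, M22. field.
  - intros u v. unfold quad2, cub2, D. field.
Qed.
End Moments.

(** * Bounds of the Taylor terms by powers of a single constant *)

Section Bounds.
Variables (G B : R).
Hypothesis HG : 1 <= G.
Hypothesis HB : Rabs B <= G.

Lemma coef_bounds : Rabs (B / 2 * (B - 1)) <= G ^ 2 /\ Rabs (B / 2) <= G / 2 /\
  Rabs (- B * (B * B - 1) / 6) <= G ^ 3 / 3 /\ Rabs (B * (B + 1) / 2) <= G ^ 2 /\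
  Rabs (- B * (B * B - 1) / 2) <= G ^ 3.
Proof.
  unfold Rdiv. repeat split.
  - eapply Rle_trans; [absb|]. rewrite !Rabs_right by lra. simpl; nra.
  - eapply Rle_trans; [absb|]. rewrite !Rabs_right by lra. lra.
  - eapply Rle_trans; [absb|]. rewrite !Rabs_right by lra.
    assert (G <= G * G * G) by nra. simpl; nra.
  - eapply Rle_trans; [absb|]. rewrite !Rabs_right by lra. simpl; nra.
  - eapply Rle_trans; [absb|]. rewrite !Rabs_right by lra.
    assert (G <= G * G * G) by nra. simpl; nra.
Qed.

Lemma quad_bound d1 d2 s : Rabs d1 <= s -> Rabs d2 <= s ->
  Rabs (quad1 B d1 d2) <= 2 * G ^ 2 * s ^ 2 /\ Rabs (quad2 B d1 d2) <= 2 * G ^ 2 * s ^ 2.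
Proof.
  intros H1 H2. destruct coef_bounds as [K1 [K2 _]].
  assert (S2 : 0 <= s ^ 2) by apply pow2_ge_0.
  assert (GG : G <= G ^ 2) by (simpl; nra).
  split.
  - replace (quad1 B d1 d2) with (B / 2 * (B - 1) * (d1 * d1) - B / 2 * (d2 * d2)) by (unfold quad1; ring).
    eapply Rle_trans; [absb|]. replace (s * s) with (s ^ 2) by ring. nra.
  - unfold quad2. eapply Rle_trans; [absb|]. replace (s * s) with (s ^ 2) by ring. nra.
Qed.

Lemma cub_bound d1 d2 s : 0 <= s -> Rabs d1 <= s -> Rabs d2 <= s ->
  Rabs (cub1 B d1 d2) <= 3 * G ^ 3 * s ^ 3 /\ Rabs (cub2 B d1 d2) <= 3 * G ^ 3 * s ^ 3.
Proof.
  intros Hs H1 H2. destruct coef_bounds as [_ [K2 [K3 [K4 _]]]].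
  assert (S3 : 0 <= s ^ 3) by (apply pow_le; auto).
  assert (GG : G <= G ^ 3) by (simpl; assert (G <= G * G) by nra; nra).
  assert (GG2 : G ^ 2 <= G ^ 3) by (simpl; nra).
  assert (Q1 : G * s ^ 3 <= G ^ 3 * s ^ 3) by (apply Rmult_le_compat_r; auto).
  assert (Q2 : G ^ 2 * s ^ 3 <= G ^ 3 * s ^ 3) by (apply Rmult_le_compat_r; auto).
  split.
  - unfold cub1. eapply Rle_trans; [absb|].
    replace (s * s * s) with (s ^ 3) by ring. replace (s * (s * s)) with (s ^ 3) by ring.
    assert (0 <= G ^ 3 * s ^ 3) by (apply Rmult_le_pos; [apply pow_le; lra|auto]). lra.
  - unfold cub2. eapply Rle_trans; [absb|].
    replace (s * s * s) with (s ^ 3) by ring.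
    assert (0 <= G ^ 3 * s ^ 3) by (apply Rmult_le_pos; [apply pow_le; lra|auto]). lra.
Qed.

Lemma cubM_bound x1 x2 M11 M12 M22 s : 0 <= s -> Rabs x1 <= s -> Rabs x2 <= s ->
  Rabs M11 <= G -> Rabs M12 <= G -> Rabs M22 <= G ->
  Rabs (cubM1 B x1 x2 M11 M12 M22) <= 5 * G ^ 4 * s /\ Rabs (cubM2 B x1 x2 M11 M12 M22) <= 5 * G ^ 4 * s.
Proof.
  intros Hs H1 H2 N1 N2 N3. destruct coef_bounds as [_ [K2 [_ [K4 K5]]]].
  assert (Gs : 0 <= G * s) by nra.
  assert (GG2 : G ^ 2 <= G ^ 3) by (simpl; nra). assert (GG1 : G <= G ^ 3) by (simpl in *; nra).
  assert (Q1 : G ^ 2 * (G * s) <= G ^ 3 * (G * s)) by (apply Rmult_le_compat_r; auto).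
  assert (Q2 : G * (G * s) <= G ^ 3 * (G * s)) by (apply Rmult_le_compat_r; auto).
  assert (Q3 : 0 <= G ^ 3 * (G * s)) by (apply Rmult_le_pos; [apply pow_le; lra|auto]).
  assert (E : 5 * G ^ 4 * s = 5 * (G ^ 3 * (G * s))) by ring. rewrite E.
  split.
  - unfold cubM1. eapply Rle_trans; [absb|]. rewrite (Rabs_right 2) by lra. lra.
  - unfold cubM2. eapply Rle_trans; [absb|]. rewrite (Rabs_right 2), (Rabs_right 3) by lra. lra.
Qed.

Lemma cubN_bound M1 M2 : Rabs M1 <= G -> Rabs M2 <= G ->
  Rabs (cubN1 B M1 M2) <= 2 * G ^ 4 /\ Rabs (cubN2 B M1 M2) <= 2 * G ^ 4.
Proof.
  intros N1 N2. destruct coef_bounds as [_ [K2 [K3 [K4 _]]]].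
  assert (GG2 : G ^ 2 <= G ^ 3) by (simpl; nra). assert (GG1 : G <= G ^ 3) by (simpl in *; nra).
  assert (Q1 : G ^ 2 * G <= G ^ 3 * G) by (apply Rmult_le_compat_r; lra).
  assert (Q2 : G * G <= G ^ 3 * G) by (apply Rmult_le_compat_r; lra).
  assert (Q3 : 0 <= G ^ 3 * G) by (apply Rmult_le_pos; [apply pow_le; lra|lra]).
  assert (E : 2 * G ^ 4 = 2 * (G ^ 3 * G)) by ring. rewrite E.
  split.
  - unfold cubN1. eapply Rle_trans; [absb|]. lra.
  - unfold cubN2. eapply Rle_trans; [absb|]. lra.
Qed.
End Bounds.

Lemma eta_bound theta b1 b2 j t Hb : Rabs (b1 j t) <= Hb -> Rabs (b2 j t) <= Hb ->
  Rabs (eta1 theta b1 b2 j t) <= 2 * Hb /\ Rabs (eta2 theta b1 b2 j t) <= 2 * Hb.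
Proof.
  intros H1 H2.
  assert (Hc : Rabs (cos (theta + t)) <= 1) by (apply Rabs_le; apply COS_bound).
  assert (Hs : Rabs (sin (theta + t)) <= 1) by (apply Rabs_le; apply SIN_bound).
  unfold eta1, eta2. split; (eapply Rle_trans; [absb|lra]).
Qed.

Lemma small_le_1 G eps : 1 <= G -> 0 < eps -> 24 * G * eps <= 1 -> eps <= 1.
Proof. intros; nra. Qed.

(** [X] is the order of the displacement, a mode of amplitude [A] plus a correction; [E] collects
    the orders left as error. The term to be computed exactly has order [A * eps^2], and the
    products listed here are those that may be discarded against it. *)
Lemma scale_bounds (A eps : R) : 0 < eps -> eps <= 1 -> 0 <= A <= eps ->
  let X := A + eps ^ 2 in let E := eps ^ 4 + A ^ 3 + A * eps ^ 3 in
  0 <= E /\ X ^ 3 <= 4 * E /\ A * X ^ 2 <= 2 * E /\ A * X ^ 3 <= 4 * E /\ A * (eps ^ 2 * X) <= 2 * E /\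
  eps ^ 4 <= E /\ A * eps ^ 3 <= E /\ A * eps ^ 4 <= E.
Proof.
  intros He He1 HA X E.
  assert (ep2 : 0 <= eps ^ 2) by apply pow2_ge_0.
  assert (ep21 : eps ^ 2 <= 1) by (simpl; nra).
  assert (ep4 : 0 <= eps ^ 4) by (apply pow_le; lra).
  assert (ep3 : 0 <= eps ^ 3) by (apply pow_le; lra).
  assert (A3 : 0 <= A ^ 3) by (apply pow_le; lra).
  assert (Ae3 : 0 <= A * eps ^ 3) by (apply Rmult_le_pos; lra).
  assert (X0 : 0 <= X) by (unfold X; lra).
  assert (K1 : A * eps ^ 4 <= A * eps ^ 3).
  { apply Rmult_le_compat_l; [lra|]. replace (eps ^ 4) with (eps * eps ^ 3) by ring. nra. }
  assert (K2 : A * A * eps ^ 2 <= A * eps ^ 3).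
  { replace (A * A * eps ^ 2) with (A * (A * eps ^ 2)) by ring. apply Rmult_le_compat_l; [lra|].
    replace (eps ^ 3) with (eps * eps ^ 2) by ring. apply Rmult_le_compat_r; lra. }
  assert (K4 : eps ^ 6 <= eps ^ 4).
  { replace (eps ^ 6) with (eps ^ 4 * eps ^ 2) by ring. nra. }
  assert (X3 : X ^ 3 <= 4 * (A ^ 3 + eps ^ 6)).
  { unfold X. replace (eps ^ 6) with ((eps ^ 2) ^ 3) by ring. set (v := eps ^ 2) in *.
    assert (H : 0 <= (A + v) * ((A - v) * (A - v))) by (apply Rmult_le_pos; [lra|apply Rle_0_sqr]).
    clear - H. simpl. nra. }
  assert (X2 : X ^ 2 <= 2 * (A ^ 2 + eps ^ 4)).
  { unfold X. replace (eps ^ 4) with ((eps ^ 2) ^ 2) by ring. set (v := eps ^ 2).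
    assert (H : 0 <= (A - v) * (A - v)) by apply Rle_0_sqr. clear - H. simpl; nra. }
  unfold E. split; [lra|]. split; [lra|]. split; [|split; [|split; [|split; [lra|split; lra]]]].
  - apply Rle_trans with (A * (2 * (A ^ 2 + eps ^ 4))); [apply Rmult_le_compat_l; lra|].
    replace (A * (2 * (A ^ 2 + eps ^ 4))) with (2 * (A ^ 3 + A * eps ^ 4)) by ring. lra.
  - apply Rle_trans with (1 * X ^ 3); [apply Rmult_le_compat_r; [apply pow_le; auto|lra]|]. lra.
  - unfold X. replace (A * (eps ^ 2 * (A + eps ^ 2))) with (A * A * eps ^ 2 + A * eps ^ 4) by ring. lra.
Qed.

(** * Projection of the force on a resonant mode *)

Section Resonant.
Variables (p q k n : nat) (m : nat -> R) (b1 b2 : nat -> R -> R) (theta eps : R).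
Hypothesis Hp : (1 <= p)%nat.
Hypothesis Hk : (1 <= k)%nat.
Hypothesis Hkp : k <> p.
Hypothesis Hk2 : (k < 2 * p)%nat.
Hypothesis Hq : (6 * p <= q)%nat.
Hypothesis Hn : (1 <= n)%nat.

Let T := 2 * PI * INR p.
Let sg := 2 * PI * INR p / INR q.
Let kap := INR k / INR p.
Let gam := 2 / kap.

Hypothesis Hm : forall j, (j < n)%nat -> 0 < m j.
Hypothesis Hm1 : rsum n m = 1.
Hypothesis Pb : forall j, (j < n)%nat -> pc sg (b1 j) /\ pc sg (b2 j).
Hypothesis Zb : forall t, mom1 n m (fun j => b1 j t) = 0 /\ mom1 n m (fun j => b2 j t) = 0.

Variables (C S : R -> R).
Hypothesis SC : spec p q (fun l => l = Z.of_nat k) C.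
Hypothesis SS : spec p q (fun l => l = Z.of_nat k) S.
Hypothesis SCC : spec p q (fun l => l = (2 * Z.of_nat k)%Z) (fun t => C t * C t - S t * S t).
Hypothesis SSC : spec p q (fun l => l = (2 * Z.of_nat k)%Z) (fun t => 2 * (S t * C t)).
Hypothesis dC : forall t : R, is_derive C t (- (kap * S t)).
Hypothesis dS : forall t : R, is_derive S t (kap * C t).
Hypothesis CS1 : forall t, C t * C t + S t * S t = 1.

Notation e1 j := (eta1 theta b1 b2 j).
Notation e2 j := (eta2 theta b1 b2 j).

Lemma Hq1 : (1 <= q)%nat. Proof. lia. Qed.

Lemma mom1_zero t : mom1 n m (fun j => e1 j t) = 0 /\ mom1 n m (fun j => e2 j t) = 0.
Proof.
  destruct (Zb t) as [Z1 Z2]. unfold mom1, eta1, eta2 in *. split.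
  - rewrite (rsum_ext n _ (fun j => cos (theta + t) * (m j * b1 j t) - sin (theta + t) * (m j * b2 j t))) by (intros; ring).
    rewrite rsum_minus, !rsum_scal, Z1, Z2. ring.
  - rewrite (rsum_ext n _ (fun j => cos (theta + t) * (m j * b2 j t) + sin (theta + t) * (m j * b1 j t))) by (intros; ring).
    rewrite rsum_plus, !rsum_scal, Z1, Z2. ring.
Qed.

Lemma spec_eta j : (j < n)%nat ->
  spec p q (fun l => l = Z.of_nat p) (e1 j) /\ spec p q (fun l => l = Z.of_nat p) (e2 j).
Proof.
  intro Hj. destruct (Pb j Hj) as [P1 P2]. unfold eta1, eta2. split.
  - apply (spec_rot p q Hp _ (fun t => cos theta * b1 j t - sin theta * b2 j t) (fun t => - sin theta * b1 j t - cos theta * b2 j t)).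
    + fold sg. pcs.
    + fold sg. pcs.
    + intro t. rewrite cos_plus, sin_plus. ring.
  - apply (spec_rot p q Hp _ (fun t => cos theta * b2 j t + sin theta * b1 j t) (fun t => - sin theta * b2 j t + cos theta * b1 j t)).
    + fold sg. pcs.
    + fold sg. pcs.
    + intro t. rewrite cos_plus, sin_plus. ring.
Qed.

Lemma cos_2p t : cos (IZR (2 * Z.of_nat p) / INR p * t) = cos t * cos t - sin t * sin t /\
  sin (IZR (2 * Z.of_nat p) / INR p * t) = 2 * (sin t * cos t).
Proof.
  assert (Zp := INR_gt0 p Hp). rewrite mult_IZR, <- INR_IZR_INZ.
  replace (2 * INR p / INR p * t) with (2 * t) by (field; lra).
  rewrite cos_2a, sin_2a. split; ring.
Qed.

(** These are the real part and half the imaginary part of the square of [eta1 + i eta2], which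
    turns at twice the frequency of the frame. The rotation-invariant trace, by contrast, has only
    the short period. *)
Lemma spec_eta2 j : (j < n)%nat ->
  spec p q (fun l => l = (2 * Z.of_nat p)%Z) (fun t => e1 j t * e1 j t - e2 j t * e2 j t) /\
  spec p q (fun l => l = (2 * Z.of_nat p)%Z) (fun t => e1 j t * e2 j t).
Proof.
  intro Hj. destruct (Pb j Hj) as [P1 P2].
  set (c2 := cos theta * cos theta - sin theta * sin theta). set (s2 := 2 * (sin theta * cos theta)).
  split; apply (spec_mono p q _ (2 * Z.of_nat p)%Z); auto.
  - exists (fun t => c2 * (b1 j t * b1 j t - b2 j t * b2 j t) - 2 * (s2 * (b1 j t * b2 j t))),
     (fun t => - s2 * (b1 j t * b1 j t - b2 j t * b2 j t) - 2 * (c2 * (b1 j t * b2 j t))).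
    fold sg. split; [pcs|split; [pcs|]]. intro t. destruct (cos_2p t) as [-> ->].
    unfold eta1, eta2, c2, s2. rewrite cos_plus, sin_plus. ring.
  - exists (fun t => c2 * (b1 j t * b2 j t) + / 2 * (s2 * (b1 j t * b1 j t - b2 j t * b2 j t))),
     (fun t => - s2 * (b1 j t * b2 j t) + / 2 * (c2 * (b1 j t * b1 j t - b2 j t * b2 j t))).
    fold sg. split; [pcs|split; [pcs|]]. intro t. destruct (cos_2p t) as [-> ->].
    unfold eta1, eta2, c2, s2. rewrite cos_plus, sin_plus. field.
Qed.

Let M11 t := mom2 n m (fun j => e1 j t) (fun j => e1 j t).
Let M12 t := mom2 n m (fun j => e1 j t) (fun j => e2 j t).
Let M22 t := mom2 n m (fun j => e2 j t) (fun j => e2 j t).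
Let M111 t := mom3 n m (fun j => e1 j t) (fun j => e1 j t) (fun j => e1 j t).
Let M112 t := mom3 n m (fun j => e1 j t) (fun j => e1 j t) (fun j => e2 j t).
Let M122 t := mom3 n m (fun j => e1 j t) (fun j => e2 j t) (fun j => e2 j t).
Let M222 t := mom3 n m (fun j => e2 j t) (fun j => e2 j t) (fun j => e2 j t).
Let mm t := / 2 * (M11 t - M22 t).
Let rr t := rsum n (fun j => m j * (b1 j t * b1 j t + b2 j t * b2 j t)).

Lemma M_sum t : M11 t + M22 t = rr t.
Proof.
  unfold M11, M22, rr, mom2. rewrite <- rsum_plus. apply rsum_ext. intros j _.
  unfold eta1, eta2. assert (Q := sin2_cos2 (theta + t)). unfold Rsqr in Q.
  transitivity (m j * ((sin (theta + t) * sin (theta + t) + cos (theta + t) * cos (theta + t)) * (b1 j t * b1 j t + b2 j t * b2 j t))); [ring|].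
  rewrite Q. ring.
Qed.

Definition lowset (l : Z) : Prop := l = (2 * Z.of_nat p)%Z \/ l = 0%Z.
Lemma spec_M2 : spec p q (fun l => l = (2 * Z.of_nat p)%Z) M12 /\ spec p q (fun l => l = (2 * Z.of_nat p)%Z) mm /\
  spec p q lowset M11 /\ spec p q lowset M22.
Proof.
  assert (Q : spec p q (fun l => l = (2 * Z.of_nat p)%Z) mm).
  { replace mm with (fun t => / 2 * rsum n (fun j => m j * (e1 j t * e1 j t - e2 j t * e2 j t))).
    - apply spec_scal.
      apply (spec_rsum p q _ n m (fun j t => e1 j t * e1 j t - e2 j t * e2 j t)); auto.
      intros; apply spec_eta2; auto.
    - apply functional_extensionality; intro t. unfold mm, M11, M22, mom2.
      rewrite <- rsum_minus. f_equal. apply rsum_ext; intros; ring. }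
  split; [|split; [exact Q|split]].
  - apply (spec_rsum p q _ n m (fun j t => e1 j t * e2 j t)); auto. intros; apply spec_eta2; auto.
  - apply (spec_rsum p q _ n m (fun j t => e1 j t * e1 j t)); auto. intros j Hj.
    eapply spec_imp; [|eapply (spec_mult p q Hp); apply spec_eta; auto].
    intros l [x [y [-> [-> H]]]]. unfold lowset. lia.
  - apply (spec_rsum p q _ n m (fun j t => e2 j t * e2 j t)); auto. intros j Hj.
    eapply spec_imp; [|eapply (spec_mult p q Hp); apply spec_eta; auto].
    intros l [x [y [-> [-> H]]]]. unfold lowset. lia.
Qed.

Lemma spec_3 (f g h : nat -> R -> R) :
  (forall j, (j < n)%nat -> spec p q (fun l => l = Z.of_nat p) (f j)) ->
  (forall j, (j < n)%nat -> spec p q (fun l => l = Z.of_nat p) (g j)) ->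
  (forall j, (j < n)%nat -> spec p q (fun l => l = Z.of_nat p) (h j)) ->
  spec p q (fun l => l = (3 * Z.of_nat p)%Z \/ l = Z.of_nat p \/ l = (- Z.of_nat p)%Z)
    (fun t => mom3 n m (fun j => f j t) (fun j => g j t) (fun j => h j t)).
Proof.
  intros F G H. apply (spec_rsum p q _ n m (fun j t => f j t * g j t * h j t)); auto. intros j Hj.
  eapply spec_imp; [|eapply (spec_mult p q Hp _ _ (fun t => f j t * g j t) (h j)); [eapply (spec_mult p q Hp); [apply F|apply G]; auto|apply H; auto]].
  intros l [x [y [[u [v [-> [-> Hx]]]] [-> Hl]]]]. lia.
Qed.

Variables (a bb : R).
Let k1 t := a * C t + bb * S t.
Let k2 t := gam * (a * S t - bb * C t).
Let PP t := a * (C t * C t - S t * S t) + bb * (2 * (S t * C t)).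
Let QQ t := a * (2 * (S t * C t)) - bb * (C t * C t - S t * S t).

Lemma spec_k : spec p q (fun l => l = Z.of_nat k) k1 /\ spec p q (fun l => l = Z.of_nat k) k2.
Proof.
  split.
  - apply (spec_plus p q _ (fun t => a * C t) (fun t => bb * S t)); apply spec_scal; auto.
  - apply (spec_scal p q _ gam (fun t => a * S t - bb * C t)).
    apply (spec_minus p q _ (fun t => a * S t) (fun t => bb * C t)); apply spec_scal; auto.
Qed.

Lemma spec_PQ : spec p q (fun l => l = (2 * Z.of_nat k)%Z) PP /\ spec p q (fun l => l = (2 * Z.of_nat k)%Z) QQ.
Proof.
  split.
  - apply (spec_plus p q _ (fun t => a * (C t * C t - S t * S t)) (fun t => bb * (2 * (S t * C t)))).
    + apply (spec_scal p q _ a (fun t => C t * C t - S t * S t)); auto.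
    + apply (spec_scal p q _ bb (fun t => 2 * (S t * C t))); auto.
  - apply (spec_minus p q _ (fun t => a * (2 * (S t * C t))) (fun t => bb * (C t * C t - S t * S t))).
    + apply (spec_scal p q _ a (fun t => 2 * (S t * C t))); auto.
    + apply (spec_scal p q _ bb (fun t => C t * C t - S t * S t)); auto.
Qed.

(** Products of two modes split into a constant and a part of doubled frequency [2 k / p], whose two
    components are [PP] and [QQ]. *)
Lemma k_prods t : k1 t * C t = / 2 * (a + PP t) /\ k2 t * (gam * S t) = gam * gam / 2 * (a - PP t) /\
  k2 t * C t + k1 t * S t * gam = gam * QQ t.
Proof.
  unfold k1, k2, PP, QQ.
  assert (E : S t * S t = 1 - C t * C t) by (specialize (CS1 t); lra).
  split; [|split].
  - transitivity (/ 2 * (a * (C t * C t + S t * S t) + (a * (C t * C t - S t * S t) + bb * (2 * (S t * C t))))); [field|rewrite CS1; field].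
  - transitivity (gam * gam / 2 * (a * (C t * C t + S t * S t) - (a * (C t * C t - S t * S t) + bb * (2 * (S t * C t))))); [field|rewrite CS1; field].
  - ring.
Qed.

(** The threshold [6 * p] exceeds all combinations that occur, namely [3 k], [3 p + k] and
    [2 p + 2 k], since [k < 2 * p]. *)
Lemma nz_bound (l : Z) : l <> 0%Z -> (Z.abs l < 6 * Z.of_nat p)%Z -> nz q l.
Proof. intros; split; [auto|lia]. Qed.

(* After averaging, every term of low degree of the force projected on the resonant mode vanishes,
because its frequencies are nonzero multiples of [1/p] below [q/p]. *)
Lemma null_kkk B : spec p q (nz q) (fun t => quad1 B (k1 t) (k2 t) * C t + quad2 B (k1 t) (k2 t) * (gam * S t)).
Proof.
  destruct spec_k as [K1 K2].
  replace (fun t => quad1 B (k1 t) (k2 t) * C t + quad2 B (k1 t) (k2 t) * (gam * S t)) with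
    (fun t => B / 2 * (B - 1) * ((k1 t * k1 t) * C t) + - (B / 2) * ((k2 t * k2 t) * C t) + (- B * gam) * ((k1 t * k2 t) * S t))
    by (apply functional_extensionality; intro; unfold quad1, quad2; ring).
  assert (Q : forall u v w, spec p q (fun l => l = Z.of_nat k) u -> spec p q (fun l => l = Z.of_nat k) v ->
     spec p q (fun l => l = Z.of_nat k) w -> spec p q (nz q) (fun t => (u t * v t) * w t)).
  { intros u v w U V W.
    eapply spec_imp; [|eapply (spec_mult p q Hp _ _ (fun t => u t * v t) w); [eapply (spec_mult p q Hp); eassumption|eassumption]].
    intros l [x [y [[x' [y' [-> [-> Hx]]]] [-> Hl]]]]. apply nz_bound; lia. }
  apply (spec_plus p q _ (fun t => B / 2 * (B - 1) * ((k1 t * k1 t) * C t) + - (B / 2) * ((k2 t * k2 t) * C t))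
     (fun t => (- B * gam) * ((k1 t * k2 t) * S t))).
  - apply (spec_plus p q _ (fun t => B / 2 * (B - 1) * ((k1 t * k1 t) * C t)) (fun t => - (B / 2) * ((k2 t * k2 t) * C t))).
    + apply (spec_scal p q _ _ (fun t => (k1 t * k1 t) * C t)); auto.
    + apply (spec_scal p q _ _ (fun t => (k2 t * k2 t) * C t)); auto.
  - apply (spec_scal p q _ _ (fun t => (k1 t * k2 t) * S t)); auto.
Qed.

(** The frequencies are those of the second moments, 0 and [2 p], shifted by [k] in either
    direction; none is zero because [0 < k < 2 * p]. *)
Lemma null_M B : spec p q (nz q) (fun t => quadM1 B (M11 t) (M22 t) * C t + quadM2 B (M12 t) * (gam * S t)).
Proof.
  destruct spec_M2 as [S12 [_ [S11 S22]]].
  assert (S12' : spec p q lowset M12) by (eapply spec_imp; [|exact S12]; intros l ->; left; auto).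
  replace (fun t => quadM1 B (M11 t) (M22 t) * C t + quadM2 B (M12 t) * (gam * S t)) with
    (fun t => B / 2 * (B - 1) * (M11 t * C t) + - (B / 2) * (M22 t * C t) + (- B * gam) * (M12 t * S t))
    by (apply functional_extensionality; intro; unfold quadM1, quadM2; ring).
  assert (Q : forall u w, spec p q lowset u ->
     spec p q (fun l => l = Z.of_nat k) w -> spec p q (nz q) (fun t => u t * w t)).
  { intros u w U W.
    eapply spec_imp; [|eapply (spec_mult p q Hp _ _ u w); eassumption].
    intros l [x [y [Hx [-> Hl]]]]. unfold lowset in Hx. apply nz_bound; lia. }
  apply (spec_plus p q _ (fun t => B / 2 * (B - 1) * (M11 t * C t) + - (B / 2) * (M22 t * C t))
     (fun t => (- B * gam) * (M12 t * S t))).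
  - apply (spec_plus p q _ (fun t => B / 2 * (B - 1) * (M11 t * C t)) (fun t => - (B / 2) * (M22 t * C t))).
    + apply (spec_scal p q _ _ (fun t => M11 t * C t)); auto.
    + apply (spec_scal p q _ _ (fun t => M22 t * C t)); auto.
  - apply (spec_scal p q _ _ (fun t => M12 t * S t)); auto.
Qed.

(** The third moments contain the frequency [p], so [p - k] occurs: here [k <> p], hence
    [alpha <> 2], is essential. *)
Lemma null_M3 B : spec p q (nz q) (fun t => cubN1 B (M111 t) (M122 t) * C t + cubN2 B (M112 t) (M222 t) * (gam * S t)).
Proof.
  set (c1 := - B * (B * B - 1) / 6). set (c2 := B * (B + 1) / 2).
  replace (fun t => cubN1 B (M111 t) (M122 t) * C t + cubN2 B (M112 t) (M222 t) * (gam * S t)) with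
    (fun t => (c1 * (M111 t * C t) + c2 * (M122 t * C t)) + (c2 * gam * (M112 t * S t) + (- (B / 2) * gam) * (M222 t * S t)))
    by (apply functional_extensionality; intro; unfold cubN1, cubN2, c1, c2; ring).
  assert (Q : forall (f g h : nat -> R -> R) w,
  (forall j, (j < n)%nat -> spec p q (fun l => l = Z.of_nat p) (f j)) ->
  (forall j, (j < n)%nat -> spec p q (fun l => l = Z.of_nat p) (g j)) ->
  (forall j, (j < n)%nat -> spec p q (fun l => l = Z.of_nat p) (h j)) ->
     spec p q (fun l => l = Z.of_nat k) w ->
     spec p q (nz q) (fun t => mom3 n m (fun j => f j t) (fun j => g j t) (fun j => h j t) * w t)).
  { intros f g h w F G H W.
    eapply spec_imp; [|eapply (spec_mult p q Hp _ _ (fun t => mom3 n m (fun j => f j t) (fun j => g j t) (fun j => h j t)) w); [apply spec_3; eassumption|eassumption]].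
    intros l [x [y [Hx [-> Hl]]]]. apply nz_bound; lia. }
  assert (E1 : forall j, (j < n)%nat -> spec p q (fun l => l = Z.of_nat p) (e1 j)) by (intros; apply spec_eta; auto).
  assert (E2 : forall j, (j < n)%nat -> spec p q (fun l => l = Z.of_nat p) (e2 j)) by (intros; apply spec_eta; auto).
  apply (spec_plus p q _ (fun t => c1 * (M111 t * C t) + c2 * (M122 t * C t)) (fun t => c2 * gam * (M112 t * S t) + (- (B / 2) * gam) * (M222 t * S t))).
  - apply (spec_plus p q _ (fun t => c1 * (M111 t * C t)) (fun t => c2 * (M122 t * C t))).
    + apply (spec_scal p q _ _ (fun t => M111 t * C t)). apply (Q (fun j => e1 j) (fun j => e1 j) (fun j => e1 j) C); auto.
    + apply (spec_scal p q _ _ (fun t => M122 t * C t)). apply (Q (fun j => e1 j) (fun j => e2 j) (fun j => e2 j) C); auto.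
  - apply (spec_plus p q _ (fun t => c2 * gam * (M112 t * S t)) (fun t => (- (B / 2) * gam) * (M222 t * S t))).
    + apply (spec_scal p q _ _ (fun t => M112 t * S t)). apply (Q (fun j => e1 j) (fun j => e1 j) (fun j => e2 j) S); auto.
    + apply (spec_scal p q _ _ (fun t => M222 t * S t)). apply (Q (fun j => e2 j) (fun j => e2 j) (fun j => e2 j) S); auto.
Qed.

Variable (B : R).
Hypothesis HBk : B = 4 - kap * kap.

(** Coefficients of the explicit solution of [L Y = V], where [V] has frequencies 0 and [2 kap]. The
    angular equation gives [cy1] in terms of [cy2]; the radial one then has the factor
    [4 - 4 kap^2 - B = - 3 kap^2], which is not zero, so the doubled frequency is not resonant. *)
Let cy2 := (B / 2 * (B - 1 + gam * gam) - (4 * (kap * kap) + B) * B / (2 * (kap * kap))) / (kap * (- 3 * (kap * kap))).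
Let cy1 := kap * cy2 - B / (2 * (kap * kap)).
Let cy0 := - (B - 1 - gam * gam) / 2.
Let Y1 t := cy0 * a + cy1 * PP t.
Let Y2 t := cy2 * QQ t.

Lemma kap_pos : 0 < kap.
Proof. unfold kap. apply Rdiv_lt_0_compat; apply lt_0_INR; lia. Qed.

(** The origin of the coefficient [B (B - 2) / 4]: it combines the direct effect of the cubic terms
    with the effect that passes through the correction, represented by [Y]. What remains oscillates
    at [2 k], [2 p] or [2 p] plus or minus [2 k], and the difference is nonzero because [k <> p]. *)
Lemma null_main : spec p q (nz q) (fun t =>
  - (cubM1 B (k1 t) (k2 t) (M11 t) (M12 t) (M22 t) * C t + cubM2 B (k1 t) (k2 t) (M11 t) (M12 t) (M22 t) * (gam * S t))
  + (Y1 t * quadM1 B (M11 t) (M22 t) + Y2 t * quadM2 B (M12 t)) - B * (B - 2) / 4 * a * rr t).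
Proof.
  destruct spec_M2 as [S12 [Sm _]]. destruct spec_PQ as [SP SQ].
  set (A3 := - B * (B * B - 1) / 2). set (Bc := B * (B + 1) / 2).
  assert (Srr : spec p q (fun l => l = 0%Z) rr).
  { apply spec_short. fold sg. apply (pc_rsum sg n (fun j t => m j * (b1 j t * b1 j t + b2 j t * b2 j t))).
    intros j Hj. destruct (Pb j Hj). pcs. }
  (* Coefficients read off after splitting [M11] and [M22] into half the trace [rr] plus or minus
     the oscillating part [mm]. *)
  pose (d0 := / 4 * (A3 + Bc)). pose (d1 := gam * gam / 4 * (Bc - 3 * (B / 2))).
  pose (f1 := - d0 + d1 + cy1 * (B / 4 * (B - 2))).
  pose (g0 := - / 2 * (A3 - Bc) - gam * gam / 2 * (Bc + 3 * (B / 2)) + cy0 * (B / 2 * B)).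
  pose (g1 := - / 2 * (A3 - Bc) + gam * gam / 2 * (Bc + 3 * (B / 2)) + cy1 * (B / 2 * B)).
  pose (g2 := - 2 * Bc * gam - B * cy2).
  match goal with |- spec _ _ _ ?f => replace f with
    (fun t => (f1 * (rr t * PP t) + g0 * a * mm t) + (g1 * (mm t * PP t) + g2 * (M12 t * QQ t))) end.
  - assert (Q1 : forall u w, spec p q (fun l => l = 0%Z) u -> spec p q (fun l => l = (2 * Z.of_nat k)%Z) w -> spec p q (nz q) (fun t => u t * w t)).
    { intros u w U W. eapply spec_imp; [|eapply (spec_mult p q Hp _ _ u w); eassumption].
      intros l [x [y [-> [-> Hl]]]]. apply nz_bound; lia. }
    assert (Q2 : forall u w, spec p q (fun l => l = (2 * Z.of_nat p)%Z) u -> spec p q (fun l => l = (2 * Z.of_nat k)%Z) w -> spec p q (nz q) (fun t => u t * w t)).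
    { intros u w U W. eapply spec_imp; [|eapply (spec_mult p q Hp _ _ u w); eassumption].
      intros l [x [y [-> [-> Hl]]]]. apply nz_bound; lia. }
    apply (spec_plus p q _ (fun t => f1 * (rr t * PP t) + g0 * a * mm t) (fun t => g1 * (mm t * PP t) + g2 * (M12 t * QQ t))).
    + apply (spec_plus p q _ (fun t => f1 * (rr t * PP t)) (fun t => g0 * a * mm t)).
      * apply (spec_scal p q _ _ (fun t => rr t * PP t)); auto.
      * apply (spec_scal p q _ (g0 * a) mm). eapply spec_imp; [|exact Sm]. intros l ->. apply nz_bound; lia.
    + apply (spec_plus p q _ (fun t => g1 * (mm t * PP t)) (fun t => g2 * (M12 t * QQ t))).
      * apply (spec_scal p q _ _ (fun t => mm t * PP t)); auto.
      * apply (spec_scal p q _ _ (fun t => M12 t * QQ t)); auto.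
  - apply functional_extensionality; intro t.
    destruct (k_prods t) as [E1 [E2 E3]].
    assert (H11 : M11 t = / 2 * rr t + mm t) by (rewrite <- M_sum; unfold mm; field).
    assert (H22 : M22 t = / 2 * rr t - mm t) by (rewrite <- M_sum; unfold mm; field).
    unfold cubM1, cubM2. fold A3 Bc.
    transitivity (- ((A3 * M11 t + Bc * M22 t) * (k1 t * C t) + (Bc * M11 t - 3 * (B / 2) * M22 t) * (k2 t * (gam * S t))
      + 2 * Bc * M12 t * (k2 t * C t + k1 t * S t * gam))
      + (Y1 t * quadM1 B (M11 t) (M22 t) + Y2 t * quadM2 B (M12 t)) - B * (B - 2) / 4 * a * rr t); [|ring].
    rewrite E1, E2, E3, H11, H22. unfold Y1, Y2, quadM1, quadM2, f1, g0, g1, g2, d0, d1, cy0, A3, Bc.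
    field.
Qed.

Variables (w1 w2 D1 D2 : R -> R) (l0 l1 l2 G A Hb : R).
Let x1 t := k1 t + w1 t.
Let x2 t := k2 t + w2 t.
Let N1 := NN1 (B / 2) eps theta n m b1 b2 x1 x2.
Let N2 := NN2 (B / 2) eps theta n m b1 b2 x1 x2.
Hypothesis Pw1 : pc T w1.
Hypothesis Pw2 : pc T w2.
Hypothesis PD1 : pc T D1.
Hypothesis PD2 : pc T D2.
Hypothesis PN1 : pc T N1.
Hypothesis PN2 : pc T N2.
Hypothesis dw1 : forall t : R, is_derive w1 t (D1 t).
Hypothesis dw2 : forall t : R, is_derive w2 t (D2 t).
Hypothesis dD1 : forall t : R, is_derive D1 t (N1 t - l1 * C t - l2 * S t - 2 * D2 t + B * w1 t).
Hypothesis dD2 : forall t : R, is_derive D2 t (N2 t - l0 - l1 * (gam * S t) + l2 * (gam * C t) + 2 * D1 t).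

(** [w1 * V1 + w2 * V2] is the cross term of the quadratic force at [k + w], taken against the mode
    [(C, gam * S)]. *)
Let V1 t := B * (B - 1) * (k1 t * C t) - B * (k2 t * (gam * S t)).
Let V2 t := - B * (k2 t * C t + k1 t * S t * gam).

Lemma PT_all : pc T C /\ pc T S /\ pc T PP /\ pc T QQ /\ pc T k1 /\ pc T k2 /\ pc T Y1 /\ pc T Y2.
Proof.
  assert (H1 := spec_pc p q Hp Hq1 _ _ SC). assert (H2 := spec_pc p q Hp Hq1 _ _ SS).
  fold T in H1, H2.
  assert (H3 : pc T PP) by (unfold PP; pcs). assert (H4 : pc T QQ) by (unfold QQ; pcs).
  split; [auto|]. split; [auto|]. split; [auto|]. split; [auto|].
  split; [unfold k1; pcs|]. split; [unfold k2; pcs|]. split; [unfold Y1; pcs|unfold Y2; pcs].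
Qed.

Lemma PP_derive (t : R) : is_derive PP t (- (2 * kap * QQ t)).
Proof.
  unfold PP, QQ. evar_last.
  - apply (is_derive_plus (V:=R_NormedModule)).
    + apply (is_derive_scal (fun t => C t * C t - S t * S t) t a).
      apply (is_derive_minus (V:=R_NormedModule)).
      * apply (is_derive_mult C C t _ _ (dC t) (dC t)). intros; apply Rmult_comm.
      * apply (is_derive_mult S S t _ _ (dS t) (dS t)). intros; apply Rmult_comm.
    + apply (is_derive_scal (fun t => 2 * (S t * C t)) t bb). apply (is_derive_scal (fun t => S t * C t) t 2).
      apply (is_derive_mult S C t _ _ (dS t) (dC t)). intros; apply Rmult_comm.
  - unfold minus, plus, opp, mult; simpl; unfold mult; simpl. ring.
Qed.

Lemma QQ_derive (t : R) : is_derive QQ t (2 * kap * PP t).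
Proof.
  unfold PP, QQ. evar_last.
  - apply (is_derive_minus (V:=R_NormedModule)).
    + apply (is_derive_scal (fun t => 2 * (S t * C t)) t a). apply (is_derive_scal (fun t => S t * C t) t 2).
      apply (is_derive_mult S C t _ _ (dS t) (dC t)). intros; apply Rmult_comm.
    + apply (is_derive_scal (fun t => C t * C t - S t * S t) t bb).
      apply (is_derive_minus (V:=R_NormedModule)).
      * apply (is_derive_mult C C t _ _ (dC t) (dC t)). intros; apply Rmult_comm.
      * apply (is_derive_mult S S t _ _ (dS t) (dS t)). intros; apply Rmult_comm.
  - unfold minus, plus, opp, mult; simpl; unfold mult; simpl. ring.
Qed.

(** [Y] has only the frequencies 0 and [2 k], hence is orthogonal to the modes of frequency [k], and
    its angular component has zero mean. The unknown multipliers in the equation of [w] thus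
    disappear when it is tested against [Y]. *)
Lemma null_modes : spec p q (nz q) (fun t => l1 * (Y1 t * C t + Y2 t * (gam * S t)) + l2 * (Y1 t * S t - Y2 t * (gam * C t)) + l0 * Y2 t).
Proof.
  destruct spec_PQ as [SP SQ].
  assert (Q : forall u w, spec p q (fun l => l = (2 * Z.of_nat k)%Z) u -> spec p q (fun l => l = Z.of_nat k) w -> spec p q (nz q) (fun t => u t * w t)).
  { intros u w U W. eapply spec_imp; [|eapply (spec_mult p q Hp _ _ u w); eassumption].
    intros l [x [y [-> [-> Hl]]]]. apply nz_bound; lia. }
  assert (Q1 : forall w, spec p q (fun l => l = Z.of_nat k) w -> spec p q (nz q) w).
  { intros w W. eapply spec_imp; [|exact W]. intros l ->. apply nz_bound; lia. }
  assert (Q2 : spec p q (nz q) QQ).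
  { eapply spec_imp; [|exact SQ]. intros l ->. apply nz_bound; lia. }
  match goal with |- spec _ _ _ ?f => replace f with
    (fun t => ((l1 * (cy0 * a) * C t + l2 * (cy0 * a) * S t) + (l1 * cy1 * (PP t * C t) + l2 * cy1 * (PP t * S t)))
       + ((l1 * cy2 * gam * (QQ t * S t) + (- l2 * cy2 * gam) * (QQ t * C t)) + l0 * cy2 * QQ t)) end.
  2:{ apply functional_extensionality; intro t. unfold Y1, Y2. ring. }
  apply (spec_plus p q _ (fun t => (l1 * (cy0 * a) * C t + l2 * (cy0 * a) * S t) + (l1 * cy1 * (PP t * C t) + l2 * cy1 * (PP t * S t)))
    (fun t => (l1 * cy2 * gam * (QQ t * S t) + (- l2 * cy2 * gam) * (QQ t * C t)) + l0 * cy2 * QQ t)).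
  - apply (spec_plus p q _ (fun t => l1 * (cy0 * a) * C t + l2 * (cy0 * a) * S t) (fun t => l1 * cy1 * (PP t * C t) + l2 * cy1 * (PP t * S t))).
    + apply (spec_plus p q _ (fun t => l1 * (cy0 * a) * C t) (fun t => l2 * (cy0 * a) * S t)); apply spec_scal; auto.
    + apply (spec_plus p q _ (fun t => l1 * cy1 * (PP t * C t)) (fun t => l2 * cy1 * (PP t * S t))).
      * apply (spec_scal p q _ _ (fun t => PP t * C t)); auto.
      * apply (spec_scal p q _ _ (fun t => PP t * S t)); auto.
  - apply (spec_plus p q _ (fun t => l1 * cy2 * gam * (QQ t * S t) + (- l2 * cy2 * gam) * (QQ t * C t)) (fun t => l0 * cy2 * QQ t)).
    + apply (spec_plus p q _ (fun t => l1 * cy2 * gam * (QQ t * S t)) (fun t => (- l2 * cy2 * gam) * (QQ t * C t))).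
      * apply (spec_scal p q _ _ (fun t => QQ t * S t)); auto.
      * apply (spec_scal p q _ _ (fun t => QQ t * C t)); auto.
    + apply spec_scal; auto.
Qed.

(* [Y] solves [L Y = V] for the self-adjoint operator [L], and [L w] is the force up to kernel modes. *)
Lemma test_Y : Int0 T (fun t => w1 t * V1 t + w2 t * V2 t) = Int0 T (fun t => Y1 t * N1 t + Y2 t * N2 t).
Proof.
  destruct PT_all as [PC [PS [PPP [PQQ [Pk1 [Pk2 [PY1 PY2]]]]]]].
  assert (PV1 : pc T V1) by (unfold V1; pcs). assert (PV2 : pc T V2) by (unfold V2; pcs).
  assert (KP := kap_pos).
  assert (Z := spec_zero p q Hp Hq1 _ null_modes). fold T in Z.
  assert (dY1 : forall t : R, is_derive Y1 t (- (2 * kap * cy1 * QQ t))).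
  { intro t. unfold Y1. evar_last.
    - apply (is_derive_plus (V:=R_NormedModule)); [apply (is_derive_const (K:=R_AbsRing) (V:=R_NormedModule))|].
      apply (is_derive_scal PP t cy1). apply PP_derive.
    - unfold plus, zero; simpl. ring. }
  assert (dY2 : forall t : R, is_derive Y2 t (2 * kap * cy2 * PP t)).
  { intro t. unfold Y2. evar_last.
    - apply (is_derive_scal QQ t cy2). apply QQ_derive.
    - ring. }
  assert (LY1 : forall t, - (4 * (kap * kap) * cy1 * PP t) + 2 * (2 * kap * cy2 * PP t) - B * Y1 t = V1 t).
  { intro t. destruct (k_prods t) as [E1 [E2 _]]. unfold V1, Y1. rewrite E1, E2.
    unfold cy1, cy0, cy2. replace gam with (2 / kap) by reflexivity. rewrite HBk. field. lra. }
  assert (LY2 : forall t, - (4 * (kap * kap) * cy2 * QQ t) + 4 * kap * cy1 * QQ t = V2 t).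
  { intro t. destruct (k_prods t) as [_ [_ E3]]. unfold V2. rewrite E3.
    unfold cy1. replace gam with (2 / kap) by reflexivity. field. lra. }
  assert (E : Int0 T (fun t => (Y1 t * N1 t + Y2 t * N2 t) - (l1 * (Y1 t * C t + Y2 t * (gam * S t)) + l2 * (Y1 t * S t - Y2 t * (gam * C t)) + l0 * Y2 t)
      - (w1 t * V1 t + w2 t * V2 t)) = 0).
  (* Lagrange's identity for [L]; the last bracket of the primitive accounts for the Coriolis
     terms. *)
  { apply (Int0_derive0 T (fun t => Y1 t * D1 t - (- (2 * kap * cy1 * QQ t)) * w1 t + (Y2 t * D2 t - 2 * kap * cy2 * PP t * w2 t)
      + (2 * (Y1 t * w2 t) - 2 * (Y2 t * w1 t)))); [cts| |].
    - intro t. evar_last.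
      + apply (is_derive_plus (V:=R_NormedModule)); [apply (is_derive_plus (V:=R_NormedModule))|].
        * apply (is_derive_minus (V:=R_NormedModule)).
          -- apply (is_derive_mult Y1 D1 t _ _ (dY1 t) (dD1 t)). intros; apply Rmult_comm.
          -- apply (is_derive_mult (fun t => - (2 * kap * cy1 * QQ t)) w1 t (- (2 * kap * cy1 * (2 * kap * PP t))) (D1 t)); [|apply dw1|intros; apply Rmult_comm].
             apply (is_derive_opp (V:=R_NormedModule)). apply (is_derive_scal QQ t (2 * kap * cy1)). apply QQ_derive.
        * apply (is_derive_minus (V:=R_NormedModule)).
          -- apply (is_derive_mult Y2 D2 t _ _ (dY2 t) (dD2 t)). intros; apply Rmult_comm.
          -- apply (is_derive_mult (fun t => 2 * kap * cy2 * PP t) w2 t (2 * kap * cy2 * (- (2 * kap * QQ t))) (D2 t)); [|apply dw2|intros; apply Rmult_comm].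
             apply (is_derive_scal PP t (2 * kap * cy2)). apply PP_derive.
        * apply (is_derive_minus (V:=R_NormedModule)).
          -- apply (is_derive_scal (fun t => Y1 t * w2 t) t 2). apply (is_derive_mult Y1 w2 t _ _ (dY1 t) (dw2 t)). intros; apply Rmult_comm.
          -- apply (is_derive_scal (fun t => Y2 t * w1 t) t 2). apply (is_derive_mult Y2 w1 t _ _ (dY2 t) (dw1 t)). intros; apply Rmult_comm.
      + rewrite <- LY1, <- LY2. unfold minus, plus, opp, mult; simpl; unfold mult; simpl. ring.
    - assert (PF : pc T (fun t => Y1 t * D1 t - (- (2 * kap * cy1 * QQ t)) * w1 t + (Y2 t * D2 t - 2 * kap * cy2 * PP t * w2 t)
      + (2 * (Y1 t * w2 t) - 2 * (Y2 t * w1 t)))) by pcs. exact (proj2 PF). }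
  rewrite Int0_minus, Int0_minus, Z in E by cts. lra.
Qed.

Hypothesis HG : 1 <= G.
Hypothesis HBG : Rabs B <= G.
Hypothesis HgG : 2 + 2 * gam <= G.
Hypothesis Bb : forall j t, (j < n)%nat -> Rabs (b1 j t) <= Hb /\ Rabs (b2 j t) <= Hb.
Hypothesis HbG : 2 * Hb <= G /\ (2 * Hb) * (2 * Hb) <= G /\ (2 * Hb) * (2 * Hb) * (2 * Hb) <= G.
Hypothesis HyG : Rabs cy0 + 4 * Rabs cy1 <= G /\ 4 * Rabs cy2 <= G.
Hypothesis HTay : forall d1 d2 s,
  Rabs d1 <= s -> Rabs d2 <= s -> s <= 1 / 8 ->
  Rabs (nl1 (B / 2) d1 d2 - quad1 B d1 d2 - cub1 B d1 d2) <= G * s ^ 4 /\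
  Rabs (nl2 (B / 2) d1 d2 - quad2 B d1 d2 - cub2 B d1 d2) <= G * s ^ 4.
Hypothesis Heps : 0 < eps.
Hypothesis HGe : 24 * G * eps <= 1.
Hypothesis HA : 0 <= A <= eps.
Hypothesis Ha : Rabs a <= A.
Hypothesis Hbb : Rabs bb <= A.
Hypothesis Bw : forall t, Rabs (w1 t) <= G * eps ^ 2 /\ Rabs (w2 t) <= G * eps ^ 2.

Let Er1 t := rsum n (fun j => m j * (nl1 (B / 2) (x1 t - eps * e1 j t) (x2 t - eps * e2 j t)
   - quad1 B (x1 t - eps * e1 j t) (x2 t - eps * e2 j t) - cub1 B (x1 t - eps * e1 j t) (x2 t - eps * e2 j t))).
Let Er2 t := rsum n (fun j => m j * (nl2 (B / 2) (x1 t - eps * e1 j t) (x2 t - eps * e2 j t)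
   - quad2 B (x1 t - eps * e1 j t) (x2 t - eps * e2 j t) - cub2 B (x1 t - eps * e1 j t) (x2 t - eps * e2 j t))).

Lemma N_expand t :
  N1 t = - (quad1 B (x1 t) (x2 t) + eps ^ 2 * quadM1 B (M11 t) (M22 t) + cub1 B (x1 t) (x2 t)
     + eps ^ 2 * cubM1 B (x1 t) (x2 t) (M11 t) (M12 t) (M22 t) - eps ^ 3 * cubN1 B (M111 t) (M122 t) + Er1 t) /\
  N2 t = - (quad2 B (x1 t) (x2 t) + eps ^ 2 * quadM2 B (M12 t) + cub2 B (x1 t) (x2 t)
     + eps ^ 2 * cubM2 B (x1 t) (x2 t) (M11 t) (M12 t) (M22 t) - eps ^ 3 * cubN2 B (M112 t) (M222 t) + Er2 t).
Proof.
  destruct (mom1_zero t) as [Z1 Z2]. split.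
  - unfold N1, NN1, Er1.
    assert (E := sum_nl1 n m (fun j => e1 j t) (fun j => e2 j t) eps B (x1 t) (x2 t) Hm1 Z1 Z2).
    cbv beta in E. unfold M11, M22, M12, M111, M122.
    f_equal. rewrite <- E, <- rsum_plus. apply rsum_ext. intros; ring.
  - unfold N2, NN2, Er2.
    assert (E := sum_nl2 n m (fun j => e1 j t) (fun j => e2 j t) eps B (x1 t) (x2 t) Hm1 Z1 Z2).
    cbv beta in E. unfold M11, M22, M12, M112, M222.
    f_equal. rewrite <- E, <- rsum_plus. apply rsum_ext. intros; ring.
Qed.

Lemma gam_pos : 0 < gam.
Proof. unfold gam. apply Rdiv_lt_0_compat; [lra|apply kap_pos]. Qed.

Lemma basic_bounds t :
  Rabs (C t) <= 1 /\ Rabs (S t) <= 1 /\ Rabs (k1 t) <= G * A /\ Rabs (k2 t) <= G * A /\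
  Rabs (Y1 t) <= G * A /\ Rabs (Y2 t) <= G * A /\
  Rabs (x1 t) <= G * (A + eps ^ 2) /\ Rabs (x2 t) <= G * (A + eps ^ 2).
Proof.
  assert (GP := gam_pos). assert (E := CS1 t).
  assert (HC : Rabs (C t) <= 1) by (apply Rabs_le; split; nra).
  assert (HS : Rabs (S t) <= 1) by (apply Rabs_le; split; nra).
  assert (B1 : Rabs (k1 t) <= G * A).
  { unfold k1. eapply Rle_trans; [absb|]. nra. }
  assert (B2 : Rabs (k2 t) <= G * A).
  { unfold k2. eapply Rle_trans; [absb|]. rewrite Rabs_right by lra. nra. }
  assert (BP : Rabs (PP t) <= 4 * A).
  { unfold PP. eapply Rle_trans; [absb|]. rewrite Rabs_right by lra. lra. }
  assert (BQ : Rabs (QQ t) <= 4 * A).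
  { unfold QQ. eapply Rle_trans; [absb|]. rewrite Rabs_right by lra. lra. }
  destruct HyG as [Hy1 Hy2]. destruct (Bw t) as [W1 W2].
  split; [auto|split; [auto|split; [auto|split; [auto|]]]].
  split; [|split; [|split]].
  - unfold Y1. apply Rle_trans with (Rabs cy0 * A + Rabs cy1 * (4 * A)).
    + apply ab_plus; apply ab_mult; auto; apply ab_const.
    + replace (Rabs cy0 * A + Rabs cy1 * (4 * A)) with ((Rabs cy0 + 4 * Rabs cy1) * A) by ring.
      apply Rmult_le_compat_r; lra.
  - unfold Y2. apply Rle_trans with (Rabs cy2 * (4 * A)).
    + apply ab_mult; auto; apply ab_const.
    + replace (Rabs cy2 * (4 * A)) with ((4 * Rabs cy2) * A) by ring.
      apply Rmult_le_compat_r; lra.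
  - unfold x1. eapply Rle_trans; [apply ab_plus; eassumption|]. lra.
  - unfold x2. eapply Rle_trans; [apply ab_plus; eassumption|]. lra.
Qed.

Lemma moment_bounds t : Rabs (M11 t) <= G /\ Rabs (M12 t) <= G /\ Rabs (M22 t) <= G /\
  Rabs (M111 t) <= G /\ Rabs (M112 t) <= G /\ Rabs (M122 t) <= G /\ Rabs (M222 t) <= G.
Proof.
  destruct HbG as [G1 [G2 G3]].
  assert (E : forall j, (j < n)%nat -> Rabs (e1 j t) <= 2 * Hb /\ Rabs (e2 j t) <= 2 * Hb).
  { intros j Hj. destruct (Bb j t Hj). apply eta_bound; auto. }
  unfold M11, M12, M22, M111, M112, M122, M222, mom2, mom3.
  repeat split; apply rsum_avg; auto; intros j Hj; destruct (E j Hj) as [E1 E2];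
    (eapply Rle_trans; [absb|]); auto.
Qed.

Lemma Er_bounds t : Rabs (Er1 t) <= 81 * G ^ 5 * eps ^ 4 /\ Rabs (Er2 t) <= 81 * G ^ 5 * eps ^ 4.
Proof.
  destruct HbG as [G1 _].
  destruct (basic_bounds t) as [_ [_ [_ [_ [_ [_ [X1 X2]]]]]]].
  assert (He1 := small_le_1 G eps HG Heps HGe).
  assert (XX : G * (A + eps ^ 2) <= 2 * (G * eps)).
  { assert (eps ^ 2 <= eps) by (simpl; nra). nra. }
  assert (E : forall j, (j < n)%nat -> Rabs (x1 t - eps * e1 j t) <= 3 * (G * eps) /\ Rabs (x2 t - eps * e2 j t) <= 3 * (G * eps)).
  { intros j Hj. destruct (Bb j t Hj) as [Q1 Q2]. destruct (eta_bound theta b1 b2 j t Hb Q1 Q2) as [E1 E2].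
    split; (eapply Rle_trans; [absb|]); rewrite Rabs_right by lra; nra. }
  replace (81 * G ^ 5 * eps ^ 4) with (G * (3 * (G * eps)) ^ 4) by ring.
  unfold Er1, Er2. split; apply rsum_avg; auto; intros j Hj; destruct (E j Hj) as [E1 E2];
    apply (HTay _ _ _ E1 E2); lra.
Qed.

Let E0 := eps ^ 4 + A ^ 3 + A * eps ^ 3.

(** The multiplier is linear in [a] to leading order, with the moment of inertia as slope. By
    [test_Y] the cross term in the unknown [w] may be replaced inside the integral ([Zf]); the
    low-order part [nl] has zero mean, and the rest is bounded pointwise. *)
Lemma proj_estimate : Rabs (Int0 T (fun t => N1 t * C t + N2 t * (gam * S t)) - eps ^ 2 * a * (B * (B - 2) / 4) * Int0 T rr)
  <= T * (420 * G ^ 7 * E0).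
Proof.
  destruct PT_all as [PC [PS [PPP [PQQ [Pk1 [Pk2 [PY1 PY2]]]]]]].
  assert (PV1 : pc T V1) by (unfold V1; pcs). assert (PV2 : pc T V2) by (unfold V2; pcs).
  assert (Prr : pc T rr).
  { apply (short_long p q Hq1). apply (pc_rsum sg n (fun j t => m j * (b1 j t * b1 j t + b2 j t * b2 j t))).
    intros j Hj. destruct (Pb j Hj). pcs. }
  assert (T0 : 0 < T).
  { unfold T. assert (HPI := PI_RGT_0). assert (HP := INR_gt0 p Hp). apply Rmult_lt_0_compat; lra. }
  assert (n1 := null_kkk B). assert (n2 := null_M B). assert (n3 := null_M3 B). assert (n4 := null_main).
  assert (Z1 := spec_zero p q Hp Hq1 _ n1). assert (Z2 := spec_zero p q Hp Hq1 _ n2).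
  assert (Z3 := spec_zero p q Hp Hq1 _ n3). assert (Z4 := spec_zero p q Hp Hq1 _ n4).
  apply (spec_pc p q Hp Hq1) in n1, n2, n3, n4. fold T in n1, n2, n3, n4, Z1, Z2, Z3, Z4.
  set (f1 := fun t => quad1 B (k1 t) (k2 t) * C t + quad2 B (k1 t) (k2 t) * (gam * S t)) in *.
  set (f2 := fun t => quadM1 B (M11 t) (M22 t) * C t + quadM2 B (M12 t) * (gam * S t)) in *.
  set (f3 := fun t => cubN1 B (M111 t) (M122 t) * C t + cubN2 B (M112 t) (M222 t) * (gam * S t)) in *.
  match type of n4 with pc _ ?f => set (f4 := f) in * end.
  pose (Zf := fun t => (N1 t * C t + N2 t * (gam * S t)) + (w1 t * V1 t + w2 t * V2 t) - (Y1 t * N1 t + Y2 t * N2 t)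
     - eps ^ 2 * a * (B * (B - 2) / 4) * rr t).
  pose (nl := fun t => - f1 t - eps ^ 2 * f2 t + eps ^ 3 * f3 t + eps ^ 2 * f4 t).
  assert (E1 : Int0 T (fun t => N1 t * C t + N2 t * (gam * S t)) - eps ^ 2 * a * (B * (B - 2) / 4) * Int0 T rr = Int0 T (fun t => Zf t - nl t)).
  { assert (TY := test_Y).
    unfold Zf, nl. rewrite !Int0_minus, !Int0_plus, !Int0_minus, Int0_opp, !Int0_scal, Z1, Z2, Z3, Z4 by cts.
    rewrite (Int0_plus T (fun t => w1 t * V1 t)) in TY by cts.
    rewrite (Int0_plus T (fun t => Y1 t * N1 t)) in TY by cts. lra. }
  rewrite E1. apply Int0_bound; [lra|unfold Zf, nl; cts|]. intro t.
  set (R1 := quad1 B (x1 t) (x2 t) + cub1 B (x1 t) (x2 t)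
     + eps ^ 2 * cubM1 B (x1 t) (x2 t) (M11 t) (M12 t) (M22 t) - eps ^ 3 * cubN1 B (M111 t) (M122 t) + Er1 t).
  set (R2 := quad2 B (x1 t) (x2 t) + cub2 B (x1 t) (x2 t)
     + eps ^ 2 * cubM2 B (x1 t) (x2 t) (M11 t) (M12 t) (M22 t) - eps ^ 3 * cubN2 B (M112 t) (M222 t) + Er2 t).
  (* The terms bilinear in the mode and in [w] cancel against [w1 * V1 + w2 * V2], so [w] survives
     only quadratically or with further small factors. *)
  assert (E2 : Zf t - nl t =
    - (quad1 B (w1 t) (w2 t) * C t + quad2 B (w1 t) (w2 t) * (gam * S t))
    - (cub1 B (x1 t) (x2 t) * C t + cub2 B (x1 t) (x2 t) * (gam * S t))
    - eps ^ 2 * (cubM1 B (w1 t) (w2 t) (M11 t) (M12 t) (M22 t) * C t + cubM2 B (w1 t) (w2 t) (M11 t) (M12 t) (M22 t) * (gam * S t))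
    - (Er1 t * C t + Er2 t * (gam * S t)) + (Y1 t * R1 + Y2 t * R2)).
  { destruct (N_expand t) as [EN1 EN2]. unfold Zf, nl, f1, f2, f3, f4, R1, R2, V1, V2. rewrite EN1, EN2.
    assert (Q1 : quad1 B (x1 t) (x2 t) = quad1 B (k1 t) (k2 t) + quad1 B (w1 t) (w2 t) + B * ((B - 1) * (k1 t * w1 t) - k2 t * w2 t))
      by (unfold quad1, x1, x2; field).
    assert (Q2 : quad2 B (x1 t) (x2 t) = quad2 B (k1 t) (k2 t) + quad2 B (w1 t) (w2 t) - B * (k1 t * w2 t + k2 t * w1 t))
      by (unfold quad2, x1, x2; field).
    assert (Q3 : cubM1 B (x1 t) (x2 t) (M11 t) (M12 t) (M22 t) = cubM1 B (k1 t) (k2 t) (M11 t) (M12 t) (M22 t) + cubM1 B (w1 t) (w2 t) (M11 t) (M12 t) (M22 t))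
      by (unfold cubM1, x1, x2; ring).
    assert (Q4 : cubM2 B (x1 t) (x2 t) (M11 t) (M12 t) (M22 t) = cubM2 B (k1 t) (k2 t) (M11 t) (M12 t) (M22 t) + cubM2 B (w1 t) (w2 t) (M11 t) (M12 t) (M22 t))
      by (unfold cubM2, x1, x2; ring).
    rewrite Q1, Q2, Q3, Q4. ring. }
  rewrite E2. clear E2 E1 Zf nl.
  destruct (basic_bounds t) as [HC [HS [HK1 [HK2 [HY1 [HY2 [HX1 HX2]]]]]]].
  destruct (moment_bounds t) as [m11 [m12 [m22 [m111 [m112 [m122 m222]]]]]].
  destruct (Er_bounds t) as [r1 r2]. destruct (Bw t) as [W1 W2].
  assert (He1 := small_le_1 G eps HG Heps HGe).
  assert (e2p : 0 <= eps ^ 2) by apply pow2_ge_0.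
  set (X := A + eps ^ 2) in *.
  assert (X0 : 0 <= X) by (unfold X; lra).
  assert (GX0 : 0 <= G * X) by (apply Rmult_le_pos; lra). assert (Ge0 : 0 <= G * eps ^ 2) by (apply Rmult_le_pos; lra).
  assert (GS : Rabs (gam * S t) <= G).
  { assert (GP := gam_pos). eapply Rle_trans; [absb|]. rewrite Rabs_right by lra. lra. }
  destruct (quad_bound G B HG HBG _ _ _ W1 W2) as [q1 q2].
  destruct (quad_bound G B HG HBG _ _ _ HX1 HX2) as [q3 q4].
  destruct (cub_bound G B HG HBG _ _ _ GX0 HX1 HX2) as [c1 c2].
  destruct (cubM_bound G B HG HBG _ _ _ _ _ _ Ge0 W1 W2 m11 m12 m22) as [d1 d2].
  destruct (cubM_bound G B HG HBG _ _ _ _ _ _ GX0 HX1 HX2 m11 m12 m22) as [d3 d4].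
  destruct (cubN_bound G B HG HBG _ _ m111 m122) as [h1 _].
  destruct (cubN_bound G B HG HBG _ _ m112 m222) as [_ h2].
  assert (P : forall u v x, 0 <= x -> Rabs u <= x -> Rabs v <= x -> Rabs (u * C t + v * (gam * S t)) <= 2 * (G * x)).
  { intros u v x Hx Hu Hv. eapply Rle_trans; [apply ab_plus; apply ab_mult; eassumption|]. clear - HG Hx. nra. }
  assert (G7 : forall i, (i <= 7)%nat -> G ^ i <= G ^ 7) by (intros; apply Rle_pow; lia || lra).
  assert (Gp : forall i, 0 <= G ^ i) by (intro; apply pow_le; lra).
  assert (ep4 : 0 <= eps ^ 4) by (apply pow_le; lra).
  assert (ep3 : 0 <= eps ^ 3) by (apply pow_le; lra).
  destruct (scale_bounds A eps Heps He1 HA) as [E0p [MX3 [MAX2 [MAX3 [MeAX [ee [MAe3 MAe4]]]]]]].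
  fold X E0 in E0p, MX3, MAX2, MAX3, MeAX, ee, MAe3, MAe4.
  assert (S7 : forall i x, (i <= 7)%nat -> 0 <= x -> G ^ i * x <= G ^ 7 * x).
  { intros i x Hi Hx. apply Rmult_le_compat_r; auto. }
  assert (p1 := P _ _ _ (Rle_trans _ _ _ (Rabs_pos _) q1) q1 q2).
  assert (p2 := P _ _ _ (Rle_trans _ _ _ (Rabs_pos _) c1) c1 c2).
  assert (p3 := P _ _ _ (Rle_trans _ _ _ (Rabs_pos _) d1) d1 d2).
  assert (p4 := P _ _ _ (Rle_trans _ _ _ (Rabs_pos _) r1) r1 r2).
  (* The five terms contribute [4 + 12 + 10 + 2 + 81 = 109]. *)
  assert (RB : forall u1 u2 u3 u4 u5, Rabs u1 <= 2 * G ^ 2 * (G * X) ^ 2 -> Rabs u2 <= 3 * G ^ 3 * (G * X) ^ 3 ->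
     Rabs u3 <= 5 * G ^ 4 * (G * X) -> Rabs u4 <= 2 * G ^ 4 -> Rabs u5 <= 81 * G ^ 5 * eps ^ 4 ->
     A * Rabs (u1 + u2 + eps ^ 2 * u3 - eps ^ 3 * u4 + u5) <= 109 * (G ^ 6 * E0)).
  { intros u1 u2 u3 u4 u5 B1 B2 B3 B4 B5.
    apply Rle_trans with (A * (2 * G ^ 2 * (G * X) ^ 2 + 3 * G ^ 3 * (G * X) ^ 3 + eps ^ 2 * (5 * G ^ 4 * (G * X)) + eps ^ 3 * (2 * G ^ 4) + 81 * G ^ 5 * eps ^ 4)).
    - apply Rmult_le_compat_l; [lra|].
      eapply Rle_trans; [absb|]. rewrite !(Rabs_right eps) by lra. lra.
    - replace (A * (2 * G ^ 2 * (G * X) ^ 2 + 3 * G ^ 3 * (G * X) ^ 3 + eps ^ 2 * (5 * G ^ 4 * (G * X)) + eps ^ 3 * (2 * G ^ 4) + 81 * G ^ 5 * eps ^ 4))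
       with (2 * (G ^ 4 * (A * X ^ 2)) + 3 * (G ^ 6 * (A * X ^ 3)) + 5 * (G ^ 5 * (A * (eps ^ 2 * X))) + 2 * (G ^ 4 * (A * eps ^ 3)) + 81 * (G ^ 5 * (A * eps ^ 4))) by ring.
      assert (S6 : forall i x y, (i <= 6)%nat -> 0 <= x -> x <= y -> G ^ i * x <= G ^ 6 * y).
      { intros i x y Hi Hx Hxy. apply Rmult_le_compat; auto. apply Rle_pow; auto. }
      assert (X2p : 0 <= X ^ 2) by apply pow2_ge_0. assert (X3p : 0 <= X ^ 3) by (apply pow_le; auto).
      assert (Y1' := S6 4%nat (A * X ^ 2) (2 * E0) ltac:(lia) ltac:(apply Rmult_le_pos; lra) MAX2).
      assert (Y2' := S6 6%nat (A * X ^ 3) (4 * E0) ltac:(lia) ltac:(apply Rmult_le_pos; lra) MAX3).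
      assert (Y3' := S6 5%nat (A * (eps ^ 2 * X)) (2 * E0) ltac:(lia) ltac:(apply Rmult_le_pos; [lra|apply Rmult_le_pos; lra]) MeAX).
      assert (Y4' := S6 4%nat (A * eps ^ 3) E0 ltac:(lia) ltac:(apply Rmult_le_pos; lra) MAe3).
      assert (Y5' := S6 5%nat (A * eps ^ 4) E0 ltac:(lia) ltac:(apply Rmult_le_pos; lra) MAe4).
      lra. }
  assert (p5 : Rabs (Y1 t * R1) <= 109 * (G ^ 7 * E0)).
  { rewrite Rabs_mult. apply Rle_trans with (G * A * Rabs R1); [apply Rmult_le_compat_r; [apply Rabs_pos|auto]|].
    assert (Q := RB _ _ _ _ _ q3 c1 d3 h1 r1). fold R1 in Q.
    replace (G * A * Rabs R1) with (G * (A * Rabs R1)) by ring.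
    replace (109 * (G ^ 7 * E0)) with (G * (109 * (G ^ 6 * E0))) by ring. apply Rmult_le_compat_l; lra. }
  assert (p6 : Rabs (Y2 t * R2) <= 109 * (G ^ 7 * E0)).
  { rewrite Rabs_mult. apply Rle_trans with (G * A * Rabs R2); [apply Rmult_le_compat_r; [apply Rabs_pos|auto]|].
    assert (Q := RB _ _ _ _ _ q4 c2 d4 h2 r2). fold R2 in Q.
    replace (G * A * Rabs R2) with (G * (A * Rabs R2)) by ring.
    replace (109 * (G ^ 7 * E0)) with (G * (109 * (G ^ 6 * E0))) by ring. apply Rmult_le_compat_l; lra. }
  assert (p3' : Rabs (eps ^ 2 * (cubM1 B (w1 t) (w2 t) (M11 t) (M12 t) (M22 t) * C t + cubM2 B (w1 t) (w2 t) (M11 t) (M12 t) (M22 t) * (gam * S t)))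
     <= eps ^ 2 * (2 * (G * (5 * G ^ 4 * (G * eps ^ 2))))).
  { apply ab_mult; [rewrite Rabs_right; [lra|apply Rle_ge; auto]|exact p3]. }
  eapply Rle_trans; [apply ab_plus; [apply ab_minus; [apply ab_minus; [apply ab_minus; [apply ab_opp; exact p1|exact p2]|exact p3']|exact p4]|apply ab_plus; [exact p5|exact p6]]|].
  assert (F1 : 2 * (G * (2 * G ^ 2 * (G * eps ^ 2) ^ 2)) = 4 * (G ^ 5 * eps ^ 4)) by ring.
  assert (F2 : 2 * (G * (3 * G ^ 3 * (G * X) ^ 3)) = 6 * (G ^ 7 * X ^ 3)) by ring.
  assert (F3 : eps ^ 2 * (2 * (G * (5 * G ^ 4 * (G * eps ^ 2)))) = 10 * (G ^ 6 * eps ^ 4)) by ring.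
  assert (F4 : 2 * (G * (81 * G ^ 5 * eps ^ 4)) = 162 * (G ^ 6 * eps ^ 4)) by ring.
  rewrite F1, F2, F3, F4.
  assert (H1 := S7 5%nat (eps ^ 4) ltac:(lia) ep4). assert (H2 := S7 6%nat (eps ^ 4) ltac:(lia) ep4).
  assert (H3 : G ^ 7 * eps ^ 4 <= G ^ 7 * E0) by (apply Rmult_le_compat_l; auto).
  assert (H4 : G ^ 7 * X ^ 3 <= G ^ 7 * (4 * E0)) by (apply Rmult_le_compat_l; auto).
  assert (H5 : 0 <= G ^ 7 * E0) by (apply Rmult_le_pos; auto).
  (* The contributions add up to [4 + 24 + 10 + 162 + 2 * 109 = 418]. *)
  replace (420 * G ^ 7 * E0) with (420 * (G ^ 7 * E0)) by ring.
  lra.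
Qed.
End Resonant.

(** * The reduced action *)

Lemma max_abs_le x y D : Rmax (Rabs x) (Rabs y) <= D -> Rabs x <= D /\ Rabs y <= D.
Proof. intro H; split; eapply Rle_trans; [apply Rmax_l| |apply Rmax_r|]; eassumption. Qed.

Lemma derive_ext_eq (f g : R -> R) (t l l' : R) :
  (forall t, f t = g t) -> is_derive f t l -> l = l' -> is_derive g t l'.
Proof. intros E D <-. exact (is_derive_ext f g t l E D). Qed.

(** * Reduction to the kernel parameters [theta], [a1], [a2] *)

Section Family.
Variables (p : nat) (B kappa M Cl Cn Hb eps A : R) (c s : R -> R).
Variables (X1 X2 D1 D2 : (R -> R) -> (R -> R) -> R -> R).
Variables (n : nat) (m : nat -> R) (b1 b2 : nat -> R -> R).
Let T := 2 * PI * INR p.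
Let K := 4 - B.
Let b := B / 2.
Let k2 := 2 / kappa.
Hypothesis Hp : (1 <= p)%nat.
Hypothesis HB : 0 < B.
Hypothesis MD : modes T K kappa c s.
Hypothesis HM : 0 < M.
Hypothesis HX : forall h1 h2, pc T h1 -> pc T h2 ->
    pc T (X1 h1 h2) /\ pc T (X2 h1 h2) /\
    (forall t : R, is_derive (X1 h1 h2) t (D1 h1 h2 t)) /\
    (forall t : R, is_derive (X2 h1 h2) t (D2 h1 h2 t)) /\
    (forall t : R, is_derive (D1 h1 h2) t
       (red1 T kappa c s h1 h2 t - 2 * D2 h1 h2 t + (4 - K) * X1 h1 h2 t)) /\
    (forall t : R, is_derive (D2 h1 h2) t (red2 T kappa c s h1 h2 t + 2 * D1 h1 h2 t)) /\
    Int0 T (X2 h1 h2) = 0 /\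
    pr1 T kappa c s (X1 h1 h2) (X2 h1 h2) = 0 /\ pr2 T kappa c s (X1 h1 h2) (X2 h1 h2) = 0.
Hypothesis HXl : forall h1 h2 h1' h2', pc T h1 -> pc T h2 -> pc T h1' -> pc T h2' -> forall B,
    (forall t, Rabs (h1 t - h1' t) <= B /\ Rabs (h2 t - h2' t) <= B) -> forall t,
    Rabs (X1 h1 h2 t - X1 h1' h2' t) <= M * B /\ Rabs (X2 h1 h2 t - X2 h1' h2' t) <= M * B /\
    Rabs (D1 h1 h2 t - D1 h1' h2' t) <= M * B /\ Rabs (D2 h1 h2 t - D2 h1' h2' t) <= M * B.
Hypothesis HXb : forall B h1 h2, pc T h1 -> pc T h2 ->
    (forall t, Rabs (h1 t) <= B /\ Rabs (h2 t) <= B) -> forall t,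
    Rabs (X1 h1 h2 t) <= M * B /\ Rabs (X2 h1 h2 t) <= M * B /\
    Rabs (D1 h1 h2 t) <= M * B /\ Rabs (D2 h1 h2 t) <= M * B.
Hypothesis HCl : 0 < Cl.
Hypothesis HL : forall d1 d2 e1 e2 s D,
  Rabs d1 <= s -> Rabs d2 <= s -> Rabs e1 <= s -> Rabs e2 <= s -> s <= 1 / 8 ->
  Rabs (d1 - e1) <= D -> Rabs (d2 - e2) <= D ->
  Rabs (nl1 b d1 d2 - nl1 b e1 e2) <= Cl * s * D /\ Rabs (nl2 b d1 d2 - nl2 b e1 e2) <= Cl * s * D.
Hypothesis HCn : 0 < Cn.
Hypothesis HN : forall d1 d2 s,
  Rabs d1 <= s -> Rabs d2 <= s -> s <= 1 / 8 ->
  Rabs (nl1 b d1 d2) <= Cn * s * s /\ Rabs (nl2 b d1 d2) <= Cn * s * s.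
Hypothesis Hm : forall j, (j < n)%nat -> 0 < m j.
Hypothesis Hm1 : rsum n m = 1.
Hypothesis Pb : forall j, (j < n)%nat -> pc T (b1 j) /\ pc T (b2 j).
Hypothesis Zb : forall t, mom1 n m (fun j => b1 j t) = 0 /\ mom1 n m (fun j => b2 j t) = 0.
Hypothesis Bb : forall j t, (j < n)%nat -> Rabs (b1 j t) <= Hb /\ Rabs (b2 j t) <= Hb.
Hypothesis HHb : 0 <= Hb.
Hypothesis Heps : 0 < eps.
Hypothesis HA : 0 <= A.

Let Kb := 1 + k2.
(** [W * eps^2] bounds the correction: the norm [M] of the inverse times the quadratic bound of the
    force at displacements of size [sz], made of at most [eps] for the orbit and [2 * Hb * eps] for
    a primary. The three smallness hypotheses keep the orbit within [eps], keep the Taylor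
    expansions valid and make the contraction rate 1/2. *)
Let W := M * (Cn * ((1 + 2 * Hb) * (1 + 2 * Hb))).
Let sz := (1 + 2 * Hb) * eps.
Hypothesis HAe : 2 * (Kb * A) + W * eps ^ 2 <= eps.
Hypothesis Hsz : sz <= 1 / 8.
Hypothesis Hmu : M * (Cl * sz) <= 1 / 2.

Lemma T_pos : 0 < T.
Proof. unfold T. assert (H := PI_RGT_0). assert (H' := INR_gt0 p Hp). apply Rmult_lt_0_compat; lra. Qed.

Lemma k2_pos : 0 < k2.
Proof. unfold k2. destruct MD. apply Rdiv_lt_0_compat; lra. Qed.

Lemma eps_small : eps <= 1 / 8.
Proof. unfold sz in Hsz. nra. Qed.

(** [kk1], [kk2] form the kernel element with amplitudes [a1], [a2], and [kd1], [kd2] its velocity;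
    the factor 2 in [kd2] is [k2 * kappa]. *)
Definition kk1 (a1 a2 t : R) : R := a1 * c t + a2 * s t.
Definition kk2 (a1 a2 t : R) : R := a1 * (k2 * s t) - a2 * (k2 * c t).
Definition kd1 (a1 a2 t : R) : R := kappa * (a2 * c t - a1 * s t).
Definition kd2 (a1 a2 t : R) : R := 2 * (a1 * c t + a2 * s t).

Lemma kk_pc a1 a2 : pc T (kk1 a1 a2) /\ pc T (kk2 a1 a2) /\ pc T (kd1 a1 a2) /\ pc T (kd2 a1 a2).
Proof. destruct MD. unfold kk1, kk2, kd1, kd2. repeat split; try (apply (pc_cont T)); try pcs;
  intro t; rewrite (proj2 md_c0), (proj2 md_s0); reflexivity. Qed.

Lemma kk_bound a1 a2 r t : Rabs a1 <= r -> Rabs a2 <= r ->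
  Rabs (kk1 a1 a2 t) <= 2 * (Kb * r) /\ Rabs (kk2 a1 a2 t) <= 2 * (Kb * r) /\
  Rabs (kd1 a1 a2 t) <= 2 * (kappa * r) /\ Rabs (kd2 a1 a2 t) <= 4 * r.
Proof.
  intros H1 H2. destruct MD. destruct (md_bound0 t) as [Hc Hs].
  assert (r0 : 0 <= r) by (eapply Rle_trans; [apply Rabs_pos | exact H1]).
  assert (KP := k2_pos). assert (k2r : 0 <= k2 * r) by nra.
  unfold kk1, kk2, kd1, kd2, Kb. repeat split; (eapply Rle_trans; [absb|]); rewrite ?Rabs_right by lra; lra.
Qed.

Definition xx1 (a1 a2 : R) (f1 : R -> R) (t : R) : R := kk1 a1 a2 t + f1 t.
Definition xx2 (a1 a2 : R) (f2 : R -> R) (t : R) : R := kk2 a1 a2 t + f2 t.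
Definition hh1 (theta a1 a2 : R) (f1 f2 : R -> R) : R -> R := NN1 b eps theta n m b1 b2 (xx1 a1 a2 f1) (xx2 a1 a2 f2).
Definition hh2 (theta a1 a2 : R) (f1 f2 : R -> R) : R -> R := NN2 b eps theta n m b1 b2 (xx1 a1 a2 f1) (xx2 a1 a2 f2).

Lemma cos_shift_pc theta : pc T (fun t => cos (theta + t)) /\ pc T (fun t => sin (theta + t)).
Proof.
  assert (Z : forall x, cos (x + T) = cos x /\ sin (x + T) = sin x).
  { intro x. unfold T. replace (x + 2 * PI * INR p) with (x + 2 * INR p * PI) by ring.
    rewrite cos_period, sin_period. auto. }
  split; (split; [cts|]); intro t; rewrite <- Rplus_assoc; apply Z.
Qed.

Lemma eta_pc theta j : (j < n)%nat -> pc T (eta1 theta b1 b2 j) /\ pc T (eta2 theta b1 b2 j).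
Proof.
  intro Hj. destruct (Pb j Hj). destruct (cos_shift_pc theta) as [C1 C2].
  unfold eta1, eta2. split.
  - apply (pc_minus T (fun t => cos (theta + t) * b1 j t) (fun t => sin (theta + t) * b2 j t)).
    + apply (pc_mult T (fun t => cos (theta + t))); auto.
    + apply (pc_mult T (fun t => sin (theta + t))); auto.
  - apply (pc_plus T (fun t => cos (theta + t) * b2 j t) (fun t => sin (theta + t) * b1 j t)).
    + apply (pc_mult T (fun t => cos (theta + t))); auto.
    + apply (pc_mult T (fun t => sin (theta + t))); auto.
Qed.

Definition ball_A (a1 a2 : R) : Prop := Rabs a1 <= A /\ Rabs a2 <= A.

Lemma W_nonneg : 0 <= W * eps ^ 2.
Proof.
  unfold W. apply Rmult_le_pos; [|apply pow2_ge_0]. apply Rmult_le_pos; [lra|].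
  apply Rmult_le_pos; [lra|apply Rle_0_sqr].
Qed.

Lemma xx_bound a1 a2 f1 f2 : ball_A a1 a2 -> small_pc T (W * eps ^ 2) f1 f2 ->
  pc T (xx1 a1 a2 f1) /\ pc T (xx2 a1 a2 f2) /\
  forall t, Rabs (xx1 a1 a2 f1 t) <= eps /\ Rabs (xx2 a1 a2 f2 t) <= eps.
Proof.
  intros [A1 A2] [P1 [P2 Q]]. destruct (kk_pc a1 a2) as [K1 [K2 _]].
  split; [unfold xx1; pcs|split; [unfold xx2; pcs|]].
  intro t. destruct (kk_bound a1 a2 A t A1 A2) as [B1 [B2 _]]. destruct (Q t).
  unfold xx1, xx2. split; (eapply Rle_trans; [apply ab_plus; eassumption|lra]).
Qed.

Lemma dd_bound theta x1 x2 j t : (j < n)%nat -> Rabs x1 <= eps -> Rabs x2 <= eps ->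
  Rabs (x1 - eps * eta1 theta b1 b2 j t) <= sz /\ Rabs (x2 - eps * eta2 theta b1 b2 j t) <= sz.
Proof.
  intros Hj H1 H2. destruct (Bb j t Hj) as [Q1 Q2].
  destruct (eta_bound theta b1 b2 j t Hb Q1 Q2) as [E1 E2].
  unfold sz. split; (eapply Rle_trans; [absb|]); rewrite Rabs_right by lra; lra.
Qed.

Lemma NN_pc theta x1 x2 : pc T x1 -> pc T x2 -> (forall t, Rabs (x1 t) <= eps /\ Rabs (x2 t) <= eps) ->
  pc T (NN1 b eps theta n m b1 b2 x1 x2) /\ pc T (NN2 b eps theta n m b1 b2 x1 x2).
Proof.
  intros P1 P2 Q.
  assert (S : forall j, (j < n)%nat -> pc T (fun t => pw b (sq (x1 t - eps * eta1 theta b1 b2 j t) (x2 t - eps * eta2 theta b1 b2 j t)))).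
  { intros j Hj. destruct (eta_pc theta j Hj).
    apply (pc_pw T b (fun t => sq (x1 t - eps * eta1 theta b1 b2 j t) (x2 t - eps * eta2 theta b1 b2 j t))).
    - unfold sq. pcs.
    - intro t. destruct (Q t) as [Q1 Q2]. destruct (dd_bound theta _ _ j t Hj Q1 Q2) as [E1 E2].
      assert (Z := sq_bound _ _ _ E1 E2 Hsz). apply half_gt. lra. }
  unfold NN1, NN2. split; apply pc_opp.
  - apply (pc_rsum T n (fun j t => m j * nl1 b (x1 t - eps * eta1 theta b1 b2 j t) (x2 t - eps * eta2 theta b1 b2 j t))).
    intros j Hj. destruct (eta_pc theta j Hj). specialize (S j Hj). unfold nl1. pcs.
  - apply (pc_rsum T n (fun j t => m j * nl2 b (x1 t - eps * eta1 theta b1 b2 j t) (x2 t - eps * eta2 theta b1 b2 j t))).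
    intros j Hj. destruct (eta_pc theta j Hj). specialize (S j Hj). unfold nl2. pcs.
Qed.

Lemma NN_bound theta x1 x2 t : Rabs (x1 t) <= eps -> Rabs (x2 t) <= eps ->
  Rabs (NN1 b eps theta n m b1 b2 x1 x2 t) <= Cn * sz * sz /\ Rabs (NN2 b eps theta n m b1 b2 x1 x2 t) <= Cn * sz * sz.
Proof.
  intros Q1 Q2. unfold NN1, NN2. rewrite !Rabs_Ropp.
  split; apply rsum_avg; auto; intros j Hj; destruct (dd_bound theta _ _ j t Hj Q1 Q2) as [E1 E2]; apply (HN _ _ _ E1 E2 Hsz).
Qed.

(** Angles are compared through cosine and sine, so that angles equal modulo [2 * PI] are at
    distance zero. *)
Definition dpar (theta a1 a2 theta' a1' a2' : R) : R :=
  Rabs (cos theta - cos theta') + Rabs (sin theta - sin theta') + Rabs (a1 - a1') + Rabs (a2 - a2').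

Lemma rot_diff theta theta' t :
  Rabs (cos (theta + t) - cos (theta' + t)) <= Rabs (cos theta - cos theta') + Rabs (sin theta - sin theta') /\
  Rabs (sin (theta + t) - sin (theta' + t)) <= Rabs (cos theta - cos theta') + Rabs (sin theta - sin theta').
Proof.
  assert (Hc : Rabs (cos t) <= 1) by (apply Rabs_le; apply COS_bound).
  assert (Hs : Rabs (sin t) <= 1) by (apply Rabs_le; apply SIN_bound).
  assert (U1 := Rabs_pos (cos theta - cos theta')). assert (U2 := Rabs_pos (sin theta - sin theta')).
  rewrite !cos_plus, !sin_plus. split.
  - replace (cos theta * cos t - sin theta * sin t - (cos theta' * cos t - sin theta' * sin t)) with
      ((cos theta - cos theta') * cos t - (sin theta - sin theta') * sin t) by ring.
    eapply Rle_trans; [apply ab_minus; apply ab_mult; [apply ab_const|exact Hc|apply ab_const|exact Hs]|]. lra.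
  - replace (sin theta * cos t + cos theta * sin t - (sin theta' * cos t + cos theta' * sin t)) with
      ((sin theta - sin theta') * cos t + (cos theta - cos theta') * sin t) by ring.
    eapply Rle_trans; [apply ab_plus; apply ab_mult; [apply ab_const|exact Hc|apply ab_const|exact Hs]|]. lra.
Qed.

Lemma NN_lip theta theta' x1 x2 x1' x2' t D :
  Rabs (x1 t) <= eps -> Rabs (x2 t) <= eps -> Rabs (x1' t) <= eps -> Rabs (x2' t) <= eps ->
  Rabs (x1 t - x1' t) <= D -> Rabs (x2 t - x2' t) <= D ->
  let E := D + 2 * Hb * (Rabs (cos theta - cos theta') + Rabs (sin theta - sin theta')) in
  Rabs (NN1 b eps theta n m b1 b2 x1 x2 t - NN1 b eps theta' n m b1 b2 x1' x2' t) <= Cl * sz * E /\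
  Rabs (NN2 b eps theta n m b1 b2 x1 x2 t - NN2 b eps theta' n m b1 b2 x1' x2' t) <= Cl * sz * E.
Proof.
  intros Q1 Q2 Q1' Q2' HD1 HD2 E.
  set (r := Rabs (cos theta - cos theta') + Rabs (sin theta - sin theta')) in *.
  assert (r0 : 0 <= r) by (unfold r; apply Rplus_le_le_0_compat; apply Rabs_pos).
  destruct (rot_diff theta theta' t) as [Rc Rs]. fold r in Rc, Rs.
  assert (ES := eps_small).
  assert (ED : forall j, (j < n)%nat -> Rabs (eta1 theta b1 b2 j t - eta1 theta' b1 b2 j t) <= 2 * Hb * r /\
      Rabs (eta2 theta b1 b2 j t - eta2 theta' b1 b2 j t) <= 2 * Hb * r).
  { intros j Hj. destruct (Bb j t Hj) as [P1 P2]. unfold eta1, eta2. split.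
    - replace (cos (theta + t) * b1 j t - sin (theta + t) * b2 j t - (cos (theta' + t) * b1 j t - sin (theta' + t) * b2 j t)) with
       ((cos (theta + t) - cos (theta' + t)) * b1 j t - (sin (theta + t) - sin (theta' + t)) * b2 j t) by ring.
      eapply Rle_trans; [apply ab_minus; apply ab_mult; eassumption|]. lra.
    - replace (cos (theta + t) * b2 j t + sin (theta + t) * b1 j t - (cos (theta' + t) * b2 j t + sin (theta' + t) * b1 j t)) with
       ((cos (theta + t) - cos (theta' + t)) * b2 j t + (sin (theta + t) - sin (theta' + t)) * b1 j t) by ring.
      eapply Rle_trans; [apply ab_plus; apply ab_mult; eassumption|]. lra. }
  assert (DD : forall u v e e', Rabs (u - v) <= D -> Rabs (e - e') <= 2 * Hb * r -> Rabs ((u - eps * e) - (v - eps * e')) <= E).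
  { intros u v e e' Hu He. replace ((u - eps * e) - (v - eps * e')) with ((u - v) - eps * (e - e')) by ring.
    eapply Rle_trans; [apply ab_minus; [exact Hu|apply ab_mult; [apply ab_const|exact He]]|].
    rewrite Rabs_right by lra. unfold E. assert (0 <= 2 * Hb * r) by nra. nra. }
  assert (NE : forall f : R -> R -> R, (forall d1 d2 e1 e2,
     Rabs d1 <= sz -> Rabs d2 <= sz -> Rabs e1 <= sz -> Rabs e2 <= sz -> Rabs (d1 - e1) <= E -> Rabs (d2 - e2) <= E ->
     Rabs (f d1 d2 - f e1 e2) <= Cl * sz * E) ->
    Rabs (- rsum n (fun j => m j * f (x1 t - eps * eta1 theta b1 b2 j t) (x2 t - eps * eta2 theta b1 b2 j t)) -
          - rsum n (fun j => m j * f (x1' t - eps * eta1 theta' b1 b2 j t) (x2' t - eps * eta2 theta' b1 b2 j t))) <= Cl * sz * E).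
  { intros f Hf.
    replace (- rsum n (fun j => m j * f (x1 t - eps * eta1 theta b1 b2 j t) (x2 t - eps * eta2 theta b1 b2 j t)) -
          - rsum n (fun j => m j * f (x1' t - eps * eta1 theta' b1 b2 j t) (x2' t - eps * eta2 theta' b1 b2 j t))) with
     (- rsum n (fun j => m j * (f (x1 t - eps * eta1 theta b1 b2 j t) (x2 t - eps * eta2 theta b1 b2 j t) -
            f (x1' t - eps * eta1 theta' b1 b2 j t) (x2' t - eps * eta2 theta' b1 b2 j t)))).
    - rewrite Rabs_Ropp. apply rsum_avg; auto. intros j Hj.
      destruct (dd_bound theta _ _ j t Hj Q1 Q2) as [E1 E2]. destruct (dd_bound theta' _ _ j t Hj Q1' Q2') as [F1 F2].
      destruct (ED j Hj). apply Hf; auto.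
    - rewrite (rsum_ext n _ (fun j => m j * f (x1 t - eps * eta1 theta b1 b2 j t) (x2 t - eps * eta2 theta b1 b2 j t) -
            m j * f (x1' t - eps * eta1 theta' b1 b2 j t) (x2' t - eps * eta2 theta' b1 b2 j t))) by (intros; ring).
      rewrite rsum_minus. ring. }
  split.
  - apply (NE (nl1 b)). intros; apply (HL d1 d2 e1 e2 sz E); auto.
  - apply (NE (nl2 b)). intros; apply (HL d1 d2 e1 e2 sz E); auto.
Qed.

(* The equation modulo the kernel: [X1, X2] inverts the linearisation after the force has been
projected, and the projections left over are the multipliers [pr0], [mult1] and [mult2]. *)
Definition reduced_sol (theta a1 a2 : R) (f1 f2 : R -> R) : Prop :=
  ball_A a1 a2 /\ small_pc T (W * eps ^ 2) f1 f2 /\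
  X1 (hh1 theta a1 a2 f1 f2) (hh2 theta a1 a2 f1 f2) = f1 /\
  X2 (hh1 theta a1 a2 f1 f2) (hh2 theta a1 a2 f1 f2) = f2.

Lemma hh_pc theta a1 a2 f1 f2 : ball_A a1 a2 -> small_pc T (W * eps ^ 2) f1 f2 ->
  pc T (hh1 theta a1 a2 f1 f2) /\ pc T (hh2 theta a1 a2 f1 f2).
Proof. intros Ha Hf. destruct (xx_bound _ _ _ _ Ha Hf) as [P1 [P2 Q]]. apply NN_pc; auto. Qed.

Lemma sol_exists theta a1 a2 : ball_A a1 a2 -> exists f1 f2, reduced_sol theta a1 a2 f1 f2.
Proof.
  intro Ha.
  destruct (fixpoint T (W * eps ^ 2)
     (fun f1 f2 => X1 (hh1 theta a1 a2 f1 f2) (hh2 theta a1 a2 f1 f2))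
     (fun f1 f2 => X2 (hh1 theta a1 a2 f1 f2) (hh2 theta a1 a2 f1 f2))) as [f1 [f2 [H1 H2]]].
  - apply W_nonneg.
  - intros f1 f2 Hf. destruct (xx_bound _ _ _ _ Ha Hf) as [P1 [P2 Q]].
    destruct (hh_pc theta a1 a2 f1 f2 Ha Hf) as [G1 G2].
    destruct (HX _ _ G1 G2) as [Z1 [Z2 _]]. split; [exact Z1|split; [exact Z2|]].
    intro t. assert (BB := HXb (Cn * sz * sz) _ _ G1 G2 (fun t => NN_bound theta _ _ t (proj1 (Q t)) (proj2 (Q t))) t).
    replace (W * eps ^ 2) with (M * (Cn * sz * sz)) by (unfold W, sz; ring).
    split; apply BB.
  - intros f1 f2 g1 g2 Hf Hg D HD t.
    destruct (xx_bound _ _ _ _ Ha Hf) as [P1 [P2 Q]]. destruct (xx_bound _ _ _ _ Ha Hg) as [P1' [P2' Q']].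
    destruct (hh_pc theta a1 a2 f1 f2 Ha Hf) as [G1 G2]. destruct (hh_pc theta a1 a2 g1 g2 Ha Hg) as [G1' G2'].
    assert (D0 : 0 <= D) by (eapply Rle_trans; [apply Rabs_pos | apply (HD 0)]).
    assert (BB := HXl _ _ _ _ G1 G2 G1' G2' (Cl * sz * D)).
    assert (LL : forall t, Rabs (hh1 theta a1 a2 f1 f2 t - hh1 theta a1 a2 g1 g2 t) <= Cl * sz * D /\
                 Rabs (hh2 theta a1 a2 f1 f2 t - hh2 theta a1 a2 g1 g2 t) <= Cl * sz * D).
    { intro u. destruct (Q u), (Q' u), (HD u).
      assert (NL := NN_lip theta theta (xx1 a1 a2 f1) (xx2 a1 a2 f2) (xx1 a1 a2 g1) (xx2 a1 a2 g2) u D).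
      rewrite !Rminus_diag, Rabs_R0 in NL. replace (D + 2 * Hb * (0 + 0)) with D in NL by ring.
      apply NL; auto.
      - unfold xx1. replace (kk1 a1 a2 u + f1 u - (kk1 a1 a2 u + g1 u)) with (f1 u - g1 u) by ring. auto.
      - unfold xx2. replace (kk2 a1 a2 u + f2 u - (kk2 a1 a2 u + g2 u)) with (f2 u - g2 u) by ring. auto. }
    destruct (BB LL t) as [E1 [E2 _]].
    assert (M * (Cl * sz * D) <= D / 2).
    { replace (M * (Cl * sz * D)) with (M * (Cl * sz) * D) by ring. apply Rle_trans with (1 / 2 * D); [|lra].
      apply Rmult_le_compat_r; auto. }
    lra.
  - exists f1, f2. split; [exact Ha|split; [exact H1|]].
    split; apply functional_extensionality; intro t; apply H2.
Qed.

(** The fixed point of a contraction of rate 1/2 depends Lipschitz continuously on its parameters.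
    At distance zero this is uniqueness of the correction. *)
Lemma sol_lip theta a1 a2 f1 f2 theta' a1' a2' f1' f2' :
  reduced_sol theta a1 a2 f1 f2 -> reduced_sol theta' a1' a2' f1' f2' ->
  let L := 2 * (2 * Kb + 2 * Hb) * dpar theta a1 a2 theta' a1' a2' in forall t,
  Rabs (f1 t - f1' t) <= L /\ Rabs (f2 t - f2' t) <= L /\
  Rabs (D1 (hh1 theta a1 a2 f1 f2) (hh2 theta a1 a2 f1 f2) t - D1 (hh1 theta' a1' a2' f1' f2') (hh2 theta' a1' a2' f1' f2') t) <= L /\
  Rabs (D2 (hh1 theta a1 a2 f1 f2) (hh2 theta a1 a2 f1 f2) t - D2 (hh1 theta' a1' a2' f1' f2') (hh2 theta' a1' a2' f1' f2') t) <= L.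
Proof.
  intros [Ha [Hf [E1 E2]]] [Ha' [Hf' [E1' E2']]] L.
  set (dp := dpar theta a1 a2 theta' a1' a2') in *.
  assert (dp0 : 0 <= dp) by (unfold dp, dpar; repeat apply Rplus_le_le_0_compat; apply Rabs_pos).
  assert (KP := k2_pos). assert (Kb1 : 1 <= Kb) by (unfold Kb; lra).
  set (r := Rabs (cos theta - cos theta') + Rabs (sin theta - sin theta')).
  assert (Hr : 0 <= r <= dp).
  { unfold r, dp, dpar. assert (V1 := Rabs_pos (cos theta - cos theta')). assert (V2 := Rabs_pos (sin theta - sin theta')).
    assert (V3 := Rabs_pos (a1 - a1')). assert (V4 := Rabs_pos (a2 - a2')). lra. }
  assert (Hda : Rabs (a1 - a1') <= dp /\ Rabs (a2 - a2') <= dp).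
  { unfold dp, dpar. assert (V1 := Rabs_pos (cos theta - cos theta')). assert (V2 := Rabs_pos (sin theta - sin theta')).
    assert (V3 := Rabs_pos (a1 - a1')). assert (V4 := Rabs_pos (a2 - a2')). lra. }
  destruct (xx_bound _ _ _ _ Ha Hf) as [P1 [P2 Q]]. destruct (xx_bound _ _ _ _ Ha' Hf') as [P1' [P2' Q']].
  destruct (hh_pc theta a1 a2 f1 f2 Ha Hf) as [G1 G2]. destruct (hh_pc theta' a1' a2' f1' f2' Ha' Hf') as [G1' G2'].
  (* One pass through the equation halves a known bound [D] and adds the change of parameters;
     [sup_absorb] then removes [D]. *)
  assert (Step : forall D, 0 <= D -> (forall t, Rabs (f1 t - f1' t) <= D /\ Rabs (f2 t - f2' t) <= D) -> forall t,
     let E := (2 * Kb + 2 * Hb) * dp / 2 + D / 2 in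
     Rabs (f1 t - f1' t) <= E /\ Rabs (f2 t - f2' t) <= E /\
  Rabs (D1 (hh1 theta a1 a2 f1 f2) (hh2 theta a1 a2 f1 f2) t - D1 (hh1 theta' a1' a2' f1' f2') (hh2 theta' a1' a2' f1' f2') t) <= E /\
  Rabs (D2 (hh1 theta a1 a2 f1 f2) (hh2 theta a1 a2 f1 f2) t - D2 (hh1 theta' a1' a2' f1' f2') (hh2 theta' a1' a2' f1' f2') t) <= E).
  { intros D HD0 HD t E.
    set (Z := 2 * Kb * dp + D + 2 * Hb * r).
    assert (LL : forall t, Rabs (hh1 theta a1 a2 f1 f2 t - hh1 theta' a1' a2' f1' f2' t) <= Cl * sz * Z /\
                 Rabs (hh2 theta a1 a2 f1 f2 t - hh2 theta' a1' a2' f1' f2' t) <= Cl * sz * Z).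
    { intro u. destruct (Q u), (Q' u), (HD u). destruct Hda as [Hd1 Hd2].
      destruct (kk_bound (a1 - a1') (a2 - a2') dp u Hd1 Hd2) as [KB1 [KB2 _]].
      assert (NL := NN_lip theta theta' (xx1 a1 a2 f1) (xx2 a1 a2 f2) (xx1 a1' a2' f1') (xx2 a1' a2' f2') u (2 * Kb * dp + D)).
      fold r in NL. fold Z in NL. apply NL; auto.
      - unfold xx1. replace (kk1 a1 a2 u + f1 u - (kk1 a1' a2' u + f1' u)) with (kk1 (a1 - a1') (a2 - a2') u + (f1 u - f1' u)) by (unfold kk1; ring).
        eapply Rle_trans; [apply ab_plus; eassumption|]. lra.
      - unfold xx2. replace (kk2 a1 a2 u + f2 u - (kk2 a1' a2' u + f2' u)) with (kk2 (a1 - a1') (a2 - a2') u + (f2 u - f2' u)) by (unfold kk2; ring).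
        eapply Rle_trans; [apply ab_plus; eassumption|]. lra. }
    assert (BB := HXl _ _ _ _ G1 G2 G1' G2' (Cl * sz * Z) LL t).
    rewrite E1, E2, E1', E2' in BB.
    assert (ZZ : M * (Cl * sz * Z) <= E).
    { assert (Z0 : 0 <= Z) by (unfold Z; assert (0 <= Kb * dp) by nra; assert (0 <= Hb * r) by nra; lra).
      replace (M * (Cl * sz * Z)) with (M * (Cl * sz) * Z) by ring. apply Rle_trans with (1 / 2 * Z).
      - apply Rmult_le_compat_r; auto.
      - unfold Z, E. assert (Hb * r <= Hb * dp) by (apply Rmult_le_compat_l; lra). lra. }
    lra. }
  assert (Fin : forall t, Rmax (Rabs (f1 t - f1' t)) (Rabs (f2 t - f2' t)) <= 2 * ((2 * Kb + 2 * Hb) * dp / 2)).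
  { assert (KH : 0 <= (2 * Kb + 2 * Hb) * dp) by (apply Rmult_le_pos; lra).
    apply (sup_absorb _ _ (2 * (W * eps ^ 2))).
    - assert (Z := W_nonneg). lra.
    - intro t. destruct Hf as [_ [_ Bf]], Hf' as [_ [_ Bf']]. destruct (Bf t), (Bf' t).
      apply Rmax_lub; (eapply Rle_trans; [apply ab_minus; eassumption|lra]).
    - intros D HD0 HD t. apply Rmax_lub; apply (Step D HD0); intro u; apply max_abs_le; auto.
    - lra. }
  intro t.
  assert (KH : 0 <= (2 * Kb + 2 * Hb) * dp) by (apply Rmult_le_pos; lra).
  assert (S := Step ((2 * Kb + 2 * Hb) * dp) KH (fun u => max_abs_le _ _ _ (Rle_trans _ _ ((2 * Kb + 2 * Hb) * dp) (Fin u) ltac:(lra))) t).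
  cbv zeta in S. unfold L. lra.
Qed.

Section CorrectedOrbit.
Variables (theta a1 a2 : R) (f1 f2 : R -> R).
Hypothesis HS : reduced_sol theta a1 a2 f1 f2.
Let h1 := hh1 theta a1 a2 f1 f2.
Let h2 := hh2 theta a1 a2 f1 f2.
Let l0 := pr0 T h2.
Let l1 := pr1 T kappa c s h1 h2.
Let l2 := pr2 T kappa c s h1 h2.
Definition x1 : R -> R := xx1 a1 a2 f1.
Definition x2 : R -> R := xx2 a1 a2 f2.
Definition v1 (t : R) : R := kd1 a1 a2 t + D1 h1 h2 t.
Definition v2 (t : R) : R := kd2 a1 a2 t + D2 h1 h2 t.

Lemma kk_derive (t : R) : is_derive (kk1 a1 a2) t (kd1 a1 a2 t) /\ is_derive (kk2 a1 a2) t (kd2 a1 a2 t) /\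
  is_derive (kd1 a1 a2) t (B * kk1 a1 a2 t - 2 * kd2 a1 a2 t) /\ is_derive (kd2 a1 a2) t (2 * kd1 a1 a2 t).
Proof.
  destruct MD. assert (Hk : k2 * kappa = 2) by (unfold k2; field; lra).
  assert (K1 := md_Kc0 t). assert (K2 := md_Ks0 t).
  assert (L : forall u v w, is_derive (fun t => u * (v * c t + w * s t)) t (u * (v * (- (kappa * s t)) + w * (kappa * c t)))).
  { intros u v w. apply (is_derive_scal (fun t => v * c t + w * s t) t u).
    apply (is_derive_plus (V:=R_NormedModule) (fun t => v * c t) (fun t => w * s t)).
    - apply (is_derive_scal c t v). apply md_dc0.
    - apply (is_derive_scal s t w). apply md_ds0. }
  split; [|split; [|split]].
  - eapply (derive_ext_eq (fun t => 1 * (a1 * c t + a2 * s t))); [intro; unfold kk1; ring|apply L|]. unfold kd1. ring.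
  - eapply (derive_ext_eq (fun t => k2 * ((- a2) * c t + a1 * s t))); [intro; unfold kk2; ring|apply L|]. unfold kd2. rewrite <- Hk. ring.
  - eapply (derive_ext_eq (fun t => kappa * (a2 * c t + (- a1) * s t))); [intro; unfold kd1; ring|apply L|]. unfold kk1, kd2. unfold K in K1, K2.
    transitivity (- (a1 * (kappa * kappa * c t) + a2 * (kappa * kappa * s t))); [ring|]. rewrite <- K1, <- K2. ring.
  - eapply (derive_ext_eq (fun t => 2 * (a1 * c t + a2 * s t))); [intro; unfold kd2; ring|apply L|]. unfold kd1. ring.
Qed.

(** Since the correction is orthogonal to the kernel, the projections of the whole displacement are
    exactly the amplitudes, unless the modes vanish. The angular mean is zero because the phase is
    carried by [theta]. *)
Lemma sol_facts :
  pc T x1 /\ pc T x2 /\ pc T v1 /\ pc T v2 /\ pc T h1 /\ pc T h2 /\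
  (forall t, Rabs (x1 t) <= eps /\ Rabs (x2 t) <= eps) /\
  (forall t : R, is_derive x1 t (v1 t)) /\ (forall t : R, is_derive x2 t (v2 t)) /\
  (forall t : R, is_derive v1 t (red1 T kappa c s h1 h2 t - 2 * v2 t + B * x1 t)) /\
  (forall t : R, is_derive v2 t (red2 T kappa c s h1 h2 t + 2 * v1 t)) /\
  Int0 T x2 = 0 /\
  ((forall t, c t = 0 /\ s t = 0) \/ (pr1 T kappa c s x1 x2 = a1 /\ pr2 T kappa c s x1 x2 = a2)) /\
  (forall t, Rabs (v1 t) <= 2 * (kappa * A) + W * eps ^ 2 /\ Rabs (v2 t) <= 4 * A + W * eps ^ 2).
Proof.
  destruct HS as [Ha [Hf [E1 E2]]].
  destruct (xx_bound _ _ _ _ Ha Hf) as [P1 [P2 Q]].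
  destruct (hh_pc theta a1 a2 f1 f2 Ha Hf) as [G1 G2]. fold h1 h2 in G1, G2, E1, E2.
  destruct (HX h1 h2 G1 G2) as [Y1 [Y2 [Y3 [Y4 [Y5 [Y6 [Y7 [Y8 Y9]]]]]]]].
  rewrite E1, E2 in *.
  assert (d1 : forall t : R, is_derive x1 t (v1 t)).
  { intro t. apply (derive_ext_eq (fun t => kk1 a1 a2 t + f1 t) x1 t (kd1 a1 a2 t + D1 h1 h2 t)); [reflexivity| |reflexivity].
    apply (is_derive_plus (V:=R_NormedModule) (kk1 a1 a2) f1); [apply kk_derive|apply Y3]. }
  assert (d2 : forall t : R, is_derive x2 t (v2 t)).
  { intro t. apply (derive_ext_eq (fun t => kk2 a1 a2 t + f2 t) x2 t (kd2 a1 a2 t + D2 h1 h2 t)); [reflexivity| |reflexivity].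
    apply (is_derive_plus (V:=R_NormedModule) (kk2 a1 a2) f2); [apply kk_derive|apply Y4]. }
  assert (d3 : forall t : R, is_derive v1 t (red1 T kappa c s h1 h2 t - 2 * v2 t + B * x1 t)).
  { intro t. apply (derive_ext_eq (fun t => kd1 a1 a2 t + D1 h1 h2 t) v1 t
      (B * kk1 a1 a2 t - 2 * kd2 a1 a2 t + (red1 T kappa c s h1 h2 t - 2 * D2 h1 h2 t + (4 - K) * f1 t))); [reflexivity| |].
    - apply (is_derive_plus (V:=R_NormedModule) (kd1 a1 a2) (D1 h1 h2)); [apply kk_derive|apply Y5].
    - unfold v2, x1, xx1, K. ring. }
  assert (d4 : forall t : R, is_derive v2 t (red2 T kappa c s h1 h2 t + 2 * v1 t)).
  { intro t. apply (derive_ext_eq (fun t => kd2 a1 a2 t + D2 h1 h2 t) v2 t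
      (2 * kd1 a1 a2 t + (red2 T kappa c s h1 h2 t + 2 * D1 h1 h2 t))); [reflexivity| |].
    - apply (is_derive_plus (V:=R_NormedModule) (kd2 a1 a2) (D2 h1 h2)); [apply kk_derive|apply Y6].
    - unfold v1. ring. }
  assert (TP := T_pos).
  destruct (kk_pc a1 a2) as [K1 [K2 _]].
  split; [exact P1|split; [exact P2|]].
  split; [exact (pc_derive T x1 v1 d1 (cont_derive _ _ d3) (proj2 P1))|].
  split; [exact (pc_derive T x2 v2 d2 (cont_derive _ _ d4) (proj2 P2))|].
  split; [exact G1|split; [exact G2|split; [exact Q|split; [exact d1|split; [exact d2|split; [exact d3|split; [exact d4|]]]]]]].
  destruct Hf as [Pf1 [Pf2 Bf]].
  split; [|split].
  - unfold x2, xx2. rewrite Int0_plus, Y7 by cts. unfold kk2. destruct MD.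
    rewrite Int0_minus, !Int0_scal, md_Ic0, md_Is0 by cts. ring.
  - destruct (pr_modes T K kappa c s TP MD a1 a2 0) as [Z|[Z1 Z2]]; [left; exact Z|right].
    assert (F1 : x1 = fun t => 1 * (a1 * c t + a2 * s t) + 1 * f1 t) by (apply functional_extensionality; intro; unfold x1, xx1, kk1; ring).
    assert (F2 : x2 = fun t => 1 * (0 + a1 * (2 / kappa * s t) - a2 * (2 / kappa * c t)) + 1 * f2 t)
      by (apply functional_extensionality; intro; unfold x2, xx2, kk2, k2; ring).
    assert (U1 : pc T (fun t => a1 * c t + a2 * s t)) by (destruct MD; pcs).
    assert (U2 : pc T (fun t => 0 + a1 * (2 / kappa * s t) - a2 * (2 / kappa * c t))) by (destruct MD; pcs).
    rewrite F1, F2.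
    destruct (pr_lin T K kappa c s TP MD 1 1 _ _ _ _ U1 U2 Pf1 Pf2) as [-> ->].
    rewrite Z1, Z2, Y8, Y9. split; ring.
  - intro t. destruct Ha as [A1 A2]. destruct (kk_bound a1 a2 A t A1 A2) as [_ [_ [B1 B2]]].
    assert (BB := HXb (Cn * sz * sz) _ _ G1 G2 (fun t => NN_bound theta _ _ t (proj1 (Q t)) (proj2 (Q t))) t).
    replace (W * eps ^ 2) with (M * (Cn * sz * sz)) by (unfold W, sz; ring).
    destruct BB as [_ [_ [B3 B4]]].
    split; [unfold v1|unfold v2]; apply ab_plus; auto.
Qed.
End CorrectedOrbit.

(** Back to the fixed frame: [rot1], [rot2] apply the matrix [e^(J (theta + t))]. *)
Definition rot1 (theta : R) (y1 y2 : R -> R) (t : R) : R := cos (theta + t) * y1 t + sin (theta + t) * y2 t.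
Definition rot2 (theta : R) (y1 y2 : R -> R) (t : R) : R := - sin (theta + t) * y1 t + cos (theta + t) * y2 t.

Lemma rot_pc theta y1 y2 : pc T y1 -> pc T y2 -> pc T (rot1 theta y1 y2) /\ pc T (rot2 theta y1 y2).
Proof.
  intros Y1 Y2. destruct (cos_shift_pc theta) as [C1 C2]. unfold rot1, rot2. split.
  - apply (pc_plus T (fun t => cos (theta + t) * y1 t) (fun t => sin (theta + t) * y2 t)).
    + apply (pc_mult T (fun t => cos (theta + t))); auto.
    + apply (pc_mult T (fun t => sin (theta + t))); auto.
  - apply (pc_plus T (fun t => - sin (theta + t) * y1 t) (fun t => cos (theta + t) * y2 t)).
    + apply (pc_mult T (fun t => - sin (theta + t))); auto. apply (pc_opp T (fun t => sin (theta + t))); auto.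
    + apply (pc_mult T (fun t => cos (theta + t))); auto.
Qed.

(** Differentiating the rotation adds [J y = (y2, - y1)] to the velocity in the moving frame. *)
Lemma rot_derive theta (y1 y2 dy1 dy2 : R -> R) (t : R) :
  is_derive y1 t (dy1 t) -> is_derive y2 t (dy2 t) ->
  is_derive (rot1 theta y1 y2) t (rot1 theta (fun t => dy1 t + y2 t) (fun t => dy2 t - y1 t) t) /\
  is_derive (rot2 theta y1 y2) t (rot2 theta (fun t => dy1 t + y2 t) (fun t => dy2 t - y1 t) t).
Proof.
  intros H1 H2.
  assert (Dc : is_derive (fun t => cos (theta + t)) t (- sin (theta + t))) by (auto_derive; auto; ring).
  assert (Ds : is_derive (fun t => sin (theta + t)) t (cos (theta + t))) by (auto_derive; auto; ring).
  assert (Dn : is_derive (fun t => - sin (theta + t)) t (- cos (theta + t))) by (auto_derive; auto; ring).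
  unfold rot1, rot2. split.
  - evar_last.
    + apply (is_derive_plus (V:=R_NormedModule)).
      * apply (is_derive_mult (fun t => cos (theta + t)) y1 t _ _ Dc H1). intros; apply Rmult_comm.
      * apply (is_derive_mult (fun t => sin (theta + t)) y2 t _ _ Ds H2). intros; apply Rmult_comm.
    + unfold plus, mult; simpl. ring.
  - evar_last.
    + apply (is_derive_plus (V:=R_NormedModule)).
      * apply (is_derive_mult (fun t => - sin (theta + t)) y1 t _ _ Dn H1). intros; apply Rmult_comm.
      * apply (is_derive_mult (fun t => cos (theta + t)) y2 t _ _ Dc H2). intros; apply Rmult_comm.
    + unfold plus, mult; simpl. ring.
Qed.

Lemma rot_lip theta theta' y1 y2 z1 z2 t V D r :
  Rabs (z1 t) <= V -> Rabs (z2 t) <= V -> Rabs (y1 t - z1 t) <= D -> Rabs (y2 t - z2 t) <= D ->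
  Rabs (cos theta - cos theta') + Rabs (sin theta - sin theta') <= r ->
  Rabs (rot1 theta y1 y2 t - rot1 theta' z1 z2 t) <= 2 * D + 2 * (r * V) /\
  Rabs (rot2 theta y1 y2 t - rot2 theta' z1 z2 t) <= 2 * D + 2 * (r * V).
Proof.
  intros H1 H2 H3 H4 Hr. destruct (rot_diff theta theta' t) as [Rc Rs].
  assert (Rc' : Rabs (cos (theta + t) - cos (theta' + t)) <= r) by lra.
  assert (Rs' : Rabs (sin (theta + t) - sin (theta' + t)) <= r) by lra.
  assert (Hc : Rabs (cos (theta + t)) <= 1) by (apply Rabs_le; apply COS_bound).
  assert (Hs : Rabs (sin (theta + t)) <= 1) by (apply Rabs_le; apply SIN_bound).
  clear Rc Rs Hr. unfold rot1, rot2. split.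
  - replace (cos (theta + t) * y1 t + sin (theta + t) * y2 t - (cos (theta' + t) * z1 t + sin (theta' + t) * z2 t)) with
     (cos (theta + t) * (y1 t - z1 t) + sin (theta + t) * (y2 t - z2 t)
      + ((cos (theta + t) - cos (theta' + t)) * z1 t + (sin (theta + t) - sin (theta' + t)) * z2 t)) by ring.
    eapply Rle_trans; [apply ab_plus; apply ab_plus; apply ab_mult; eassumption|]. lra.
  - replace (- sin (theta + t) * y1 t + cos (theta + t) * y2 t - (- sin (theta' + t) * z1 t + cos (theta' + t) * z2 t)) with
     (cos (theta + t) * (y2 t - z2 t) - sin (theta + t) * (y1 t - z1 t)
      + ((cos (theta + t) - cos (theta' + t)) * z2 t - (sin (theta + t) - sin (theta' + t)) * z1 t)) by ring.
    eapply Rle_trans; [apply ab_plus; apply ab_minus; apply ab_mult; eassumption|]. lra.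
Qed.

Lemma gap_rot theta (y1 y2 : R -> R) j t :
  gap eps b1 b2 (rot1 theta (fun t => 1 + y1 t) y2) (rot2 theta (fun t => 1 + y1 t) y2) j t =
  sq (y1 t - eps * eta1 theta b1 b2 j t) (y2 t - eps * eta2 theta b1 b2 j t).
Proof.
  assert (Q := sin2_cos2 (theta + t)). unfold Rsqr in Q.
  unfold gap, sq, rot1, rot2, eta1, eta2.
  set (cc := cos (theta + t)) in *. set (ss := sin (theta + t)) in *.
  set (u := 1 + y1 t). set (v := y2 t). set (p1 := b1 j t). set (p2 := b2 j t).
  transitivity ((ss * ss + cc * cc) * (u * u + v * v) - 2 * eps * (p1 * (cc * u + ss * v) + p2 * (- ss * u + cc * v))
    + eps * eps * (p1 * p1 + p2 * p2) - 1); [ring|].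
  transitivity ((u * u + v * v) - 2 * eps * (p1 * (cc * u + ss * v) + p2 * (- ss * u + cc * v))
    + eps * eps * ((ss * ss + cc * cc) * (p1 * p1 + p2 * p2)) - 1); [rewrite Q; ring|unfold u; ring].
Qed.

Section RotatedOrbit.
Variables (theta a1 a2 : R) (f1 f2 : R -> R).
Hypothesis HS : reduced_sol theta a1 a2 f1 f2.
Let h1 := hh1 theta a1 a2 f1 f2.
Let h2 := hh2 theta a1 a2 f1 f2.
Let l0 := pr0 T h2.
Let l1 := pr1 T kappa c s h1 h2.
Let l2 := pr2 T kappa c s h1 h2.
Notation y1 := (x1 a1 a2 f1).
Notation y2 := (x2 a1 a2 f2).
Notation w1 := (v1 theta a1 a2 f1 f2).
Notation w2 := (v2 theta a1 a2 f1 f2).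
(** The part of the force on the kernel that the projected equation leaves over. [E1], [E2] express
    it in the fixed frame, with the sign that makes it the residual in [Q'' = E - force]. *)
Definition lam1 (t : R) : R := l1 * c t + l2 * s t.
Definition lam2 (t : R) : R := l0 + l1 * (k2 * s t) - l2 * (k2 * c t).
Definition Q1 : R -> R := rot1 theta (fun t => 1 + y1 t) y2.
Definition Q2 : R -> R := rot2 theta (fun t => 1 + y1 t) y2.
Definition P1 : R -> R := rot1 theta (fun t => w1 t + y2 t) (fun t => w2 t - (1 + y1 t)).
Definition P2 : R -> R := rot2 theta (fun t => w1 t + y2 t) (fun t => w2 t - (1 + y1 t)).
Definition E1 : R -> R := fun t => - rot1 theta lam1 lam2 t.
Definition E2 : R -> R := fun t => - rot2 theta lam1 lam2 t.

(** The vanishing first moments make the linear part of the force independent of the primaries, so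
    the whole force is the linearisation at the circle minus [h1], [h2]. *)
Lemma force_rot t :
  force1 b eps n m b1 b2 Q1 Q2 t = rot1 theta (fun t => 1 - (B - 1) * y1 t - h1 t) (fun t => y2 t - h2 t) t /\
  force2 b eps n m b1 b2 Q1 Q2 t = rot2 theta (fun t => 1 - (B - 1) * y1 t - h1 t) (fun t => y2 t - h2 t) t.
Proof.
  destruct (Zb t) as [Z1 Z2]. unfold mom1 in Z1, Z2.
  assert (QQ := sin2_cos2 (theta + t)). unfold Rsqr in QQ.
  set (pj := fun j => pw b (sq (y1 t - eps * eta1 theta b1 b2 j t) (y2 t - eps * eta2 theta b1 b2 j t))).
  set (F1 := rsum n (fun j => m j * ((1 + (y1 t - eps * eta1 theta b1 b2 j t)) * pj j))).
  set (F2 := rsum n (fun j => m j * ((y2 t - eps * eta2 theta b1 b2 j t) * pj j))).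
  assert (Ze1 : rsum n (fun j => m j * eta1 theta b1 b2 j t) = 0).
  { unfold eta1. rewrite (rsum_ext n _ (fun j => cos (theta + t) * (m j * b1 j t) - sin (theta + t) * (m j * b2 j t))) by (intros; ring).
    rewrite rsum_minus, !rsum_scal, Z1, Z2. ring. }
  assert (Ze2 : rsum n (fun j => m j * eta2 theta b1 b2 j t) = 0).
  { unfold eta2. rewrite (rsum_ext n _ (fun j => cos (theta + t) * (m j * b2 j t) + sin (theta + t) * (m j * b1 j t))) by (intros; ring).
    rewrite rsum_plus, !rsum_scal, Z1, Z2. ring. }
  assert (H1 : 1 - (B - 1) * y1 t - h1 t = F1).
  { unfold h1, hh1, NN1.
    rewrite (rsum_ext n _
      (fun j => m j * ((1 + (y1 t - eps * eta1 theta b1 b2 j t)) * pj j) + ((B - 1) * y1 t - 1) * m j - (B - 1) * eps * (m j * eta1 theta b1 b2 j t))).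
    - rewrite rsum_minus, rsum_plus, !rsum_scal, Hm1, Ze1. fold F1. ring.
    - intros j _. unfold pj, nl1, x1, x2, b. field. }
  assert (H2 : y2 t - h2 t = F2).
  { unfold h2, hh2, NN2.
    rewrite (rsum_ext n _
      (fun j => m j * ((y2 t - eps * eta2 theta b1 b2 j t) * pj j) - y2 t * m j + eps * (m j * eta2 theta b1 b2 j t))).
    - rewrite rsum_plus, rsum_minus, !rsum_scal, Hm1, Ze2. fold F2. ring.
    - intros j _. unfold pj, nl2, x1, x2. ring. }
  unfold rot1, rot2. rewrite H1, H2. unfold force1, force2, F1, F2. split.
  - rewrite <- !rsum_scal, <- rsum_plus. apply rsum_ext. intros j _.
    unfold Q1, Q2. rewrite gap_rot. fold (pj j). unfold rot1, rot2, eta1, eta2.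
    transitivity (m j * (pj j * ((cos (theta + t) * (1 + y1 t) + sin (theta + t) * y2 t) - eps * ((sin (theta + t) * sin (theta + t) + cos (theta + t) * cos (theta + t)) * b1 j t)))); [rewrite QQ; ring|ring].
  - rewrite <- !rsum_scal, <- rsum_plus. apply rsum_ext. intros j _.
    unfold Q1, Q2. rewrite gap_rot. fold (pj j). unfold rot1, rot2, eta1, eta2.
    transitivity (m j * (pj j * ((- sin (theta + t) * (1 + y1 t) + cos (theta + t) * y2 t) - eps * ((sin (theta + t) * sin (theta + t) + cos (theta + t) * cos (theta + t)) * b2 j t)))); [rewrite QQ; ring|ring].
Qed.

Lemma lam_pc : pc T lam1 /\ pc T lam2.
Proof. destruct MD. unfold lam1, lam2. split; pcs. Qed.

Lemma rot_facts :
  pc T Q1 /\ pc T Q2 /\ pc T P1 /\ pc T P2 /\ pc T E1 /\ pc T E2 /\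
  (forall t : R, is_derive Q1 t (P1 t)) /\ (forall t : R, is_derive Q2 t (P2 t)) /\
  (forall t : R, is_derive P1 t (E1 t - force1 b eps n m b1 b2 Q1 Q2 t)) /\
  (forall t : R, is_derive P2 t (E2 t - force2 b eps n m b1 b2 Q1 Q2 t)) /\
  (forall j t, (j < n)%nat -> Rabs (gap eps b1 b2 Q1 Q2 j t) <= 3 * sz).
Proof.
  destruct (sol_facts theta a1 a2 f1 f2 HS) as [A1 [A2 [A3 [A4 [A5 [A6 [A7 [A8 [A9 [A10 [A11 _]]]]]]]]]]].
  destruct lam_pc as [L1 L2].
  assert (Y1 : pc T (fun t => 1 + y1 t)) by pcs.
  assert (V1 : pc T (fun t => w1 t + y2 t)) by pcs. assert (V2 : pc T (fun t => w2 t - (1 + y1 t))) by pcs.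
  destruct (rot_pc theta _ _ Y1 A2) as [R1 R2]. destruct (rot_pc theta _ _ V1 V2) as [R3 R4].
  destruct (rot_pc theta _ _ L1 L2) as [R5 R6].
  assert (dy1 : forall t : R, is_derive (fun t => 1 + y1 t) t (w1 t)).
  { intro t. apply (derive_ext_eq (fun t => 1 + y1 t) _ t (0 + w1 t)); [reflexivity| |ring].
    apply (is_derive_plus (V:=R_NormedModule) (fun _ => 1) y1); [apply (is_derive_const (K:=R_AbsRing) (V:=R_NormedModule))|apply A8]. }
  assert (dV1 : forall t : R, is_derive (fun t => w1 t + y2 t) t
     (red1 T kappa c s h1 h2 t - 2 * w2 t + B * y1 t + w2 t)).
  { intro t. apply (is_derive_plus (V:=R_NormedModule) w1 y2); [apply A10|apply A9]. }
  assert (dV2 : forall t : R, is_derive (fun t => w2 t - (1 + y1 t)) t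
     (red2 T kappa c s h1 h2 t + 2 * w1 t - w1 t)).
  { intro t. apply (is_derive_minus (V:=R_NormedModule) w2 (fun t => 1 + y1 t)); [apply A11|apply dy1]. }
  split; [exact R1|split; [exact R2|split; [exact R3|split; [exact R4|]]]].
  split; [exact (pc_opp T _ R5)|split; [exact (pc_opp T _ R6)|]].
  split; [intro t; exact (proj1 (rot_derive theta _ _ w1 w2 t (dy1 t) (A9 t)))|].
  split; [intro t; exact (proj2 (rot_derive theta _ _ w1 w2 t (dy1 t) (A9 t)))|].
  split; [|split].
  - intro t. assert (D := proj1 (rot_derive theta _ _ (fun t => red1 T kappa c s h1 h2 t - 2 * w2 t + B * y1 t + w2 t)
      (fun t => red2 T kappa c s h1 h2 t + 2 * w1 t - w1 t) t (dV1 t) (dV2 t))).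
    refine (derive_ext_eq P1 P1 t _ _ (fun _ => eq_refl) D _).
    rewrite (proj1 (force_rot t)). unfold E1, rot1, lam1, lam2, red1, red2. fold k2 l0 l1 l2. ring.
  - intro t. assert (D := proj2 (rot_derive theta _ _ (fun t => red1 T kappa c s h1 h2 t - 2 * w2 t + B * y1 t + w2 t)
      (fun t => red2 T kappa c s h1 h2 t + 2 * w1 t - w1 t) t (dV1 t) (dV2 t))).
    refine (derive_ext_eq P2 P2 t _ _ (fun _ => eq_refl) D _).
    rewrite (proj2 (force_rot t)). unfold E2, rot2, lam1, lam2, red1, red2. fold k2 l0 l1 l2. ring.
  - intros j t Hj. unfold Q1, Q2. rewrite gap_rot. destruct (A7 t) as [B1 B2].
    destruct (dd_bound theta _ _ j t Hj B1 B2) as [C1 C2]. exact (sq_bound _ _ _ C1 C2 Hsz).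
Qed.
End RotatedOrbit.

(** [CX] is the Lipschitz constant of position and velocity in the rotating frame, [CV] bounds their
    size there, and [CQ] is the resulting constant in the fixed frame, where a change of angle also
    rotates the whole orbit. *)
Let CL := 2 * (2 * Kb + 2 * Hb).
Let CX := 2 * Kb + 2 * kappa + 4 + CL.
Let CV := 2 * (kappa * A) + 4 * A + 2.
Let CQ := 4 * CX + 2 * CV.

Lemma CX_pos : 0 < CX /\ 0 < CV /\ 0 < CQ.
Proof.
  assert (K0 := k2_pos). destruct MD. assert (0 <= kappa * A) by (apply Rmult_le_pos; lra).
  unfold CQ, CX, CL, CV, Kb. lra.
Qed.

(** * First variation of the reduced action *)

Section Comparison.
Variables (theta a1 a2 : R) (f1 f2 : R -> R) (theta' a1' a2' : R) (f1' f2' : R -> R).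
Hypothesis HS : reduced_sol theta a1 a2 f1 f2.
Hypothesis HS' : reduced_sol theta' a1' a2' f1' f2'.
Let dp := dpar theta' a1' a2' theta a1 a2.
Notation h1 := (hh1 theta a1 a2 f1 f2).
Notation h2 := (hh2 theta a1 a2 f1 f2).

Lemma dp_parts : 0 <= dp /\ Rabs (cos theta' - cos theta) + Rabs (sin theta' - sin theta) <= dp /\
  Rabs (a1' - a1) <= dp /\ Rabs (a2' - a2) <= dp.
Proof.
  unfold dp, dpar. assert (V1 := Rabs_pos (cos theta' - cos theta)). assert (V2 := Rabs_pos (sin theta' - sin theta)).
  assert (V3 := Rabs_pos (a1' - a1)). assert (V4 := Rabs_pos (a2' - a2)). lra.
Qed.

Lemma sol_compare t :
  Rabs (Q1 theta' a1' a2' f1' f2' t - Q1 theta a1 a2 f1 f2 t) <= CQ * dp /\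
  Rabs (Q2 theta' a1' a2' f1' f2' t - Q2 theta a1 a2 f1 f2 t) <= CQ * dp /\
  Rabs (P1 theta' a1' a2' f1' f2' t - P1 theta a1 a2 f1 f2 t) <= CQ * dp /\
  Rabs (P2 theta' a1' a2' f1' f2' t - P2 theta a1 a2 f1 f2 t) <= CQ * dp.
Proof.
  destruct dp_parts as [dp0 [Hr [H1 H2]]]. destruct CX_pos as [X0 [V0 _]].
  assert (SL := sol_lip theta' a1' a2' f1' f2' theta a1 a2 f1 f2 HS' HS t). cbv zeta in SL. fold dp CL in SL.
  destruct SL as [L1 [L2 [L3 L4]]].
  destruct (kk_bound (a1' - a1) (a2' - a2) dp t H1 H2) as [K1 [K2 [K3 K4]]].
  destruct (sol_facts theta a1 a2 f1 f2 HS) as [_ [_ [_ [_ [_ [_ [A7 [_ [_ [_ [_ [_ [_ A14]]]]]]]]]]]]].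
  destruct (A7 t) as [B1 B2]. destruct (A14 t) as [B3 B4].
  assert (ES := eps_small). assert (KP := k2_pos). assert (WN := W_nonneg).
  assert (kap0 : 0 < kappa) by (destruct MD; auto).
  assert (kA : 0 <= kappa * A) by (apply Rmult_le_pos; lra). assert (KA : 0 <= Kb * A) by (apply Rmult_le_pos; unfold Kb; lra).
  assert (kdp : 0 <= kappa * dp) by (apply Rmult_le_pos; lra). assert (Kdp : 0 <= Kb * dp) by (apply Rmult_le_pos; unfold Kb; lra).
  assert (CLdp : 0 <= CL * dp) by (apply Rmult_le_pos; [unfold CL, Kb; lra|lra]).
  assert (D1x : Rabs (x1 a1' a2' f1' t - x1 a1 a2 f1 t) <= CX * dp).
  { unfold x1, xx1. replace (kk1 a1' a2' t + f1' t - (kk1 a1 a2 t + f1 t)) with (kk1 (a1' - a1) (a2' - a2) t + (f1' t - f1 t)) by (unfold kk1; ring).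
    eapply Rle_trans; [apply ab_plus; eassumption|]. unfold CX. lra. }
  assert (D2x : Rabs (x2 a1' a2' f2' t - x2 a1 a2 f2 t) <= CX * dp).
  { unfold x2, xx2. replace (kk2 a1' a2' t + f2' t - (kk2 a1 a2 t + f2 t)) with (kk2 (a1' - a1) (a2' - a2) t + (f2' t - f2 t)) by (unfold kk2; ring).
    eapply Rle_trans; [apply ab_plus; eassumption|]. unfold CX. lra. }
  assert (D1v : Rabs (v1 theta' a1' a2' f1' f2' t - v1 theta a1 a2 f1 f2 t) <= CX * dp).
  { unfold v1. replace (kd1 a1' a2' t + D1 (hh1 theta' a1' a2' f1' f2') (hh2 theta' a1' a2' f1' f2') t - (kd1 a1 a2 t + D1 h1 h2 t)) with
      (kd1 (a1' - a1) (a2' - a2) t + (D1 (hh1 theta' a1' a2' f1' f2') (hh2 theta' a1' a2' f1' f2') t - D1 h1 h2 t)) by (unfold kd1; ring).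
    eapply Rle_trans; [apply ab_plus; eassumption|]. unfold CX. lra. }
  assert (D2v : Rabs (v2 theta' a1' a2' f1' f2' t - v2 theta a1 a2 f1 f2 t) <= CX * dp).
  { unfold v2. replace (kd2 a1' a2' t + D2 (hh1 theta' a1' a2' f1' f2') (hh2 theta' a1' a2' f1' f2') t - (kd2 a1 a2 t + D2 h1 h2 t)) with
      (kd2 (a1' - a1) (a2' - a2) t + (D2 (hh1 theta' a1' a2' f1' f2') (hh2 theta' a1' a2' f1' f2') t - D2 h1 h2 t)) by (unfold kd2; ring).
    eapply Rle_trans; [apply ab_plus; eassumption|]. unfold CX. lra. }
  set (dX := CX * dp) in *. assert (dX0 : 0 <= dX) by (unfold dX; apply Rmult_le_pos; lra).
  assert (RQ := rot_lip theta' theta (fun t => 1 + x1 a1' a2' f1' t) (x2 a1' a2' f2') (fun t => 1 + x1 a1 a2 f1 t) (x2 a1 a2 f2) t CV (2 * dX) dp).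
  assert (RP := rot_lip theta' theta (fun t => v1 theta' a1' a2' f1' f2' t + x2 a1' a2' f2' t) (fun t => v2 theta' a1' a2' f1' f2' t - (1 + x1 a1' a2' f1' t))
     (fun t => v1 theta a1 a2 f1 f2 t + x2 a1 a2 f2 t) (fun t => v2 theta a1 a2 f1 f2 t - (1 + x1 a1 a2 f1 t)) t CV (2 * dX) dp).
  replace (2 * (2 * dX) + 2 * (dp * CV)) with (CQ * dp) in RQ, RP by (unfold CQ, dX; ring).
  assert (One : Rabs 1 <= 1) by (rewrite Rabs_R1; lra).
  unfold Q1, Q2, P1, P2.
  destruct RQ as [U1 U2].
  { eapply Rle_trans; [apply ab_plus; [exact One|exact B1]|]. unfold CV. lra. }
  { unfold CV. lra. }
  { replace (1 + x1 a1' a2' f1' t - (1 + x1 a1 a2 f1 t)) with (x1 a1' a2' f1' t - x1 a1 a2 f1 t) by ring. lra. }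
  { lra. }
  { exact Hr. }
  destruct RP as [U3 U4].
  { eapply Rle_trans; [apply ab_plus; [exact B3|exact B2]|]. unfold CV. lra. }
  { eapply Rle_trans; [apply ab_minus; [exact B4|apply ab_plus; [exact One|exact B1]]|]. unfold CV. lra. }
  { replace (v1 theta' a1' a2' f1' f2' t + x2 a1' a2' f2' t - (v1 theta a1 a2 f1 f2 t + x2 a1 a2 f2 t)) with
     ((v1 theta' a1' a2' f1' f2' t - v1 theta a1 a2 f1 f2 t) + (x2 a1' a2' f2' t - x2 a1 a2 f2 t)) by ring.
    eapply Rle_trans; [apply ab_plus; eassumption|]. lra. }
  { replace (v2 theta' a1' a2' f1' f2' t - (1 + x1 a1' a2' f1' t) - (v2 theta a1 a2 f1 f2 t - (1 + x1 a1 a2 f1 t))) with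
     ((v2 theta' a1' a2' f1' f2' t - v2 theta a1 a2 f1 f2 t) - (x1 a1' a2' f1' t - x1 a1 a2 f1 t)) by ring.
    eapply Rle_trans; [apply ab_minus; eassumption|]. lra. }
  { exact Hr. }
  auto.
Qed.

Definition act (theta a1 a2 : R) (f1 f2 : R -> R) : R :=
  action T b eps n m b1 b2 (Q1 theta a1 a2 f1 f2) (Q2 theta a1 a2 f1 f2) (P1 theta a1 a2 f1 f2) (P2 theta a1 a2 f1 f2).

(** Minus the integral of the residual against the displacement, in the rotating frame of the first
    orbit, where only the difference of the angles enters. *)
Definition pairing : R := Int0 T (fun t =>
   lam1 theta a1 a2 f1 f2 t * (cos (theta' - theta) * (1 + x1 a1' a2' f1' t) + sin (theta' - theta) * x2 a1' a2' f2' t - (1 + x1 a1 a2 f1 t))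
 + lam2 theta a1 a2 f1 f2 t * (- sin (theta' - theta) * (1 + x1 a1' a2' f1' t) + cos (theta' - theta) * x2 a1' a2' f2' t - x2 a1 a2 f2 t)).

Lemma pairing_eq :
  Int0 T (fun t => E1 theta a1 a2 f1 f2 t * (Q1 theta' a1' a2' f1' f2' t - Q1 theta a1 a2 f1 f2 t)
     + E2 theta a1 a2 f1 f2 t * (Q2 theta' a1' a2' f1' f2' t - Q2 theta a1 a2 f1 f2 t)) = - pairing.
Proof.
  unfold pairing. destruct (sol_facts theta a1 a2 f1 f2 HS) as [A1 [A2 _]].
  destruct (sol_facts theta' a1' a2' f1' f2' HS') as [A1' [A2' _]].
  destruct (lam_pc theta a1 a2 f1 f2) as [L1 L2].
  rewrite <- Int0_opp by cts. apply Int0_ext. intro t.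
  unfold E1, E2, Q1, Q2, rot1, rot2.
  replace (theta' - theta) with ((theta' + t) - (theta + t)) by ring.
  rewrite cos_minus, sin_minus.
  assert (QQ := sin2_cos2 (theta + t)). unfold Rsqr in QQ.
  set (cc := cos (theta + t)) in *. set (ss := sin (theta + t)) in *.
  set (cc' := cos (theta' + t)). set (ss' := sin (theta' + t)).
  set (u := 1 + x1 a1 a2 f1 t). set (v := x2 a1 a2 f2 t). set (u' := 1 + x1 a1' a2' f1' t). set (v' := x2 a1' a2' f2' t).
  set (g1 := lam1 theta a1 a2 f1 f2 t). set (g2 := lam2 theta a1 a2 f1 f2 t).
  transitivity (- (g1 * ((cc' * cc + ss' * ss) * u' + (ss' * cc - cc' * ss) * v' - (ss * ss + cc * cc) * u)
     + g2 * (- (ss' * cc - cc' * ss) * u' + (cc' * cc + ss' * ss) * v' - (ss * ss + cc * cc) * v))); [ring|].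
  rewrite QQ. ring.
Qed.
End Comparison.

(** Here the multipliers become derivatives of the action: the residual along a corrected orbit lies
    in the kernel, so to first order the change of the action sees the multipliers and the
    displacement only. The correction enters through its Lipschitz dependence. *)
Lemma act_expand : exists C, 0 < C /\ forall theta a1 a2 f1 f2 theta' a1' a2' f1' f2',
  reduced_sol theta a1 a2 f1 f2 -> reduced_sol theta' a1' a2' f1' f2' ->
  Rabs (act theta' a1' a2' f1' f2' - act theta a1 a2 f1 f2 - pairing theta a1 a2 f1 f2 theta' a1' a2' f1' f2')
    <= C * (dpar theta' a1' a2' theta a1 a2 * dpar theta' a1' a2' theta a1 a2).
Proof.
  destruct (action_expand T b eps n m b1 b2 T_pos ltac:(unfold b; lra) Hm Hm1 Pb) as [C [HC HE]].
  destruct CX_pos as [_ [_ HQ]].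
  exists (C * (CQ * CQ)). split; [apply Rmult_lt_0_compat; [auto|nra]|].
  intros theta a1 a2 f1 f2 theta' a1' a2' f1' f2' HS HS'.
  destruct (rot_facts theta a1 a2 f1 f2 HS) as [R1 [R2 [R3 [R4 [R5 [R6 [R7 [R8 [R9 [R10 R11]]]]]]]]]].
  destruct (rot_facts theta' a1' a2' f1' f2' HS') as [S1 [S2 [S3 [S4 [_ [_ [S7 [S8 [_ [_ S11]]]]]]]]]].
  assert (SC := sol_compare theta a1 a2 f1 f2 theta' a1' a2' f1' f2' HS HS').
  set (dp := dpar theta' a1' a2' theta a1 a2) in *.
  assert (S3z : 3 * sz <= 1 / 2) by lra.
  assert (Z := HE _ _ _ _ _ _ _ _ _ _ (CQ * dp) R1 R2 R3 R4 S1 S2 S3 S4 R5 R6 R7 R8 S7 S8 R9 R10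
    (fun j t Hj => Rle_trans _ _ _ (R11 j t Hj) S3z) (fun j t Hj => Rle_trans _ _ _ (S11 j t Hj) S3z)
    (fun t => proj1 (SC t)) (fun t => proj1 (proj2 (SC t))) (fun t => proj1 (proj2 (proj2 (SC t)))) (fun t => proj2 (proj2 (proj2 (SC t))))).
  rewrite (pairing_eq theta a1 a2 f1 f2 theta' a1' a2' f1' f2' HS HS') in Z.
  unfold act. replace (C * (CQ * CQ) * (dp * dp)) with (C * (CQ * dp * (CQ * dp))) by ring. exact Z.
Qed.

Definition mult1 theta a1 a2 f1 f2 : R := pr1 T kappa c s (hh1 theta a1 a2 f1 f2) (hh2 theta a1 a2 f1 f2).
Definition mult2 theta a1 a2 f1 f2 : R := pr2 T kappa c s (hh1 theta a1 a2 f1 f2) (hh2 theta a1 a2 f1 f2).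

Lemma pairing_bound : exists L, 0 < L /\ forall theta a1 a2 f1 f2 theta' a1' a2' f1' f2',
  reduced_sol theta a1 a2 f1 f2 -> reduced_sol theta' a1' a2' f1' f2' ->
  Rabs (pairing theta a1 a2 f1 f2 theta' a1' a2' f1' f2') <= L * dpar theta' a1' a2' theta a1 a2.
Proof.
  assert (TP := T_pos). assert (K0 := k2_pos). destruct CX_pos as [_ [_ HQ]].
  set (al := T * (1 + 2 / kappa) / mode_norm2 T kappa).
  assert (Hal : 0 <= al).
  { unfold al. apply Rdiv_le_0_compat; [|apply (msq_pos T kappa TP)].
    apply Rmult_le_pos; [lra|fold k2; lra]. }
  assert (SS0 : 0 <= sz * sz) by apply Rle_0_sqr.
  set (Bn := Cn * sz * sz).
  assert (HBn : 0 <= Bn) by (unfold Bn; rewrite Rmult_assoc; apply Rmult_le_pos; lra).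
  assert (H0 : 0 <= al * Bn) by (apply Rmult_le_pos; lra).
  assert (H0' : 0 <= k2 * (al * Bn)) by (apply Rmult_le_pos; lra).
  set (EB := 2 * (al * Bn) + (Bn + 2 * (k2 * (al * Bn)))).
  assert (HEB : 0 <= EB) by (unfold EB; lra).
  exists (T * (2 * (EB * CQ)) + 1). split.
  { assert (0 <= EB * CQ) by (apply Rmult_le_pos; lra).
    assert (0 <= T * (2 * (EB * CQ))) by (apply Rmult_le_pos; lra). lra. }
  intros theta a1 a2 f1 f2 theta' a1' a2' f1' f2' HS HS'.
  assert (SC := sol_compare theta a1 a2 f1 f2 theta' a1' a2' f1' f2' HS HS').
  destruct (dp_parts theta a1 a2 theta' a1' a2') as [dp0 _].
  set (dp := dpar theta' a1' a2' theta a1 a2) in *.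
  destruct (rot_facts theta a1 a2 f1 f2 HS) as [R1 [R2 [_ [_ [R5 [R6 _]]]]]].
  destruct (rot_facts theta' a1' a2' f1' f2' HS') as [S1 [S2 _]].
  assert (PE := pairing_eq theta a1 a2 f1 f2 theta' a1' a2' f1' f2' HS HS').
  replace (pairing theta a1 a2 f1 f2 theta' a1' a2' f1' f2') with (- - pairing theta a1 a2 f1 f2 theta' a1' a2' f1' f2') by ring.
  rewrite <- PE, Rabs_Ropp.
  apply Rle_trans with (T * (2 * (EB * (CQ * dp)))); [|assert (0 <= dp) by auto; nra].
  apply Int0_bound; [lra|cts|]. intro t. destruct (SC t) as [D1' [D2' _]].
  destruct (sol_facts theta a1 a2 f1 f2 HS) as [_ [_ [_ [_ [A5 [A6 [A7 _]]]]]]].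
  assert (NB : forall t, Rabs (hh1 theta a1 a2 f1 f2 t) <= Bn /\ Rabs (hh2 theta a1 a2 f1 f2 t) <= Bn).
  { intro u. destruct (A7 u). apply NN_bound; auto. }
  destruct (pr_bound T K kappa c s TP MD Bn _ _ A5 A6 NB) as [B1 B2]. fold al in B1, B2.
  assert (B0 : Rabs (pr0 T (hh2 theta a1 a2 f1 f2)) <= Bn) by (apply (mean_bound T TP); [cts|intro u; apply NB]).
  destruct (md_bound _ _ _ _ _ MD t) as [Hc Hs].
  assert (Hcc : Rabs (cos (theta + t)) <= 1) by (apply Rabs_le; apply COS_bound).
  assert (Hss : Rabs (sin (theta + t)) <= 1) by (apply Rabs_le; apply SIN_bound).
  assert (Hk2 : Rabs k2 <= k2) by (rewrite Rabs_right; lra).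
  assert (L1 : Rabs (lam1 theta a1 a2 f1 f2 t) <= 2 * (al * Bn)).
  { unfold lam1. eapply Rle_trans; [apply ab_plus; apply ab_mult; eassumption|]. lra. }
  assert (L2 : Rabs (lam2 theta a1 a2 f1 f2 t) <= Bn + 2 * (k2 * (al * Bn))).
  { unfold lam2. eapply Rle_trans; [apply ab_minus; [apply ab_plus; [exact B0|]|]; apply ab_mult; [exact B1|apply ab_mult; eassumption|exact B2|apply ab_mult; eassumption]|]. lra. }
  assert (BE1 : Rabs (E1 theta a1 a2 f1 f2 t) <= EB).
  { unfold E1, rot1. eapply Rle_trans; [apply ab_opp, ab_plus; apply ab_mult; eassumption|]. unfold EB; lra. }
  assert (BE2 : Rabs (E2 theta a1 a2 f1 f2 t) <= EB).
  { unfold E2, rot2. eapply Rle_trans; [apply ab_opp, ab_plus; apply ab_mult; [apply ab_opp| | | ]; eassumption|]. unfold EB; lra. }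
  eapply Rle_trans; [apply ab_plus; apply ab_mult; eassumption|]. lra.
Qed.

Lemma act_lip : exists L, 0 < L /\ forall theta a1 a2 f1 f2 theta' a1' a2' f1' f2',
  reduced_sol theta a1 a2 f1 f2 -> reduced_sol theta' a1' a2' f1' f2' ->
  Rabs (act theta' a1' a2' f1' f2' - act theta a1 a2 f1 f2) <= L * dpar theta' a1' a2' theta a1 a2.
Proof.
  destruct pairing_bound as [L [HL0 HLb]]. destruct act_expand as [C [HC HE]].
  exists (L + C * (4 + 4 * A)). split; [assert (0 <= C * (4 + 4 * A)) by (apply Rmult_le_pos; lra); lra|].
  intros theta a1 a2 f1 f2 theta' a1' a2' f1' f2' HS HS'.
  specialize (HLb _ _ _ _ _ _ _ _ _ _ HS HS'). specialize (HE _ _ _ _ _ _ _ _ _ _ HS HS').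
  destruct (dp_parts theta a1 a2 theta' a1' a2') as [dp0 _].
  (* The parameter set is bounded, so the quadratic error is absorbed into a linear one. *)
  assert (dpm : dpar theta' a1' a2' theta a1 a2 <= 4 + 4 * A).
  { destruct HS as [[A1 A2] _], HS' as [[A1' A2'] _]. unfold dpar.
    assert (U : forall x y r, Rabs x <= r -> Rabs y <= r -> Rabs (x - y) <= 2 * r).
    { intros x y r Hx Hy. eapply Rle_trans; [apply ab_minus; eassumption|]. lra. }
    assert (Cb : forall x, Rabs (cos x) <= 1) by (intro; apply Rabs_le; apply COS_bound).
    assert (Sb : forall x, Rabs (sin x) <= 1) by (intro; apply Rabs_le; apply SIN_bound).
    assert (W1 := U _ _ 1 (Cb theta') (Cb theta)). assert (W2 := U _ _ 1 (Sb theta') (Sb theta)).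
    assert (W3 := U _ _ A A1' A1). assert (W4 := U _ _ A A2' A2). lra. }
  set (dp := dpar theta' a1' a2' theta a1 a2) in *.
  assert (C * (dp * dp) <= C * (4 + 4 * A) * dp).
  { rewrite Rmult_assoc. apply Rmult_le_compat_l; [lra|]. apply Rmult_le_compat_r; auto. }
  set (P := pairing theta a1 a2 f1 f2 theta' a1' a2' f1' f2') in *.
  replace (act theta' a1' a2' f1' f2' - act theta a1 a2 f1 f2) with
    ((act theta' a1' a2' f1' f2' - act theta a1 a2 f1 f2 - P) + P) by ring.
  eapply Rle_trans; [apply ab_plus; eassumption|]. lra.
Qed.

(** The retraction onto the admissible amplitudes. It extends the reduced action to all real
    amplitudes as a Lipschitz function, as the minimisation lemma requires. *)
Definition clip (x : R) : R := Rmax (- A) (Rmin x A).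

Lemma clip_in x : Rabs (clip x) <= A.
Proof. unfold clip, Rmax, Rmin. apply Rabs_le. destruct (Rle_dec x A), (Rle_dec _ _); lra. Qed.
Lemma clip_id x : - A <= x <= A -> clip x = x.
Proof. intro H. unfold clip, Rmax, Rmin. destruct (Rle_dec x A), (Rle_dec _ _); lra. Qed.
Lemma clip_lip x y : Rabs (clip x - clip y) <= Rabs (x - y).
Proof.
  unfold clip, Rmax, Rmin.
  destruct (Rle_dec x A), (Rle_dec y A); repeat destruct (Rle_dec _ _); unfold Rabs; repeat destruct (Rcase_abs _); lra.
Qed.

Lemma cos_sin_lip x y : Rabs (cos x - cos y) <= Rabs (x - y) /\ Rabs (sin x - sin y) <= Rabs (x - y).
Proof.
  split.
  - rewrite <- (Rmult_1_l (Rabs (x - y))). apply (mvt_abs cos (fun u => - sin u)). intros u _. split; [apply is_derive_cos|].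
    rewrite Rabs_Ropp. apply Rabs_le; apply SIN_bound.
  - rewrite <- (Rmult_1_l (Rabs (x - y))). apply (mvt_abs sin cos). intros u _. split; [apply is_derive_sin|].
    apply Rabs_le; apply COS_bound.
Qed.

(** The corrections are picked by choice, yet [g] is Lipschitz because any two solutions obey
    [act_lip]. For the same reason the minimum over the chosen ones is a minimum over all: a
    solution with another correction, or with an angle shifted by multiples of [2 * PI], is at
    distance zero and has equal action. *)
Lemma min_sol : exists theta a1 a2 f1 f2, 0 <= theta <= 2 * PI /\ reduced_sol theta a1 a2 f1 f2 /\
  forall theta' a1' a2' f1' f2', reduced_sol theta' a1' a2' f1' f2' -> act theta a1 a2 f1 f2 <= act theta' a1' a2' f1' f2'.
Proof.
  destruct act_lip as [L [HL0 HLp]].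
  assert (Ex : forall theta a1 a2, exists ff : (R -> R) * (R -> R), reduced_sol theta (clip a1) (clip a2) (fst ff) (snd ff)).
  { intros theta a1 a2. destruct (sol_exists theta (clip a1) (clip a2) (conj (clip_in a1) (clip_in a2))) as [f1 [f2 H]].
    exists (f1, f2). exact H. }
  pose (ch := fun theta a1 a2 => proj1_sig (constructive_indefinite_description _ (Ex theta a1 a2))).
  assert (Hch : forall theta a1 a2, reduced_sol theta (clip a1) (clip a2) (fst (ch theta a1 a2)) (snd (ch theta a1 a2)))
    by (intros; exact (proj2_sig (constructive_indefinite_description _ (Ex theta a1 a2)))).
  pose (g := fun theta a1 a2 => act theta (clip a1) (clip a2) (fst (ch theta a1 a2)) (snd (ch theta a1 a2))).
  assert (HPI := PI_RGT_0).
  destruct (min3_lip g (2 * L) 0 (2 * PI) A) as [theta [a1 [a2 [Ht [H1 [H2 Hmin]]]]]]; [lra|auto| |].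
  { intros x y z x' y' z'. unfold g.
    eapply Rle_trans; [apply (HLp _ _ _ _ _ _ _ _ _ _ (Hch x' y' z') (Hch x y z))|].
    rewrite (Rmult_comm 2 L), Rmult_assoc. apply Rmult_le_compat_l; [lra|].
    unfold dpar. destruct (cos_sin_lip x x') as [U1 U2]. assert (U3 := clip_lip y y'). assert (U4 := clip_lip z z').
    assert (V3 := Rabs_pos (y - y')). assert (V4 := Rabs_pos (z - z')). lra. }
  assert (S0 := Hch theta a1 a2). assert (I1 := clip_id a1 H1). assert (I2 := clip_id a2 H2).
  exists theta, a1, a2, (fst (ch theta a1 a2)), (snd (ch theta a1 a2)). split; [exact Ht|].
  split; [rewrite I1, I2 in S0; exact S0|].
  intros theta' a1' a2' f1' f2' HS'.
  assert (Ha' : - A <= a1' <= A /\ - A <= a2' <= A).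
  { destruct HS' as [[A1 A2] _]. split; apply Rabs_le_between; auto. }
  destruct Ha' as [Ha1 Ha2].
  set (k := up (theta' / (2 * PI))).
  destruct (archimed (theta' / (2 * PI))) as [Ar1 Ar2]. fold k in Ar1, Ar2.
  set (th := theta' + IZR (1 - k) * (2 * PI)).
  assert (Hth : 0 <= th <= 2 * PI).
  { unfold th. rewrite minus_IZR.
    assert (E : theta' = (theta' / (2 * PI)) * (2 * PI)) by (field; lra).
    set (r := theta' / (2 * PI)) in *. rewrite E. split; nra. }
  assert (Ec : cos th = cos theta').
  { unfold th. apply (per_IZR (2 * PI) cos). intro u. rewrite cos_plus, cos_2PI, sin_2PI; ring. }
  assert (Es : sin th = sin theta').
  { unfold th. apply (per_IZR (2 * PI) sin). intro u. rewrite sin_plus, cos_2PI, sin_2PI; ring. }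
  assert (G := Hmin th a1' a2' Hth Ha1 Ha2). unfold g in G.
  assert (S1 := Hch th a1' a2'). rewrite (clip_id a1' Ha1), (clip_id a2' Ha2) in *. rewrite I1, I2 in *.
  assert (Z := HLp _ _ _ _ _ _ _ _ _ _ HS' S1). unfold dpar in Z. rewrite Ec, Es, !Rminus_diag, Rabs_R0 in Z.
  replace (L * (0 + 0 + 0 + 0)) with 0 in Z by ring. apply Rabs_le_between in Z. lra.
Qed.

(** The first-order condition at a one-sided minimum, in a form that needs no differentiability: a
    negative [g] loses against the quadratic term only for [h] above the order of [- g / C]. *)
Lemma sign_of_min (g C e : R) : 0 <= C -> 0 < e -> (forall h, 0 <= h <= e -> 0 <= g * h + C * (h * h)) -> 0 <= g.
Proof.
  intros HC He H. destruct (Rle_or_lt 0 g) as [|Hg]; auto.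
  set (h := Rmin e (- g / (2 * (C + 1)))).
  assert (Hq : 0 < - g / (2 * (C + 1))) by (apply Rdiv_lt_0_compat; lra).
  assert (h0 : 0 < h) by (unfold h; apply Rmin_pos; auto).
  assert (h1 : h <= e) by apply Rmin_l. assert (h2 : h <= - g / (2 * (C + 1))) by apply Rmin_r.
  specialize (H h ltac:(lra)).
  assert (h3 : h * (2 * (C + 1)) <= - g).
  { apply Rmult_le_compat_r with (r := 2 * (C + 1)) in h2; [|lra].
    replace (- g / (2 * (C + 1)) * (2 * (C + 1))) with (- g) in h2 by (field; lra). exact h2. }
  assert (g * h + C * (h * h) = h * (g + C * h)) by ring.
  assert (g + C * h < 0) by nra. nra.
Qed.

(* Interior condition for the minimum of the reduced action: on the faces of the box, the resonant
multipliers point outwards. *)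
Definition outward_on_faces : Prop := forall theta a1 a2 f1 f2, reduced_sol theta a1 a2 f1 f2 ->
  (a1 = A -> 0 < mult1 theta a1 a2 f1 f2) /\ (a1 = - A -> mult1 theta a1 a2 f1 f2 < 0) /\
  (a2 = A -> 0 < mult2 theta a1 a2 f1 f2) /\ (a2 = - A -> mult2 theta a1 a2 f1 f2 < 0).

(** At equal angles the pairing meets the orbits only through their projections on the modes and
    their angular mean, that is through the amplitudes and zero. *)
Lemma pairing_same theta a1 a2 f1 f2 a1' a2' f1' f2' :
  reduced_sol theta a1 a2 f1 f2 -> reduced_sol theta a1' a2' f1' f2' ->
  (pr1 T kappa c s (x1 a1 a2 f1) (x2 a1 a2 f2) = a1 /\ pr2 T kappa c s (x1 a1 a2 f1) (x2 a1 a2 f2) = a2) ->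
  (pr1 T kappa c s (x1 a1' a2' f1') (x2 a1' a2' f2') = a1' /\ pr2 T kappa c s (x1 a1' a2' f1') (x2 a1' a2' f2') = a2') ->
  pairing theta a1 a2 f1 f2 theta a1' a2' f1' f2' =
    mode_norm2 T kappa * (mult1 theta a1 a2 f1 f2 * (a1' - a1) + mult2 theta a1 a2 f1 f2 * (a2' - a2)).
Proof.
  intros HS HS' [E1' E2'] [F1 F2]. assert (N := msq_pos T kappa T_pos).
  destruct (sol_facts theta a1 a2 f1 f2 HS) as [A1 [A2 [_ [_ [_ [_ [_ [_ [_ [_ [_ [Z _]]]]]]]]]]]].
  destruct (sol_facts theta a1' a2' f1' f2' HS') as [A1' [A2' [_ [_ [_ [_ [_ [_ [_ [_ [_ [Z' _]]]]]]]]]]]].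
  unfold pr1, pr2 in E1', E2', F1, F2. fold k2 in E1', E2', F1, F2.
  assert (G : forall u v, u / mode_norm2 T kappa = v -> u = mode_norm2 T kappa * v) by (intros u v <-; field; lra).
  apply G in E1', E2', F1, F2.
  unfold pairing, lam1, lam2. fold (mult1 theta a1 a2 f1 f2) (mult2 theta a1 a2 f1 f2).
  set (l1 := mult1 theta a1 a2 f1 f2). set (l2 := mult2 theta a1 a2 f1 f2). set (l0 := pr0 T (hh2 theta a1 a2 f1 f2)).
  set (X1' := x1 a1' a2' f1') in *. set (X2' := x2 a1' a2' f2') in *. set (Y1 := x1 a1 a2 f1) in *. set (Y2 := x2 a1 a2 f2) in *.
  rewrite Rminus_diag, cos_0, sin_0. destruct MD.
  rewrite (Int0_ext T _ (fun t => l1 * (X1' t * c t + X2' t * (k2 * s t)) - l1 * (Y1 t * c t + Y2 t * (k2 * s t))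
     + (l2 * (X1' t * s t - X2' t * (k2 * c t)) - l2 * (Y1 t * s t - Y2 t * (k2 * c t))) + (l0 * X2' t - l0 * Y2 t))) by (intro; ring).
  rewrite !Int0_plus, !Int0_minus, !Int0_scal by cts. rewrite E1', E2', F1, F2, Z, Z'. ring.
Qed.

(** One-sided variations of an amplitude give the sign opposite to the one required on a face, so
    the minimum is interior and the mode multipliers vanish. Only then does a variation of the angle
    isolate [l0]. *)
Lemma exact_sol : ((forall t, c t = 0 /\ s t = 0) \/ (0 < A /\ outward_on_faces)) ->
  exists theta a1 a2 f1 f2, 0 <= theta <= 2 * PI /\ reduced_sol theta a1 a2 f1 f2 /\
    forall t, lam1 theta a1 a2 f1 f2 t = 0 /\ lam2 theta a1 a2 f1 f2 t = 0.
Proof.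
  intro Hcase. destruct min_sol as [theta [a1 [a2 [f1 [f2 [Ht [HS Hmin]]]]]]].
  exists theta, a1, a2, f1, f2. split; [exact Ht|split; [exact HS|]].
  destruct act_expand as [C [HC HE]]. assert (N := msq_pos T kappa T_pos).
  assert (TP := T_pos).
  assert (Key : forall theta' a1' a2' f1' f2', reduced_sol theta' a1' a2' f1' f2' ->
     0 <= pairing theta a1 a2 f1 f2 theta' a1' a2' f1' f2' + C * (dpar theta' a1' a2' theta a1 a2 * dpar theta' a1' a2' theta a1 a2)).
  { intros theta' a1' a2' f1' f2' HS'. specialize (HE _ _ _ _ _ _ _ _ _ _ HS HS'). specialize (Hmin _ _ _ _ _ HS').
    apply Rabs_le_between in HE. lra. }
  assert (Hlam : forall t, mult1 theta a1 a2 f1 f2 * c t = 0 /\ mult1 theta a1 a2 f1 f2 * s t = 0 /\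
      mult2 theta a1 a2 f1 f2 * c t = 0 /\ mult2 theta a1 a2 f1 f2 * s t = 0).
  { destruct (sol_facts theta a1 a2 f1 f2 HS) as [_ [_ [_ [_ [_ [_ [_ [_ [_ [_ [_ [_ [A13 _]]]]]]]]]]]]].
    destruct A13 as [Zcs|Nrm]; [intro t; destruct (Zcs t) as [-> ->]; repeat split; ring|].
    destruct Hcase as [Zcs|[HA0 HF]]; [intro t; destruct (Zcs t) as [-> ->]; repeat split; ring|].
    assert (Ha : - A <= a1 <= A /\ - A <= a2 <= A).
    { destruct HS as [[B1 B2] _]. split; apply Rabs_le_between; auto. }
    destruct Ha as [Ha1 Ha2].
    set (l1 := mult1 theta a1 a2 f1 f2) in *. set (l2 := mult2 theta a1 a2 f1 f2) in *.
    assert (Var : forall a1' a2', - A <= a1' <= A -> - A <= a2' <= A ->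
       0 <= mode_norm2 T kappa * (l1 * (a1' - a1) + l2 * (a2' - a2)) + C * ((Rabs (a1' - a1) + Rabs (a2' - a2)) * (Rabs (a1' - a1) + Rabs (a2' - a2)))).
    { intros a1' a2' H1 H2.
      destruct (sol_exists theta a1' a2') as [f1' [f2' HS']]; [split; apply Rabs_le_between; auto|].
      assert (Q := Key _ _ _ _ _ HS').
      destruct (sol_facts theta a1' a2' f1' f2' HS') as [_ [_ [_ [_ [_ [_ [_ [_ [_ [_ [_ [_ [B13 _]]]]]]]]]]]]].
      destruct B13 as [Zcs|Nrm'].
      (* If the modes vanished, so would all mode multipliers, against the strict sign on the face
         [a1 = A]. *)
      - exfalso. destruct Nrm as [N1 N2]. unfold pr1, pr2 in N1, N2.
        assert (E : forall u v : R -> R, Int0 T (fun t => u t * c t + v t * (2 / kappa * s t)) = 0 /\ Int0 T (fun t => u t * s t - v t * (2 / kappa * c t)) = 0).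
        { intros u v. split; (rewrite (Int0_ext T _ (fun _ => 0)); [rewrite Int0_const; ring|intro t; destruct (Zcs t) as [-> ->]; ring]). }
        destruct (E (x1 a1 a2 f1) (x2 a1 a2 f2)) as [E1' E2']. rewrite E1' in N1. rewrite E2' in N2.
        unfold Rdiv in N1, N2. rewrite Rmult_0_l in N1, N2.
        destruct (HF _ _ _ _ _ HS) as [X1' _].
        destruct (sol_exists theta A 0) as [g1 [g2 HG]]; [split; rewrite ?Rabs_R0, ?Rabs_right; lra|].
        destruct (HF _ _ _ _ _ HG) as [Y1' _]. specialize (Y1' eq_refl). unfold mult1, pr1 in Y1'.
        rewrite (proj1 (E _ _)) in Y1'. unfold Rdiv in Y1'. rewrite Rmult_0_l in Y1'. lra.
      - rewrite (pairing_same theta a1 a2 f1 f2 a1' a2' f1' f2' HS HS' Nrm Nrm') in Q. fold l1 l2 in Q.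
        unfold dpar in Q. rewrite !Rminus_diag, Rabs_R0 in Q.
        replace (0 + 0 + Rabs (a1' - a1) + Rabs (a2' - a2)) with (Rabs (a1' - a1) + Rabs (a2' - a2)) in Q by ring. exact Q. }
    assert (SQ : forall h, Rabs h * Rabs h = h * h) by (intro; rewrite <- Rabs_mult; apply Rabs_right, Rle_ge, Rle_0_sqr).
    assert (U1 : a1 < A -> 0 <= l1).
    { intro H. assert (G : 0 <= mode_norm2 T kappa * l1).
      { apply (sign_of_min _ C (A - a1)); [lra|lra|]. intros h Hh.
        assert (Q := Var (a1 + h) a2 ltac:(lra) Ha2). rewrite Rminus_diag, Rabs_R0 in Q.
        replace (a1 + h - a1) with h in Q by ring. rewrite !Rplus_0_r, SQ in Q. lra. }
      apply Rmult_le_reg_l with (mode_norm2 T kappa); lra. }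
    assert (U2 : - A < a1 -> l1 <= 0).
    { intro H. assert (G : 0 <= - (mode_norm2 T kappa * l1)).
      { apply (sign_of_min _ C (a1 + A)); [lra|lra|]. intros h Hh.
        assert (Q := Var (a1 - h) a2 ltac:(lra) Ha2). rewrite Rminus_diag, Rabs_R0 in Q.
        replace (a1 - h - a1) with (- h) in Q by ring. rewrite !Rplus_0_r, SQ in Q. lra. }
      apply Rmult_le_reg_l with (mode_norm2 T kappa); lra. }
    assert (U3 : a2 < A -> 0 <= l2).
    { intro H. assert (G : 0 <= mode_norm2 T kappa * l2).
      { apply (sign_of_min _ C (A - a2)); [lra|lra|]. intros h Hh.
        assert (Q := Var a1 (a2 + h) Ha1 ltac:(lra)). rewrite Rminus_diag, Rabs_R0 in Q.
        replace (a2 + h - a2) with h in Q by ring. rewrite !Rplus_0_l, SQ in Q. lra. }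
      apply Rmult_le_reg_l with (mode_norm2 T kappa); lra. }
    assert (U4 : - A < a2 -> l2 <= 0).
    { intro H. assert (G : 0 <= - (mode_norm2 T kappa * l2)).
      { apply (sign_of_min _ C (a2 + A)); [lra|lra|]. intros h Hh.
        assert (Q := Var a1 (a2 - h) Ha1 ltac:(lra)). rewrite Rminus_diag, Rabs_R0 in Q.
        replace (a2 - h - a2) with (- h) in Q by ring. rewrite !Rplus_0_l, SQ in Q. lra. }
      apply Rmult_le_reg_l with (mode_norm2 T kappa); lra. }
    destruct (HF _ _ _ _ _ HS) as [F1 [F2 [F3 F4]]]. fold l1 l2 in F1, F2, F3, F4.
    assert (W1 : l1 = 0).
    { destruct (Req_dec a1 A) as [E|E]; [specialize (F1 E); lra|].
      destruct (Req_dec a1 (- A)) as [E'|E']; [specialize (F2 E'); lra|]. lra. }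
    assert (W2 : l2 = 0).
    { destruct (Req_dec a2 A) as [E|E]; [specialize (F3 E); lra|].
      destruct (Req_dec a2 (- A)) as [E'|E']; [specialize (F4 E'); lra|]. lra. }
    intro t. rewrite W1, W2. repeat split; ring. }
  set (l0 := pr0 T (hh2 theta a1 a2 f1 f2)).
  assert (L1 : forall t, lam1 theta a1 a2 f1 f2 t = 0).
  { intro t. unfold lam1. fold (mult1 theta a1 a2 f1 f2) (mult2 theta a1 a2 f1 f2). destruct (Hlam t) as [H1 [_ [_ H4]]]. lra. }
  assert (L2 : forall t, lam2 theta a1 a2 f1 f2 t = l0).
  { intro t. unfold lam2. fold (mult1 theta a1 a2 f1 f2) (mult2 theta a1 a2 f1 f2) l0. destruct (Hlam t) as [_ [H2 [H3 _]]].
    transitivity (l0 + k2 * (mult1 theta a1 a2 f1 f2 * s t) - k2 * (mult2 theta a1 a2 f1 f2 * c t)); [ring|rewrite H2, H3; ring]. }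
  (* Turning by [h] pairs to [- l0 * sin h] times the integral of [1 + x1], since the angular
     displacement has zero mean. This integral lies between [7/8] and [9/8] of [T], whence the main
     term and the error [T / 4]. *)
  assert (Th : forall h, 0 <= - l0 * sin h * (T * (7 / 8)) + C * (4 * (h * h)) + T * (1 / 4) * Rabs (l0 * sin h)).
  { intro h.
    assert (Ha : ball_A a1 a2) by (destruct HS; auto).
    destruct (sol_exists (theta + h) a1 a2 Ha) as [f1' [f2' HS']].
    assert (Q := Key _ _ _ _ _ HS').
    destruct (sol_facts theta a1 a2 f1 f2 HS) as [A1 [A2 [_ [_ [_ [_ [_ [_ [_ [_ [_ [Z _]]]]]]]]]]]].
    destruct (sol_facts _ a1 a2 f1' f2' HS') as [A1' [A2' [_ [_ [_ [_ [Bx [_ [_ [_ [_ [Z' _]]]]]]]]]]]].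
    unfold pairing in Q. replace (theta + h - theta) with h in Q by ring.
    rewrite (Int0_ext T _ (fun t => (- l0 * sin h) * (1 + x1 a1 a2 f1' t) + ((l0 * cos h) * x2 a1 a2 f2' t - l0 * x2 a1 a2 f2 t))) in Q.
    2:{ intro t. rewrite L1, L2. ring. }
    rewrite Int0_plus, Int0_minus, !Int0_scal, Int0_plus, Int0_const, Z, Z' in Q by cts.
    assert (I1 := Int0_bound T (x1 a1 a2 f1') (1 / 8) (Rlt_le _ _ TP) (proj1 A1')
       (fun t => Rle_trans _ _ _ (proj1 (Bx t)) eps_small)).
    set (J := Int0 T (x1 a1 a2 f1')) in *.
    assert (dd : dpar (theta + h) a1 a2 theta a1 a2 <= 2 * Rabs h).
    { unfold dpar. rewrite !Rminus_diag, Rabs_R0. destruct (cos_sin_lip (theta + h) theta) as [V1 V2].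
      replace (theta + h - theta) with h in V1, V2 by ring. lra. }
    destruct (dp_parts theta a1 a2 (theta + h) a1 a2) as [dp0 _].
    set (d := dpar (theta + h) a1 a2 theta a1 a2) in *.
    assert (d2 : d * d <= 4 * (h * h)).
    { assert (SQ : Rabs h * Rabs h = h * h) by (rewrite <- Rabs_mult; apply Rabs_right, Rle_ge, Rle_0_sqr).
      rewrite <- SQ. assert (V := Rabs_pos h). nra. }
    assert (C * (d * d) <= C * (4 * (h * h))) by (apply Rmult_le_compat_l; lra).
    assert (IJ : - l0 * sin h * (T * 1 + J) <= - l0 * sin h * (T * (7 / 8)) + T * (1 / 4) * Rabs (l0 * sin h)).
    { set (u := l0 * sin h). replace (- l0 * sin h * (T * 1 + J)) with (- u * (T * (7 / 8)) + - u * (T * (1 / 8) + J)) by (unfold u; field).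
      replace (- l0 * sin h * (T * (7 / 8))) with (- u * (T * (7 / 8))) by (unfold u; ring).
      apply Rplus_le_compat_l. apply Rabs_le_between in I1.
      assert (Hu := Rle_abs (- u)). rewrite Rabs_Ropp in Hu. assert (Hu0 := Rabs_pos u).
      apply Rle_trans with (Rabs u * (T * (1 / 8) + J)); [apply Rmult_le_compat_r; lra|].
      replace (T * (1 / 4) * Rabs u) with (Rabs u * (T * (1 / 4))) by ring. apply Rmult_le_compat_l; lra. }
    lra. }
  assert (L0 : l0 = 0).
  { assert (HP := PI_RGT_0). assert (HP4 := PI_4).
    assert (Sn : forall h, 0 <= h <= 1 -> h / 2 <= sin h).
    { intros h Hh. destruct (Req_dec h 0) as [->|Hne]; [rewrite sin_0; lra|].
      destruct (MVT_gen sin 0 h cos) as [u [Hu Eu]].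
      - intros; apply is_derive_sin.
      - intros x _. apply continuity_sin.
      - rewrite Rmin_left, Rmax_right in Hu by lra. rewrite sin_0 in Eu.
        assert (Q : cos (PI / 3) <= cos u).
        { assert (P3 := PI2_3_2). destruct (Req_dec u (PI / 3)) as [->|]; [lra|]. left. apply cos_decreasing_1; lra. }
        rewrite cos_PI3 in Q. nra. }
    destruct (Rtotal_order l0 0) as [Hl|[Hl|Hl]]; [exfalso|exact Hl|exfalso].
    (* For the unfavourable sign [7/8 - 1/4 = 5/8] remains, and [sin h >= h / 2] halves it. *)
    - assert (G : 0 <= l0 * (T * (5 / 16))).
      { apply (sign_of_min _ (4 * C) 1); [lra|lra|]. intros h Hh.
        assert (Q := Th (- h)). rewrite sin_neg in Q. specialize (Sn h Hh).
        assert (E : Rabs (l0 * - sin h) = - l0 * sin h).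
        { rewrite Rabs_right; [ring|]. apply Rle_ge. nra. }
        rewrite E in Q. assert (l0 * (T * (5 / 8)) * (sin h - h / 2) <= 0).
        { assert (l0 * (T * (5 / 8)) <= 0) by nra. nra. }
        nra. }
      assert (0 < T * (5 / 16)) by lra. nra.
    - assert (G : 0 <= - l0 * (T * (5 / 16))).
      { apply (sign_of_min _ (4 * C) 1); [lra|lra|]. intros h Hh.
        assert (Q := Th h). specialize (Sn h Hh).
        assert (E : Rabs (l0 * sin h) = l0 * sin h).
        { rewrite Rabs_right; [ring|]. apply Rle_ge. nra. }
        rewrite E in Q. assert (0 <= l0 * (T * (5 / 8)) * (sin h - h / 2)).
        { assert (0 <= l0 * (T * (5 / 8))) by nra. nra. }
        nra. }
      assert (0 < T * (5 / 16)) by lra. nra. }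
  intro t. rewrite L1, L2, L0. auto.
Qed.

(** The equation of the correction alone, freed from the kernel element, in the shape in which the
    resonant estimate expects [w1], [w2]. *)
Lemma sol_w_facts theta a1 a2 f1 f2 : reduced_sol theta a1 a2 f1 f2 ->
  exists d1 d2 l0, let h1 := hh1 theta a1 a2 f1 f2 in let h2 := hh2 theta a1 a2 f1 f2 in
  let l1 := mult1 theta a1 a2 f1 f2 in let l2 := mult2 theta a1 a2 f1 f2 in
  pc T f1 /\ pc T f2 /\ pc T d1 /\ pc T d2 /\ pc T h1 /\ pc T h2 /\
  (forall t : R, is_derive f1 t (d1 t)) /\ (forall t : R, is_derive f2 t (d2 t)) /\
  (forall t : R, is_derive d1 t (h1 t - l1 * c t - l2 * s t - 2 * d2 t + B * f1 t)) /\
  (forall t : R, is_derive d2 t (h2 t - l0 - l1 * (k2 * s t) + l2 * (k2 * c t) + 2 * d1 t)) /\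
  (forall t, Rabs (f1 t) <= W * eps ^ 2 /\ Rabs (f2 t) <= W * eps ^ 2).
Proof.
  intros [Ha [Hf [E1' E2']]].
  destruct (hh_pc theta a1 a2 f1 f2 Ha Hf) as [G1 G2].
  set (h1 := hh1 theta a1 a2 f1 f2) in *. set (h2 := hh2 theta a1 a2 f1 f2) in *.
  destruct (HX h1 h2 G1 G2) as [_ [_ [Y3 [Y4 [Y5 [Y6 _]]]]]].
  rewrite E1', E2' in *. destruct Hf as [Pf1 [Pf2 Bf]].
  exists (D1 h1 h2), (D2 h1 h2), (pr0 T h2). cbv zeta.
  split; [exact Pf1|split; [exact Pf2|]].
  split; [exact (pc_derive T f1 _ Y3 (cont_derive _ _ Y5) (proj2 Pf1))|].
  split; [exact (pc_derive T f2 _ Y4 (cont_derive _ _ Y6) (proj2 Pf2))|].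
  split; [exact G1|split; [exact G2|split; [exact Y3|split; [exact Y4|split; [|split; [|exact Bf]]]]]].
  - intro t. refine (derive_ext_eq _ _ t _ _ (fun _ => eq_refl) (Y5 t) _).
    unfold red1, mult1, mult2, K. fold h1 h2. ring.
  - intro t. exact (Y6 t).
Qed.

Lemma exact_orbit : ((forall t, c t = 0 /\ s t = 0) \/ (0 < A /\ outward_on_faces)) ->
  exists theta y1 y2 p1 p2, 0 <= theta <= 2 * PI /\
  let q1 := rot1 theta (fun t => 1 + y1 t) y2 in let q2 := rot2 theta (fun t => 1 + y1 t) y2 in
  (forall t, Rabs (y1 t) <= 2 * (Kb * A) + W * eps ^ 2 /\ Rabs (y2 t) <= 2 * (Kb * A) + W * eps ^ 2) /\
  (forall t, q1 (t + T) = q1 t) /\ (forall t, q2 (t + T) = q2 t) /\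
  (forall t : R, is_derive q1 t (p1 t)) /\ (forall t : R, is_derive q2 t (p2 t)) /\
  (forall t : R, is_derive p1 t (- force1 b eps n m b1 b2 q1 q2 t)) /\
  (forall t : R, is_derive p2 t (- force2 b eps n m b1 b2 q1 q2 t)) /\
  (forall j t, (j < n)%nat -> Rabs (gap eps b1 b2 q1 q2 j t) <= 1 / 2).
Proof.
  intro H. destruct (exact_sol H) as [theta [a1 [a2 [f1 [f2 [Ht [HS HL0]]]]]]].
  destruct (rot_facts theta a1 a2 f1 f2 HS) as [R1 [R2 [_ [_ [_ [_ [R7 [R8 [R9 [R10 R11]]]]]]]]]].
  exists theta, (x1 a1 a2 f1), (x2 a1 a2 f2), (P1 theta a1 a2 f1 f2), (P2 theta a1 a2 f1 f2).
  split; [exact Ht|]. cbv zeta.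
  split; [|split; [exact (proj2 R1)|split; [exact (proj2 R2)|split; [exact R7|split; [exact R8|]]]]].
  - destruct HS as [[A1 A2] [[_ [_ Bf]] _]]. intro t.
    destruct (kk_bound a1 a2 A t A1 A2) as [B1 [B2 _]]. destruct (Bf t).
    unfold x1, x2, xx1, xx2. split; apply ab_plus; auto.
  - split; [|split].
    + intro t. refine (derive_ext_eq _ _ t _ _ (fun _ => eq_refl) (R9 t) _).
      destruct (HL0 t) as [Z1 Z2]. unfold E1, rot1. rewrite Z1, Z2. unfold Q1, Q2, rot1, rot2. ring.
    + intro t. refine (derive_ext_eq _ _ t _ _ (fun _ => eq_refl) (R10 t) _).
      destruct (HL0 t) as [Z1 Z2]. unfold E2, rot2. rewrite Z1, Z2. unfold Q1, Q2, rot1, rot2. ring.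
    + intros j t Hj. assert (Q := R11 j t Hj). unfold Q1, Q2 in Q. lra.
Qed.

End Family.

(** * Existence of the scaled orbit *)

(** A solution of the scaled problem near the unit circle, with distance [Cx * eps^2]. The bound on
    [gap] keeps it away from collisions. *)
Definition orbit (p n : nat) (B eps Cx : R) (m : nat -> R) (b1 b2 : nat -> R -> R) : Prop :=
  exists theta y1 y2 p1 p2, 0 <= theta <= 2 * PI /\
  let q1 := rot1 theta (fun t => 1 + y1 t) y2 in let q2 := rot2 theta (fun t => 1 + y1 t) y2 in
  (forall t, Rabs (y1 t) <= Cx * eps ^ 2 /\ Rabs (y2 t) <= Cx * eps ^ 2) /\
  (forall t, q1 (t + 2 * PI * INR p) = q1 t) /\ (forall t, q2 (t + 2 * PI * INR p) = q2 t) /\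
  (forall t : R, is_derive q1 t (p1 t)) /\ (forall t : R, is_derive q2 t (p2 t)) /\
  (forall t : R, is_derive p1 t (- force1 (B / 2) eps n m b1 b2 q1 q2 t)) /\
  (forall t : R, is_derive p2 t (- force2 (B / 2) eps n m b1 b2 q1 q2 t)) /\
  (forall j t, (j < n)%nat -> Rabs (gap eps b1 b2 q1 q2 j t) <= 1 / 2).

Lemma small_mult (c S eps : R) : 0 <= c <= S -> 0 < S -> 0 < eps <= / S -> c * eps <= 1.
Proof.
  intros Hc HS He. apply Rle_trans with (S * / S); [|rewrite Rinv_r; lra].
  apply Rmult_le_compat; lra.
Qed.

(** The value 1 of [kappa] is a placeholder: without modes any positive number would serve. *)
Lemma modes_zero T K : modes T K 1 (fun _ => 0) (fun _ => 0).
Proof.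
  assert (Z : Int0 T (fun _ => 0) = 0) by (rewrite Int0_const; ring).
  constructor; try (intro t); try apply pc_const; try lra; auto.
  - evar_last; [apply (is_derive_const (K:=R_AbsRing) (V:=R_NormedModule))|]. unfold zero; simpl; ring.
  - evar_last; [apply (is_derive_const (K:=R_AbsRing) (V:=R_NormedModule))|]. unfold zero; simpl; ring.
  - rewrite Rabs_R0. lra.
  - rewrite (Int0_ext T _ (fun _ => 0)); auto. intro; ring.
Qed.

Lemma modes_trig (p k : nat) (K : R) : (1 <= p)%nat -> (1 <= k)%nat -> K = (INR k / INR p) * (INR k / INR p) ->
  modes (2 * PI * INR p) K (INR k / INR p) (fun t => cos (INR k / INR p * t)) (fun t => sin (INR k / INR p * t)).
Proof.
  intros Hp Hk HK. assert (P0 := INR_gt0 p Hp). assert (K0 := INR_gt0 k Hk).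
  set (w := INR k / INR p) in *. assert (w0 : 0 < w) by (unfold w; apply Rdiv_lt_0_compat; lra).
  set (T := 2 * PI * INR p).
  assert (dc : forall t : R, is_derive (fun t => cos (w * t)) t (- (w * sin (w * t)))).
  { intro t. auto_derive; auto. ring. }
  assert (ds : forall t : R, is_derive (fun t => sin (w * t)) t (w * cos (w * t))).
  { intro t. auto_derive; auto. ring. }
  assert (WT : forall t, w * (t + T) = w * t + 2 * INR k * PI).
  { intro t. unfold w, T. field. lra. }
  assert (pcc : pc T (fun t => cos (w * t))).
  { split; [cts|]. intro t. rewrite WT. apply cos_period. }
  assert (pss : pc T (fun t => sin (w * t))).
  { split; [cts|]. intro t. rewrite WT. apply sin_period. }
  assert (Ic : Int0 T (fun t => cos (w * t)) = 0).
  { apply (Int0_derive0 T (fun t => / w * sin (w * t))); [cts| |].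
    - intro t. auto_derive; auto. field. lra.
    - intro t. rewrite (proj2 pss). reflexivity. }
  assert (Is : Int0 T (fun t => sin (w * t)) = 0).
  { apply (Int0_derive0 T (fun t => - / w * cos (w * t))); [cts| |].
    - intro t. auto_derive; auto. field. lra.
    - intro t. rewrite (proj2 pcc). reflexivity. }
  assert (Ics : Int0 T (fun t => cos (w * t) * sin (w * t)) = 0).
  { apply (Int0_derive0 T (fun t => / (2 * w) * (sin (w * t) * sin (w * t)))); [cts| |].
    - intro t. auto_derive; auto. field. lra.
    - intro t. rewrite (proj2 pss). reflexivity. }
  assert (Id : Int0 T (fun t => cos (w * t) * cos (w * t) - sin (w * t) * sin (w * t)) = 0).
  { apply (Int0_derive0 T (fun t => / w * (sin (w * t) * cos (w * t)))); [cts| |].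
    - intro t. auto_derive; auto. field. lra.
    - intro t. rewrite (proj2 pss), (proj2 pcc). reflexivity. }
  assert (Ip : Int0 T (fun t => cos (w * t) * cos (w * t) + sin (w * t) * sin (w * t)) = T).
  { rewrite (Int0_ext T _ (fun _ => 1)); [rewrite Int0_const; ring|].
    intro t. assert (Q := sin2_cos2 (w * t)). unfold Rsqr in Q. lra. }
  rewrite Int0_minus in Id by cts. rewrite Int0_plus in Ip by cts.
  constructor; auto.
  - intro t. rewrite HK. reflexivity.
  - intro t. rewrite HK. reflexivity.
  - intro t. split; apply Rabs_le; [apply COS_bound|apply SIN_bound].
  - left. split; lra.
Qed.

(** Without modes the box of amplitudes shrinks to a point ([A = 0]) and the action is minimised
    over the circle of phases alone. *)
Lemma orbit_nonresonant (p n : nat) (B Hb : R) (m : nat -> R) : (1 <= p)%nat -> 0 < B ->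
  solver (2 * PI * INR p) (4 - B) (fun _ => 0) (fun _ => 0) ->
  (forall j, (j < n)%nat -> 0 < m j) -> rsum n m = 1 -> 0 <= Hb ->
  exists e0 Cx, 0 < e0 /\ 0 < Cx /\ forall b1 b2 eps, 0 < eps <= e0 ->
    (forall j, (j < n)%nat -> pc (2 * PI * INR p) (b1 j) /\ pc (2 * PI * INR p) (b2 j)) ->
    (forall t, mom1 n m (fun j => b1 j t) = 0 /\ mom1 n m (fun j => b2 j t) = 0) ->
    (forall j t, (j < n)%nat -> Rabs (b1 j t) <= Hb /\ Rabs (b2 j t) <= Hb) ->
    orbit p n B eps Cx m b1 b2.
Proof.
  intros Hp HB HS Hm Hm1 HHb.
  set (T := 2 * PI * INR p) in *.
  assert (TP : 0 < T) by exact (T_pos p Hp).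
  assert (MD := modes_zero T (4 - B)).
  destruct (vec_solver T (4 - B) 1 _ _ TP MD HS ltac:(lra)) as [X1 [X2 [D1 [D2 [M [HM [HX [HXl HXb]]]]]]]].
  destruct (nl_lip (B / 2) ltac:(lra)) as [Cl [HCl HL]].
  destruct (nl_bound (B / 2) ltac:(lra)) as [Cn [HCn HN]].
  set (W := M * (Cn * ((1 + 2 * Hb) * (1 + 2 * Hb)))).
  assert (HW : 0 < W) by (unfold W; repeat apply Rmult_lt_0_compat; lra).
  assert (HMl : 0 < 2 * M * Cl * (1 + 2 * Hb)) by (repeat apply Rmult_lt_0_compat; lra).
  (* Each summand times [eps] must be at most 1; with [eps <= / S] all these conditions hold
     together. *)
  set (S := W + 8 * (1 + 2 * Hb) + 2 * M * Cl * (1 + 2 * Hb)).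
  assert (HS0 : 0 < S) by (unfold S; lra).
  exists (/ S), W. split; [apply Rinv_0_lt_compat; auto|split; [exact HW|]].
  intros b1 b2 eps He Pb Zb Bb.
  assert (S1 := small_mult W S eps ltac:(unfold S; lra) HS0 He).
  assert (S2 := small_mult (8 * (1 + 2 * Hb)) S eps ltac:(unfold S; lra) HS0 He).
  assert (S3 := small_mult (2 * M * Cl * (1 + 2 * Hb)) S eps ltac:(unfold S; lra) HS0 He).
  assert (C1 : 2 * ((1 + 2 / 1) * 0) + W * eps ^ 2 <= eps).
  { replace (2 * ((1 + 2 / 1) * 0) + W * eps ^ 2) with (W * eps * eps) by field. nra. }
  assert (C2 : (1 + 2 * Hb) * eps <= 1 / 8) by lra.
  assert (C3 : M * (Cl * ((1 + 2 * Hb) * eps)) <= 1 / 2) by lra.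
  destruct (exact_orbit p B 1 M Cl Cn Hb eps 0 (fun _ => 0) (fun _ => 0) X1 X2 D1 D2 n m b1 b2
    Hp HB MD HM HX HXl HXb HL HCn HN Hm Hm1 Pb Zb Bb HHb (proj1 He) (Rle_refl 0) C1 C2 C3 (or_introl (fun t => conj eq_refl eq_refl)))
    as [theta [y1 [y2 [p1 [p2 [Ht [By Hr]]]]]]].
  exists theta, y1, y2, p1, p2. split; [exact Ht|split; [|exact Hr]].
  intro t. specialize (By t). fold W in By.
  replace (2 * ((1 + 2 / 1) * 0) + W * eps ^ 2) with (W * eps ^ 2) in By by field. exact By.
Qed.

Lemma spec_trig (p q k : nat) : (1 <= p)%nat ->
  let w := INR k / INR p in
  spec p q (fun l => l = Z.of_nat k) (fun t => cos (w * t)) /\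
  spec p q (fun l => l = Z.of_nat k) (fun t => sin (w * t)) /\
  spec p q (fun l => l = (2 * Z.of_nat k)%Z) (fun t => cos (w * t) * cos (w * t) - sin (w * t) * sin (w * t)) /\
  spec p q (fun l => l = (2 * Z.of_nat k)%Z) (fun t => 2 * (sin (w * t) * cos (w * t))).
Proof.
  intros Hp w. assert (P0 := INR_gt0 p Hp).
  assert (E : forall t, IZR (2 * Z.of_nat k) / INR p * t = 2 * (w * t)).
  { intro t. rewrite mult_IZR, <- INR_IZR_INZ. unfold w. field. lra. }
  split; [|split; [|split]].
  - apply (spec_mono p q _ (Z.of_nat k)); [auto|]. exists (fun _ => 1), (fun _ => 0).
    split; [apply pc_const|split; [apply pc_const|]]. intro t. rewrite <- INR_IZR_INZ. fold w. ring.
  - apply (spec_mono p q _ (Z.of_nat k)); [auto|]. exists (fun _ => 0), (fun _ => 1).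
    split; [apply pc_const|split; [apply pc_const|]]. intro t. rewrite <- INR_IZR_INZ. fold w. ring.
  - apply (spec_mono p q _ (2 * Z.of_nat k)%Z); [auto|]. exists (fun _ => 1), (fun _ => 0).
    split; [apply pc_const|split; [apply pc_const|]]. intro t. rewrite E, cos_2a. ring.
  - apply (spec_mono p q _ (2 * Z.of_nat k)%Z); [auto|]. exists (fun _ => 0), (fun _ => 1).
    split; [apply pc_const|split; [apply pc_const|]]. intro t. rewrite E, sin_2a. ring.
Qed.

(** The inertia integral [R0] is prescribed before [q] and the primaries, so that [e0] and [Cx],
    which depend on it, are uniform in [q]. *)
Lemma orbit_resonant (p n k : nat) (B Hb R0 : R) (m : nat -> R) : (1 <= p)%nat -> (1 <= n)%nat -> 2 < B ->
  (1 <= k)%nat -> k <> p -> (k < 2 * p)%nat -> 4 - B = (INR k / INR p) * (INR k / INR p) ->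
  solver (2 * PI * INR p) (4 - B) (fun t => cos (INR k / INR p * t)) (fun t => sin (INR k / INR p * t)) ->
  (forall j, (j < n)%nat -> 0 < m j) -> rsum n m = 1 -> 0 <= Hb -> 0 < R0 ->
  exists e0 Cx, 0 < e0 /\ 0 < Cx /\ forall q b1 b2 eps, (6 * p <= q)%nat -> 0 < eps <= e0 ->
    (forall j, (j < n)%nat -> pc (2 * PI * INR p / INR q) (b1 j) /\ pc (2 * PI * INR p / INR q) (b2 j)) ->
    (forall t, mom1 n m (fun j => b1 j t) = 0 /\ mom1 n m (fun j => b2 j t) = 0) ->
    (forall j t, (j < n)%nat -> Rabs (b1 j t) <= Hb /\ Rabs (b2 j t) <= Hb) ->
    Int0 (2 * PI * INR p) (fun t => rsum n (fun j => m j * (b1 j t * b1 j t + b2 j t * b2 j t))) = R0 ->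
    orbit p n B eps Cx m b1 b2.
Proof.
  intros Hp Hn HB2 Hk Hkp Hk2 HK HS Hm Hm1 HHb HR0.
  set (T := 2 * PI * INR p) in *. set (w := INR k / INR p) in *.
  assert (HB : 0 < B) by lra.
  assert (TP : 0 < T) by exact (T_pos p Hp).
  assert (MD : modes T (4 - B) w (fun t => cos (w * t)) (fun t => sin (w * t))) by (apply modes_trig; auto).
  assert (w0 : 0 < w) by (destruct MD; auto).
  destruct (vec_solver T (4 - B) w _ _ TP MD HS ltac:(lra)) as [X1 [X2 [D1 [D2 [M [HM [HX [HXl HXb]]]]]]]].
  destruct (nl_lip (B / 2) ltac:(lra)) as [Cl [HCl HL]].
  destruct (nl_bound (B / 2) ltac:(lra)) as [Cn [HCn HN]].
  destruct (nl_taylor (B / 2) ltac:(lra)) as [Ct [HCt HTay]].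
  set (W := M * (Cn * ((1 + 2 * Hb) * (1 + 2 * Hb)))).
  assert (HW : 0 < W) by (unfold W; repeat apply Rmult_lt_0_compat; lra).
  set (gam := 2 / w). assert (Hgam : 0 < gam) by (unfold gam; apply Rdiv_lt_0_compat; lra).
  set (cy2 := (B / 2 * (B - 1 + gam * gam) - (4 * (w * w) + B) * B / (2 * (w * w))) / (w * (- 3 * (w * w)))).
  set (cy1 := w * cy2 - B / (2 * (w * w))). set (cy0 := - (B - 1 - gam * gam) / 2).
  set (H2 := (2 * Hb) * (2 * Hb)). set (H3 := (2 * Hb) * (2 * Hb) * (2 * Hb)).
  assert (H2p : 0 <= H2) by (unfold H2; apply Rmult_le_pos; lra).
  assert (H3p : 0 <= H3) by (unfold H3; apply Rmult_le_pos; [exact H2p|lra]).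
  (* One constant above every quantity that the resonant estimate bounds by [G], including the
     Taylor constant and the size [W] of the correction. *)
  set (G := 3 + B + 2 * gam + 2 * Hb + H2 + H3 + Rabs cy0 + 4 * Rabs cy1 + 4 * Rabs cy2 + Ct + W).
  assert (Y0 := Rabs_pos cy0). assert (Y1 := Rabs_pos cy1). assert (Y2 := Rabs_pos cy2).
  assert (HG : 1 <= G) by (unfold G; lra).
  set (k0 := B * (B - 2) / 4). assert (Hk0 : 0 < k0) by (unfold k0; nra).
  assert (kR : 0 < k0 * R0) by (apply Rmult_lt_0_compat; auto).
  assert (G7 : 0 < T * (420 * G ^ 7)) by (apply Rmult_lt_0_compat; [auto|apply Rmult_lt_0_compat; [lra|apply pow_lt; lra]]).
  (* The half-width of the box is [Kr * eps^2]. On a face the leading term is then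
     [Kr * k0 * R0 * eps^4], which exceeds the error [3 * T * 420 * G^7 * eps^4] by [eps^4]. *)
  set (Kr := (3 * (T * (420 * G ^ 7)) + 1) / (k0 * R0)).
  assert (HKr : 0 < Kr) by (unfold Kr; apply Rdiv_lt_0_compat; lra).
  assert (EKr : Kr * (k0 * R0) = 3 * (T * (420 * G ^ 7)) + 1) by (unfold Kr; field; lra).
  set (Cx := 2 * ((1 + gam) * Kr) + W).
  assert (HKb : 0 < (1 + gam) * Kr) by (apply Rmult_lt_0_compat; lra).
  assert (HMl : 0 < 2 * M * Cl * (1 + 2 * Hb)) by (repeat apply Rmult_lt_0_compat; lra).
  assert (HK3 : 0 < Kr * Kr * Kr) by (apply Rmult_lt_0_compat; [apply Rmult_lt_0_compat|]; exact HKr).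
  set (S := Cx + 8 * (1 + 2 * Hb) + 2 * M * Cl * (1 + 2 * Hb) + 24 * G + Kr + Kr * Kr * Kr).
  assert (HCx : 0 < Cx) by (unfold Cx; lra).
  assert (HS0 : 0 < S) by (unfold S; lra).
  exists (/ S), Cx. split; [apply Rinv_0_lt_compat; auto|split; [exact HCx|]].
  intros q b1 b2 eps Hq He Pb Zb Bb HR.
  assert (S1 := small_mult Cx S eps ltac:(unfold S; lra) HS0 He).
  assert (S2 := small_mult (8 * (1 + 2 * Hb)) S eps ltac:(unfold S; lra) HS0 He).
  assert (S3 := small_mult (2 * M * Cl * (1 + 2 * Hb)) S eps ltac:(unfold S; lra) HS0 He).
  assert (S4 := small_mult (24 * G) S eps ltac:(unfold S; lra) HS0 He).
  assert (S5 := small_mult Kr S eps ltac:(unfold S; lra) HS0 He).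
  assert (S6 := small_mult (Kr * Kr * Kr) S eps ltac:(unfold S; lra) HS0 He).
  destruct He as [He0 _].
  assert (He1 := small_le_1 G eps HG He0 S4).
  set (A := Kr * eps ^ 2).
  assert (e2 : 0 < eps ^ 2) by (apply pow_lt; auto).
  assert (HA0 : 0 < A) by (unfold A; apply Rmult_lt_0_compat; auto).
  assert (HAe : A <= eps).
  { unfold A. replace (Kr * eps ^ 2) with (Kr * eps * eps) by ring. rewrite <- (Rmult_1_l eps) at 3. apply Rmult_le_compat_r; lra. }
  assert (C1 : 2 * ((1 + 2 / w) * A) + W * eps ^ 2 <= eps).
  { fold gam. unfold A. replace (2 * ((1 + gam) * (Kr * eps ^ 2)) + W * eps ^ 2) with (Cx * eps * eps) by (unfold Cx; ring).
    rewrite <- (Rmult_1_l eps) at 3. apply Rmult_le_compat_r; lra. }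
  assert (C2 : (1 + 2 * Hb) * eps <= 1 / 8) by lra.
  assert (C3 : M * (Cl * ((1 + 2 * Hb) * eps)) <= 1 / 2) by lra.
  (* Smallness of [eps] against [Kr] keeps the error constant independent of [Kr]; otherwise
     enlarging the box would enlarge the error as well. *)
  assert (HE0 : eps ^ 4 + A ^ 3 + A * eps ^ 3 <= 3 * eps ^ 4).
  { assert (e4 : 0 < eps ^ 4) by (apply pow_lt; auto).
    assert (Q1 : A ^ 3 <= eps ^ 4).
    { unfold A. replace ((Kr * eps ^ 2) ^ 3) with (Kr * Kr * Kr * eps * eps * eps ^ 4) by ring.
      rewrite <- (Rmult_1_l (eps ^ 4)) at 2. apply Rmult_le_compat_r; [lra|].
      rewrite <- (Rmult_1_l 1). apply Rmult_le_compat; try lra. apply Rmult_le_pos; lra. }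
    assert (Q2 : A * eps ^ 3 <= eps ^ 4).
    { unfold A. replace (Kr * eps ^ 2 * eps ^ 3) with (Kr * eps * eps ^ 4) by ring.
      rewrite <- (Rmult_1_l (eps ^ 4)) at 2. apply Rmult_le_compat_r; lra. }
    lra. }
  assert (PbT : forall j, (j < n)%nat -> pc T (b1 j) /\ pc T (b2 j)).
  { intros j Hj. destruct (Pb j Hj). split; apply (short_long p q); auto; lia. }
  destruct (spec_trig p q k Hp) as [Sc [Ss [Scc Ssc]]]. fold w in Sc, Ss, Scc, Ssc.
  assert (HF : outward_on_faces p B w M Cn Hb eps A (fun t => cos (w * t)) (fun t => sin (w * t)) X1 X2 n m b1 b2).
  { intros theta a1 a2 f1 f2 HSol.
    destruct (sol_w_facts p B w M Cn Hb eps A _ _ X1 X2 D1 D2 n m b1 b2 MD HX PbT Bb He0 C1 C2 theta a1 a2 f1 f2 HSol)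
      as [d1 [d2 [l0 [F1 [F2 [F3 [F4 [F5 [F6 [F7 [F8 [F9 [F10 F11]]]]]]]]]]]]].
    destruct HSol as [[Ba1 Ba2] _].
    assert (N := msq_pos T w TP).
    unfold mult1, mult2 in *. fold T in F9, F10 |- *.
    set (h1 := hh1 B w eps (fun t => cos (w * t)) (fun t => sin (w * t)) n m b1 b2 theta a1 a2 f1 f2) in *.
    set (h2 := hh2 B w eps (fun t => cos (w * t)) (fun t => sin (w * t)) n m b1 b2 theta a1 a2 f1 f2) in *.
    set (l1 := pr1 T w (fun t => cos (w * t)) (fun t => sin (w * t)) h1 h2) in *.
    set (l2 := pr2 T w (fun t => cos (w * t)) (fun t => sin (w * t)) h1 h2) in *.
    assert (Eh : forall (C0 S0 : R -> R) a b, (forall t, a * C0 t + b * S0 t = kk1 (fun t => cos (w * t)) (fun t => sin (w * t)) a1 a2 t) ->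
       (forall t, gam * (a * S0 t - b * C0 t) = kk2 w (fun t => cos (w * t)) (fun t => sin (w * t)) a1 a2 t) ->
       NN1 (B / 2) eps theta n m b1 b2 (fun t => a * C0 t + b * S0 t + f1 t) (fun t => gam * (a * S0 t - b * C0 t) + f2 t) = h1 /\
       NN2 (B / 2) eps theta n m b1 b2 (fun t => a * C0 t + b * S0 t + f1 t) (fun t => gam * (a * S0 t - b * C0 t) + f2 t) = h2).
    { intros C0 S0 a b Ha Hb'. unfold h1, h2, hh1, hh2.
      replace (fun t => a * C0 t + b * S0 t + f1 t) with (xx1 (fun t => cos (w * t)) (fun t => sin (w * t)) a1 a2 f1)
        by (apply functional_extensionality; intro; unfold xx1; rewrite Ha; reflexivity).
      replace (fun t => gam * (a * S0 t - b * C0 t) + f2 t) with (xx2 w (fun t => cos (w * t)) (fun t => sin (w * t)) a1 a2 f2)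
        by (apply functional_extensionality; intro; unfold xx2; rewrite Hb'; reflexivity).
      auto. }
    assert (HBG : Rabs B <= G) by (rewrite Rabs_right; unfold G; lra).
    assert (HgG : 2 + 2 * gam <= G) by (unfold G; lra).
    assert (HbG : 2 * Hb <= G /\ (2 * Hb) * (2 * Hb) <= G /\ (2 * Hb) * (2 * Hb) * (2 * Hb) <= G) by (fold H3; fold H2; unfold G; lra).
    assert (HyG : Rabs cy0 + 4 * Rabs cy1 <= G /\ 4 * Rabs cy2 <= G) by (unfold G; lra).
    assert (HTay' : forall d1 d2 s, Rabs d1 <= s -> Rabs d2 <= s -> s <= 1 / 8 ->
       Rabs (nl1 (B / 2) d1 d2 - quad1 B d1 d2 - cub1 B d1 d2) <= G * s ^ 4 /\
       Rabs (nl2 (B / 2) d1 d2 - quad2 B d1 d2 - cub2 B d1 d2) <= G * s ^ 4).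
    { intros u v s Hu Hv Hs. destruct (HTay u v s Hu Hv Hs) as [T1 T2]. replace (2 * (B / 2)) with B in T1, T2 by field.
      assert (s4 : 0 <= s ^ 4) by (apply pow_le; eapply Rle_trans; [apply Rabs_pos | exact Hu]).
      assert (Ct * s ^ 4 <= G * s ^ 4) by (apply Rmult_le_compat_r; [auto|unfold G; lra]). lra. }
    assert (Bw : forall t, Rabs (f1 t) <= G * eps ^ 2 /\ Rabs (f2 t) <= G * eps ^ 2).
    { intro t. specialize (F11 t). fold W in F11. assert (W * eps ^ 2 <= G * eps ^ 2) by (apply Rmult_le_compat_r; [lra|unfold G; lra]). lra. }
    assert (HBk : B = 4 - w * w) by lra.
    assert (Dc : forall t : R, is_derive (fun t => cos (w * t)) t (- (w * sin (w * t)))) by (destruct MD; auto).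
    assert (Ds : forall t : R, is_derive (fun t => sin (w * t)) t (w * cos (w * t))) by (destruct MD; auto).
    assert (SC2 : forall t, sin (w * t) * sin (w * t) + cos (w * t) * cos (w * t) = 1)
      by (intro t; assert (Z := sin2_cos2 (w * t)); unfold Rsqr in Z; exact Z).
    assert (Est1 : Rabs (Int0 T (fun t => h1 t * cos (w * t) + h2 t * (gam * sin (w * t))) - eps ^ 2 * a1 * k0 * R0)
       <= T * (420 * G ^ 7) * (3 * eps ^ 4)).
    { destruct (Eh (fun t => cos (w * t)) (fun t => sin (w * t)) a1 a2) as [N1 N2].
      { intro; reflexivity. } { intro t. unfold kk2. fold gam. ring. }
      assert (PE := proj_estimate p q k n m b1 b2 theta eps Hp Hk Hkp Hk2 Hq Hn Hm Hm1 Pb Zb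
        (fun t => cos (w * t)) (fun t => sin (w * t)) Sc Ss Scc Ssc Dc Ds
        (fun t => eq_trans (Rplus_comm _ _) (SC2 t)) a1 a2 B HBk f1 f2 d1 d2 l0 l1 l2 G A Hb).
      cbv beta zeta in PE. fold w gam T in PE. rewrite N1, N2 in PE. fold cy2 in PE. fold cy1 cy0 in PE.
      rewrite HR in PE. fold k0 in PE.
      eapply Rle_trans; [apply PE; auto|].
      - split; lra.
      - replace (T * (420 * G ^ 7 * (eps ^ 4 + A ^ 3 + A * eps ^ 3))) with (T * (420 * G ^ 7) * (eps ^ 4 + A ^ 3 + A * eps ^ 3)) by ring.
        apply Rmult_le_compat_l; lra. }
    (* The second multiplier is the first one for the modes shifted by a quarter period:
       [(cos, sin)] becomes [(sin, - cos)], and [(a1, a2)] becomes [(a2, - a1)]. This is why the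
       estimate was proved for abstract [C] and [S]. *)
    assert (Est2 : Rabs (Int0 T (fun t => h1 t * sin (w * t) + h2 t * (gam * - cos (w * t))) - eps ^ 2 * a2 * k0 * R0)
       <= T * (420 * G ^ 7) * (3 * eps ^ 4)).
    { destruct (Eh (fun t => sin (w * t)) (fun t => - cos (w * t)) a2 (- a1)) as [N1 N2].
      { intro t. unfold kk1. ring. } { intro t. unfold kk2. fold gam. ring. }
      assert (Sc' : spec p q (fun l => l = Z.of_nat k) (fun t => - cos (w * t))).
      { replace (fun t => - cos (w * t)) with (fun t => -1 * cos (w * t)) by (apply functional_extensionality; intro; ring). apply spec_scal; auto. }
      assert (Scc' : spec p q (fun l => l = (2 * Z.of_nat k)%Z) (fun t => sin (w * t) * sin (w * t) - - cos (w * t) * - cos (w * t))).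
      { replace (fun t => sin (w * t) * sin (w * t) - - cos (w * t) * - cos (w * t)) with (fun t => -1 * (cos (w * t) * cos (w * t) - sin (w * t) * sin (w * t)))
          by (apply functional_extensionality; intro; ring).
        apply (spec_scal p q _ (-1) (fun t => cos (w * t) * cos (w * t) - sin (w * t) * sin (w * t))); auto. }
      assert (Ssc' : spec p q (fun l => l = (2 * Z.of_nat k)%Z) (fun t => 2 * (- cos (w * t) * sin (w * t)))).
      { replace (fun t => 2 * (- cos (w * t) * sin (w * t))) with (fun t => -1 * (2 * (sin (w * t) * cos (w * t))))
          by (apply functional_extensionality; intro; ring).
        apply (spec_scal p q _ (-1) (fun t => 2 * (sin (w * t) * cos (w * t)))); auto. }
      assert (Ds' : forall t : R, is_derive (fun t => sin (w * t)) t (- (w * - cos (w * t)))).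
      { intro t. evar_last; [apply Ds|]. ring. }
      assert (Dc' : forall t : R, is_derive (fun t => - cos (w * t)) t (w * sin (w * t))).
      { intro t. evar_last; [apply (is_derive_opp (V:=R_NormedModule)), Dc|]. unfold opp; simpl. ring. }
      assert (PE := proj_estimate p q k n m b1 b2 theta eps Hp Hk Hkp Hk2 Hq Hn Hm Hm1 Pb Zb
        (fun t => sin (w * t)) (fun t => - cos (w * t)) Ss Sc' Scc' Ssc' Ds' Dc'
        (fun t => eq_trans (f_equal (Rplus _) (Rmult_opp_opp _ _)) (SC2 t)) a2 (- a1) B HBk f1 f2 d1 d2 l0 l2 (- l1) G A Hb).
      cbv beta zeta in PE. fold w gam T in PE. rewrite N1, N2 in PE. fold cy2 in PE. fold cy1 cy0 in PE.
      rewrite HR in PE. fold k0 in PE.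
      eapply Rle_trans; [apply PE; auto|].
      - intro t. evar_last; [apply F9|]. ring.
      - intro t. evar_last; [apply F10|]. unfold gam. ring.
      - split; lra.
      - rewrite Rabs_Ropp; auto.
      - replace (T * (420 * G ^ 7 * (eps ^ 4 + A ^ 3 + A * eps ^ 3))) with (T * (420 * G ^ 7) * (eps ^ 4 + A ^ 3 + A * eps ^ 3)) by ring.
        apply Rmult_le_compat_l; lra. }
    assert (Q1 : Int0 T (fun t => h1 t * cos (w * t) + h2 t * (gam * sin (w * t))) = mode_norm2 T w * l1) by (unfold l1, pr1; fold gam; field; lra).
    assert (Q2 : Int0 T (fun t => h1 t * sin (w * t) + h2 t * (gam * - cos (w * t))) = mode_norm2 T w * l2).
    { unfold l2, pr2. fold gam. rewrite (Int0_ext T _ (fun t => h1 t * sin (w * t) - h2 t * (gam * cos (w * t)))) by (intro; ring). field; lra. }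
    rewrite Q1 in Est1. rewrite Q2 in Est2.
    apply Rabs_le_between in Est1. apply Rabs_le_between in Est2.
    assert (e4 : 0 < eps ^ 4) by (apply pow_lt; auto).
    assert (EA : eps ^ 2 * A * k0 * R0 = (3 * (T * (420 * G ^ 7)) + 1) * eps ^ 4) by (rewrite <- EKr; unfold A; ring).
    assert (Pos : forall x l a, a = A -> - x <= mode_norm2 T w * l - eps ^ 2 * a * k0 * R0 -> x = T * (420 * G ^ 7) * (3 * eps ^ 4) -> 0 < l).
    { intros x l a -> Hx ->. rewrite EA in Hx. apply Rmult_lt_reg_l with (mode_norm2 T w); [exact N|]. lra. }
    assert (Neg : forall x l a, a = - A -> mode_norm2 T w * l - eps ^ 2 * a * k0 * R0 <= x -> x = T * (420 * G ^ 7) * (3 * eps ^ 4) -> l < 0).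
    { intros x l a -> Hx ->. replace (eps ^ 2 * - A * k0 * R0) with (- (eps ^ 2 * A * k0 * R0)) in Hx by ring.
      rewrite EA in Hx. apply Rmult_lt_reg_l with (mode_norm2 T w); [exact N|]. lra. }
    split; [intro Z; apply (Pos _ l1 a1 Z (proj1 Est1) eq_refl)|].
    split; [intro Z; apply (Neg _ l1 a1 Z (proj2 Est1) eq_refl)|].
    split; [intro Z; apply (Pos _ l2 a2 Z (proj1 Est2) eq_refl)|intro Z; apply (Neg _ l2 a2 Z (proj2 Est2) eq_refl)]. }
  destruct (exact_orbit p B w M Cl Cn Hb eps A _ _ X1 X2 D1 D2 n m b1 b2
    Hp HB MD HM HX HXl HXb HL HCn HN Hm Hm1 PbT Zb Bb HHb He0 (Rlt_le _ _ HA0) C1 C2 C3 (or_intror (conj HA0 HF)))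
    as [theta [y1 [y2 [p1 [p2 [Ht [By Hr]]]]]]].
  exists theta, y1, y2, p1, p2. split; [exact Ht|split; [|exact Hr]].
  intro t. specialize (By t). fold W gam in By.
  replace (2 * ((1 + gam) * A) + W * eps ^ 2) with (Cx * eps ^ 2) in By by (unfold Cx, A; ring). exact By.
Qed.

(** For [alpha = 1] the stiffness is 2 and the coefficient [B * (B - 2)] vanishes; irrationality of
    its square root excludes a resonance there. *)
Lemma sqrt2_irrational (a b : nat) : (a * a = 2 * (b * b))%nat -> b = 0%nat.
Proof.
  revert b. induction a as [a IH] using (well_founded_induction lt_wf). intros b H.
  destruct (Nat.eq_dec b 0) as [|Hb]; [auto|exfalso].
  assert (Ev : Nat.Even a).
  { destruct (Nat.Even_or_Odd a) as [|[u Hu]]; auto. exfalso. subst a. lia. }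
  destruct Ev as [u Hu]. subst a.
  assert (H' : (b * b = 2 * (u * u))%nat) by lia.
  assert (Hlt : (b < 2 * u)%nat) by nia.
  assert (u = 0)%nat by (apply (IH b Hlt u H')). subst u. lia.
Qed.

Lemma orbit_exists (p n : nat) (B Hb R0 : R) (m : nat -> R) : (1 <= p)%nat -> (1 <= n)%nat -> 2 <= B -> B <> 3 ->
  (forall j, (j < n)%nat -> 0 < m j) -> rsum n m = 1 -> 0 <= Hb -> 0 < R0 ->
  exists e0 Cx, 0 < e0 /\ 0 < Cx /\ forall q b1 b2 eps, (6 * p <= q)%nat -> 0 < eps <= e0 ->
    (forall j, (j < n)%nat -> pc (2 * PI * INR p / INR q) (b1 j) /\ pc (2 * PI * INR p / INR q) (b2 j)) ->
    (forall t, mom1 n m (fun j => b1 j t) = 0 /\ mom1 n m (fun j => b2 j t) = 0) ->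
    (forall j t, (j < n)%nat -> Rabs (b1 j t) <= Hb /\ Rabs (b2 j t) <= Hb) ->
    Int0 (2 * PI * INR p) (fun t => rsum n (fun j => m j * (b1 j t * b1 j t + b2 j t * b2 j t))) = R0 ->
    orbit p n B eps Cx m b1 b2.
Proof.
  intros Hp Hn HB HB3 Hm Hm1 HHb HR0.
  destruct (oscillator_solver p (4 - B) Hp) as [HS|[k [Hk [HK HS]]]].
  - destruct (orbit_nonresonant p n B Hb m Hp ltac:(lra) HS Hm Hm1 HHb) as [e0 [Cx [H1 [H2 H3]]]].
    exists e0, Cx. split; [auto|split; [auto|]]. intros q b1 b2 eps Hq He Pb Zb Bb _.
    apply H3; auto. intros j Hj. destruct (Pb j Hj). split; apply (short_long p q); auto; lia.
  - assert (P0 := INR_gt0 p Hp).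
    assert (E : INR k * INR k = (4 - B) * (INR p * INR p)) by (rewrite HK; field; lra).
    (* A resonance with [k = p] has stiffness 1, that is [B = 3] and [alpha = 2]. *)
    assert (Hkp : k <> p).
    { intro; subst k. assert (INR p * INR p <> 0) by nra. apply HB3.
      assert ((3 - B) * (INR p * INR p) = 0) by lra. apply Rmult_integral in H0. destruct H0; [lra|contradiction]. }
    (* The stiffness is at most 2 because [B >= 2]. *)
    assert (Hk2 : (k < 2 * p)%nat).
    { apply INR_lt. rewrite mult_INR. simpl (INR 2). assert (0 < INR k) by (apply INR_gt0; auto).
      assert (INR k * INR k <= 2 * (INR p * INR p)) by nra. nra. }
    assert (HB2 : 2 < B).
    { destruct (Req_dec B 2) as [->|]; [exfalso|lra].
      assert (Z : (k * k = 2 * (p * p))%nat) by (apply INR_eq; rewrite !mult_INR; simpl (INR 2); lra).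
      apply sqrt2_irrational in Z. lia. }
    exact (orbit_resonant p n k B Hb R0 m Hp Hn HB2 Hk Hkp Hk2 HK HS Hm Hm1 HHb HR0).
Qed.

(** * Return to the original variables *)

Lemma fst_vsum n f : fst (vsum n f) = rsum n (fun j => fst (f j)).
Proof. induction n as [|n IH]; simpl; [reflexivity|]. now rewrite IH. Qed.

Lemma snd_vsum n f : snd (vsum n f) = rsum n (fun j => snd (f j)).
Proof. induction n as [|n IH]; simpl; [reflexivity|]. now rewrite IH. Qed.

Lemma second_derivative_cont x a : has_second_derivative x a ->
  cont (fun t => fst (x t)) /\ cont (fun t => snd (x t)).
Proof.
  intros [v Hv]. split; [apply (cont_derive _ (fun t => fst (v t)))|apply (cont_derive _ (fun t => snd (v t)))];
    intro t; apply Hv.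
Qed.

Lemma pc_family_bounded T n (f : nat -> R -> R) : 0 < T -> (forall j, (j < n)%nat -> pc T (f j)) ->
  exists M, 0 <= M /\ forall j t, (j < n)%nat -> Rabs (f j t) <= M.
Proof.
  intros HT. induction n as [|n IH]; intro H; [exists 0; split; [lra|intros; lia]|].
  destruct IH as [M1 [HM1 H1]]; [auto|].
  destruct (pc_bounded T (f n) HT (H n ltac:(lia))) as [M2 [HM2 H2]].
  exists (M1 + M2). split; [lra|]. intros j t Hj. destruct (Nat.eq_dec j n) as [->|Hn].
  - specialize (H2 t). lra.
  - specialize (H1 j t ltac:(lia)). lra.
Qed.

Lemma prim_periods T f q : pc T f -> prim f (INR q * T) = INR q * Int0 T f.
Proof.
  intro P. induction q as [|q IH]; [simpl INR; rewrite !Rmult_0_l; apply prim_0|].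
  rewrite S_INR. replace ((INR q + 1) * T) with (INR q * T + T) by ring.
  rewrite prim_shift, IH by exact P. ring.
Qed.

Lemma pc_rescale p q f : (1 <= p)%nat -> (1 <= q)%nat -> pc (2 * PI) f ->
  pc (2 * PI * INR p / INR q) (fun t => f (t * (INR q / INR p))).
Proof.
  intros Hp Hq [F P]. assert (P0 := INR_gt0 p Hp). assert (Q0 := INR_gt0 q Hq).
  split; [apply (cont_comp f (fun t => t * (INR q / INR p))); auto; apply cont_mult; [apply cont_id|apply cont_const]|].
  intro t. rewrite <- (P (t * (INR q / INR p))). f_equal. field; lra.
Qed.

(** The rescaled function runs through [q] of its periods, each shortened by the factor [p / q]: the
    integral does not depend on [q], as uniformity of the constants requires. *)
Lemma Int0_rescale p q f : (1 <= p)%nat -> (1 <= q)%nat -> pc (2 * PI) f ->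
  Int0 (2 * PI * INR p) (fun t => f (t * (INR q / INR p))) = INR p * Int0 (2 * PI) f.
Proof.
  intros Hp Hq F. assert (P0 := INR_gt0 p Hp). assert (Q0 := INR_gt0 q Hq).
  rewrite (Int0_derive _ (fun t => INR p / INR q * prim f (t * (INR q / INR p)))).
  - rewrite Rmult_0_l, prim_0.
    replace (2 * PI * INR p * (INR q / INR p)) with (INR q * (2 * PI)) by (field; lra).
    rewrite prim_periods by exact F. field; lra.
  - apply (pc_rescale p q f Hp Hq F).
  - intro t. evar_last.
    + apply is_derive_scal. apply (is_derive_comp (prim f) (fun t => t * (INR q / INR p))).
      * apply is_derive_prim, F.
      * instantiate (1 := INR q / INR p). auto_derive; [exact I|ring].
    + unfold scal; simpl; unfold mult; simpl. field; lra.
Qed.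

Lemma expJ_x0 a : expJ a x0 = (cos a, - sin a).
Proof. unfold expJ, vadd, vscal, Jmul, x0; simpl. f_equal; ring. Qed.

Lemma vnorm_le u c : 0 <= c -> fst u * fst u + snd u * snd u <= c * c -> vnorm u <= c.
Proof. intros Hc H. unfold vnorm. rewrite <- (sqrt_square c Hc). apply sqrt_le_1_alt, H. Qed.

Lemma vnorm_components u c : vnorm u <= c -> Rabs (fst u) <= c /\ Rabs (snd u) <= c.
Proof.
  intro H. assert (forall a, a * a <= fst u * fst u + snd u * snd u -> Rabs a <= c).
  { intros a Ha. eapply Rle_trans; [|exact H]. rewrite <- sqrt_Rsqr_abs. apply sqrt_le_1_alt, Ha. }
  split; apply H0; nra.
Qed.

Lemma inv_Rpower_vnorm B eps X Y g : 0 < eps -> -1 < g -> X * X + Y * Y - 1 = g ->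
  / Rpower (vnorm (/ eps * X, / eps * Y)) B = Rpower eps B * pw (B / 2) g.
Proof.
  intros He Hg E. unfold vnorm; simpl.
  replace (/ eps * X * (/ eps * X) + / eps * Y * (/ eps * Y)) with ((/ eps) * (/ eps) * (1 + g)) by (rewrite <- E; ring).
  assert (0 < / eps) by (apply Rinv_0_lt_compat; auto).
  rewrite sqrt_mult, sqrt_square by nra.
  unfold pw, Rpower. rewrite <- exp_Ropp, <- exp_plus. f_equal.
  rewrite ln_mult by (auto; apply sqrt_lt_R0; lra). rewrite ln_Rinv by auto.
  replace (ln (sqrt (1 + g))) with (/ 2 * ln (1 + g)); [field|].
  rewrite <- (Rpower_sqrt (1 + g)) by lra. unfold Rpower. now rewrite ln_exp.
Qed.

Definition solution_near n alpha m qs (p q : nat) eps C (z : R -> vec2) th :=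
  restricted_solution n alpha m qs z /\ (forall t, z (t + 2 * PI * INR q) = z t) /\
  (forall t, vnorm (vsub (z t) (vscal (/ eps) (expJ (th + INR p * t / INR q) x0))) <= C * eps).

(** The relation between [eps] and [p / q] makes acceleration and force scale alike. Dividing by
    [eps] turns the distance [Cx * eps^2] into [Cx * eps], and the factor 2 covers the norm of two
    components. *)
Lemma orbit_solution n alpha m qs p q eps Cx : (1 <= p)%nat -> (1 <= q)%nat -> 0 < eps -> 0 < Cx ->
  Rpower eps (alpha + 1) = (INR p / INR q) * (INR p / INR q) ->
  orbit p n (alpha + 1) eps Cx m (fun j t => fst (qs j (t * (INR q / INR p)))) (fun j t => snd (qs j (t * (INR q / INR p)))) ->
  exists z th, 0 <= th <= 2 * PI /\ solution_near n alpha m qs p q eps (2 * Cx) z th.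
Proof.
  intros Hp Hq He HC HR [th [y1 [y2 [p1 [p2 [Hth HO]]]]]].
  assert (P0 := INR_gt0 p Hp). assert (Q0 := INR_gt0 q Hq).
  set (b1 := fun j t => fst (qs j (t * (INR q / INR p)))) in *.
  set (b2 := fun j t => snd (qs j (t * (INR q / INR p)))) in *.
  set (nu := INR p / INR q) in *. cbv zeta in HO.
  set (q1 := rot1 th (fun t => 1 + y1 t) y2) in *. set (q2 := rot2 th (fun t => 1 + y1 t) y2) in *.
  destruct HO as [Hy [Q1 [Q2 [D1 [D2 [A1 [A2 Hg]]]]]]].
  assert (Eb : forall j t, b1 j (nu * t) = fst (qs j t) /\ b2 j (nu * t) = snd (qs j t)).
  { intros j t. unfold b1, b2. replace (nu * t * (INR q / INR p)) with t by (unfold nu; field; lra). auto. }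
  assert (ie : 0 < / eps) by (apply Rinv_0_lt_compat; auto).
  assert (ee : eps * / eps = 1) by (apply Rinv_r; lra).
  assert (Ev : forall j t, vsub (/ eps * q1 (nu * t), / eps * q2 (nu * t)) (qs j t) =
    (/ eps * (q1 (nu * t) - eps * b1 j (nu * t)), / eps * (q2 (nu * t) - eps * b2 j (nu * t)))).
  { intros j t. destruct (Eb j t) as [-> ->]. unfold vsub; simpl. f_equal; field; lra. }
  assert (Hforce : forall j t, (j < n)%nat -> force alpha (/ eps * q1 (nu * t), / eps * q2 (nu * t)) (qs j t) =
     (nu * nu * pw ((alpha + 1) / 2) (gap eps b1 b2 q1 q2 j (nu * t)) * (/ eps * (q1 (nu * t) - eps * b1 j (nu * t))),
      nu * nu * pw ((alpha + 1) / 2) (gap eps b1 b2 q1 q2 j (nu * t)) * (/ eps * (q2 (nu * t) - eps * b2 j (nu * t))))).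
  { intros j t Hj. unfold force. rewrite Ev.
    rewrite (inv_Rpower_vnorm _ eps _ _ (gap eps b1 b2 q1 q2 j (nu * t)) He (half_gt _ (Hg j _ Hj)) eq_refl), HR.
    reflexivity. }
  assert (Dl : forall (f df : R -> R) c, (forall t : R, is_derive f t (df t)) ->
     forall t : R, is_derive (fun t => c * f (nu * t)) t (c * nu * df (nu * t))).
  { intros f df c H t. evar_last.
    - apply is_derive_scal, (is_derive_comp f (fun t => nu * t)); [apply H|instantiate (1 := nu); auto_derive; [exact I|ring]].
    - unfold scal; simpl; unfold mult; simpl. ring. }
  exists (fun t => (/ eps * q1 (nu * t), / eps * q2 (nu * t))), th.
  split; [exact Hth|]. split; [split|split].
  (* At a collision [gap] would equal -1. *)
  - intros t j Hj Z. assert (G := half_gt _ (Hg j (nu * t) Hj)). unfold gap in G.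
    destruct (Eb j t) as [E1 E2]. rewrite E1, E2, <- Z in G. simpl in G.
    replace (q1 (nu * t) - eps * (/ eps * q1 (nu * t))) with ((1 - eps * / eps) * q1 (nu * t)) in G by ring.
    replace (q2 (nu * t) - eps * (/ eps * q2 (nu * t))) with ((1 - eps * / eps) * q2 (nu * t)) in G by ring.
    rewrite ee in G. lra.
  - exists (fun t => (/ eps * nu * p1 (nu * t), / eps * nu * p2 (nu * t))). intro t. simpl.
    split; [apply Dl; auto|split; [apply Dl; auto|]].
    rewrite fst_vsum, snd_vsum. split.
    + evar_last; [apply (Dl p1 _ (/ eps * nu) A1)|]. unfold force1.
      transitivity (- (/ eps * nu * nu * rsum n (fun j => m j * ((q1 (nu * t) - eps * b1 j (nu * t)) *
         pw ((alpha + 1) / 2) (gap eps b1 b2 q1 q2 j (nu * t)))))); [ring|].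
      rewrite <- rsum_scal, <- (Rmult_1_l (rsum n _)), Ropp_mult_distr_l. f_equal. apply rsum_ext. intros j Hj.
      rewrite Hforce by exact Hj. simpl. ring.
    + evar_last; [apply (Dl p2 _ (/ eps * nu) A2)|]. unfold force2.
      transitivity (- (/ eps * nu * nu * rsum n (fun j => m j * ((q2 (nu * t) - eps * b2 j (nu * t)) *
         pw ((alpha + 1) / 2) (gap eps b1 b2 q1 q2 j (nu * t)))))); [ring|].
      rewrite <- rsum_scal, <- (Rmult_1_l (rsum n _)), Ropp_mult_distr_l. f_equal. apply rsum_ext. intros j Hj.
      rewrite Hforce by exact Hj. simpl. ring.
  - intro t. replace (nu * (t + 2 * PI * INR q)) with (nu * t + 2 * PI * INR p) by (unfold nu; field; lra).
    now rewrite Q1, Q2.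
  - intro t. rewrite expJ_x0. replace (th + INR p * t / INR q) with (th + nu * t) by (unfold nu; field; lra).
    apply vnorm_le; [nra|]. unfold vsub, vscal; simpl. unfold q1, q2, rot1, rot2.
    destruct (Hy (nu * t)) as [Y1 Y2]. set (s := y1 (nu * t)) in *. set (r := y2 (nu * t)) in *.
    assert (SC := sin2_cos2 (th + nu * t)). unfold Rsqr in SC.
    set (cc := cos (th + nu * t)) in *. set (ss := sin (th + nu * t)) in *.
    transitivity (/ eps * / eps * (s * s + r * r)).
    + right. transitivity (/ eps * / eps * ((ss * ss + cc * cc) * (s * s + r * r))); [ring|rewrite SC; ring].
    + assert (Sq : forall x, Rabs x <= Cx * eps ^ 2 -> x * x <= Cx * eps ^ 2 * (Cx * eps ^ 2)).
      { intros x Hx. apply Rabs_le_between in Hx. nra. }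
      apply Sq in Y1, Y2.
      transitivity (/ eps * / eps * (2 * (Cx * eps ^ 2 * (Cx * eps ^ 2)))).
      { apply Rmult_le_compat_l; [nra|lra]. }
      replace (/ eps * / eps * (2 * (Cx * eps ^ 2 * (Cx * eps ^ 2)))) with (2 * (Cx * eps * (Cx * eps))) by (field; lra).
      assert (0 < Cx * eps) by nra. nra.
Qed.

Lemma restricted_shift n alpha m qs z s : (forall j t, (j < n)%nat -> qs j (t + s) = qs j t) ->
  restricted_solution n alpha m qs z -> restricted_solution n alpha m qs (fun t => z (t + s)).
Proof.
  intros Hs [N [v Hv]]. split.
  - intros t j Hj. rewrite <- (Hs j t Hj). apply N, Hj.
  - exists (fun t => v (t + s)). intro t. destruct (Hv (t + s)) as [V1 [V2 [V3 V4]]].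
    split; [apply (is_derive_shift (fun u => fst (z u))), V1|].
    split; [apply (is_derive_shift (fun u => snd (z u))), V2|].
    assert (E : forall f g : nat -> vec2, (forall j, (j < n)%nat -> f j = g j) -> vsum n f = vsum n g).
    { clear. induction n as [|n IH]; intros f g H; simpl; [auto|]. rewrite (IH f g), H; auto. }
    rewrite (E _ (fun j => vscal (m j) (force alpha (z (t + s)) (qs j (t + s))))) by (intros j Hj; now rewrite (Hs j t Hj)).
    split; [apply (is_derive_shift (fun u => fst (v u))), V3|apply (is_derive_shift (fun u => snd (v u))), V4].
Qed.

Lemma solution_near_shift n alpha m qs p q eps C z th k : (1 <= q)%nat ->
  (forall j t, (j < n)%nat -> qs j (t + 2 * PI) = qs j t) ->
  solution_near n alpha m qs p q eps C z th ->
  solution_near n alpha m qs p q eps C (fun t => z (t + INR k * (2 * PI))) (th + INR p * (INR k * (2 * PI)) / INR q).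
Proof.
  intros Hq Hqs [H1 [H2 H3]]. assert (Q0 := INR_gt0 q Hq). split; [|split].
  - apply restricted_shift; [|exact H1]. intros j t Hj.
    induction k as [|k IH]; [simpl INR; rewrite Rmult_0_l, Rplus_0_r; reflexivity|].
    rewrite S_INR. replace (t + (INR k + 1) * (2 * PI)) with (t + INR k * (2 * PI) + 2 * PI) by ring.
    rewrite Hqs by exact Hj. exact IH.
  - intro t. rewrite <- (H2 (t + _)). f_equal; ring.
  - intro t. assert (H := H3 (t + INR k * (2 * PI))).
    replace (th + INR p * (INR k * (2 * PI)) / INR q + INR p * t / INR q)
      with (th + INR p * (t + INR k * (2 * PI)) / INR q) by (field; lra). exact H.
Qed.

Lemma solution_near_angle n alpha m qs p q eps C z th :
  solution_near n alpha m qs p q eps C z (th + 2 * PI) -> solution_near n alpha m qs p q eps C z th.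
Proof.
  intros [H1 [H2 H3]]. split; [exact H1|split; [exact H2|]]. intro t.
  assert (H := H3 t). rewrite expJ_x0 in *.
  replace (th + 2 * PI + INR p * t / INR q) with (th + INR p * t / INR q + 2 * PI) in H by ring.
  assert (P1 := cos_period (th + INR p * t / INR q) 1). assert (P2 := sin_period (th + INR p * t / INR q) 1).
  simpl INR in P1, P2. rewrite Rmult_1_r in P1, P2. rewrite P1, P2 in H.
  exact H.
Qed.

(** Unit vectors at an angle [d] with [cos d <= 0] have squared distance at least 2, while a common
    orbit close to both would leave less than 1 in each coordinate. *)
Lemma solution_near_distinct n alpha m qs p q eps C z1 z2 th d : 0 < eps -> 0 <= C -> 2 * C * (eps * eps) < 1 ->
  cos d <= 0 -> solution_near n alpha m qs p q eps C z1 th -> solution_near n alpha m qs p q eps C z2 (th + d) -> z1 <> z2.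
Proof.
  intros He HC Hs Hd [_ [_ H1]] [_ [_ H2]] Z. subst z2. specialize (H1 0). specialize (H2 0).
  rewrite expJ_x0 in *. rewrite Rmult_0_r, Rdiv_0_l, Rplus_0_r in H1, H2.
  apply vnorm_components in H1, H2. unfold vsub, vscal in *; simpl in *.
  destruct H1 as [X1 Y1]. destruct H2 as [X2 Y2].
  assert (ie : 0 < / eps) by (apply Rinv_0_lt_compat; auto).
  assert (K : forall u v c, Rabs (u - / eps * v) <= C * eps -> Rabs (u - / eps * c) <= C * eps -> - 1 < v - c < 1).
  { intros u v c U V. apply Rabs_le_between in U, V.
    assert (E : v - c = eps * ((u - / eps * c) - (u - / eps * v))) by (field; lra).
    set (w := (u - / eps * c) - (u - / eps * v)) in *. assert (- (2 * (C * eps)) <= w <= 2 * (C * eps)) by (unfold w; lra).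
    rewrite E. split; nra. }
  assert (K1 := K _ _ _ X1 X2). assert (K2 := K _ _ _ Y1 Y2).
  assert (S1 := sin2_cos2 th). assert (S2 := sin2_cos2 (th + d)). unfold Rsqr in *.
  assert (Ed : cos d = cos (th + d) * cos th + sin (th + d) * sin th).
  { rewrite <- cos_minus. f_equal; ring. }
  set (a := cos th) in *. set (b := sin th) in *. set (c := cos (th + d)) in *. set (e := sin (th + d)) in *.
  assert ((a - c) * (a - c) < 1) by nra. assert ((- b - - e) * (- b - - e) < 1) by nra. nra.
Qed.

Lemma rsum_pos n f j : (forall i, (i < n)%nat -> 0 <= f i) -> (j < n)%nat -> 0 < f j -> 0 < rsum n f.
Proof.
  revert j. induction n as [|n IH]; intros j H Hj Hf; [lia|]. simpl.
  destruct (Nat.eq_dec j n) as [->|Hn].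
  - assert (N : 0 <= rsum n f); [|lra].
    rewrite <- (Rmult_0_l (rsum n (fun _ => 0))), <- rsum_scal. apply rsum_le. intros i Hi. rewrite Rmult_0_l. apply H; lia.
  - assert (Z := H n ltac:(lia)). assert (0 < rsum n f); [|lra]. apply (IH j); auto; lia.
Qed.

(** At time 0 the first two bodies do not collide, so at least one of them is away from the
    origin. *)
Lemma inertia_pos n m (qs : nat -> R -> vec2) : (2 <= n)%nat -> (forall j, (j < n)%nat -> 0 < m j) ->
  (forall t j k, (j < n)%nat -> (k < n)%nat -> j <> k -> qs j t <> qs k t) ->
  (forall j, (j < n)%nat -> pc (2 * PI) (fun t => fst (qs j t)) /\ pc (2 * PI) (fun t => snd (qs j t))) ->
  0 < Int0 (2 * PI) (fun t => rsum n (fun j => m j * (fst (qs j t) * fst (qs j t) + snd (qs j t) * snd (qs j t)))).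
Proof.
  intros Hn Hm Hc HP.
  assert (N : forall j t, (j < n)%nat -> 0 <= m j * (fst (qs j t) * fst (qs j t) + snd (qs j t) * snd (qs j t))).
  { intros j t Hj. apply Rmult_le_pos; [left; auto|nra]. }
  apply (Int0_pos _ _ 0).
  - assert (H := PI_RGT_0); lra.
  - apply (pc_rsum _ n (fun j t => m j * (fst (qs j t) * fst (qs j t) + snd (qs j t) * snd (qs j t)))).
    intros j Hj. destruct (HP j Hj). pcs.
  - intro t. rewrite <- (Rmult_0_l (rsum n (fun _ => 0))), <- rsum_scal. apply rsum_le. intros i Hi. rewrite Rmult_0_l. apply N; lia.
  - assert (Z : forall j, (j < n)%nat -> qs j 0 <> vzero -> 0 < m j * (fst (qs j 0) * fst (qs j 0) + snd (qs j 0) * snd (qs j 0))).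
    { intros j Hj Hz. apply Rmult_lt_0_compat; [auto|].
      destruct (Req_dec (fst (qs j 0)) 0) as [E1|]; [|nra]. destruct (Req_dec (snd (qs j 0)) 0) as [E2|]; [|nra].
      exfalso; apply Hz. rewrite (surjective_pairing (qs j 0)), E1, E2. reflexivity. }
    assert (H01 := Hc 0 0%nat 1%nat ltac:(lia) ltac:(lia) ltac:(lia)).
    destruct (classic (qs 0%nat 0 = vzero)) as [E0|E0].
    + apply (rsum_pos n _ 1%nat); [intros; apply N; auto|lia|]. apply Z; [lia|]. congruence.
    + apply (rsum_pos n _ 0%nat); [intros; apply N; auto|lia|]. apply Z; [lia|auto].
Qed.

(** Among the phase shifts by multiples of [2 * PI * p / q], the largest one not above [PI] is
    taken, whence [k] is the quotient of [q] by [2 * p]. From [q >= 4 * p] it is at least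
    [PI / 2]. *)
Lemma second_angle th p q : (1 <= p)%nat -> (4 * p <= q)%nat -> 0 <= th <= 2 * PI ->
  exists k d th2, d = INR p * (INR k * (2 * PI)) / INR q /\ cos d <= 0 /\
    0 <= th2 <= 2 * PI /\ (th2 = th + d \/ th + d = th2 + 2 * PI).
Proof.
  intros Hp Hq Hth. assert (P0 := INR_gt0 p Hp). assert (Q0 := INR_gt0 q ltac:(lia)). assert (HPI := PI_RGT_0).
  set (k := (q / (2 * p))%nat).
  assert (E := Nat.div_mod_eq q (2 * p)). assert (L := Nat.mod_upper_bound q (2 * p) ltac:(lia)). fold k in E.
  assert (K1 : INR (2 * p * k) <= INR q) by (apply le_INR; lia).
  assert (K2 : INR q <= INR (4 * p * k)) by (apply le_INR; nia).
  rewrite !mult_INR in K1, K2. simpl (INR 2) in K1. simpl (INR 4) in K2.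
  exists k, (INR p * (INR k * (2 * PI)) / INR q).
  set (d := INR p * (INR k * (2 * PI)) / INR q).
  assert (Ed : d * INR q = 2 * INR p * INR k * PI) by (unfold d; field; lra).
  assert (D1 : d <= PI) by (apply Rmult_le_reg_r with (INR q); nra).
  assert (D2 : PI / 2 <= d) by (apply Rmult_le_reg_r with (INR q); nra).
  assert (Cd : cos d <= 0) by (apply cos_le_0; lra).
  destruct (Rle_dec (th + d) (2 * PI)).
  - exists (th + d). split; [reflexivity|split; [exact Cd|split; [lra|left; reflexivity]]].
  - exists (th + d - 2 * PI). split; [reflexivity|split; [exact Cd|split; [lra|right; ring]]].
Qed.

Lemma Rpower_ratio_small p B e : (1 <= p)%nat -> 0 < B -> 0 < e ->
  exists N, forall q, (N < q)%nat -> Rpower (INR p / INR q) (2 / B) <= e.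
Proof.
  intros Hp HB He. assert (P0 := INR_gt0 p Hp). set (r := Rpower e (B / 2)).
  assert (R0 : 0 < r) by apply exp_pos.
  destruct (INR_unbounded (INR p / r)) as [N HN]. exists N. intros q Hq.
  assert (Q0 := INR_gt0 q ltac:(lia)). assert (NQ : INR N < INR q) by (apply lt_INR; auto).
  assert (HL : INR p / INR q <= r).
  { apply Rmult_le_reg_r with (INR q); [auto|]. replace (INR p / INR q * INR q) with (INR p / r * r) by (field; lra). nra. }
  assert (0 < INR p / INR q) by (apply Rdiv_lt_0_compat; auto).
  replace e with (Rpower r (2 / B)).
  - apply Rle_Rpower_l; [|split; auto]. apply Rlt_le, Rdiv_lt_0_compat; lra.
  - unfold r. rewrite Rpower_mult. replace (B / 2 * (2 / B)) with 1 by (field; lra). apply Rpower_1, He.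
Qed.

Theorem theorem2 (n : nat) (alpha : R) (m : nat -> R) (qs : nat -> R -> vec2) :
  (2 <= n)%nat -> 1 <= alpha -> alpha <> 2 ->
  (forall j, (j < n)%nat -> 0 < m j) ->
  rsum n m = 1 ->
  nbody_solution n alpha m qs ->
  (forall j t, (j < n)%nat -> qs j (t + 2 * PI) = qs j t) ->
  (forall t, vsum n (fun j => vscal (m j) (qs j t)) = vzero) ->
  forall p : nat, (1 <= p)%nat ->
  exists (q0 : nat) (C : R), 0 < C /\
  forall qq : nat, (q0 < qq)%nat ->
    let eps := Rpower (INR p / INR qq) (2 / (alpha + 1)) in
    exists (z1 z2 : R -> vec2) (th1 th2 : R),
      z1 <> z2 /\
      0 <= th1 <= 2 * PI /\ 0 <= th2 <= 2 * PI /\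
      restricted_solution n alpha m qs z1 /\
      restricted_solution n alpha m qs z2 /\
      (forall t, z1 (t + 2 * PI * INR qq) = z1 t) /\
      (forall t, z2 (t + 2 * PI * INR qq) = z2 t) /\
      (forall t, vnorm (vsub (z1 t)
          (vscal (/ eps) (expJ (th1 + INR p * t / INR qq) x0))) <= C * eps) /\
      (forall t, vnorm (vsub (z2 t)
          (vscal (/ eps) (expJ (th2 + INR p * t / INR qq) x0))) <= C * eps).
Proof.
  intros Hn Ha Ha2 Hm Hm1 [Hcol Hsol] Hper Hcm p Hp.
  assert (P0 := INR_gt0 p Hp). assert (HPI := PI_RGT_0).
  assert (HP : forall j, (j < n)%nat -> pc (2 * PI) (fun t => fst (qs j t)) /\ pc (2 * PI) (fun t => snd (qs j t))).
  { intros j Hj. destruct (second_derivative_cont _ _ (Hsol j Hj)).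
    split; (split; [assumption|intro t; now rewrite Hper]). }
  destruct (pc_family_bounded (2 * PI) n (fun j t => fst (qs j t)) ltac:(lra) (fun j Hj => proj1 (HP j Hj))) as [M1 [HM1 BM1]].
  destruct (pc_family_bounded (2 * PI) n (fun j t => snd (qs j t)) ltac:(lra) (fun j Hj => proj2 (HP j Hj))) as [M2 [HM2 BM2]].
  set (rr := fun t => rsum n (fun j => m j * (fst (qs j t) * fst (qs j t) + snd (qs j t) * snd (qs j t)))).
  assert (R0 : 0 < Int0 (2 * PI) rr) by (apply inertia_pos; auto).
  destruct (orbit_exists p n (alpha + 1) (M1 + M2) (INR p * Int0 (2 * PI) rr) m Hp ltac:(lia) ltac:(lra) ltac:(lra) Hm Hm1 ltac:(lra)
    (Rmult_lt_0_compat _ _ P0 R0)) as [e0 [Cx [He0 [HCx Hcore]]]].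
  (* The last two bounds together give [4 * Cx * eps^2 < 1], which separates the two solutions. *)
  set (e1 := Rmin e0 (Rmin 1 (/ (4 * Cx + 1)))).
  assert (i1 : 0 < / (4 * Cx + 1)) by (apply Rinv_0_lt_compat; lra).
  assert (He1 : 0 < e1) by (unfold e1; repeat apply Rmin_glb_lt; lra).
  destruct (Rpower_ratio_small p (alpha + 1) e1 Hp ltac:(lra) He1) as [N HN].
  (* [6 * p] serves the averaging and also covers the [4 * p] needed for the second phase; [N] makes
     [eps] small. *)
  exists (N + 6 * p)%nat, (2 * Cx). split; [lra|]. intros qq Hqq eps.
  assert (Q0 := INR_gt0 qq ltac:(lia)).
  assert (Hq1 : (1 <= qq)%nat) by lia.
  assert (E0 : 0 < eps) by apply exp_pos.
  assert (E1 : eps <= e1) by (apply HN; lia).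
  assert (E2 : eps <= e0) by (eapply Rle_trans; [exact E1|apply Rmin_l]).
  assert (E3 : eps <= 1) by (eapply Rle_trans; [exact E1|eapply Rle_trans; [apply Rmin_r|apply Rmin_l]]).
  assert (E4 : eps <= / (4 * Cx + 1)) by (eapply Rle_trans; [exact E1|eapply Rle_trans; [apply Rmin_r|apply Rmin_r]]).
  assert (E5 : 2 * (2 * Cx) * (eps * eps) < 1).
  { assert (EE : eps * (4 * Cx + 1) <= 1).
    { apply Rmult_le_reg_r with (/ (4 * Cx + 1)); [exact i1|]. rewrite Rmult_assoc, Rinv_r, Rmult_1_r, Rmult_1_l by lra. exact E4. }
    assert (eps * (4 * Cx) < 1) by lra. assert (0 < eps * (4 * Cx)) by (apply Rmult_lt_0_compat; lra). nra. }
  assert (HR : Rpower eps (alpha + 1) = INR p / INR qq * (INR p / INR qq)).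
  { unfold eps. rewrite Rpower_mult. replace (2 / (alpha + 1) * (alpha + 1)) with (INR 2) by (simpl; field; lra).
    rewrite Rpower_pow by (apply Rdiv_lt_0_compat; lra). simpl. ring. }
  destruct (orbit_solution n alpha m qs p qq eps Cx Hp Hq1 E0 HCx HR) as [z [th [Hth Hz]]].
  { apply (Hcore qq _ _ eps); [lia|lra| | | |].
    - intros j Hj. destruct (HP j Hj) as [A1 A2]. split; [exact (pc_rescale p qq _ Hp Hq1 A1)|exact (pc_rescale p qq _ Hp Hq1 A2)].
    - intro t. specialize (Hcm (t * (INR qq / INR p))). unfold mom1.
      assert (Z1 := f_equal fst Hcm). assert (Z2 := f_equal snd Hcm). rewrite fst_vsum in Z1. rewrite snd_vsum in Z2. auto.
    - intros j t Hj. assert (U1 := BM1 j (t * (INR qq / INR p)) Hj). assert (U2 := BM2 j (t * (INR qq / INR p)) Hj). simpl in U1, U2. lra.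
    - apply (Int0_rescale p qq rr Hp Hq1).
      apply (pc_rsum _ n (fun j t => m j * (fst (qs j t) * fst (qs j t) + snd (qs j t) * snd (qs j t)))).
      intros j Hj. destruct (HP j Hj). pcs. }
  destruct (second_angle th p qq Hp ltac:(lia) Hth) as [k [d [th2 [Ed [Cd [Hth2 Eth2]]]]]].
  assert (Hz2 := solution_near_shift _ _ _ _ _ _ _ _ _ _ k Hq1 Hper Hz). rewrite <- Ed in Hz2.
  exists z, (fun t => z (t + INR k * (2 * PI))), th, th2.
  split; [apply (solution_near_distinct n alpha m qs p qq eps (2 * Cx) _ _ th d); auto; lra|].
  assert (Hz3 : solution_near n alpha m qs p qq eps (2 * Cx) (fun t => z (t + INR k * (2 * PI))) th2).
  { destruct Eth2 as [->|Eth2]; [exact Hz2|]. rewrite Eth2 in Hz2. apply solution_near_angle, Hz2. }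
  destruct Hz as [S1 [S2 S3]]. destruct Hz3 as [S4 [S5 S6]]. repeat (split; [assumption|]). assumption.
Qed.
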